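(* Let $\Omega\subset\mathbb{R}^3$ be an open, bounded, connected set with smooth boundary $\partial\Omega$. Assume $\Omega$ is non-convex in the sense that $\gamma_0^{\mathbf S}\neq\emptyset$. Let $(x_0,v_0)\in\gamma_0^{\mathbf S}$ be arbitrary with $v_0\neq0$. Then for every sufficiently small $\delta>0$ the following hold. 1. (In-flow) There exist $t_0\in(0,\min\{\delta,t_{\mathbf b}(x_0,-v_0)\})$, an initial datum $F_0(x,v)$ continuous on $(\Omega\times\mathbb{R}^3)\cup\gamma_-\cup\gamma_0^{\mathbf S}$, and an in-flow boundary datum $G(t,x,v)$ continuous on $[0,\infty)\times(\gamma_-\cup\gamma_0^{\mathbf S})$, satisfying $$F_0(x,v)=G(0,x,v)\quad\text{for }(x,v)\in\gamma_-\cup\gamma_0^{\mathbf S}$$ and $$\Big\|w\frac{F_0-\mu}{\sqrt\mu}\Big\|_{L^\infty(\bar\Omega\times\mathbb{R}^3)}+\sup_{t\in[0,\infty)}\Big\|w\frac{G(t)-\mu}{\sqrt\mu}\Big\|_{L^\infty(\gamma_-)}<\delta,$$ such that if $F$ on $[0,\infty)\times\bar\Omega\times\mathbb{R}^3$ is the Boltzmann solution with initial datum $F_0$ and the in-flow boundary condition $F=G$ on $\gamma_-$, then $F$ is discontinuous in space and velocity at $(t_0,x_0,v_0)$, i.e. $[F(t_0)]_{x_0,v_0}\neq0$. 2. (Diffuse reflection) There exist $t_0\in(0,\min\{\delta,t_{\mathbf b}(x_0,-v_0)\})$ and an initial datum $F_0(x,v)$ continuous on $(\Omega\times\mathbb{R}^3)\cup\gamma_-\cup\gamma_0^{\mathbf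 S}$, satisfying $$F_0(x,v)=c_\mu\mu(v)\int_{v'\cdot n(x)>0}F_0(x,v')\{n(x)\cdot v'\}\,dv'\quad\text{for }(x,v)\in\gamma_-\cup\gamma_0^{\mathbf S}$$ and $$\Big\|w\frac{F_0-\mu}{\sqrt\mu}\Big\|_{L^\infty(\bar\Omega\times\mathbb{R}^3)}<\delta,$$ such that if $F$ on $[0,\infty)\times\bar\Omega\times\mathbb{R}^3$ is the Boltzmann solution with initial datum $F_0$ and the diffuse reflection boundary condition, then $[F(t_0)]_{x_0,v_0}\neq0$. 3. (Bounce-back) There exist $t_0\in(0,\min\{\delta,t_{\mathbf b}(x_0,-v_0),t_{\mathbf b}(x_0,v_0)\})$ and an initial datum $F_0(x,v)$ continuous on $(\Omega\times\mathbb{R}^3)\cup\gamma_-\cup\gamma_0^{\mathbf S}$, satisfying $\big\|w\frac{F_0-\mu}{\sqrt\mu}\big\|_{L^\infty(\bar\Omega\times\mathbb{R}^3)}<\delta$ and $$F_0(x,v)=F_0(x,-v)\quad\text{for }(x,v)\in\gamma_-\cup\gamma_0^{\mathbf S},$$ such that if $F$ on $[0,\infty)\times\bar\Omega\times\mathbb{R}^3$ is the Boltzmann solution with initial datum $F_0$ and the bounce-back boundary condition, then $[F(t_0)]_{x_0,v_0}\neq0$.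
   Context: **Domain.** Smoothness of $\partial\Omega$ means: for each $x_0\in\partial\Omega$ there are $r>0$ and a smooth $\Phi_{x_0}:\mathbb{R}^2\to\mathbb{R}$ such that, upon relabeling and reorienting the coordinate axes, $\Omega\cap B(x_0,r)=\{x\in B(x_0,r):x_3>\Phi_{x_0}(x_1,x_2)\}$. $n(x)$ is the outward unit normal at $x\in\partial\Omega$. **Backward exit time and position.** For $(x,v)\in\bar\Omega\times\mathbb{R}^3$, $t_{\mathbf b}(x,v)=\sup(\{0\}\cup\{\tau>0:x-sv\in\Omega\text{ for all }0<s<\tau\})$ and $x_{\mathbf b}(x,v)=x-t_{\mathbf b}(x,v)v$. **Phase boundary.** $\gamma_\pm=\{(x,v)\in\partial\Omega\times\mathbb{R}^3:\pm n(x)\cdot v>0\}$, $\gamma_0=\{(x,v)\in\partial\Omega\times\mathbb{R}^3:n(x)\cdot v=0\}$, and the concave (singular) grazing boundary is $\gamma_0^{\mathbf S}=\{(x,v)\in\gamma_0:t_{\mathbf b}(x,v)\neq0\text{ and }t_{\mathbf b}(x,-v)\neq0\}$. **Grazing set.** $\mathfrak G=\{(x,v)\in\bar\Omega\times\mathbb{R}^3:n(x_{\mathbf b}(x,v))\cdot v=0\}$. **Discontinuity jump.** For $\phi$ defined on $[0,\infty)\times\{(\bar\Omega\times\mathbb{R}^3)\setminus\mathfrak G\}$, $$[\phi(t)]_{x,v}=\lim_{\delta\downarrow0}\ \sup\ |\phi(t,x',v')-\phi(t,x'',v'')|,$$ the supremum over $(x',v'),(x'',v'')\in\{(\bar\Omega\times\mathbb{R}^3)\setminus\mathfrak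 G\}\cap\{B((x,v);\delta)\setminus\{(x,v)\}\}$. $\phi$ is discontinuous in space and velocity at $(t,x,v)$ iff $[\phi(t)]_{x,v}\ne0$. **Boltzmann equation.** $\partial_tF+v\cdot\nabla_xF=Q(F,F)$, where $$Q(F_1,F_2)=\int_{\mathbb{R}^3}\int_{\mathbb{S}^2}B(v-u,\omega)F_1(u')F_2(v')\,d\omega du-\int_{\mathbb{R}^3}\int_{\mathbb{S}^2}B(v-u,\omega)F_1(u)F_2(v)\,d\omega du=:Q_+(F_1,F_2)-Q_-(F_1,F_2),$$ $u'=u+[(v-u)\cdot\omega]\omega$, $v'=v-[(v-u)\cdot\omega]\omega$, $B(v-u,\omega)=|v-u|^\gamma q_0\big(\frac{v-u}{|v-u|}\cdot\omega\big)$, $0<\gamma\le1$ (hard potential), $\int_{\mathbb{S}^2}q_0(\hat u\cdot\omega)d\omega<\infty$ for all $\hat u\in\mathbb{S}^2$ (angular cutoff). **Maxwellian and weight.** $\mu(v)=e^{-|v|^2/2}$; $c_\mu>0$ is the constant with $c_\mu\int_{v'\cdot n(x)>0}\mu(v')|n(x)\cdot v'|dv'=1$; $w(v)=(1+\rho^2|v|^2)^\beta$ with $w^{-2}(v)(1+|v|)^3\in L^1(\mathbb{R}^3)$. **Boundary conditions** for $(x,v)\in\gamma_-$: in-flow $F(t,x,v)=G(t,x,v)$; diffuse reflection $F(t,x,v)=c_\mu\mu(v)\int_{v'\cdot n(x)>0}F(t,x,v')\{n(x)\cdot v'\}dv'$; bounce-back $F(t,x,v)=F(t,x,-v)$. **Solutions.**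 Write $F=\mu+\sqrt\mu f$, $h=wf$, $h_0=w(F_0-\mu)/\sqrt\mu$, $\nu(v)=\int\!\!\int|v-u|^\gamma\mu(u)q_0(\frac{v-u}{|v-u|}\cdot\omega)d\omega du$, $Kf=\frac1{\sqrt\mu}\{Q_+(\mu,\sqrt\mu f)+Q_+(\sqrt\mu f,\mu)-Q_-(\sqrt\mu f,\mu)\}$, $K_wh=wK(h/w)$, $\Gamma(f,g)=\frac1{\sqrt\mu}Q(\sqrt\mu f,\sqrt\mu g)$. The equation reads $\{\partial_t+v\cdot\nabla_x+\nu-K_w\}h=w\Gamma(\frac hw,\frac hw)$, and ''Boltzmann solution'' means the global near-Maxwellian solution with the given initial datum and boundary condition: $h$ is bounded on $[0,\infty)\times\bar\Omega\times\mathbb{R}^3$, satisfies the equation in integrated (Duhamel) form along the characteristics $s\mapsto(x-(t-s)v,v)$ until they hit the boundary, and takes the prescribed boundary values on $\gamma_-$. For small data such a global solution exists and satisfies $\sup_{t\ge0}\|h(t)\|_\infty\le C'\|h_0\|_\infty$ for diffuse and bounce-back conditions and for the in-flow condition with $G\equiv\mu$, with $C'$ independent of the data. *)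

(* Defs.v *)
From HB Require Import structures.
From mathcomp Require Import all_boot all_order all_algebra perm.
From mathcomp Require Import all_classical all_reals all_analysis.

Set Implicit Arguments.
Unset Strict Implicit.
Unset Printing Implicit Defensive.

Import Order.TTheory GRing.Theory Num.Theory.
Import numFieldNormedType.Exports.

Local Open Scope classical_set_scope.
Local Open Scope ring_scope.

(* The library norm on row vectors is the sup norm; all balls and lengths below
   use the Euclidean norm [enorm]. The topologies coincide. *)
Definition dot (R : realType) (x y : 'rV[R]_3) : R :=
  \sum_(i < 3) x 0 i * y 0 i.

Definition enorm (R : realType) (x : 'rV[R]_3) : R := Num.sqrt (dot x x).

Definition vec3 (R : realType) (p : R * R * R) : 'rV[R]_3 :=
  \row_(i < 3) [:: p.1.1; p.1.2; p.2]`_i.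

Definition lebesgue3 (R : realType) :=
  ((@lebesgue_measure R \x @lebesgue_measure R) \x @lebesgue_measure R)%E.

Definition int3 (R : realType) (D : set 'rV[R]_3) (f : 'rV[R]_3 -> R) : R :=
  \int[@lebesgue3 R]_(p in @vec3 R @^-1` D) f (vec3 p).

(* Surface measure of the unit sphere, in spherical coordinates:
   dω = sin θ dθ dφ on [0, π] × [0, 2π]. *)
Definition sph (R : realType) (theta phi : R) : 'rV[R]_3 :=
  vec3 (sin theta * cos phi, sin theta * sin phi, cos theta).

Definition eint_sphere (R : realType) (f : 'rV[R]_3 -> \bar R) : \bar R :=
  (\int[@lebesgue_measure R \x @lebesgue_measure R]_(
      p in `[0%R, pi]%classic `*` `[0%R, (pi *+ 2)%R]%classic)
    (f (sph p.1 p.2) * (sin p.1)%:E))%E.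

Definition int_sphere (R : realType) (f : 'rV[R]_3 -> R) : R :=
  fine (eint_sphere (fun omega => (f omega)%:E)).

(* Supremum in [0, +oo]; in particular the supremum of the empty set is 0. *)
Definition nnsup (R : realType) (A : set (\bar R)) : \bar R :=
  ereal_sup (0%E |` A).

Fixpoint Ck (R : realType) (n k : nat) (f : 'rV[R]_n -> R) : Prop :=
  continuous f /\
  if k is k'.+1 then
    forall i : 'I_n,
      (forall y, derivable f y (delta_mx 0 i)) /\
      Ck k' (fun y => 'D_(delta_mx 0 i) f y)
  else True.

Definition smooth (R : realType) (n : nat) (f : 'rV[R]_n -> R) : Prop :=
  forall k, Ck k f.

(* Relabelling (s) and reorientation (e) of the coordinate axes. *)
Definition relabel (R : realType) (s : 'S_3) (e : 'I_3 -> bool)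
    (x : 'rV[R]_3) : 'rV[R]_3 :=
  \row_(i < 3) ((-1) ^+ e i * x 0 (s i)).

Definition first2 (R : realType) (y : 'rV[R]_3) : 'rV[R]_2 :=
  \row_(i < 2) y 0 (inord i).

Definition is_chart (R : realType) (Omega : set 'rV[R]_3) (x0 : 'rV[R]_3)
    (r : R) (s : 'S_3) (e : 'I_3 -> bool) (Phi : 'rV[R]_2 -> R) : Prop :=
  [/\ 0 < r, smooth Phi &
      Omega `&` [set x | enorm (x - x0) < r] =
      [set x | enorm (x - x0) < r /\
               Phi (first2 (relabel s e x)) < relabel s e x 0 ord_max]].

Definition bdry (R : realType) (Omega : set 'rV[R]_3) : set 'rV[R]_3 :=
  closure Omega `\` interior Omega.

Definition smooth_boundary (R : realType) (Omega : set 'rV[R]_3) : Prop :=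
  forall x0, bdry Omega x0 ->
    exists r s e Phi, is_chart Omega x0 r s e Phi.

(* In chart coordinates the outward unit normal of {y_3 > Phi (y_1, y_2)} is
   (d_1 Phi, d_2 Phi, -1) / sqrt (1 + |grad Phi|^2). *)
Definition is_outward_normal (R : realType) (Omega : set 'rV[R]_3)
    (x n : 'rV[R]_3) : Prop :=
  exists r s e Phi, is_chart Omega x r s e Phi /\
    let y := first2 (relabel s e x) in
    let p1 := 'D_(delta_mx 0 ord0) Phi y in
    let p2 := 'D_(delta_mx 0 ord_max) Phi y in
    relabel s e n =
      (Num.sqrt (1 + p1 ^+ 2 + p2 ^+ 2))^-1 *: vec3 (p1, p2, -1).

(* The value 0 away from the boundary is a dummy. *)
Definition normal (R : realType) (Omega : set 'rV[R]_3) (x : 'rV[R]_3)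
    : 'rV[R]_3 :=
  if pselect (bdry Omega x) then xget 0 (is_outward_normal Omega x) else 0.

(* Extended-real valued: t_b (x, 0) = +oo for x in Omega. *)
Definition t_b (R : realType) (Omega : set 'rV[R]_3) (x v : 'rV[R]_3) : \bar R :=
  ereal_sup (0%E |`
    [set tau%:E | tau in [set tau : R | 0 < tau /\
       forall s : R, 0 < s -> s < tau -> Omega (x - s *: v)]]).

(* For bounded Omega, t_b (x, v) = +oo only if v = 0, where x_b (x, 0) = x. *)
Definition x_b (R : realType) (Omega : set 'rV[R]_3) (x v : 'rV[R]_3)
    : 'rV[R]_3 :=
  x - fine (t_b Omega x v) *: v.

Definition gamma_plus (R : realType) (Omega : set 'rV[R]_3)
    : set ('rV[R]_3 * 'rV[R]_3) :=
  [set p | bdry Omega p.1 /\ 0 < dot (normal Omega p.1) p.2].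

Definition gamma_minus (R : realType) (Omega : set 'rV[R]_3)
    : set ('rV[R]_3 * 'rV[R]_3) :=
  [set p | bdry Omega p.1 /\ dot (normal Omega p.1) p.2 < 0].

Definition gamma_0 (R : realType) (Omega : set 'rV[R]_3)
    : set ('rV[R]_3 * 'rV[R]_3) :=
  [set p | bdry Omega p.1 /\ dot (normal Omega p.1) p.2 = 0].

Definition gamma_0S (R : realType) (Omega : set 'rV[R]_3)
    : set ('rV[R]_3 * 'rV[R]_3) :=
  [set p | [/\ gamma_0 Omega p, t_b Omega p.1 p.2 <> 0%E &
               t_b Omega p.1 (- p.2) <> 0%E]].

(* Contains every (x, 0). *)
Definition grazing (R : realType) (Omega : set 'rV[R]_3)
    : set ('rV[R]_3 * 'rV[R]_3) :=
  [set p | closure Omega p.1 /\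
           dot (normal Omega (x_b Omega p.1 p.2)) p.2 = 0].

Definition phase_dist (R : realType) (p q : 'rV[R]_3 * 'rV[R]_3) : R :=
  Num.sqrt (enorm (p.1 - q.1) ^+ 2 + enorm (p.2 - q.2) ^+ 2).

(* Admissible points of the punctured Euclidean ball of R^6. *)
Definition jump_nbhd (R : realType) (Omega : set 'rV[R]_3)
    (p : 'rV[R]_3 * 'rV[R]_3) (d : R) : set ('rV[R]_3 * 'rV[R]_3) :=
  [set q | [/\ closure Omega q.1, ~ grazing Omega q,
               phase_dist q p < d & q <> p]].

Definition jump (R : realType) (Omega : set 'rV[R]_3)
    (phi : R -> 'rV[R]_3 -> 'rV[R]_3 -> R) (t : R) (x v : 'rV[R]_3) : \bar R :=
  lim ((fun d : R => nnsup [set z | exists q1 q2,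
          [/\ jump_nbhd Omega (x, v) d q1, jump_nbhd Omega (x, v) d q2 &
              z = `|phi t q1.1 q1.2 - phi t q2.1 q2.2|%:E]])
       @ 0^'+).

Definition discontinuous_at (R : realType) (Omega : set 'rV[R]_3)
    (phi : R -> 'rV[R]_3 -> 'rV[R]_3 -> R) (t : R) (x v : 'rV[R]_3) : Prop :=
  jump Omega phi t x v <> 0%E.

Definition mu (R : realType) (v : 'rV[R]_3) : R := expR (- enorm v ^+ 2 / 2).

Definition weight (R : realType) (rho beta : R) (v : 'rV[R]_3) : R :=
  (1 + rho ^+ 2 * enorm v ^+ 2) `^ beta.

Definition kernelB (R : realType) (gam : R) (q0 : R -> R)
    (z omega : 'rV[R]_3) : R :=
  enorm z `^ gam * q0 (dot ((enorm z)^-1 *: z) omega).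

Definition post_u (R : realType) (u v omega : 'rV[R]_3) : 'rV[R]_3 :=
  u + dot (v - u) omega *: omega.

Definition post_v (R : realType) (u v omega : 'rV[R]_3) : 'rV[R]_3 :=
  v - dot (v - u) omega *: omega.

Definition Qplus (R : realType) (gam : R) (q0 : R -> R)
    (F1 F2 : 'rV[R]_3 -> R) (v : 'rV[R]_3) : R :=
  int3 setT (fun u => int_sphere (fun omega =>
    kernelB gam q0 (v - u) omega * F1 (post_u u v omega) * F2 (post_v u v omega))).

Definition Qminus (R : realType) (gam : R) (q0 : R -> R)
    (F1 F2 : 'rV[R]_3 -> R) (v : 'rV[R]_3) : R :=
  int3 setT (fun u => int_sphere (fun omega =>
    kernelB gam q0 (v - u) omega * F1 u * F2 v)).

Definition Qcoll (R : realType) (gam : R) (q0 : R -> R)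
    (F1 F2 : 'rV[R]_3 -> R) (v : 'rV[R]_3) : R :=
  Qplus gam q0 F1 F2 v - Qminus gam q0 F1 F2 v.

Definition nu (R : realType) (gam : R) (q0 : R -> R) (v : 'rV[R]_3) : R :=
  int3 setT (fun u => int_sphere (fun omega =>
    enorm (v - u) `^ gam * mu u * q0 (dot ((enorm (v - u))^-1 *: (v - u)) omega))).

Definition sqmu (R : realType) (v : 'rV[R]_3) : R := Num.sqrt (mu v).

Definition Kop (R : realType) (gam : R) (q0 : R -> R) (f : 'rV[R]_3 -> R)
    (v : 'rV[R]_3) : R :=
  let g := fun u => sqmu u * f u in
  (sqmu v)^-1 *
    (Qplus gam q0 (@mu R) g v + Qplus gam q0 g (@mu R) v
     - Qminus gam q0 g (@mu R) v).

Definition Kw (R : realType) (gam : R) (q0 : R -> R) (rho beta : R)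
    (h : 'rV[R]_3 -> R) (v : 'rV[R]_3) : R :=
  weight rho beta v * Kop gam q0 (fun u => h u / weight rho beta u) v.

Definition Gam (R : realType) (gam : R) (q0 : R -> R) (f g : 'rV[R]_3 -> R)
    (v : 'rV[R]_3) : R :=
  (sqmu v)^-1 *
    Qcoll gam q0 (fun u => sqmu u * f u) (fun u => sqmu u * g u) v.

Definition wpert (R : realType) (rho beta : R)
    (F : 'rV[R]_3 -> 'rV[R]_3 -> R) (x v : 'rV[R]_3) : R :=
  weight rho beta v * ((F x v - mu v) / sqmu v).

(* F0 is Borel measurable on closure Omega × R^3. *)
Definition measurable_datum (R : realType) (Omega : set 'rV[R]_3)
    (F0 : 'rV[R]_3 -> 'rV[R]_3 -> R) : Prop :=
  measurable_fun [set p : (R * R * R) * (R * R * R) | closure Omega (vec3 p.1)]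
    (fun p => F0 (vec3 p.1) (vec3 p.2)).

Definition measurable_sol (R : realType) (Omega : set 'rV[R]_3)
    (F : R -> 'rV[R]_3 -> 'rV[R]_3 -> R) : Prop :=
  measurable_fun [set p : R * ((R * R * R) * (R * R * R)) |
                    0 <= p.1 /\ closure Omega (vec3 p.2.1)]
    (fun p => F p.1 (vec3 p.2.1) (vec3 p.2.2)).

(* (d_t + v . grad_x + nu - K_w) h = w Gamma (h / w, h / w), integrated over
   [s, t] along tau |-> (x - (t - tau) v, v), for every segment of the backward
   characteristic that does not go beyond its first exit point. *)
Definition duhamel (R : realType) (gam : R) (q0 : R -> R) (rho beta : R)
    (Omega : set 'rV[R]_3) (h : R -> 'rV[R]_3 -> 'rV[R]_3 -> R) : Prop :=
  forall (s t : R) (x v : 'rV[R]_3),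
    0 <= s -> s <= t -> closure Omega x ->
    ((t - s)%:E <= t_b Omega x v)%E ->
    h t x v =
      expR (- nu gam q0 v * (t - s)) * h s (x - (t - s) *: v) v +
      \int[@lebesgue_measure R]_(tau in `[s, t])
        (expR (- nu gam q0 v * (t - tau)) *
          (let y := x - (t - tau) *: v in
           let f := fun u => h tau y u / weight rho beta u in
           Kw gam q0 rho beta (h tau y) v +
           weight rho beta v * Gam gam q0 f f v)).

Definition boltzmann_solution (R : realType) (gam : R) (q0 : R -> R)
    (rho beta : R) (Omega : set 'rV[R]_3)
    (BC : (R -> 'rV[R]_3 -> 'rV[R]_3 -> R) -> Prop)
    (F0 : 'rV[R]_3 -> 'rV[R]_3 -> R)
    (F : R -> 'rV[R]_3 -> 'rV[R]_3 -> R) : Prop :=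
  let h := fun t => wpert rho beta (F t) in
  [/\ measurable_sol Omega F,
      exists M : R, forall t x v, 0 <= t -> closure Omega x -> `|h t x v| <= M,
      forall x v, closure Omega x -> F 0 x v = F0 x v,
      duhamel gam q0 rho beta Omega h &
      BC F].

Definition outflux (R : realType) (Omega : set 'rV[R]_3) (x : 'rV[R]_3)
    (g : 'rV[R]_3 -> R) : R :=
  int3 [set v' | 0 < dot v' (normal Omega x)]
       (fun v' => g v' * dot (normal Omega x) v').

Definition inflow_bc (R : realType) (Omega : set 'rV[R]_3)
    (G F : R -> 'rV[R]_3 -> 'rV[R]_3 -> R) : Prop :=
  forall t x v, 0 <= t -> gamma_minus Omega (x, v) -> F t x v = G t x v.

Definition diffuse_bc (R : realType) (cmu : R) (Omega : set 'rV[R]_3)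
    (F : R -> 'rV[R]_3 -> 'rV[R]_3 -> R) : Prop :=
  forall t x v, 0 <= t -> gamma_minus Omega (x, v) ->
    F t x v = cmu * mu v * outflux Omega x (F t x).

Definition bounceback_bc (R : realType) (Omega : set 'rV[R]_3)
    (F : R -> 'rV[R]_3 -> 'rV[R]_3 -> R) : Prop :=
  forall t x v, 0 <= t -> gamma_minus Omega (x, v) -> F t x v = F t x (- v).

Definition gamma_in (R : realType) (Omega : set 'rV[R]_3)
    : set ('rV[R]_3 * 'rV[R]_3) :=
  gamma_minus Omega `|` gamma_0S Omega.

Definition continuous_datum (R : realType) (Omega : set 'rV[R]_3)
    (F0 : 'rV[R]_3 -> 'rV[R]_3 -> R) : Prop :=
  {within (Omega `*` setT) `|` gamma_in Omega,
    continuous (fun p : 'rV[R]_3 * 'rV[R]_3 => F0 p.1 p.2)}.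

Definition continuous_bdatum (R : realType) (Omega : set 'rV[R]_3)
    (G : R -> 'rV[R]_3 -> 'rV[R]_3 -> R) : Prop :=
  {within [set t : R | 0 <= t] `*` gamma_in Omega,
    continuous (fun p : R * ('rV[R]_3 * 'rV[R]_3) => G p.1 p.2.1 p.2.2)}.

(* Pointwise supremum norms, which dominate the essential ones. *)
Definition datum_norm (R : realType) (rho beta : R) (Omega : set 'rV[R]_3)
    (F0 : 'rV[R]_3 -> 'rV[R]_3 -> R) : \bar R :=
  nnsup [set `|wpert rho beta F0 p.1 p.2|%:E | p in closure Omega `*` setT].

Definition bdatum_norm (R : realType) (rho beta : R) (Omega : set 'rV[R]_3)
    (G : R -> 'rV[R]_3 -> 'rV[R]_3 -> R) : \bar R :=
  nnsup [set nnsup [set `|wpert rho beta (G t) p.1 p.2|%:E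
                     | p in gamma_minus Omega] | t in [set t : R | 0 <= t]].

(* Main.v *)
Require Import Defs.
From HB Require Import structures.
From mathcomp Require Import all_boot all_order all_algebra perm.
From mathcomp Require Import all_classical all_reals all_analysis.
From mathcomp Require Import measurable_realfun.
From mathcomp Require Import ring lra.

Set Implicit Arguments.
Unset Strict Implicit.
Unset Printing Implicit Defensive.

Import Order.TTheory GRing.Theory Num.Theory.
Import numFieldNormedType.Exports.

Local Open Scope classical_set_scope.
Local Open Scope ring_scope.

(** A small bump is added to the Maxwellian near (x0 - t0 v0, v0), away from the
    boundary; the boundary datum is the Maxwellian. Near x0 there are x2, whose
    backward trajectory with a velocity w close to v0 stays in Omega up to time
    t0 and meets the bump, and x1, slightly on the concave side, whose backward
    trajectory hits the boundary first and comes from the shadow. Along the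
    first one the perturbation is transported up to an error of order t0, hence
    is comparable to the amplitude c of the bump. At the boundary point met by
    the second one it is at most c/16: it vanishes for in-flow, it comes from
    velocities near -v0 for bounce-back, and for diffuse reflection from an
    average over few velocities plus a short collision history. So the jump is
    at least c/16, uniformly as x1, x2, w tend to x0, x0, v0.

    The errors are controlled by a bound of the perturbation by a multiple of c
    times a Gaussian whose rate relaxes linearly in time, which absorbs the
    linear velocity growth of the collision terms for hard potentials.
    Everything is shown off a null set of velocities: by Sard's theorem the
    grazing velocities at a given point are negligible, and almost every
    collision avoids a given null set. *)

(** * Integration without measurability, and changes of variable on the line *)

(** The difficulty is how little a solution provides. Its a priori bound is of unknown size,
    unrelated to [delta], so smallness up to a time independent of that bound has to be earned: the
    unknown bound enters only with a factor made small by shortening the time step, each step is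
    then improved to a bound by the datum alone, and the steps can be iterated up to a fixed time.
    Pointwise values are controlled only at velocities whose trajectories avoid grazing, and no
    measurability of the collision term along a trajectory is established; hence integrals are
    bounded through measurable majorants, valid almost everywhere. The cross-section is integrable
    for each direction separately, and its uniform bound rests on a hands-on form of rotation
    invariance. The rates fit together as follows: the square root of [mu] decays with rate 1/4,
    dividing by the weight leaves 3/16, the barrier starts at 1/8 and may relax to 1/16, where
    Gaussian moments are still finite. The time [t0] is fixed before the amplitude [c], all errors
    being proportional to [c]. *)

Notation leb R := (@lebesgue_measure R).

Import HBNNSimple.

(** The integral of a nonnegative [f], measurable or not, is the supremum over the simple functions
    below it, and each of these lies almost everywhere below the measurable [g]. *)
Lemma ge0_le_integral_ae d (T : measurableType d) (R : realType)
    (m : {measure set T -> \bar R}) (D : set T) (f g : T -> \bar R) :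
  measurable D -> (forall x, D x -> 0 <= f x)%E ->
  (forall x, D x -> 0 <= g x)%E -> measurable_fun D g ->
  {ae m, forall x, D x -> (f x <= g x)%E} ->
  (\int[m]_(x in D) f x <= \int[m]_(x in D) g x)%E.
Proof.
move=> mD f0 g0 mg [N [mN N0 subN]].
rewrite (ge0_integralE m f0); apply: ge_ereal_sup => /= _ [h /= hf <-].
rewrite -integralT_nnsfun [leRHS]integral_mkcond.
apply: ae_ge0_le_integral => //.
- by move=> x _; rewrite lee_fin.
- exact/measurable_EFinP/measurable_funP.
- by move=> x _; rewrite patchE; case: ifPn => // /set_mem; exact: g0.
- exact/(measurable_restrictT _ mD).
exists N; split => // x /= nx; apply: subN => /= fg; apply: nx => _.
apply: (le_trans (hf x)); rewrite !patchE; case: ifPn => // xD.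
exact/fg/set_mem.
Qed.

(** The positive and negative parts of [f] both have integrals between 0 and that of [g], which
    therefore also bounds their difference. *)
Lemma abse_integral_le_ae d (T : measurableType d) (R : realType)
    (m : {measure set T -> \bar R}) (D : set T) (f g : T -> \bar R) :
  measurable D ->
  (forall x, D x -> 0 <= g x)%E -> measurable_fun D g ->
  {ae m, forall x, D x -> (`|f x| <= g x)%E} ->
  (`|\int[m]_(x in D) f x| <= \int[m]_(x in D) g x)%E.
Proof.
move=> mD g0 mg fg; rewrite integralE.
set A := integral _ _ _; set B := integral _ _ _; set G := integral _ _ g.
have absge x : (0 <= f^\+ x <= `|f x|)%E /\ (0 <= f^\- x <= `|f x|)%E.
  have e : `|f x|%E = (f^\+ x + f^\- x)%E.
    exact: (congr1 (fun k => k x) (fune_abse f)).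
  by rewrite e funepos_ge0 funeneg_ge0 leeDl ?leeDr.
have fin (k : T -> \bar R) : (forall x, 0 <= k x <= `|f x|)%E ->
    (0 <= \int[m]_(x in D) k x <= G)%E.
  move=> kf; apply/andP; split.
    by apply: integral_ge0 => x _; case/andP: (kf x).
  apply: ge0_le_integral_ae => //; first by move=> x _; case/andP: (kf x).
  case: fg => N [mN N0 subN]; exists N; split => // x /= nx; apply: subN => /= fgx.
  by apply: nx => Dx; apply: le_trans (fgx Dx); case/andP: (kf x).
have /andP[A0 AG] := fin _ (fun x => proj1 (absge x)).
have /andP[B0 BG] := fin _ (fun x => proj2 (absge x)).
have [->|Gfin] := eqVneq G +oo%E; first exact: leey.
have : (G < +oo)%E by rewrite lt_neqAle Gfin leey.
rewrite -/A -/B in A0 AG B0 BG *.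
case: G AG BG {Gfin fin} => [r||] // AG BG _.
  case: A A0 AG => [a||] // A0 AG; case: B B0 BG => [b||] // B0 BG.
  rewrite -EFinB lee_fin ler_norml.
  move: A0 AG B0 BG; rewrite !lee_fin => *; apply/andP; split; lra.
by have := le_trans A0 AG.
Qed.

Lemma normr_Rintegral_le_ae d (T : measurableType d) (R : realType)
    (m : {measure set T -> \bar R}) (D : set T) (f : T -> R) (g : T -> \bar R) C :
  measurable D ->
  (forall x, D x -> 0 <= g x)%E -> measurable_fun D g ->
  {ae m, forall x, D x -> (`|f x|%:E <= g x)%E} ->
  (\int[m]_(x in D) g x <= C%:E)%E ->
  `|\int[m]_(x in D) f x| <= C.
Proof.
move=> mD g0 mg fg gC; rewrite /Rintegral.
have := le_trans (abse_integral_le_ae (f := EFin \o f) mD g0 mg fg) gC.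
by case: integral => [r||] //=; rewrite ?lee_fin.
Qed.

(** The product measure of the complement is the integral of the measures of its sections, and a
    nonnegative integral vanishes exactly when the integrand does almost everywhere. *)
Lemma ae_prodP d1 d2 (X : measurableType d1) (Y : measurableType d2) (R : realType)
    (m1 : {sigma_finite_measure set X -> \bar R})
    (m2 : {sigma_finite_measure set Y -> \bar R}) (A : set (X * Y)) :
  measurable A ->
  {ae (m1 \x m2)%E, forall z, A z} <->
  {ae m1, forall x, {ae m2, forall y, A (x, y)}}.
Proof.
move=> mA; pose B := ~` A; have mB : measurable B by exact: measurableC.
have mBx x : measurable (xsection B x) by exact: measurable_xsection.
have sec x : {ae m2, forall y, A (x, y)} <-> m2 (xsection B x) = 0%E.
  rewrite -(negligibleP _ (mBx x)); split; apply: negligibleS => y /=.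
  - by rewrite /xsection /= inE.
  - by rewrite /xsection /= inE.
have mf : measurable_fun setT (m2 \o xsection B) by exact: measurable_fun_xsection.
have e : {ae (m1 \x m2)%E, forall z, A z} <-> (m1 \x m2)%E B = 0%E.
  by rewrite -(negligibleP _ mB); split; apply: negligibleS => z /=.
rewrite e /product_measure1.
have := ae_eq_integral_abs m1 measurableT mf.
under eq_integral do rewrite gee0_abs//.
move=> ->; split.
- by case=> N [mN N0 sN]; exists N; split => // x nx; apply: sN => /= h; apply: nx;
    apply/sec; exact: h.
- by case=> N [mN N0 sN]; exists N; split => // x nx; apply: sN => /= h; apply: nx;
    move=> _; apply/sec.
Qed.

(** Tonelli: both iterated integrals of the indicator of the exceptional set are its product
    measure. *)
Lemma ae_swap d1 d2 (X : measurableType d1) (Y : measurableType d2) (R : realType)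
    (m1 : {sigma_finite_measure set X -> \bar R})
    (m2 : {sigma_finite_measure set Y -> \bar R}) (A : X -> Y -> Prop) :
  measurable [set z : X * Y | A z.1 z.2] ->
  {ae m1, forall x, {ae m2, forall y, A x y}} ->
  {ae m2, forall y, {ae m1, forall x, A x y}}.
Proof.
move=> mA; pose B := ~` [set z : X * Y | A z.1 z.2].
have mB : measurable B by exact: measurableC.
move/(ae_prodP m1 m2 mA) => h.
have B0 : (m1 \x m2)%E B = 0%E.
  by apply/(negligibleP _ mB); apply: negligibleS h => z.
have mBy y : measurable (ysection B y) by exact: measurable_ysection.
have mf : measurable_fun setT (m1 \o ysection B) by exact: measurable_fun_ysection.
have : (\int[m2]_y (m1 (ysection B y)) = 0)%E.
  rewrite -/(product_measure2 m1 m2 B) -B0; symmetry.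
  have := @fubini_tonelli2 _ _ _ _ _ m1 m2 (EFin \o \1_B).
  have mi : measurable_fun setT (EFin \o (\1_B : X * Y -> R)).
    exact/measurable_EFinP/measurable_indic.
  move=> /(_ mi); rewrite integral_indic// setIT => ->; last by move=> z; rewrite lee_fin.
  apply: eq_integral => y _; rewrite /fubini_G /=.
  rewrite (_ : (fun x => _) = (EFin \o \1_(ysection B y))).
    by rewrite integral_indic// setIT.
  apply/funext => x /=; congr EFin; rewrite !indicE; congr (_%:R); congr nat_of_bool.
  by rewrite /ysection; apply/idP/idP; rewrite !inE /= ?inE.
have := ae_eq_integral_abs m2 measurableT mf.
under eq_integral do rewrite gee0_abs//.
move=> e /e [N [mN N0 sN]]; exists N; split => // y ny; apply: sN => /= hy.
apply: ny; have /(negligibleP _ (mBy y)) := hy Logic.I.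
by apply: negligibleS => x /= nA; rewrite /ysection /= inE.
Qed.

(** The hypothesis on half-open intervals says that the image under [phi] of the measure with
    density [h] is Lebesgue measure; uniqueness extends this to all Borel sets. Stated this way, the
    lemma also covers a [phi] with several branches, [h] selecting one of them. *)
Lemma ge0_integral_subst (R : realType) (h phi : R -> R) :
  measurable_fun setT h -> measurable_fun setT phi -> (forall x, 0 <= h x) ->
  (forall a b, a < b ->
    (\int[leb R]_(x in phi @^-1` `]a, b]%classic) (h x)%:E
     = (b - a)%:E)%E) ->
  forall f : R -> R, measurable_fun setT f -> (forall x, 0 <= f x) ->
  (\int[leb R]_x (h x * f (phi x))%:E =
   \int[leb R]_x (f x)%:E)%E.
Proof.
move=> mh mphi h0 hphi f mf f0.
have mpre (A : set R) : measurable A -> measurable (phi @^-1` A).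
  by move=> mA; rewrite -[X in measurable X]setTI; exact: mphi.
pose nu0 (A : set (measurableTypeR R)) : \bar R :=
  (\int[leb R]_(x in phi @^-1` A) (h x)%:E)%E.
have nu00 : nu0 set0 = 0%E by rewrite /nu0 preimage_set0 integral_set0.
have nu0_ge0 A : (0 <= nu0 A)%E by apply: integral_ge0 => x _; rewrite lee_fin.
have nu0_sig : semi_sigma_additive nu0.
  move=> F mF tF mUF; rewrite /nu0 preimage_bigcup.
  rewrite ge0_integral_bigcup//=.
  - apply: is_cvg_ereal_nneg_natsum_cond => n _ _.
    by apply: integral_ge0 => x _; rewrite lee_fin.
  - by move=> k; exact: (mpre _ (mF k)).
  - by apply/measurable_EFinP; exact: measurable_funS mh.
  - by move=> x _; rewrite lee_fin.
  - move=> i j _ _ [x [/= xi xj]]; apply: (tF i j) => //; by exists (phi x).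
pose nuM := isMeasure.Build _ _ _ nu0 nu00 nu0_ge0 nu0_sig.
pose nu : {measure set (measurableTypeR R) -> \bar R} := HB.pack nu0 nuM.
have nuE (A : set R) : measurable A -> leb R A = nu0 A.
  move=> mA; apply: (lebesgue_measure_unique (mu := nu)) => //= X [[a b]] _ <- /=.
  rewrite /nu0; have [ab|ba] := ltP a b.
    by rewrite hphi// lebesgue_measure_itv/= lte_fin ab.
  by rewrite set_itv_ge ?bnd_simp -?leNgt// measure0 preimage_set0 integral_set0.
(* Layer-cake: both sides are the integral over s >= 0 of the measure of {f > s}. *)
pose S (x s : R) : R := ((0 <= s) && (s < f x))%:R.
have mS : measurable_fun setT (fun z : R * R => S z.1 z.2).
  rewrite /S; apply: (measurableT_comp (f := fun b : bool => b%:R : R)) => //.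
  apply: measurable_and.
    by apply: measurable_fun_ler => //; exact: measurable_snd.
  apply: measurable_fun_ltr; first exact: measurable_snd.
  exact: (measurableT_comp mf measurable_fst).
have lay x : ((f x)%:E = \int[leb R]_s (S x s)%:E)%E.
  transitivity (leb R `[0, f x[%classic).
    rewrite lebesgue_measure_itv /= lte_fin.
    case: ifPn => [_|]; first by rewrite oppr0 adde0.
    by rewrite -leNgt => fx; congr EFin; apply/eqP; rewrite eq_le fx f0.
  transitivity (\int[leb R]_s (\1_(`[0, f x[%classic : set R) s : R)%:E)%E.
    by rewrite integral_indic// setIT.
  apply: eq_integral => s _; rewrite indicE /S; congr EFin; congr (_%:R); congr nat_of_bool.
  by apply/idP/idP; rewrite inE /= in_itv.
have S0 x s : 0 <= S x s by rewrite /S.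
transitivity (\int[leb R]_x
    \int[leb R]_s (h x * S (phi x) s)%:E)%E.
  apply: eq_integral => x _; rewrite EFinM lay -ge0_integralZl//.
  - by apply/measurable_EFinP; exact: (measurableT_comp mS (measurable_pair1 _)).
  - by move=> s _; rewrite lee_fin.
  - by rewrite lee_fin.
pose kk (z : R * R) : \bar R := (h z.1 * S (phi z.1) z.2)%:E.
have mkk : measurable_fun setT kk.
  apply/measurable_EFinP; apply: measurable_funM.
    exact: (measurableT_comp mh measurable_fst).
  have mp : measurable_fun setT (fun z : R * R => (phi z.1, z.2)).
    apply: measurable_fun_pair; last exact: measurable_snd.
    exact: (measurableT_comp mphi measurable_fst).
  exact: (measurableT_comp mS mp).
have := @fubini_tonelli _ _ _ _ _ (leb R) (leb R) kk mkk.
rewrite /kk /= => -> => [|z]; last by rewrite lee_fin mulr_ge0.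
transitivity (\int[leb R]_s
    \int[leb R]_x (S x s)%:E)%E; last first.
  have := @fubini_tonelli _ _ _ _ _ (leb R) (leb R)
    (fun z : R * R => (S z.1 z.2)%:E).
  move=> <- /=; first by apply: eq_integral => x _; rewrite lay.
    exact/measurable_EFinP.
  by move=> z; rewrite lee_fin.
apply: eq_integral => s _.
pose A := [set x | (0 <= s) && (s < f x)].
have mA : measurable A.
  have -> : A = (fun x => S x s) @^-1` [set 1].
    apply/seteqP; split => x; rewrite /A /= /S; first by move=> ->.
    by case: andP => //= _ /esym/eqP; rewrite oner_eq0.
  rewrite -[X in measurable X]setTI.
  apply: (measurableT_comp mS (measurable_pair2 s)) => //.
have SE x : S x s = \1_A x.
  by rewrite indicE /S; congr (_%:R); congr nat_of_bool; apply/idP/idP; rewrite inE.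
under [RHS]eq_integral do rewrite SE.
have -> : (\int[leb R]_x ((\1_A : R -> R) x)%:E = nu0 A)%E.
  by rewrite -(nuE _ mA) integral_indic ?setIT.
rewrite /nu0 [RHS]integral_mkcond.
apply: eq_integral => x _; rewrite patchE SE indicE /=.
rewrite (_ : (x \in phi @^-1` A) = (phi x \in A)).
  by case: ifP => _; rewrite ?mulr1 ?mulr0.
by apply/idP/idP; rewrite !inE.
Qed.

(** The integral of [h] times the indicator of [N] at [phi] is the measure of [N], that is 0, so
    [phi] avoids [N] almost everywhere on the set where [h] is positive. *)
Lemma ae_subst (R : realType) (h phi : R -> R) (P : R -> Prop) :
  measurable_fun setT h -> measurable_fun setT phi -> (forall x, 0 <= h x) ->
  (forall a b, a < b ->
    (\int[leb R]_(x in phi @^-1` `]a, b]%classic) (h x)%:E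
     = (b - a)%:E)%E) ->
  {ae leb R, forall x, P x} ->
  {ae leb R, forall x, 0 < h x -> P (phi x)}.
Proof.
move=> mh mphi h0 hphi [N [mN N0 sN]].
have mi : measurable_fun setT (\1_N : R -> R) by exact: measurable_indic.
have mhN : measurable_fun setT (fun x => (h x * \1_N (phi x))%:E).
  by apply/measurable_EFinP/measurable_funM => //; exact: measurableT_comp.
have hN0 x : (0 <= (h x * \1_N (phi x))%:E)%E by rewrite lee_fin mulr_ge0.
have := ge0_integral_subst mh mphi h0 hphi mi (fun x => _).
move=> /(_ (fun x => ler0n _ _)).
have iN0 : (\int[leb R]_x (\1_N x)%:E = 0)%E by rewrite integral_indic// setIT.
move=> /esym; rewrite iN0 => /esym h1.
have := ae_eq_integral_abs (leb R) measurableT mhN.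
under eq_integral do rewrite gee0_abs//.
move=> /(proj1)/(_ h1) [M [mM M0 sM]].
exists M; split => // x /= nP; apply: sM => /= hz; apply: nP => hx.
apply: contrapT => nP; have : N (phi x) by exact: sN.
move=> /mem_set xN; have := hz Logic.I; rewrite indicE xN mulr1 => -[] h2.
by move: hx; rewrite h2 ltxx.
Qed.

(** * Measurability of explicit functions *)

Section measurable_terms.
Context d (T : measurableType d) (R : realType).
Implicit Types f g : T -> R.

Lemma mf_add f g : measurable_fun setT f -> measurable_fun setT g ->
  measurable_fun setT (fun x => f x + g x).
Proof. exact: measurable_funD. Qed.

Lemma mf_mul f g : measurable_fun setT f -> measurable_fun setT g ->
  measurable_fun setT (fun x => f x * g x).
Proof. exact: measurable_funM. Qed.

Lemma mf_opp f : measurable_fun setT f -> measurable_fun setT (fun x => - f x).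
Proof. exact: measurable_funN. Qed.

Lemma mf_exp f n : measurable_fun setT f -> measurable_fun setT (fun x => f x ^+ n).
Proof. exact: measurable_funX. Qed.

Lemma mf_comp (k : R -> R) f : continuous k -> measurable_fun setT f ->
  measurable_fun setT (fun x => k (f x)).
Proof. by move=> ck mf; apply: measurableT_comp mf; exact: continuous_measurable_fun. Qed.

Lemma mf_powR f a : measurable_fun setT f -> measurable_fun setT (fun x => f x `^ a).
Proof. by move=> mf; exact: (measurableT_comp (measurable_powR a) mf). Qed.

(** Inversion is rewritten through a real power of the square, an identity that also holds at 0
    because the inverse of 0 is 0. *)
Lemma mf_inv f : measurable_fun setT f -> measurable_fun setT (fun x => (f x)^-1).
Proof.
move=> mf; rewrite (_ : (fun _ => _) = fun x => f x * (f x ^+ 2) `^ (-1)).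
  exact/mf_mul/mf_powR/mf_exp.
apply/funext => x; rewrite powR_inv1 ?sqr_ge0//.
have [->|fx] := eqVneq (f x) 0; first by rewrite invr0 mul0r.
by rewrite expr2 invfM mulrA mulfV// mul1r.
Qed.

Lemma mf_sqrt f : measurable_fun setT f -> measurable_fun setT (fun x => Num.sqrt (f x)).
Proof. by apply: mf_comp => x; exact: sqrt_continuous. Qed.

Lemma mf_norm f : measurable_fun setT f -> measurable_fun setT (fun x => `|f x|).
Proof. by apply: mf_comp => x; exact: norm_continuous. Qed.

Lemma mf_max f g : measurable_fun setT f -> measurable_fun setT g ->
  measurable_fun setT (fun x => Num.max (f x) (g x)).
Proof. exact: measurable_maxr. Qed.

Lemma mf_expR f : measurable_fun setT f -> measurable_fun setT (fun x => expR (f x)).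
Proof. by move=> mf; apply: measurableT_comp mf; exact: measurable_expR. Qed.

Lemma mf_cos f : measurable_fun setT f -> measurable_fun setT (fun x => cos (f x)).
Proof. by apply: mf_comp => x; exact: continuous_cos. Qed.

Lemma mf_sin f : measurable_fun setT f -> measurable_fun setT (fun x => sin (f x)).
Proof. by apply: mf_comp => x; exact: continuous_sin. Qed.

Lemma mf_tan f : measurable_fun setT f -> measurable_fun setT (fun x => tan (f x)).
Proof. by move=> mf; apply: mf_mul; [exact: mf_sin|exact/mf_inv/mf_cos]. Qed.

End measurable_terms.

Section measurable_pairs.
Context d (T : measurableType d) d1 (T1 : measurableType d1) d2 (T2 : measurableType d2).

Lemma mf_fst (f : T -> T1 * T2) : measurable_fun setT f ->
  measurable_fun setT (fun x => (f x).1).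
Proof. by move=> mf; apply: measurableT_comp mf; exact: measurable_fst. Qed.

Lemma mf_snd (f : T -> T1 * T2) : measurable_fun setT f ->
  measurable_fun setT (fun x => (f x).2).
Proof. by move=> mf; apply: measurableT_comp mf; exact: measurable_snd. Qed.

Lemma mf_pair (f : T -> T1) (g : T -> T2) : measurable_fun setT f ->
  measurable_fun setT g -> measurable_fun setT (fun x => (f x, g x)).
Proof. exact: measurable_fun_pair. Qed.

End measurable_pairs.

Ltac meas1 :=
  match goal with
  | |- measurable_fun _ (fun x => x) => exact: measurable_id
  | |- measurable_fun _ (fun _ => ?c) => exact: measurable_cst
  | |- measurable_fun _ (fun x => @GRing.add _ (@?f x) (@?g x)) => apply: (@mf_add _ _ _ f g)
  | |- measurable_fun _ (fun x => @GRing.mul _ (@?f x) (@?g x)) => apply: (@mf_mul _ _ _ f g)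
  | |- measurable_fun _ (fun x => @GRing.opp _ (@?f x)) => apply: (@mf_opp _ _ _ f)
  | |- measurable_fun _ (fun x => @GRing.exp _ (@?f x) ?n) => apply: (@mf_exp _ _ _ f n)
  | |- measurable_fun _ (fun x => @GRing.inv _ (@?f x)) => apply: (@mf_inv _ _ _ f)
  | |- measurable_fun _ (fun x => @powR _ (@?f x) ?a) => apply: (@mf_powR _ _ _ f a)
  | |- measurable_fun _ (fun x => Num.sqrt (@?f x)) => apply: (@mf_sqrt _ _ _ f)
  | |- measurable_fun _ (fun x => expR (@?f x)) => apply: (@mf_expR _ _ _ f)
  | |- measurable_fun _ (fun x => cos (@?f x)) => apply: (@mf_cos _ _ _ f)
  | |- measurable_fun _ (fun x => sin (@?f x)) => apply: (@mf_sin _ _ _ f)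
  | |- measurable_fun _ (fun x => tan (@?f x)) => apply: (@mf_tan _ _ _ f)
  | |- measurable_fun _ (fun x => Num.max (@?f x) (@?g x)) => apply: (@mf_max _ _ _ f g)
  | |- measurable_fun _ (fun x => Num.norm (@?f x)) => apply: (@mf_norm _ _ _ f)
  | |- measurable_fun _ (fun x => fst (@?f x)) => apply: (mf_fst (f := f))
  | |- measurable_fun _ (fun x => snd (@?f x)) => apply: (mf_snd (f := f))
  | |- measurable_fun _ (fun x => (@?f x, @?g x)) => apply: (mf_pair (f := f) (g := g))
  | |- measurable_fun _ (@fst _ _) => exact: measurable_fst
  | |- measurable_fun _ (@snd _ _) => exact: measurable_snd
  | |- measurable_fun _ (@tan _) => apply: (@mf_tan _ _ _ id)
  | |- measurable_fun _ _ => assumption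
  end; rewrite ?/=.
Ltac meas := repeat meas1.

Lemma measurable_eq0 d (T : measurableType d) (R : realType) (f : T -> R) :
  measurable_fun setT f -> measurable [set x | f x = 0].
Proof.
move=> mf; rewrite -[X in measurable X]setTI.
by apply: (mf measurableT [set 0]); exact: measurable_set1.
Qed.

Lemma measurable_neq0 d (T : measurableType d) (R : realType) (f : T -> R) :
  measurable_fun setT f -> measurable [set x | f x != 0].
Proof.
move=> mf; rewrite (_ : [set _ | _] = ~` [set x | f x = 0]).
  by apply: measurableC; exact: measurable_eq0.
by apply/seteqP; split => x /=; move/eqP.
Qed.

Definition right_half (R : realType) : set R := `](- (pi / 2)), (pi / 2)[%classic.
Arguments right_half : clear implicits.

(** * Affine and tangent changes of variable *)

Section line.
Context {R : realType}.
Implicit Types f P : R -> R.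

Lemma integral_in_indic (D : set R) f :
  (\int[leb R]_(x in D) (f x)%:E = \int[leb R]_x (f x * \1_D x)%:E)%E.
Proof.
rewrite integral_mkcond; apply: eq_integral => x _; rewrite patchE indicE.
by case: ifP; rewrite ?mulr1 ?mulr0.
Qed.

Lemma tonelli_in (D E : set R) (g : R * R -> R) : measurable D -> measurable E ->
  measurable_fun setT g -> (forall z, 0 <= g z) ->
  (\int[leb R]_(x in D) \int[leb R]_(y in E) (g (x, y))%:E =
   \int[leb R]_(y in E) \int[leb R]_(x in D) (g (x, y))%:E)%E.
Proof.
move=> mD mE mg g0.
have mDi : measurable_fun setT (\1_D : R -> R) by exact: measurable_indic.
have mEi : measurable_fun setT (\1_E : R -> R) by exact: measurable_indic.
pose k (z : R * R) := (g z * \1_D z.1 * \1_E z.2)%:E.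
have k0 z : (0 <= k z)%E by rewrite lee_fin !mulr_ge0.
have mk : measurable_fun setT k.
  apply/measurable_EFinP; apply: mf_mul; first apply: mf_mul => //.
  - exact: (measurableT_comp mDi measurable_fst).
  - exact: (measurableT_comp mEi measurable_snd).
have := @fubini_tonelli _ _ _ _ _ (leb R) (leb R) k mk k0.
have e1 x : (\int[leb R]_y k (x, y) =
    ((fun x => \int[leb R]_(y in E) (g (x, y))%:E) \_ D) x)%E.
  rewrite patchE; case: ifPn => xD.
    rewrite (integral_in_indic E (fun y => g (x, y))); apply: eq_integral => y _.
    by rewrite /k /= [\1_D x]indicE xD mulr1.
  rewrite (eq_integral (cst 0%E)) ?integral0// => y _.
  by rewrite /k /= [\1_D x]indicE (negbTE xD) mulr0 mul0r.
have e2 y : (\int[leb R]_x k (x, y) =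
    ((fun y => \int[leb R]_(x in D) (g (x, y))%:E) \_ E) y)%E.
  rewrite patchE; case: ifPn => yE.
    rewrite (integral_in_indic D (fun x => g (x, y))); apply: eq_integral => x _.
    by rewrite /k /= [\1_E y]indicE yE mulr1.
  rewrite (eq_integral (cst 0%E)) ?integral0// => x _.
  by rewrite /k /= [\1_E y]indicE (negbTE yE) mulr0.
under eq_integral do rewrite e1.
under [RHS]eq_integral do rewrite e2.
by rewrite -!integral_mkcond.
Qed.

Lemma affine_density (a b : R) : a != 0 -> forall c d : R, c < d ->
  (\int[leb R]_(x in (fun x : R => a * x + b)%R @^-1` `]c, d]%classic) (`|a|%R)%:E
   = (d - c)%:E)%E.
Proof.
move=> a0 c d cd; have [ap|an|a0'] := ltgtP a 0; last by rewrite a0' eqxx in a0.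
- rewrite (_ : _ @^-1` _ = `[(d - b) / a, (c - b) / a[%classic).
    rewrite integral_cst//= lebesgue_measure_itv/= lte_fin.
    have e : ((d - b) / a < (c - b) / a) by rewrite ltr_ndivrMr// divfK ?lt_eqF// ltrD2r.
    rewrite e -EFinB -EFinM ltr0_norm//; congr EFin; field.
    by rewrite lt_eqF.
  apply/seteqP; split => x /=; rewrite !in_itv/= => /andP[h1 h2]; apply/andP; split.
  + by rewrite ler_ndivrMr// mulrC lerBrDr.
  + by rewrite ltr_ndivlMr// mulrC ltrBlDr.
  + by move: h2; rewrite ltr_ndivlMr// mulrC ltrBlDr.
  + by move: h1; rewrite ler_ndivrMr// mulrC lerBrDr.
- rewrite (_ : _ @^-1` _ = `](c - b) / a, (d - b) / a]%classic).
    rewrite integral_cst//= lebesgue_measure_itv/= lte_fin.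
    have e : ((c - b) / a < (d - b) / a) by rewrite ltr_pdivrMr// divfK ?gt_eqF// ltrD2r.
    rewrite e -EFinB -EFinM gtr0_norm//; congr EFin; field.
    by rewrite gt_eqF.
  apply/seteqP; split => x /=; rewrite !in_itv/= => /andP[h1 h2]; apply/andP; split.
  + by rewrite ltr_pdivrMr// mulrC ltrBlDr.
  + by rewrite ler_pdivlMr// mulrC lerBrDr.
  + by move: h1; rewrite ltr_pdivrMr// mulrC ltrBlDr.
  + by move: h2; rewrite ler_pdivlMr// mulrC lerBrDr.
Qed.

Lemma ge0_integral_affine (a b : R) f : a != 0 -> measurable_fun setT f ->
  (forall x, 0 <= f x) ->
  (\int[leb R]_x (`|a| * f (a * x + b))%:E = \int[leb R]_x (f x)%:E)%E.
Proof.
move=> a0 mf f0.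
apply: (@ge0_integral_subst R (fun=> `|a|) (fun x => a * x + b)) => //; first by meas.
exact: affine_density.
Qed.

Lemma ae_affine (a b : R) (P : R -> Prop) : a != 0 ->
  {ae leb R, forall x, P x} -> {ae leb R, forall x, P (a * x + b)}.
Proof.
move=> a0 h.
have := @ae_subst R (fun=> `|a|) (fun x => a * x + b) P _ _ _ _ h.
case => //; [by meas|exact: affine_density|].
move=> N [mN N0 sN]; exists N; split => // x nP; apply: sN => /= q; apply: nP; apply: q.
by rewrite normr_gt0.
Qed.

(** [tan] has derivative [cos ^- 2], so over the interval from [atan c] to [atan d] the fundamental
    theorem gives [d - c]; the indicator discards the other branches of [tan]. *)
Lemma tan_density : forall c d : R, c < d ->
  (\int[leb R]_(x in tan @^-1` `]c, d]%classic)
     (\1_(right_half R) x * (cos x) ^- 2)%:E = (d - c)%:E)%E.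
Proof.
move=> c d cd; rewrite /right_half; set I := `](- (pi / 2)), (pi / 2)[%classic.
have cpos x : x \in I -> 0 < cos x.
  by rewrite inE /I /= in_itv /= => h; apply: cos_gt0_pihalf.
have acd : atan c < atan d by exact: lt_atan.
have sub x : x \in `[atan c, atan d] -> x \in I.
  rewrite in_itv /= inE /I /= in_itv /= => /andP[h1 h2].
  by rewrite (lt_le_trans (atan_gtNpi2 _) h1) (le_lt_trans h2 (atan_ltpi2 _)).
rewrite integral_mkcond.
transitivity (\int[leb R]_(x in `]atan c, atan d]%classic) ((cos x) ^- 2)%:E)%E.
  rewrite [RHS]integral_mkcond; apply: eq_integral => x _; rewrite !patchE indicE.
  have [xI|xI] := boolP (x \in I).
    rewrite mul1r; congr (if _ then _ else _); apply/idP/idP; rewrite !inE /= !in_itv /=.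
      move=> /andP[h1 h2]; move: xI; rewrite inE /I /= => xI.
      rewrite -(tanK xI); apply/andP; split; first exact: lt_atan.
      exact: le_atan.
    move=> /andP[h1 h2]; move: xI; rewrite inE /I /= => xI.
    have aI (z : R) : atan z \in `](- (pi / 2)), (pi / 2)[ .
      by rewrite in_itv /= atan_gtNpi2 atan_ltpi2.
    apply/andP; split.
      by rewrite -[c]atanK ltr_tan.
    move: h2; rewrite le_eqVlt => /predU1P[->|h2]; first by rewrite atanK.
    by rewrite -[d]atanK ltW// ltr_tan.
  rewrite mul0r if_same; case: ifPn => // xx; move: xI; rewrite sub//.
  by move: xx; rewrite inE /= !in_itv /= => /andP[/ltW -> ->].
rewrite integral_itv_obnd_cbnd; last first.
  by apply: measurable_funTS; apply/measurable_EFinP; meas.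
rewrite (@continuous_FTC2 _ (fun x => (cos x) ^- 2) tan)//; last 3 first.
- apply: continuous_in_subspaceT => x; rewrite inE /= => /sub/cpos cx.
  apply: cvgV; first by rewrite expf_neq0// gt_eqF.
  by apply: (@continuous_comp _ _ _ cos (fun y => y ^+ 2));
    [exact: continuous_cos|exact: exprn_continuous].
- split.
  + move=> x /subset_itv_oo_cc /sub/cpos cx; apply: derivable_tan; by rewrite gt_eqF.
  + apply: cvg_at_right_filter; apply: continuous_tan; rewrite gt_eqF// cpos// sub//.
    by rewrite in_itv /= lexx ltW.
  + apply: cvg_at_left_filter; apply: continuous_tan; rewrite gt_eqF// cpos// sub//.
    by rewrite in_itv /= lexx ltW.
- move=> x /subset_itv_oo_cc /sub/cpos cx; rewrite derive1E.
  have cx0 : cos x != 0 by rewrite gt_eqF.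
  by have [_ ->] := is_derive_tan cx0.
by rewrite !atanK.
Qed.

Let mh : measurable_fun setT
  (fun x : R => \1_(right_half R) x * (cos x) ^- 2).
Proof.
by apply: mf_mul; [apply: measurable_indic; exact: measurable_itv|meas].
Qed.

Let h0 (x : R) : 0 <= \1_(right_half R) x * (cos x) ^- 2.
Proof. by rewrite mulr_ge0// invr_ge0 sqr_ge0. Qed.

Lemma ge0_integral_tan f : measurable_fun setT f -> (forall x, 0 <= f x) ->
  (\int[leb R]_(x in right_half R) ((cos x) ^- 2 * f (tan x))%:E
   = \int[leb R]_x (f x)%:E)%E.
Proof.
move=> mf f0.
have mt : measurable_fun setT (tan : R -> R) by meas.
rewrite -(ge0_integral_subst mh mt h0 tan_density mf f0).
rewrite (integral_in_indic _ (fun x => (cos x) ^- 2 * f (tan x))).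
by apply: eq_integral => x _; congr EFin; ring.
Qed.

Lemma ae_tan (P : R -> Prop) : {ae leb R, forall x, P x} ->
  {ae leb R, forall x, x \in `](- (pi / 2)), (pi / 2)[ -> P (tan x)}.
Proof.
move=> h; have mt : measurable_fun setT (tan : R -> R) by meas.
have [N [mN N0 sN]] := ae_subst mh mt h0 tan_density h.
exists N; split => // x nP; apply: sN => /= q; apply: nP => xI; apply: q.
rewrite indicE mem_set// mul1r invr_gt0 exprn_gt0//.
by move: xI; rewrite in_itv; exact: cos_gt0_pihalf.
Qed.

End line.

(** * The angular integral of a function of one direction cosine *)

Lemma EFin_measurable d (T : measurableType d) (R : realType) (f : T -> R) :
  measurable_fun setT f -> measurable_fun setT (fun x => (f x)%:E).
Proof. by move=> mf; exact/measurable_EFinP. Qed.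

Section integral_sums.
Context {R : realType} (D : set R) (mD : measurable D).
Implicit Types f g k : R -> \bar R.

Lemma ge0_integral_le_double f g : measurable_fun D f -> measurable_fun D g ->
  (forall y, D y -> 0 <= f y)%E -> (forall y, D y -> 0 <= g y)%E ->
  (forall y, D y -> f y <= g y + g y)%E ->
  (\int[leb R]_(y in D) f y <= \int[leb R]_(y in D) g y + \int[leb R]_(y in D) g y)%E.
Proof.
move=> mf mg f0 g0 fg; rewrite -ge0_integralD//.
by apply: ge0_le_integral => //; exact: emeasurable_funD.
Qed.

Lemma ge0_integral_le_triple f g k :
  measurable_fun D f -> measurable_fun D g -> measurable_fun D k ->
  (forall y, D y -> 0 <= f y)%E -> (forall y, D y -> 0 <= g y)%E ->
  (forall y, D y -> 0 <= k y)%E ->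
  (forall y, D y -> f y <= (g y + g y) + k y)%E ->
  (\int[leb R]_(y in D) f y <= (\int[leb R]_(y in D) g y + \int[leb R]_(y in D) g y)
    + \int[leb R]_(y in D) k y)%E.
Proof.
move=> mf mg mk f0 g0 k0 fgk; rewrite -!ge0_integralD//.
- by apply: ge0_le_integral => //; apply: emeasurable_funD => //; exact: emeasurable_funD.
- by move=> y Dy; rewrite adde_ge0// g0.
- exact: emeasurable_funD.
Qed.

End integral_sums.

(** * Integrals over intervals and over periods *)

Section intervals.
Context {R : realType}.
Implicit Type P : R -> R.
Local Notation J P l r := (\int[leb R]_(x in `[l%R, r%R]%classic) (P x)%:E)%E.

Lemma ge0_integral_itv_sub P (l r l' r' : R) : measurable_fun setT P ->
  (forall x, 0 <= P x) -> l' <= l -> r <= r' -> (J P l r <= J P l' r')%E.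
Proof.
move=> mP P0 ll rr; apply: ge0_subset_integral => //.
- by apply: measurable_funTS; exact/measurable_EFinP.
- by move=> x _; rewrite lee_fin.
- by move=> x /=; rewrite !in_itv /= => /andP[h1 h2]; rewrite (le_trans ll h1) (le_trans h2 rr).
Qed.

Lemma measurable_mul_itv P (i : interval R) : measurable_fun setT P ->
  measurable_fun setT (fun x => (P x * \1_[set` i] x)%:E).
Proof.
by move=> mP; apply/EFin_measurable/mf_mul => //; apply: measurable_indic; exact: measurable_itv.
Qed.

Lemma ge0_integral_itv_cat P (x y z : R) : measurable_fun setT P ->
  (forall x, 0 <= P x) -> (J P x z <= J P x y + J P y z)%E.
Proof.
move=> mP P0.
have n0 (i : interval R) t : (0 <= (P t * \1_[set` i] t)%:E)%E.
  by rewrite lee_fin mulr_ge0.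
have mi i := measurable_mul_itv i mP.
rewrite (integral_in_indic `[x, z]%classic P) (integral_in_indic `[x, y]%classic P).
rewrite (integral_in_indic `[y, z]%classic P) -ge0_integralD//.
- apply: ge0_le_integral => //; first by exact: mi.
    by apply: emeasurable_funD; exact: mi.
  move=> t _; rewrite -EFinD lee_fin -mulrDr ler_wpM2l// !indicE -natrD ler_nat.
  rewrite !mem_setE /= !in_itv /=.
  by case: (leP x t); case: (leP t y); case: (leP y t); case: (leP t z) => //= ? ? h1 h2; lra.
- exact: mi.
- exact: mi.
Qed.

Lemma ge0_integral_itv_shift P (l r c : R) : measurable_fun setT P ->
  (forall x, 0 <= P x) -> J (fun x => P (x + c)) l r = J P (l + c) (r + c).
Proof.
move=> mP P0.
rewrite (integral_in_indic `[l, r]%classic (fun x => P (x + c))).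
rewrite (integral_in_indic `[l + c, r + c]%classic P).
rewrite -(@ge0_integral_affine R 1 c (fun x => P x * \1_(`[l + c, r + c]%classic) x)).
- apply: eq_integral => x _; rewrite normr1 !mul1r; congr (_ * _)%:E.
  rewrite !indicE; congr (_%:R); congr nat_of_bool; rewrite !mem_setE /= !in_itv /=.
  by rewrite !lerD2r.
- by rewrite oner_neq0.
- by apply/mf_mul => //; apply: measurable_indic; exact: measurable_itv.
- by move=> x; rewrite mulr_ge0.
Qed.

Lemma ge0_integral_itv_refl P (l r c : R) : measurable_fun setT P ->
  (forall x, 0 <= P x) -> J (fun x => P (c - x)) l r = J P (c - r) (c - l).
Proof.
move=> mP P0.
rewrite (integral_in_indic `[l, r]%classic (fun x => P (c - x))).
rewrite (integral_in_indic `[c - r, c - l]%classic P).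
rewrite -(@ge0_integral_affine R (-1) c (fun x => P x * \1_(`[c - r, c - l]%classic) x)).
- apply: eq_integral => x _; rewrite normrN normr1 mul1r mulN1r addrC; congr (_ * _)%:E.
  rewrite !indicE; congr (_%:R); congr nat_of_bool; rewrite !mem_setE /= !in_itv /=.
  by apply/idP/idP => /andP[h1 h2]; apply/andP; split; lra.
- by rewrite oppr_eq0 oner_neq0.
- by apply/mf_mul => //; apply: measurable_indic; exact: measurable_itv.
- by move=> x; rewrite mulr_ge0.
Qed.

Lemma integral_right_half P : measurable_fun setT P ->
  (\int[leb R]_(x in right_half R) (P x)%:E = J P (- (pi / 2)) (pi / 2))%E.
Proof. by move=> mP; apply/esym/integral_itv_bndoo; apply: measurable_funTS;
  exact: EFin_measurable. Qed.

Section periodic.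
Variable P : R -> R.
Hypothesis mP : measurable_fun setT P.
Hypothesis P0 : forall x, 0 <= P x.
Hypothesis PT : forall x, P (x + pi *+ 2) = P x.

Lemma periodic_shift l r : J P (l + pi *+ 2) (r + pi *+ 2) = J P l r.
Proof.
rewrite -ge0_integral_itv_shift//; apply: eq_integral => x _; by rewrite PT.
Qed.

Lemma periodic_two_periods l r : 0 <= l -> r <= pi *+ 4 ->
  (J P l r <= J P 0 (pi *+ 2) + J P 0 (pi *+ 2))%E.
Proof.
move=> l0 r4; apply: (le_trans (ge0_integral_itv_sub mP P0 l0 r4)).
rewrite -[X in (_ + X)%E]periodic_shift add0r -mulrnDr.
exact: ge0_integral_itv_cat.
Qed.

(** The translated period lies within two periods. A finite bound for the cross-section tolerates
    such factors, which spares exact rotation invariance. *)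
Lemma periodic_translate c : 0 <= c <= pi *+ 2 ->
  (J (fun x => P (x + c)) 0 (pi *+ 2) <= J P 0 (pi *+ 2) + J P 0 (pi *+ 2))%E.
Proof.
move=> /andP[c0 c2]; rewrite ge0_integral_itv_shift//.
apply: periodic_two_periods; lra.
Qed.

(** The circle is cut at pi/2 and 3 pi/2: the first and last pieces lie, modulo a period, in the
    right half, and the middle piece is the left half. *)
Lemma periodic_le_halves : (J P 0 (pi *+ 2) <=
   (\int[leb R]_(x in right_half R) (P x)%:E + \int[leb R]_(x in right_half R) (P x)%:E) +
   \int[leb R]_(x in right_half R) (P (x + pi))%:E)%E.
Proof.
have pi0 := pi_ge0 R.
rewrite !integral_right_half//; last by apply: measurableT_comp mP _; meas.
rewrite ge0_integral_itv_shift//.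
apply: (le_trans (ge0_integral_itv_cat 0 (pi / 2) (pi *+ 2) mP P0)).
rewrite -addeA; apply: leeD; first by apply: ge0_integral_itv_sub => //; lra.
apply: (le_trans (ge0_integral_itv_cat (pi / 2) (pi / 2 + pi) (pi *+ 2) mP P0)).
rewrite addeC; apply: leeD; last by apply: ge0_integral_itv_sub => //; lra.
by rewrite -[leRHS]periodic_shift; apply: ge0_integral_itv_sub => //; lra.
Qed.

Lemma right_half_le_periodic :
  (\int[leb R]_(x in right_half R) (P x)%:E <= J P 0 (pi *+ 2) + J P 0 (pi *+ 2))%E.
Proof.
have pi0 := pi_ge0 R.
by rewrite integral_right_half// -periodic_shift; apply: periodic_two_periods; lra.
Qed.

Lemma left_half_le_periodic :
  (\int[leb R]_(x in right_half R) (P (x + pi))%:E <= J P 0 (pi *+ 2) + J P 0 (pi *+ 2))%E.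
Proof.
have pi0 := pi_ge0 R.
rewrite integral_right_half; last by apply: measurableT_comp mP _; meas.
by rewrite ge0_integral_itv_shift//; apply: periodic_two_periods; lra.
Qed.

End periodic.
End intervals.

Section angular.
Context {R : realType}.
Variable q : R -> R.
Hypothesis mq : measurable_fun setT q.
Hypothesis q0 : forall x, 0 <= q x.

Let mqc d (T : measurableType d) (f : T -> R) : measurable_fun setT f ->
  measurable_fun setT (fun x => q (f x)).
Proof. by move=> mf; exact: measurableT_comp mq mf. Qed.

(* The latitude is measured from the equator, so that x = cos theta cos phi > 0
   is the region where both angles lie in ]-pi/2, pi/2[. *)
Let g (a b c : R) (z : R * R) : R :=
  `|cos z.2| * q (a * (cos z.2 * cos z.1) + b * (cos z.2 * sin z.1) + c * sin z.2).

Let mg a b c : measurable_fun setT (g a b c).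
Proof. by apply: mf_mul; [meas|apply: mqc; meas]. Qed.

Let mg1 a b c y : measurable_fun setT (fun x => g a b c (x, y)).
Proof. by apply: mf_mul; [meas|apply: mqc; meas]. Qed.

Let g0 a b c z : 0 <= g a b c z. Proof. by rewrite mulr_ge0. Qed.

Let mrh : measurable (right_half R). Proof. exact: measurable_itv. Qed.

Definition angular (a b c : R) : \bar R :=
  (\int[leb R]_(y in right_half R) \int[leb R]_(x in `[0%R, (pi *+ 2)%R]%classic)
     (`|cos y| * q (a * (cos y * cos x) + b * (cos y * sin x) + c * sin y))%:E)%E.

Definition half_angular (a b c : R) : \bar R :=
  (\int[leb R]_(y in right_half R) \int[leb R]_(x in right_half R)
     (`|cos y| * q (a * (cos y * cos x) + b * (cos y * sin x) + c * sin y))%:E)%E.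

(** Central projection of the open hemisphere onto its tangent plane: the direction is (1, t, s)
    normalised, with t = tan x and s = tan y / cos x, and the Jacobian is the inverse cube of the
    length of (1, t, s). In these coordinates the second and third axes play the same role. *)
Lemma half_angular_gnomonic a b c : half_angular a b c =
  (\int[leb R]_s \int[leb R]_t
    ((Num.sqrt (1 + t ^+ 2 + s ^+ 2))^-1 ^+ 3 *
     q ((Num.sqrt (1 + t ^+ 2 + s ^+ 2))^-1 * (a + b * t + c * s)))%:E)%E.
Proof.
pose F x u : R := (Num.sqrt (1 + u ^+ 2))^-1 ^+ 3 *
  q ((Num.sqrt (1 + u ^+ 2))^-1 * (a * cos x + b * sin x + c * u)).
have F0 x u : 0 <= F x u by rewrite mulr_ge0// exprn_ge0// invr_ge0 sqrtr_ge0.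
have mF x : measurable_fun setT (F x) by apply: mf_mul; [meas|apply: mqc; meas].
pose k (z : R * R) : R := `|cos z.1| * F z.1 (cos z.1 * z.2).
have mk : measurable_fun setT k.
  by apply: mf_mul; [meas|apply: mf_mul; [meas|apply: mqc; meas]].
have k0 z : 0 <= k z by rewrite mulr_ge0.
have cpos x : right_half R x -> 0 < cos x.
  by rewrite /right_half /= in_itv => h; apply: cos_gt0_pihalf.
rewrite /half_angular -(tonelli_in mrh mrh (mg a b c) (g0 a b c)) /=.
transitivity (\int[leb R]_(x in right_half R) \int[leb R]_s (k (x, s))%:E)%E.
  apply: eq_integral => x; rewrite inE => /cpos cx; rewrite /k /=.
  under [RHS]eq_integral do rewrite -[cos x * _]addr0.
  rewrite (ge0_integral_affine 0 _ (mF x) (F0 x)) ?gt_eqF//.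
  rewrite -(ge0_integral_tan (mF x) (F0 x)); apply: eq_integral => y; rewrite inE => /cpos cy.
  congr EFin; rewrite /F -cos2_tan2 ?gt_eqF// sqrtrV ?sqr_ge0// sqrtr_sqr gtr0_norm// invrK.
  rewrite /g /= gtr0_norm// [RHS]mulrA.
  have -> : cos y ^- 2 * cos y ^+ 3 = cos y by field; rewrite gt_eqF.
  congr (_ * q _); rewrite /tan; field; by rewrite gt_eqF.
have -> := tonelli_in mrh measurableT mk k0.
apply: eq_integral => s _.
pose G t : R := (Num.sqrt (1 + t ^+ 2 + s ^+ 2))^-1 ^+ 3 *
     q ((Num.sqrt (1 + t ^+ 2 + s ^+ 2))^-1 * (a + b * t + c * s)).
have G0 t : 0 <= G t by rewrite mulr_ge0// exprn_ge0// invr_ge0 sqrtr_ge0.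
have mG : measurable_fun setT G by apply: mf_mul; [meas|apply: mqc; meas].
rewrite -(ge0_integral_tan mG G0); apply: eq_integral => x; rewrite inE => /cpos cx.
congr EFin; rewrite /k /G /F /= -cos2_tan2 ?gt_eqF//.
have -> : cos x ^- 2 + s ^+ 2 = (1 + (cos x * s) ^+ 2) / cos x ^+ 2.
  by field; rewrite gt_eqF.
have p1 : 0 < 1 + (cos x * s) ^+ 2 by rewrite ltr_pwDl// sqr_ge0.
rewrite sqrtrM ?(ltW p1)// sqrtrV ?sqr_ge0// sqrtr_sqr gtr0_norm//.
set r := Num.sqrt _; have r0 : r != 0 by rewrite gt_eqF// sqrtr_gt0.
rewrite (_ : (r / cos x)^-1 = r^-1 * cos x) ?exprMn; last by field; rewrite r0 gt_eqF.
have -> : cos x ^- 2 * (r^-1 ^+ 3 * cos x ^+ 3 *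
    q (r^-1 * cos x * (a + b * tan x + c * s))) =
  cos x * (r^-1 ^+ 3 * q (r^-1 * cos x * (a + b * tan x + c * s))).
  by field; rewrite r0 gt_eqF.
congr (_ * (_ * q _)); rewrite /tan; field; by rewrite r0 gt_eqF.
Qed.

(** Spherical coordinates hide the exchange of a horizontal axis with the vertical one; after
    central projection it is Tonelli. *)
Lemma half_angular_swap a b c : half_angular a b c = half_angular a c b.
Proof.
rewrite !half_angular_gnomonic.
pose k (z : R * R) : R := (Num.sqrt (1 + z.2 ^+ 2 + z.1 ^+ 2))^-1 ^+ 3 *
   q ((Num.sqrt (1 + z.2 ^+ 2 + z.1 ^+ 2))^-1 * (a + b * z.2 + c * z.1)).
have mk : measurable_fun setT k by apply: mf_mul; [meas|apply: mqc; meas].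
have k0 z : 0 <= k z by rewrite mulr_ge0// exprn_ge0// invr_ge0 sqrtr_ge0.
have := tonelli_in measurableT measurableT mk k0; rewrite /k /= => ->.
apply: eq_integral => s _; apply: eq_integral => t _.
by rewrite addrAC [a + b * _ + _]addrAC.
Qed.

Let gper a b c y x : g a b c (x + pi *+ 2, y) = g a b c (x, y).
Proof. by rewrite /g /= cosD2pi sinD2pi. Qed.

Let inner_meas (D : set R) a b c : measurable D ->
  measurable_fun setT (fun y => \int[leb R]_(x in D) (g a b c (x, y))%:E)%E.
Proof.
move=> mD; pose h (z : R * R) := (g a b c z * \1_D z.1)%:E.
have mDi : measurable_fun setT (\1_D : R -> R) by exact: measurable_indic.
have mh : measurable_fun setT h.
  apply/EFin_measurable/mf_mul; first exact: mg.
  exact: (measurableT_comp mDi measurable_fst).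
have h0 z : (0 <= h z)%E by rewrite lee_fin mulr_ge0.
have := @measurable_fun_fubini_tonelli_G _ _ _ _ _ (leb R) h mh h0.
rewrite (_ : fubini_G _ _ = fun y => \int[leb R]_(x in D) (g a b c (x, y))%:E)%E//.
apply/funext => y; rewrite /fubini_G (integral_in_indic D (fun x => g a b c (x, y))).
by [].
Qed.

Let inner_meas_rh (D : set R) a b c : measurable D ->
  measurable_fun (right_half R) (fun y => \int[leb R]_(x in D) (g a b c (x, y))%:E)%E.
Proof. by move=> mD; apply: measurable_funTS; exact: inner_meas. Qed.

Let inner_meas_pi a b c : measurable_fun (right_half R)
  (fun y => \int[leb R]_(x in right_half R) (g a b c ((x + pi)%R, y))%:E)%E.
Proof.
pose h (z : R * R) := (g a b c (z.1 + pi, z.2) * \1_(right_half R) z.1)%:E.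
have mDi : measurable_fun setT (\1_(right_half R) : R -> R) by exact: measurable_indic.
have mh : measurable_fun setT h.
  apply/EFin_measurable/mf_mul; first by apply: mf_mul; [meas|apply: mqc; meas].
  exact: (measurableT_comp mDi measurable_fst).
have h0 z : (0 <= h z)%E by rewrite lee_fin mulr_ge0.
have mG := @measurable_fun_fubini_tonelli_G _ _ _ _ _ (leb R) h mh h0.
apply: (eq_measurable_fun (fubini_G (leb R) h)); last exact: measurable_funTS.
by move=> y _; rewrite /fubini_G (integral_in_indic _ (fun x => g a b c (x + pi, y))).
Qed.

Let inner_ge0 (D : set R) a b c y : (0 <= \int[leb R]_(x in D) (g a b c (x, y))%:E)%E.
Proof. by apply: integral_ge0 => x _; rewrite lee_fin. Qed.

(** The antipodal map adds pi to the longitude and changes the sign of the latitude. *)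
Let opposite a b c : half_angular (- a) (- b) (- c) =
  (\int[leb R]_(y in right_half R) \int[leb R]_(x in right_half R)
     (g a b c ((x + pi)%R, y))%:E)%E.
Proof.
rewrite /half_angular.
have := tonelli_in mrh mrh (mg (- a) (- b) (- c)) (g0 _ _ _); rewrite /g /= => <-.
pose h (z : R * R) := g a b c (z.1 + pi, z.2).
have mh : measurable_fun setT h by apply: mf_mul; [meas|apply: mqc; meas].
have := tonelli_in mrh mrh mh (fun z => g0 a b c _); rewrite /h /= => <-.
apply: eq_integral => x _; rewrite /g /=.
set P := (fun y : R => `|cos y| *
  q (a * (cos y * cos (x + pi)) + b * (cos y * sin (x + pi)) + c * sin y)).
have mP : measurable_fun setT P by apply: mf_mul; [meas|apply: mqc; meas].
have P0 y : 0 <= P y by rewrite mulr_ge0.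
rewrite [RHS](integral_right_half mP).
have := ge0_integral_itv_refl (- (pi / 2)) (pi / 2) 0 mP P0.
rewrite !sub0r opprK => <-.
rewrite -(@integral_right_half _ (fun y => P (0 - y))); last first.
  by apply: measurableT_comp mP _; meas.
apply: eq_integral => y _; rewrite /P sub0r cosN sinN cosDpi sinDpi.
by congr (_ * q _)%:E; ring.
Qed.

Lemma angular_le_half a b c : (angular a b c <=
  (half_angular a b c + half_angular a b c) + half_angular (- a) (- b) (- c))%E.
Proof.
rewrite opposite.
pose A y := (\int[leb R]_(x in right_half R) (g a b c (x, y))%:E)%E.
pose B y := (\int[leb R]_(x in right_half R) (g a b c ((x + pi)%R, y))%:E)%E.
pose C y := (\int[leb R]_(x in `[0%R, (pi *+ 2)%R]%classic) (g a b c (x, y))%:E)%E.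
have mA : measurable_fun (right_half R) A by exact: inner_meas_rh.
have mC : measurable_fun (right_half R) C by apply: inner_meas_rh; exact: measurable_itv.
have mB : measurable_fun (right_half R) B by exact: inner_meas_pi.
have A0 y : right_half R y -> (0 <= A y)%E by move=> _; exact: inner_ge0.
have C0 y : right_half R y -> (0 <= C y)%E by move=> _; exact: inner_ge0.
have B0 y : right_half R y -> (0 <= B y)%E.
  by move=> _; apply: integral_ge0 => x _; rewrite lee_fin.
change (\int[leb R]_(y in right_half R) C y <=
  \int[leb R]_(y in right_half R) A y + \int[leb R]_(y in right_half R) A y +
  \int[leb R]_(y in right_half R) B y)%E.
apply: (ge0_integral_le_triple mrh mC mA mB C0 A0 B0) => y _.
exact: (periodic_le_halves (mg1 a b c y) (fun x => g0 a b c (x, y)) (gper a b c y)).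
Qed.

Lemma half_le_angular a b c : (half_angular a b c <= angular a b c + angular a b c)%E.
Proof.
pose A y := (\int[leb R]_(x in right_half R) (g a b c (x, y))%:E)%E.
pose C y := (\int[leb R]_(x in `[0%R, (pi *+ 2)%R]%classic) (g a b c (x, y))%:E)%E.
have mA : measurable_fun (right_half R) A by exact: inner_meas_rh.
have mC : measurable_fun (right_half R) C by apply: inner_meas_rh; exact: measurable_itv.
have A0 y : right_half R y -> (0 <= A y)%E by move=> _; exact: inner_ge0.
have C0 y : right_half R y -> (0 <= C y)%E by move=> _; exact: inner_ge0.
change (\int[leb R]_(y in right_half R) A y <=
  \int[leb R]_(y in right_half R) C y + \int[leb R]_(y in right_half R) C y)%E.
apply: (ge0_integral_le_double mrh mA mC A0 C0) => y _.
exact: (right_half_le_periodic (mg1 a b c y) (fun x => g0 a b c (x, y)) (gper a b c y)).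
Qed.

Lemma half_opp_le_angular a b c :
  (half_angular (- a) (- b) (- c) <= angular a b c + angular a b c)%E.
Proof.
rewrite opposite.
pose B y := (\int[leb R]_(x in right_half R) (g a b c ((x + pi)%R, y))%:E)%E.
pose C y := (\int[leb R]_(x in `[0%R, (pi *+ 2)%R]%classic) (g a b c (x, y))%:E)%E.
have mC : measurable_fun (right_half R) C by apply: inner_meas_rh; exact: measurable_itv.
have mB : measurable_fun (right_half R) B by exact: inner_meas_pi.
have C0 y : right_half R y -> (0 <= C y)%E by move=> _; exact: inner_ge0.
have B0 y : right_half R y -> (0 <= B y)%E.
  by move=> _; apply: integral_ge0 => x _; rewrite lee_fin.
change (\int[leb R]_(y in right_half R) B y <=
  \int[leb R]_(y in right_half R) C y + \int[leb R]_(y in right_half R) C y)%E.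
apply: (ge0_integral_le_double mrh mB mC B0 C0) => y _.
exact: (left_half_le_periodic (mg1 a b c y) (fun x => g0 a b c (x, y)) (gper a b c y)).
Qed.

Lemma angular_rotate r t c : 0 <= t <= pi *+ 2 ->
  (angular (r * cos t) (r * sin t) c <= angular r 0 c + angular r 0 c)%E.
Proof.
move=> t02.
pose A y := (\int[leb R]_(x in `[0%R, (pi *+ 2)%R]%classic) (g (r * cos t) (r * sin t) c (x, y))%:E)%E.
pose C y := (\int[leb R]_(x in `[0%R, (pi *+ 2)%R]%classic) (g r 0 c (x, y))%:E)%E.
have mA : measurable_fun (right_half R) A by apply: inner_meas_rh; exact: measurable_itv.
have mC : measurable_fun (right_half R) C by apply: inner_meas_rh; exact: measurable_itv.
have A0 y : right_half R y -> (0 <= A y)%E by move=> _; exact: inner_ge0.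
have C0 y : right_half R y -> (0 <= C y)%E by move=> _; exact: inner_ge0.
change (\int[leb R]_(y in right_half R) A y <=
  \int[leb R]_(y in right_half R) C y + \int[leb R]_(y in right_half R) C y)%E.
apply: (ge0_integral_le_double mrh mA mC A0 C0) => y _.
have t02' : 0 <= pi *+ 2 - t <= pi *+ 2 by case/andP: t02 => h1 h2; apply/andP; split; lra.
have := periodic_translate (mg1 r 0 c y) (fun x => g0 r 0 c (x, y)) (gper r 0 c y) t02'.
rewrite (_ : (\int[leb R]_(x in _) _)%E = A y)//.
apply: eq_integral => x _; rewrite /g /= addrA addrAC cosD2pi sinD2pi cosB sinB.
by congr (_ * q _)%:E; ring.
Qed.

End angular.

(** * Euclidean vectors *)

Section vectors.
Context {R : realType}.
Implicit Types (x y z : 'rV[R]_3) (a b : R).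

Definition i0 : 'I_3 := @Ordinal 3 0 isT.
Definition i1 : 'I_3 := @Ordinal 3 1 isT.
Definition i2 : 'I_3 := @Ordinal 3 2 isT.

Lemma sum3E (F : 'I_3 -> R) : \sum_(i < 3) F i = F i0 + F i1 + F i2.
Proof.
rewrite !big_ord_recl big_ord0 addr0 addrA.
by congr (F _ + F _ + F _); apply: val_inj.
Qed.

Lemma ord3P (P : 'I_3 -> Prop) : P i0 -> P i1 -> P i2 -> forall i, P i.
Proof.
move=> p0 p1 p2 [[|[|[|//]]] hi].
- by rewrite (_ : Ordinal hi = i0)//; apply: val_inj.
- by rewrite (_ : Ordinal hi = i1)//; apply: val_inj.
- by rewrite (_ : Ordinal hi = i2)//; apply: val_inj.
Qed.

Lemma vec3_i0 (p : R * R * R) : vec3 p 0 i0 = p.1.1. Proof. by rewrite mxE. Qed.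
Lemma vec3_i1 (p : R * R * R) : vec3 p 0 i1 = p.1.2. Proof. by rewrite mxE. Qed.
Lemma vec3_i2 (p : R * R * R) : vec3 p 0 i2 = p.2. Proof. by rewrite mxE. Qed.
Definition vec3E := (vec3_i0, vec3_i1, vec3_i2).

Lemma row3P x y : x 0 i0 = y 0 i0 -> x 0 i1 = y 0 i1 -> x 0 i2 = y 0 i2 -> x = y.
Proof. by move=> h0 h1 h2; apply/rowP => i; move: i; apply: ord3P. Qed.

Lemma vec3K x : vec3 (x 0 i0, x 0 i1, x 0 i2) = x.
Proof. by apply: row3P; rewrite vec3E. Qed.

Lemma dotE x y : dot x y = x 0 i0 * y 0 i0 + x 0 i1 * y 0 i1 + x 0 i2 * y 0 i2.
Proof. exact: sum3E. Qed.

Lemma dotC x y : dot x y = dot y x. Proof. by rewrite !dotE; ring. Qed.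

Lemma dotDl x y z : dot (x + y) z = dot x z + dot y z.
Proof. by rewrite !dotE !mxE; ring. Qed.

Lemma dotDr x y z : dot z (x + y) = dot z x + dot z y.
Proof. by rewrite !dotE !mxE; ring. Qed.

Lemma dotZl a x y : dot (a *: x) y = a * dot x y.
Proof. by rewrite !dotE !mxE; ring. Qed.

Lemma dotZr a x y : dot x (a *: y) = a * dot x y.
Proof. by rewrite !dotE !mxE; ring. Qed.

Lemma dotNl x y : dot (- x) y = - dot x y.
Proof. by rewrite !dotE !mxE; ring. Qed.

Lemma dotNr x y : dot x (- y) = - dot x y.
Proof. by rewrite !dotE !mxE; ring. Qed.

Lemma dotBl x y z : dot (x - y) z = dot x z - dot y z.
Proof. by rewrite dotDl dotNl. Qed.

Lemma dotBr x y z : dot z (x - y) = dot z x - dot z y.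
Proof. by rewrite dotDr dotNr. Qed.

Lemma dot0r x : dot x 0 = 0. Proof. by rewrite dotE !mxE; ring. Qed.

Lemma dot_ge0 x : 0 <= dot x x.
Proof. by rewrite dotE !addr_ge0 // -expr2 sqr_ge0. Qed.

Lemma enorm_sqr x : enorm x ^+ 2 = dot x x.
Proof. by rewrite sqr_sqrtr// dot_ge0. Qed.

Lemma enorm_ge0 x : 0 <= enorm x. Proof. exact: sqrtr_ge0. Qed.

Lemma enormZ a x : enorm (a *: x) = `|a| * enorm x.
Proof. by rewrite /enorm dotZl dotZr mulrA -expr2 sqrtrM ?sqr_ge0// sqrtr_sqr. Qed.

Lemma enormN x : enorm (- x) = enorm x.
Proof. by rewrite /enorm dotNl dotNr opprK. Qed.

Lemma enorm0 : enorm (0 : 'rV[R]_3) = 0.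
Proof. by rewrite /enorm dot0r sqrtr0. Qed.

Lemma normr_coord_le x i : `|x 0 i| <= enorm x.
Proof.
rewrite -sqrtr_sqr; apply: ler_wsqrtr; rewrite dotE.
have h j : 0 <= x 0 j * x 0 j by rewrite -expr2 sqr_ge0.
have := (h i0, h i1, h i2) => -[[? ?] ?]; rewrite expr2; move: i; apply: ord3P; lra.
Qed.

Lemma enorm_le_sum x : enorm x <= `|x 0 i0| + `|x 0 i1| + `|x 0 i2|.
Proof.
rewrite -[leRHS]ger0_norm ?addr_ge0// -sqrtr_sqr; apply: ler_wsqrtr; rewrite dotE.
rewrite -!expr2 -(real_normK (num_real (x 0 i0))) -(real_normK (num_real (x 0 i1))).
rewrite -(real_normK (num_real (x 0 i2))).
move: (normr_ge0 (x 0 i0)) (normr_ge0 (x 0 i1)) (normr_ge0 (x 0 i2)); nra.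
Qed.

Lemma enorm_eq0 x : enorm x = 0 -> x = 0.
Proof.
move=> x0; have h i : x 0 i = 0.
  by apply/eqP; rewrite -normr_le0 -x0 normr_coord_le.
by apply/rowP => i; rewrite h mxE.
Qed.

Lemma enorm_gt0 x : x != 0 -> 0 < enorm x.
Proof.
move=> x0; rewrite lt_def enorm_ge0 andbT; apply: contra x0 => /eqP/enorm_eq0 ->; exact: eqxx.
Qed.

Lemma cauchy_schwarz x y : `|dot x y| <= enorm x * enorm y.
Proof.
rewrite -sqrtr_sqr /enorm -sqrtrM ?dot_ge0//; apply: ler_wsqrtr.
rewrite -subr_ge0 !dotE.
set a := x 0 i0; set b := x 0 i1; set c := x 0 i2.
set d := y 0 i0; set e := y 0 i1; set f := y 0 i2.
rewrite (_ : _ - _ = (a * e - b * d) ^+ 2 + (a * f - c * d) ^+ 2 + (b * f - c * e) ^+ 2).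
  by rewrite !addr_ge0// sqr_ge0.
by ring.
Qed.

Lemma dot_le x y : dot x y <= enorm x * enorm y.
Proof. exact: le_trans (ler_norm _) (cauchy_schwarz x y). Qed.

Lemma enormD x y : enorm (x + y) <= enorm x + enorm y.
Proof.
rewrite -[leRHS]ger0_norm ?addr_ge0 ?enorm_ge0// -sqrtr_sqr; apply: ler_wsqrtr.
rewrite dotDl !dotDr sqrrD !enorm_sqr (dotC y x).
have := dot_le x y; lra.
Qed.

Lemma enorm_triangle x y z : enorm (x - z) <= enorm (x - y) + enorm (y - z).
Proof. by rewrite (_ : x - z = (x - y) + (y - z)) ?enormD// addrA subrK. Qed.

Lemma unit_eq x y : enorm x = 1 -> enorm y = 1 -> 1 <= dot x y -> x = y.
Proof.
move=> x1 y1 h; apply/eqP; rewrite -subr_eq0; apply/eqP/enorm_eq0/eqP.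
rewrite -sqrf_eq0 enorm_sqr; apply/eqP/le_anti; rewrite dot_ge0 andbT.
rewrite dotBl !dotBr -!enorm_sqr x1 y1 (dotC y x); lra.
Qed.

End vectors.

(** * Uniform bound for the angular cross-section *)

Lemma polar_coordinates (R : realType) (a b : R) : exists2 t : R, 0 <= t <= pi *+ 2 &
  a = Num.sqrt (a ^+ 2 + b ^+ 2) * cos t /\ b = Num.sqrt (a ^+ 2 + b ^+ 2) * sin t.
Proof.
have pi0 := pi_ge0 R; set r := Num.sqrt _.
have r2 : r ^+ 2 = a ^+ 2 + b ^+ 2 by rewrite sqr_sqrtr// addr_ge0// sqr_ge0.
have [r0|rn0] := eqVneq r 0.
  have /andP[/eqP a0 /eqP b0] : (a == 0) && (b == 0).
    by rewrite -(sqrf_eq0 a) -(sqrf_eq0 b) -paddr_eq0 ?sqr_ge0// -r2 r0 expr0n.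
  by exists 0; rewrite ?r0 ?a0 ?b0 ?mul0r ?lexx//; lra.
have rp : 0 < r by rewrite lt_def rn0 sqrtr_ge0.
have ar : -1 <= a / r <= 1.
  rewrite ler_pdivlMr// ler_pdivrMr// mulN1r mul1r -ler_norml -sqrtr_sqr /r.
  by apply: ler_wsqrtr; rewrite lerDl sqr_ge0.
have sa : sin (acos (a / r)) = `|b| / r.
  rewrite sin_acos// -[RHS]ger0_norm ?divr_ge0// ?ltW// -sqrtr_sqr; congr Num.sqrt.
  by rewrite !exprMn real_normK ?num_real// exprVn r2; field; rewrite -r2 sqrf_eq0.
have ca : cos (acos (a / r)) = a / r by rewrite acosK// in_itv.
have [h1 h2] := (acos_ge0 ar, acos_lepi ar).
have [b0|b0] := leP 0 b.
  exists (acos (a / r)); first by rewrite h1 mulr2n; lra.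
  by rewrite ca sa ger0_norm// ![r * _]mulrC !divfK.
exists (pi *+ 2 - acos (a / r)); first by apply/andP; split; lra.
rewrite cosB sinB -(add0r (pi *+ 2)) cosD2pi sinD2pi cos0 sin0 ca sa ltr0_norm//.
by rewrite !mul0r !mul1r addr0 sub0r mulNr opprK ![r * _]mulrC !divfK.
Qed.

(** The direction (1, 0, 0) is carried to (r, c, 0) by a horizontal rotation, to (r, 0, c) by
    exchanging axes on the two hemispheres, and to (a, b, c) by another horizontal rotation. The
    factors lost are 2, 6 and 2, whence 24. *)
Lemma angular_bound (R : realType) (q : R -> R) : measurable_fun setT q ->
  (forall x, 0 <= q x) -> (angular q 1 0 0 < +oo)%E ->
  exists2 C : R, 0 <= C & forall a b c, a ^+ 2 + b ^+ 2 + c ^+ 2 = 1 ->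
    (angular q a b c <= C%:E)%E.
Proof.
move=> mq q0 fin.
have ge0 a b c : (0 <= angular q a b c)%E.
  apply: integral_ge0 => y _; apply: integral_ge0 => x _.
  by rewrite lee_fin mulr_ge0.
set A := fine (angular q 1 0 0).
have AE : angular q 1 0 0 = A%:E by rewrite fineK// ge0_fin_numE// ge0.
have A0 : 0 <= A by rewrite -lee_fin -AE ge0.
exists (A *+ 24); first by rewrite mulrn_wge0.
move=> a b c n1.
have [t tI [ea eb]] := polar_coordinates a b.
set r := Num.sqrt _ in ea eb.
have r2 : r ^+ 2 = a ^+ 2 + b ^+ 2 by rewrite sqr_sqrtr// addr_ge0// sqr_ge0.
have [t' tI' [er ec]] := polar_coordinates r c.
have s1 : Num.sqrt (r ^+ 2 + c ^+ 2) = 1 by rewrite r2 n1 sqrtr1.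
rewrite s1 !mul1r in er ec.
have step1 : (angular q r c 0 <= (A *+ 2)%:E)%E.
  have := angular_rotate mq q0 1 0 tI'; rewrite !mul1r -er -ec AE.
  by rewrite mulr2n EFinD.
have step2 : (half_angular q r 0 c <= (A *+ 4)%:E)%E.
  rewrite half_angular_swap//; apply: (le_trans (half_le_angular mq q0 r c 0)).
  by rewrite (mulrnA A 2 2) [in leRHS]mulr2n EFinD; apply: leeD.
have step3 : (half_angular q (- r) (- 0) (- c) <= (A *+ 4)%:E)%E.
  rewrite half_angular_swap//; apply: (le_trans (half_opp_le_angular mq q0 r c 0)).
  by rewrite (mulrnA A 2 2) [in leRHS]mulr2n EFinD; apply: leeD.
have step4 : (angular q r 0 c <= (A *+ 12)%:E)%E.
  apply: (le_trans (angular_le_half mq q0 r 0 c)).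
  have -> : (A *+ 12)%:E = ((A *+ 4)%:E + (A *+ 4)%:E + (A *+ 4)%:E)%E.
    by rewrite -!EFinD -!mulrnDr.
  by apply: leeD => //; apply: leeD.
rewrite ea eb; apply: (le_trans (angular_rotate mq q0 r c tI)).
by rewrite (mulrnA A 12 2) [in leRHS]mulr2n EFinD; apply: leeD.
Qed.

Lemma sph_i0 (R : realType) (x y : R) : sph x y 0 i0 = sin x * cos y.
Proof. by rewrite vec3E. Qed.
Lemma sph_i1 (R : realType) (x y : R) : sph x y 0 i1 = sin x * sin y.
Proof. by rewrite vec3E. Qed.
Lemma sph_i2 (R : realType) (x y : R) : sph x y 0 i2 = cos x.
Proof. by rewrite vec3E. Qed.

Lemma enorm_sph (R : realType) (x y : R) : enorm (sph x y) = 1.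
Proof.
rewrite /enorm dotE sph_i0 sph_i1 sph_i2 (_ : _ + _ = 1) ?sqrtr1//.
have := cos2Dsin2 x; have := cos2Dsin2 y.
set a := cos x; set b := sin x; set c := cos y; set d := sin y => h1 h2.
rewrite (_ : _ + _ = b ^+ 2 * (c ^+ 2 + d ^+ 2) + a ^+ 2); last by ring.
by rewrite h1 mulr1 addrC.
Qed.

(** Colatitude becomes latitude by reflection at pi/2, and Tonelli exchanges the order of the
    angles. *)
Lemma eint_sphere_dot (R : realType) (q : R -> R) (u : 'rV[R]_3) :
  measurable_fun setT q -> (forall x, 0 <= q x) ->
  eint_sphere (fun omega => (q (dot u omega))%:E) =
  angular q (u 0 i0) (u 0 i1) (u 0 i2).
Proof.
move=> mq q0.
pose k (z : R * R) : R := `|sin z.1| *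
  q (u 0 i0 * (sin z.1 * cos z.2) + u 0 i1 * (sin z.1 * sin z.2) + u 0 i2 * cos z.1).
have mk : measurable_fun setT k by apply: mf_mul; [meas|apply: measurableT_comp mq _; meas].
have k0 z : 0 <= k z by rewrite mulr_ge0.
pose D1 : set R := `[0, pi]%classic; pose D2 : set R := `[0, pi *+ 2]%classic.
have mD1 : measurable D1 by exact: measurable_itv.
have mD2 : measurable D2 by exact: measurable_itv.
pose h (z : R * R) := (k z * \1_D1 z.1 * \1_D2 z.2)%:E.
have mi1 : measurable_fun setT (\1_D1 : R -> R) by exact: measurable_indic.
have mi2 : measurable_fun setT (\1_D2 : R -> R) by exact: measurable_indic.
have mh : measurable_fun setT h.
  apply/EFin_measurable/mf_mul; first apply: mf_mul => //.
    exact: (measurableT_comp mi1 measurable_fst).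
  exact: (measurableT_comp mi2 measurable_snd).
have h0 z : (0 <= h z)%E by rewrite lee_fin !mulr_ge0.
transitivity (\int[leb R]_(x in D1) \int[leb R]_(y in D2) (k (x, y))%:E)%E.
  rewrite /eint_sphere integral_mkcond.
  transitivity (\int[leb R \x leb R]_z h z)%E.
    apply: eq_integral => z _; rewrite patchE /h !indicE.
    rewrite (_ : (z \in _) = (z.1 \in D1) && (z.2 \in D2)); last first.
      by apply/idP/andP => [|[]]; rewrite !inE /= => -[].
    have [zD1|_] := boolP (z.1 \in D1) => /=; last by rewrite mulr0 mul0r.
    have [_|_] := boolP (z.2 \in D2); last by rewrite mulr0.
    rewrite !mulr1 -EFinM; congr EFin; rewrite /k mulrC dotE sph_i0 sph_i1 sph_i2.
    rewrite ger0_norm//; move: zD1; rewrite inE /D1 /= in_itv /= => zD1.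
    exact: sin_ge0_pi.
  rewrite (@fubini_tonelli1 _ _ _ _ _ (leb R) (leb R) h mh h0) [RHS]integral_mkcond.
  apply: eq_integral => x _; rewrite patchE /fubini_F /h /=.
  rewrite (integral_in_indic D2 (fun y => k (x, y))) [\1_D1 x]indicE.
  have [xD|xD] := boolP (x \in D1); first by apply: eq_integral => y _; rewrite mulr1.
  by rewrite -[RHS](@integral0 _ _ _ (leb R) setT); apply: eq_integral => y _;
    rewrite mulr0 mul0r.
have -> := tonelli_in mD1 mD2 mk k0.
rewrite /angular.
pose g (z : R * R) : R := `|cos z.1| *
  q (u 0 i0 * (cos z.1 * cos z.2) + u 0 i1 * (cos z.1 * sin z.2) + u 0 i2 * sin z.1).
have mg : measurable_fun setT g by apply: mf_mul; [meas|apply: measurableT_comp mq _; meas].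
have g0 z : 0 <= g z by rewrite mulr_ge0.
have mrh : measurable (right_half R) by exact: measurable_itv.
have := tonelli_in mrh mD2 mg g0; rewrite /g /= => ->.
apply: eq_integral => y _.
pose P x : R := `|cos x| *
  q (u 0 i0 * (cos x * cos y) + u 0 i1 * (cos x * sin y) + u 0 i2 * sin x).
have mP : measurable_fun setT P by apply: mf_mul; [meas|apply: measurableT_comp mq _; meas].
have P0 x : 0 <= P x by rewrite mulr_ge0.
rewrite (integral_right_half mP).
have := ge0_integral_itv_refl 0 pi (pi / 2) mP P0.
rewrite subr0 (_ : pi / 2 - pi = - (pi / 2)); last by lra.
move=> <-; apply: eq_integral => x _; rewrite /k /P /=.
have -> : cos (pi / 2 - x) = sin x by rewrite cosB cos_pihalf sin_pihalf mul0r mul1r add0r.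
have -> : sin (pi / 2 - x) = cos x by rewrite sinB cos_pihalf sin_pihalf mul0r mul1r subr0.
by [].
Qed.

(** * Almost every collision avoids a null set of velocities *)

Lemma sigma_finite_product d1 d2 (X : measurableType d1) (Y : measurableType d2)
    (R : realType) (m1 : {sigma_finite_measure set X -> \bar R})
    (m2 : {sigma_finite_measure set Y -> \bar R}) : sigma_finite setT (m1 \x m2)%E.
Proof.
have [F FT Ff] := sigma_finiteT m1; have [G GT Gf] := sigma_finiteT m2.
exists (fun n => if @unpickle (nat * nat)%type n is Some ij then F ij.1 `*` G ij.2 else set0).
  apply/esym; rewrite -subTset => -[x y] _.
  have : (setT : set X) x by [].
  have : (setT : set Y) y by [].
  rewrite FT GT => -[j _ Gy] [i _ Fx]; exists (pickle (i, j)) => //.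
  by rewrite pickleK.
move=> n; case: unpickle => [[i j]|]; last by rewrite measure0; split.
have [mF fF] := Ff i; have [mG fG] := Gf j; split; first exact: measurableX.
by rewrite product_measure1E// lte_mul_pinfty// ge0_fin_numE.
Qed.

(* The canonical sigma-finite structure on product_measure1 is only found for
   products of subprobabilities. *)
Definition sfprod d1 d2 (X : measurableType d1) (Y : measurableType d2) (R : realType)
    (m1 : {sigma_finite_measure set X -> \bar R})
    (m2 : {sigma_finite_measure set Y -> \bar R}) :
    {sigma_finite_measure set (X * Y)%type -> \bar R} :=
  HB.pack (m1 \x m2)%E
    (Measure_isSigmaFinite.Build _ _ _ (m1 \x m2)%E (sigma_finite_product m1 m2)).

Definition leb2 (R : realType) := sfprod (leb R) (leb R).

Definition leb3 (R : realType) := sfprod (sfprod (leb R) (leb R)) (leb R).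

Arguments leb2 : clear implicits.
Arguments leb3 : clear implicits.

Lemma aeS d (T : measurableType d) (R : realType) (m : {measure set T -> \bar R})
    (P Q : T -> Prop) :
  {ae m, forall x, P x} -> (forall x, P x -> Q x) -> {ae m, forall x, Q x}.
Proof.
move=> [N [mN N0 sN]] PQ; exists N; split => // x nQ; apply: sN => /= p.
by apply: nQ; exact: PQ.
Qed.

Lemma aeS2 d (T : measurableType d) (R : realType) (m : {measure set T -> \bar R})
    (P Q S : T -> Prop) :
  {ae m, forall x, P x} -> {ae m, forall x, Q x} -> (forall x, P x -> Q x -> S x) ->
  {ae m, forall x, S x}.
Proof.
move=> [N [mN N0 sN]] [M [mM M0 sM]] PQ; exists (N `|` M); split.
- exact: measurableU.
- by apply/(negligibleP _ (measurableU _ _ mN mM))/negligibleU; apply/negligibleP.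
- move=> x nS; have [p|p] := pselect (P x); last by left; apply: sN.
  by right; apply: sM => /= q; apply: nS; exact: PQ.
Qed.

Lemma aeS3 d (T : measurableType d) (R : realType) (m : {measure set T -> \bar R})
    (P Q U S : T -> Prop) :
  {ae m, forall x, P x} -> {ae m, forall x, Q x} -> {ae m, forall x, U x} ->
  (forall x, P x -> Q x -> U x -> S x) -> {ae m, forall x, S x}.
Proof.
move=> hP hQ hU h; apply: (aeS2 (aeS2 (Q := Q) (S := fun x => P x /\ Q x) hP hQ _) hU) => [x|x] //.
by case; exact: h.
Qed.

Lemma aeT d (T : measurableType d) (R : realType) (m : {measure set T -> \bar R})
    (P : T -> Prop) : (forall x, P x) -> {ae m, forall x, P x}.
Proof. by move=> h; exists set0; split => // x /(_ (h x)). Qed.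

(** * Iterated almost-everywhere statements and the collision maps *)

Section iterated_ae.
Context {R : realType}.

(** The set is the zero level of the measurable function giving the measures of the sections of the
    complement. It is what allows swaps inside longer chains of quantifiers. *)
Lemma measurable_ae d1 d2 (X : measurableType d1) (Y : measurableType d2)
    (m2 : {sigma_finite_measure set Y -> \bar R}) (A : X -> Y -> Prop) :
  measurable [set z : X * Y | A z.1 z.2] ->
  measurable [set x | {ae m2, forall y, A x y}].
Proof.
move=> mA; pose B := ~` [set z : X * Y | A z.1 z.2].
have mB : measurable B by exact: measurableC.
have mBx x : measurable (xsection B x) by exact: measurable_xsection.
have mf : measurable_fun setT (m2 \o xsection B) by exact: measurable_fun_xsection.
rewrite (_ : [set x | _] = (m2 \o xsection B) @^-1` [set 0%E]).
  rewrite -[X in measurable X]setTI; apply: (mf measurableT) => //; exact: emeasurable_set1.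
apply/seteqP; split => x /= h.
  apply/(negligibleP _ (mBx x)); apply: negligibleS h => y /=.
  by rewrite /xsection /= inE.
have /(negligibleP _ (mBx x)) := h; apply: negligibleS => y /=.
by rewrite /xsection /= inE.
Qed.

Section three.
Context d1 d2 d3 (X : measurableType d1) (Y : measurableType d2) (Z : measurableType d3)
  (m1 : {sigma_finite_measure set X -> \bar R})
  (m2 : {sigma_finite_measure set Y -> \bar R})
  (m3 : {sigma_finite_measure set Z -> \bar R}) (A : X -> Y -> Z -> Prop).
Hypothesis mA : measurable [set t : X * Y * Z | A t.1.1 t.1.2 t.2].

Lemma ae_swap12 :
  {ae m1, forall x, {ae m2, forall y, {ae m3, forall z, A x y z}}} ->
  {ae m2, forall y, {ae m1, forall x, {ae m3, forall z, A x y z}}}.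
Proof.
apply: (ae_swap (A := fun x y => {ae m3, forall z, A x y z})).
exact: (@measurable_ae _ _ (X * Y)%type Z m3 (fun xy z => A xy.1 xy.2 z) mA).
Qed.

Lemma ae_swap23 :
  {ae m1, forall x, {ae m2, forall y, {ae m3, forall z, A x y z}}} ->
  {ae m1, forall x, {ae m3, forall z, {ae m2, forall y, A x y z}}}.
Proof.
move=> /aeS; apply => x; apply: ae_swap.
have mf : measurable_fun setT (fun yz : Y * Z => ((x, yz.1), yz.2)).
  by apply: mf_pair; [apply: mf_pair; [exact: measurable_cst|exact: measurable_fst]
    |exact: measurable_snd].
by rewrite -[X in measurable X]setTI; exact: (mf measurableT _ mA).
Qed.

End three.

Lemma ae_swapR (A : R -> R -> Prop) : measurable [set z : R * R | A z.1 z.2] ->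
  {ae leb R, forall x, {ae leb R, forall y, A x y}} ->
  {ae leb R, forall y, {ae leb R, forall x, A x y}}.
Proof.
exact: (@ae_swap _ _ (measurableTypeR R) (measurableTypeR R) R (leb R) (leb R)).
Qed.

Lemma ae_swap12R (A : R -> R -> R -> Prop) :
  measurable [set t : R * R * R | A t.1.1 t.1.2 t.2] ->
  {ae leb R, forall x, {ae leb R, forall y, {ae leb R, forall z, A x y z}}} ->
  {ae leb R, forall y, {ae leb R, forall x, {ae leb R, forall z, A x y z}}}.
Proof.
exact: (@ae_swap12 _ _ _ (measurableTypeR R) (measurableTypeR R) (measurableTypeR R)
  (leb R) (leb R) (leb R)).
Qed.

Lemma ae_swap23R (A : R -> R -> R -> Prop) :
  measurable [set t : R * R * R | A t.1.1 t.1.2 t.2] ->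
  {ae leb R, forall x, {ae leb R, forall y, {ae leb R, forall z, A x y z}}} ->
  {ae leb R, forall x, {ae leb R, forall z, {ae leb R, forall y, A x y z}}}.
Proof.
exact: (@ae_swap23 _ _ _ (measurableTypeR R) (measurableTypeR R) (measurableTypeR R)
  (leb R) (leb R) (leb R)).
Qed.

Lemma ae_lebesgue3 (G : set (R * R * R)) : measurable G ->
  {ae leb3 R, forall p, G p} <->
  {ae leb R, forall x, {ae leb R, forall y, {ae leb R, forall z, G (x, y, z)}}}.
Proof.
move=> mG; have h1 := ae_prodP (leb2 R) (leb R) mG.
have m2 : measurable [set z : R * R | {ae leb R, forall y, G (z, y)}].
  have mG' : measurable [set z : R * R * R | G (z.1, z.2)].
    by rewrite (_ : [set _ | _] = G)//; apply/seteqP; split => -[].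
  exact: (@measurable_ae _ _ (measurableTypeR R * measurableTypeR R)%type (measurableTypeR R)
    (leb R) (fun xy z => G (xy, z)) mG').
have h2 := ae_prodP (leb R) (leb R) m2.
split.
- by move=> h; apply: (h2.1 (h1.1 h)).
- by move=> h; apply/h1/(h2.2 h).
Qed.

Lemma ae_neq (c : R) : {ae leb R, forall x, x != c}.
Proof.
exists [set c]; split; [exact: measurable_set1|exact: lebesgue_measure_set1|].
by move=> x /=; case: eqVneq => [->//|_]; case.
Qed.

(** Up to the two zeros of the cosine, a full period is covered by three translates of the principal
    branch of [tan], whose period is pi. *)
Lemma ae_tan_period (P : R -> Prop) : {ae leb R, forall x, P x} ->
  {ae leb R, forall x, 0 <= x <= pi *+ 2 -> cos x != 0 /\ P (tan x)}.
Proof.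
move=> hP; have h := ae_tan hP; have pi0 := pi_gt0 R.
have tanBpi (x : R) : tan (x - pi) = tan x by rewrite -{2}(subrK pi x) tanDpi.
have cosBpi (x : R) : cos (x - pi) = - cos x.
  by rewrite cosB cospi sinpi mulr0 addr0 mulrN1.
have n1 : (1 : R) != 0 by exact: oner_neq0.
have hs := ae_affine (- pi) n1 h.
have hss := ae_affine (- pi - pi) n1 h.
have h1 : {ae leb R, forall x, x != pi / 2 /\ x != pi / 2 + pi}.
  by apply: (aeS2 (ae_neq (pi / 2)) (ae_neq (pi / 2 + pi))) => x.
apply: (aeS2 (aeS2 (S := fun x => _ /\ _) h1 h (fun x a b => conj a b))
  (aeS2 (S := fun x => _ /\ _) hs hss (fun x a b => conj a b))) => x [[x1 x2] q1] [q2 q3] /andP[x0 x4].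
rewrite !mul1r in q2 q3.
have [a|a] := ltP x (pi / 2).
  have I : x \in `](- (pi / 2)), (pi / 2)[ by rewrite in_itv /=; apply/andP; split; lra.
  by split; [rewrite gt_eqF// cos_gt0_pihalf// -in_itv|exact: q1].
have {}a : pi / 2 < x by rewrite lt_neqAle eq_sym x1.
have [b|b] := ltP x (pi / 2 + pi).
  have I : x - pi \in `](- (pi / 2)), (pi / 2)[ by rewrite in_itv /=; apply/andP; split; lra.
  split; last by rewrite -tanBpi; exact: q2.
  by rewrite -oppr_eq0 -cosBpi gt_eqF// cos_gt0_pihalf// -in_itv.
have {}b : pi / 2 + pi < x by rewrite lt_neqAle eq_sym x2.
have I : x - pi - pi \in `](- (pi / 2)), (pi / 2)[ by rewrite in_itv /=; apply/andP; split; lra.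
split; last by rewrite -tanBpi -tanBpi -addrA; apply: q3; rewrite addrA.
by rewrite -[cos x]opprK -cosBpi -cosBpi gt_eqF// cos_gt0_pihalf// -in_itv.
Qed.

Lemma ae_cot (P : R -> Prop) : {ae leb R, forall x, P x} ->
  {ae leb R, forall x, 0 <= x <= pi -> sin x != 0 /\ P (cos x / sin x)}.
Proof.
move=> hP; have h := ae_tan hP; have pi0 := pi_gt0 R.
have n1 : (- 1 : R) != 0 by rewrite oppr_eq0 oner_neq0.
have hs := ae_affine (pi / 2) n1 h.
apply: (aeS3 (ae_neq 0) (ae_neq pi) hs) => x x0 xpi q /andP[h1 h2].
have {}h1 : 0 < x by rewrite lt_neqAle eq_sym x0.
have {}h2 : x < pi by rewrite lt_neqAle xpi.
rewrite mulN1r addrC in q.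
split; first by rewrite gt_eqF// sin_gt0_pi// h1.
have I : pi / 2 - x \in `](- (pi / 2)), (pi / 2)[ by rewrite in_itv /=; apply/andP; split; lra.
have := q I; rewrite /tan.
have -> : cos (pi / 2 - x) = sin x by rewrite cosB cos_pihalf sin_pihalf mul0r mul1r add0r.
by have -> : sin (pi / 2 - x) = cos x
  by rewrite sinB cos_pihalf sin_pihalf mul0r mul1r subr0.
Qed.

Lemma ae_cos_neq0 : {ae leb R, forall x, 0 <= x <= pi -> cos x != 0}.
Proof.
apply: (aeS (ae_neq (pi / 2))) => x xn xI; apply: contra xn => /eqP c0.
have pi0 := pi_ge0 R.
apply/eqP; apply: cos_inj; rewrite ?in_itv //=; first by apply/andP; split; lra.
by rewrite c0 cos_pihalf.
Qed.

(** Gaussian elimination with pivot [a]: the second output is [c / a] times the first plus [e * y]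
    and a constant, where [e] is the determinant over [a]. So only one-variable affine substitutions
    and swaps occur. *)
Lemma ae_linear2 (Q : R -> R -> Prop) (a b c d k l : R) :
  measurable [set z : R * R | Q z.1 z.2] -> a != 0 -> a * d - b * c != 0 ->
  {ae leb R, forall x, {ae leb R, forall y, Q x y}} ->
  {ae leb R, forall x, {ae leb R, forall y,
     Q (a * x + b * y + k) (c * x + d * y + l)}}.
Proof.
move=> mQ a0 D0 h.
have mcomp (f : R * R -> R * R) : measurable_fun setT f ->
    measurable [set z | Q (f z).1 (f z).2].
  by move=> mf; rewrite -[X in measurable X]setTI; exact: (mf measurableT _ mQ).
pose e := (a * d - b * c) / a; have e0 : e != 0 by rewrite mulf_neq0// invr_neq0.
have h1 : {ae leb R, forall x, {ae leb R, forall y, Q x ((c / a) * x + e * y + (l - c / a * k))}}.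
  apply: (aeS h) => x hx.
  have := ae_affine (c / a * x + (l - c / a * k)) e0 hx.
  by move=> /aeS; apply => y; rewrite [e * y + _]addrC addrAC.
have h2 : {ae leb R, forall y, {ae leb R, forall x, Q x ((c / a) * x + e * y + (l - c / a * k))}}.
  apply: ae_swapR h1.
  apply: (mcomp (fun z => (z.1, (c / a) * z.1 + e * z.2 + (l - c / a * k)))); meas.
have h3 : {ae leb R, forall y, {ae leb R, forall x, Q (a * x + b * y + k) (c * x + d * y + l)}}.
  apply: (aeS h2) => y hy.
  have := ae_affine (b * y + k) a0 hy; move=> /aeS; apply => x.
  have E1 : a * x + (b * y + k) = a * x + b * y + k by ring.
  have E2 : c / a * (a * x + (b * y + k)) + e * y + (l - c / a * k) = c * x + d * y + l.
    by rewrite /e; field.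
  by rewrite E2 E1.
apply: ae_swapR h3.
apply: (mcomp (fun z => (a * z.2 + b * z.1 + k, c * z.2 + d * z.1 + l))); meas.
Qed.

Variables (G : R * R * R -> Prop) (mG : measurable [set p | G p]).
Hypothesis hG : {ae leb3 R, forall p, G p}.

Let mcomp d (T : measurableType d) (f : T -> R * R * R) : measurable_fun setT f ->
  measurable [set z | G (f z)].
Proof. by move=> mf; rewrite -[X in measurable X]setTI; exact: (mf measurableT _ mG). Qed.

Let mdom d (T : measurableType d) (f : T -> R) (a b : R) : measurable_fun setT f ->
  measurable [set z | a <= f z <= b].
Proof.
move=> mf; rewrite (_ : [set z | _] = f @^-1` `[a, b]%classic); last first.
  by apply/seteqP; split => x /=; rewrite in_itv.
by rewrite -[X in measurable X]setTI; apply: mf => //; exact: measurable_itv.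
Qed.

Let mneq d (T : measurableType d) (f : T -> R) : measurable_fun setT f ->
  measurable [set z | f z != 0].
Proof. exact: measurable_neq0. Qed.

Let mimp d (T : measurableType d) (A B : T -> Prop) : measurable [set z | A z] ->
  measurable [set z | B z] -> measurable [set z | A z -> B z].
Proof.
move=> mA mB; rewrite (_ : [set z | _] = ~` [set z | A z] `|` [set z | B z]).
  by apply: measurableU => //; exact: measurableC.
apply/seteqP; split => x /=; last by case.
by move=> h; case: (pselect (A x)) => a; [right; exact: h|left].
Qed.

Variable v : R * R * R.

Let G123 : {ae leb R, forall x, {ae leb R, forall y, {ae leb R, forall z, G (x, y, z)}}}.
Proof. by apply/(ae_lebesgue3 mG). Qed.

(** On almost every line through [v] almost every point lies in [G]. Spherical coordinates around
    [v] are introduced one variable at a time: the second coordinate becomes x tan f, the third x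
    cot t / cos f, and finally x becomes s sin t cos f. *)
Let radial : {ae leb R, forall f, {ae leb R, forall t, {ae leb R, forall s,
  0 <= f <= pi *+ 2 -> 0 <= t <= pi ->
  G (v.1.1 - s * (sin t * cos f), v.1.2 - s * (sin t * sin f), v.2 - s * cos t)}}}.
Proof.
have n1 : (- 1 : R) != 0 by rewrite oppr_eq0 oner_neq0.
have A1 : {ae leb R, forall x, {ae leb R, forall y, {ae leb R, forall z,
    G (v.1.1 - x, v.1.2 - y, v.2 - z)}}}.
  have := ae_affine v.1.1 n1 G123; move=> /aeS; apply => x h.
  have := ae_affine v.1.2 n1 h; move=> /aeS; apply => y {}h.
  have := ae_affine v.2 n1 h; move=> /aeS; apply => z.
  by rewrite !mulN1r ![- _ + _]addrC.
have A2 : {ae leb R, forall x, {ae leb R, forall z, {ae leb R, forall f, 0 <= f <= pi *+ 2 ->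
    cos f != 0 /\ G (v.1.1 - x, v.1.2 - x * tan f, v.2 - z)}}}.
  have A1' := ae_swap23R (A := fun x y z => G (v.1.1 - x, v.1.2 - y, v.2 - z)) _ A1.
  have {}A1' := A1' ltac:(apply: mcomp; meas).
  apply: (aeS2 (ae_neq 0) A1') => x x0; move=> /aeS; apply => z h.
  have := ae_affine 0 x0 h => /ae_tan_period/aeS; apply => f hf /hf [c0].
  by rewrite addr0.
have A3 : {ae leb R, forall x, {ae leb R, forall f, {ae leb R, forall t,
    0 <= f <= pi *+ 2 -> 0 <= t <= pi ->
    (cos f != 0) && (sin t != 0) /\
    G (v.1.1 - x, v.1.2 - x * tan f, v.2 - x * (cos t / sin t / cos f))}}}.
  have A2' := ae_swap23R (A := fun x z f => 0 <= f <= pi *+ 2 ->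
    cos f != 0 /\ G (v.1.1 - x, v.1.2 - x * tan f, v.2 - z)) _ A2.
  have {}A2' := A2' ltac:(apply: mimp; [apply: mdom; meas
    |apply: measurableI; [apply: mneq; meas|apply: mcomp; meas]]).
  apply: (aeS2 (ae_neq 0) A2') => x x0; move=> /aeS; apply => f h.
  have [fI|nfI] := pselect (0 <= f <= pi *+ 2); last first.
    by apply: (aeT (leb R)) => t fI; exact: (False_ind _ (nfI fI)).
  have [c0|c0] := eqVneq (cos f) 0.
    apply: (aeS h) => z hz; have [] := hz fI; by rewrite c0 eqxx.
  have k0 : x / cos f != 0 by rewrite mulf_neq0// invr_neq0.
  have := ae_affine 0 k0 h => /ae_cot/aeS; apply => t ht _ /ht [s0 q].
  split; first by rewrite s0.
  have [_] := q fI; rewrite addr0 (_ : x / cos f * _ = x * (cos t / sin t / cos f))//.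
  by rewrite mulrAC -!mulrA.
have A4 : {ae leb R, forall f, {ae leb R, forall t, {ae leb R, forall x,
    0 <= f <= pi *+ 2 -> 0 <= t <= pi ->
    (cos f != 0) && (sin t != 0) /\
    G (v.1.1 - x, v.1.2 - x * tan f, v.2 - x * (cos t / sin t / cos f))}}}.
  have mc : measurable [set p : R * R * R | (cos p.1.2 != 0) && (sin p.2 != 0)].
    rewrite (_ : [set x | _] = [set p : R * R * R | cos p.1.2 != 0] `&` [set p | sin p.2 != 0]).
      by apply: measurableI; apply: mneq; meas.
    by apply/seteqP; split => p /= /andP.
  have m1 : measurable [set p : R * R * R | 0 <= p.1.2 <= pi *+ 2 -> 0 <= p.2 <= pi ->
      (cos p.1.2 != 0) && (sin p.2 != 0) /\
      G (v.1.1 - p.1.1, v.1.2 - p.1.1 * tan p.1.2, v.2 - p.1.1 * (cos p.2 / sin p.2 / cos p.1.2))].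
    apply: mimp; first by apply: mdom; meas.
    apply: mimp; first by apply: mdom; meas.
    apply: (measurableI _ _ mc); by apply: mcomp; meas.
  have m2 : measurable [set p : R * R * R | 0 <= p.1.1 <= pi *+ 2 -> 0 <= p.2 <= pi ->
      (cos p.1.1 != 0) && (sin p.2 != 0) /\
      G (v.1.1 - p.1.2, v.1.2 - p.1.2 * tan p.1.1, v.2 - p.1.2 * (cos p.2 / sin p.2 / cos p.1.1))].
    have mf : measurable_fun setT (fun p : R * R * R => ((p.1.2, p.1.1), p.2)) by meas.
    by rewrite -[X in measurable X]setTI; exact: (mf measurableT _ m1).
  exact: (ae_swap23R m2
    (ae_swap12R m1 A3)).
apply: (aeS A4) => f; move=> /aeS; apply => t h.
have [fI|nfI] := pselect (0 <= f <= pi *+ 2); last first.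
  by apply: (aeT (leb R)) => s fI; exact: (False_ind _ (nfI fI)).
have [tI|ntI] := pselect (0 <= t <= pi); last first.
  by apply: (aeT (leb R)) => s _ tI; exact: (False_ind _ (ntI tI)).
have [/andP[c0 s0]|c0] := boolP ((cos f != 0) && (sin t != 0)); last first.
  by apply: (aeS h) => s /(_ fI tI) [] /(elimT idP); rewrite (negbTE c0).
have k0 : sin t * cos f != 0 by rewrite mulf_neq0.
have := ae_affine 0 k0 h; move=> /aeS; apply => s /(_ fI tI) [_]; rewrite addr0 => + _ _.
congr (G (_ , _ - _, _ - _)).
- by rewrite mulrC.
- by rewrite /tan; field.
- by field; rewrite c0 s0.
Qed.

(** For frozen angles the collision maps are affine in [u]; so the statement is proved with the
    angles outermost and the order of the quantifiers is exchanged at the end. *)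
Let prod_ae (Q : R -> R -> R -> R -> R -> Prop) :
  measurable [set p : (R * R * R) * (R * R) | Q p.1.1.1 p.1.1.2 p.1.2 p.2.1 p.2.2] ->
  {ae leb R, forall f, {ae leb R, forall t, {ae leb R, forall x, {ae leb R, forall y,
     {ae leb R, forall z, Q x y z t f}}}}} ->
  {ae leb3 R, forall u, {ae (leb2 R), forall w,
     Q u.1.1 u.1.2 u.2 w.1 w.2}}.
Proof.
move=> mQ h.
have mx (t f : R) : measurable [set u : R * R * R | Q u.1.1 u.1.2 u.2 t f].
  have mf : measurable_fun setT (fun u : R * R * R => (u, (t, f))) by meas.
  by rewrite -[X in measurable X]setTI; exact: (mf measurableT _ mQ).
have h1 : {ae leb R, forall f, {ae leb R, forall t, {ae leb3 R, forall u,
     Q u.1.1 u.1.2 u.2 t f}}}.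
  by apply: (aeS h) => f; move=> /aeS; apply => t; apply: (ae_lebesgue3 (mx t f)).2.
have mQ' : measurable [set p : (R * R) * (R * R * R) | Q p.2.1.1 p.2.1.2 p.2.2 p.1.1 p.1.2].
  have mf : measurable_fun setT (fun p : (R * R) * (R * R * R) => (p.2, p.1)) by meas.
  by rewrite -[X in measurable X]setTI; exact: (mf measurableT _ mQ).
have mW : measurable [set w : R * R | {ae leb3 R, forall u, Q u.1.1 u.1.2 u.2 w.1 w.2}].
  exact: (@measurable_ae _ _ (R * R)%type _ (leb3 R)
    (fun w u => Q u.1.1 u.1.2 u.2 w.1 w.2) mQ').
have mW' : measurable [set w : R * R | {ae leb3 R, forall u, Q u.1.1 u.1.2 u.2 w.2 w.1}].
  have mf : measurable_fun setT (fun p : R * R => (p.2, p.1)) by meas.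
  by rewrite -[X in measurable X]setTI; exact: (mf measurableT _ mW).
have h2 := ae_swapR
  (A := fun f t => {ae leb3 R, forall u, Q u.1.1 u.1.2 u.2 t f}) mW' h1.
have h3 := (ae_prodP (leb R) (leb R) mW).2 h2.
exact: (ae_swap (m1 := (leb2 R)) (m2 := leb3 R)
  (A := fun w u => Q u.1.1 u.1.2 u.2 w.1 w.2) mQ' h3).
Qed.

Definition coords (x : 'rV[R]_3) : R * R * R := (x 0 i0, x 0 i1, x 0 i2).

(** The velocity [post_v] lies on the line through [v] in direction omega, at a parameter affine in
    the last coordinate of [u] with slope - cos t; [radial] is pulled back along it. *)
Lemma ae_post_v : {ae leb3 R, forall u, {ae (leb2 R), forall w,
  0 <= w.2 <= pi *+ 2 -> 0 <= w.1 <= pi ->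
  G (coords (post_v (vec3 u) (vec3 v) (sph w.1 w.2)))}}.
Proof.
pose S (x y z t f : R) := (v.1.1 - x) * (sin t * cos f) + (v.1.2 - y) * (sin t * sin f) +
  (v.2 - z) * cos t.
pose Q x y z t f := 0 <= f <= pi *+ 2 -> 0 <= t <= pi ->
  G (v.1.1 - S x y z t f * (sin t * cos f), v.1.2 - S x y z t f * (sin t * sin f),
     v.2 - S x y z t f * cos t).
have := @prod_ae Q; case.
- apply: mimp; first by apply: mdom; meas.
  apply: mimp; first by apply: mdom; meas.
  by rewrite /S; apply: mcomp; meas.
- apply: (aeS radial) => f; move=> /(aeS2 ae_cos_neq0); apply => t c0 h.
  apply: (aeT (leb R)) => x; apply: (aeT (leb R)) => y.
  have [tI|ntI] := pselect (0 <= t <= pi); last first.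
    by apply: (aeT (leb R)) => s _ tI; exact: (False_ind _ (ntI tI)).
  have k0 : - cos t != 0 by rewrite oppr_eq0 c0.
  have := ae_affine ((v.1.1 - x) * (sin t * cos f) + (v.1.2 - y) * (sin t * sin f) +
    v.2 * cos t) k0 h; move=> /aeS; apply => z; rewrite /Q.
  by rewrite (_ : _ + _ = S x y z t f)// /S; ring.
- move=> N [mN N0 sN]; exists N; split => // u nu; apply: sN => /= q; apply: nu.
  apply: (aeS q) => w qw h1 h2; have := qw h1 h2.
  congr (G _); by rewrite /coords /post_v !mxE dotE !mxE.
Qed.

(** These points form the plane through [v] orthogonal to the direction with angles t and f. For
    fixed y and nonzero z, the first coordinate sweeps the line as t varies, through the
    cotangent. *)
Let orthogonal_plane : {ae leb R, forall f, {ae leb R, forall t, {ae leb R, forall y,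
  {ae leb R, forall z, 0 <= f <= pi *+ 2 -> 0 <= t <= pi ->
    G (v.1.1 - (y * tan f + z * (cos t / sin t / cos f)), v.1.2 + y, v.2 + z)}}}}.
Proof.
have n1 : (1 : R) != 0 by exact: oner_neq0.
have n1' : (- 1 : R) != 0 by rewrite oppr_eq0 oner_neq0.
have A1 : {ae leb R, forall y, {ae leb R, forall z, {ae leb R, forall x,
    G (v.1.1 - x, v.1.2 + y, v.2 + z)}}}.
  have mm : measurable [set p : R * R * R | G (v.1.1 - p.1.1, v.1.2 + p.1.2, v.2 + p.2)].
    by apply: mcomp; meas.
  have mm' : measurable [set p : R * R * R | G (v.1.1 - p.1.2, v.1.2 + p.1.1, v.2 + p.2)].
    by apply: mcomp; meas.
  have h0 : {ae leb R, forall x, {ae leb R, forall y, {ae leb R, forall z,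
      G (v.1.1 - x, v.1.2 + y, v.2 + z)}}}.
    have := ae_affine v.1.1 n1' G123; move=> /aeS; apply => x h.
    have := ae_affine v.1.2 n1 h; move=> /aeS; apply => y {}h.
    have := ae_affine v.2 n1 h; move=> /aeS; apply => z.
    by rewrite mulN1r !mul1r [- _ + _]addrC [y + _]addrC [z + _]addrC.
  exact: (ae_swap23R (A := fun y x z => G (v.1.1 - x, v.1.2 + y, v.2 + z)) mm'
    (ae_swap12R (A := fun x y z => G (v.1.1 - x, v.1.2 + y, v.2 + z)) mm h0)).
apply: (aeS (ae_tan_period (P := fun=> True) (aeT (leb R) (fun=> Logic.I)))) => f hf.
have [fI|nfI] := pselect (0 <= f <= pi *+ 2); last first.
  apply: (aeT (leb R)) => t; apply: (aeT (leb R)) => y; apply: (aeT (leb R)) => z fI.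
  exact: (False_ind _ (nfI fI)).
have [c0 _] := hf fI.
pose Q (y z t : R) := 0 <= t <= pi ->
  G (v.1.1 - (y * tan f + z * (cos t / sin t / cos f)), v.1.2 + y, v.2 + z).
have mQ1 : measurable [set p : R * R * R | Q p.1.1 p.1.2 p.2].
  by apply: mimp; [apply: mdom; meas|apply: mcomp; meas].
have mQ2 : measurable [set p : R * R * R | Q p.1.1 p.2 p.1.2].
  by apply: mimp; [apply: mdom; meas|apply: mcomp; meas].
have A2 : {ae leb R, forall y, {ae leb R, forall z, {ae leb R, forall t, Q y z t}}}.
  apply: (aeS A1) => y; move=> /(aeS2 (ae_neq 0)); apply => z z0 h.
  have k0 : z / cos f != 0 by rewrite mulf_neq0// invr_neq0.
  have := ae_affine (y * tan f) k0 h => /ae_cot/aeS; apply => t ht /ht [s0].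
  by rewrite (_ : z / cos f * _ + _ = y * tan f + z * (cos t / sin t / cos f))//; ring.
have A3 := ae_swap12R (A := fun y t z => Q y z t) mQ2
  (ae_swap23R (A := Q) mQ1 A2).
by apply: (aeS A3) => t; move=> /aeS; apply => y; move=> /aeS; apply => z h _.
Qed.

(** The difference [post_u] minus [v] is the projection of [u] minus [v] orthogonally to omega, so
    the outcome lies in a plane met by [orthogonal_plane]; unlike for [post_v], two coordinates of
    [u] are used to sweep it. *)
Lemma ae_post_u : {ae leb3 R, forall u, {ae leb2 R, forall w,
  0 <= w.2 <= pi *+ 2 -> 0 <= w.1 <= pi ->
  G (coords (post_u (vec3 u) (vec3 v) (sph w.1 w.2)))}}.
Proof.
pose S (x y z t f : R) := (v.1.1 - x) * (sin t * cos f) + (v.1.2 - y) * (sin t * sin f) +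
  (v.2 - z) * cos t.
pose Q x y z t f := 0 <= f <= pi *+ 2 -> 0 <= t <= pi ->
  G (x + S x y z t f * (sin t * cos f), y + S x y z t f * (sin t * sin f),
     z + S x y z t f * cos t).
have mQ : measurable [set p : (R * R * R) * (R * R) | Q p.1.1.1 p.1.1.2 p.1.2 p.2.1 p.2.2].
  apply: mimp; first by apply: mdom; meas.
  apply: mimp; first by apply: mdom; meas.
  by rewrite /S; apply: mcomp; meas.
have [|N [mN N0 sN]] := prod_ae mQ; last first.
  exists N; split => // u nu; apply: sN => /= q; apply: nu.
  apply: (aeS q) => w qw h1 h2; have := qw h1 h2.
  by rewrite /coords /post_u !mxE dotE !mxE.
apply: (aeS2 orthogonal_plane
  (ae_tan_period (P := fun=> True) (aeT (leb R) (fun=> Logic.I)))) => f + hf.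
move=> /(aeS2 (ae_cot (P := fun=> True) (aeT (leb R) (fun=> Logic.I)))); apply => t ht h.
apply: (aeT (leb R)) => x.
have [/andP[fI tI]|nI] := boolP ((0 <= f <= pi *+ 2) && (0 <= t <= pi)); last first.
  apply: (aeT (leb R)) => y; apply: (aeT (leb R)) => z fI tI.
  by move: nI; rewrite fI tI.
have [[c0 _] [s0 _]] := (hf fI, ht tI).
pose a := sin t * cos f; pose b := sin t * sin f; pose c := cos t.
have n1 : a ^+ 2 + b ^+ 2 + c ^+ 2 = 1.
  rewrite /a /b /c !exprMn -mulrDr cos2Dsin2 mulr1 addrC; exact: cos2Dsin2.
have a0 : a != 0 by rewrite mulf_neq0.
have a2 : 0 < a ^+ 2 by rewrite exprn_even_gt0.
(* The first coordinate of the projection of u - v onto the plane orthogonal to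
   omega is determined by the other two, which depend on u linearly with
   determinant a^2. *)
pose P y z := G (v.1.1 - (y * tan f + z * (cos t / sin t / cos f)), v.1.2 + y, v.2 + z).
have mP : measurable [set p : R * R | P p.1 p.2] by apply: mcomp; meas.
have hP : {ae leb R, forall y, {ae leb R, forall z, P y z}}.
  by apply: (aeS h) => y; move=> /aeS; apply => z; apply.
pose k := (v.1.1 - x) * a + v.1.2 * b + v.2 * c.
have e1 : 1 - b ^+ 2 != 0 by rewrite gt_eqF//; have := sqr_ge0 c; lra.
have e2 : (1 - b ^+ 2) * (1 - c ^+ 2) - (- (b * c)) * (- (b * c)) != 0.
  rewrite (_ : _ - _ = a ^+ 2) ?gt_eqF//.
  by rewrite (_ : a ^+ 2 = 1 - b ^+ 2 - c ^+ 2); [ring|rewrite -n1; ring].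
have := ae_linear2 (k * b - v.1.2) (k * c - v.2) mP e1 e2 hP.
move=> /aeS; apply => y; move=> /aeS; apply => z; rewrite /P /Q => + _ _.
have SE : S x y z t f = k - y * b - z * c by rewrite /S /k /a /b /c; ring.
congr (G (_, _, _)); rewrite SE -/a -/b -/c.
- rewrite (_ : tan f = b / a); last by rewrite /tan /a /b; field; rewrite c0 s0.
  rewrite (_ : cos t / sin t / cos f = c / a); last by rewrite /a /c; field; rewrite c0 s0.
  apply: (mulfI a0); rewrite (_ : a * (_ - _) = a * v.1.1 -
    (((1 - b ^+ 2) * y + - (b * c) * z + (k * b - v.1.2)) * b +
    (- (b * c) * y + (1 - c ^+ 2) * z + (k * c - v.2)) * c)); last by field.
  rewrite (_ : _ - _ = a * x + a ^+ 2 * (k - y * b - z * c) +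
     (1 - (a ^+ 2 + b ^+ 2 + c ^+ 2)) * (k - y * b - z * c)); last by rewrite /k; ring.
  by rewrite n1; ring.
- by ring.
- by ring.
Qed.

End iterated_ae.

(** * Bounds for the collision operator *)

Lemma enorm_vec3_sqr (R : realType) (p : R * R * R) :
  enorm (vec3 p) ^+ 2 = p.1.1 ^+ 2 + p.1.2 ^+ 2 + p.2 ^+ 2.
Proof. by rewrite enorm_sqr dotE !vec3E -!expr2. Qed.

Lemma mf_enorm_vec3 d (T : measurableType d) (R : realType) (f : T -> R * R * R) :
  measurable_fun setT f -> measurable_fun setT (fun x => enorm (vec3 (f x))).
Proof.
move=> mf; rewrite (_ : (fun x => _) = fun x =>
  Num.sqrt ((f x).1.1 ^+ 2 + (f x).1.2 ^+ 2 + (f x).2 ^+ 2)); first by meas.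
apply/funext => x; rewrite -(enorm_vec3_sqr (f x)) sqrtr_sqr ger0_norm//.
exact: enorm_ge0.
Qed.

Lemma powR_le_gaussian (R : realType) (rho b eps : R) : 0 < eps ->
  (* Both constants are built for the base, which is at least 1: the exponent [b] is first raised to
     a positive [m], and [L] is chosen so that [L] times the linear part of the exponential
     dominates the term in [rho]. *)
  exists2 K : R, 0 < K & forall s, 0 <= s ->
    (1 + rho ^+ 2 * s) `^ b <= K * expR (eps * s).
Proof.
move=> e0; pose m : R := `|b| + 1.
have m0 : 0 < m by rewrite ltr_wpDl.
pose L := 1 + rho ^+ 2 * m / eps.
have r0 : 0 <= rho ^+ 2 by exact: sqr_ge0.
have L1 : 1 <= L by rewrite lerDl; apply: divr_ge0; [apply: mulr_ge0 => //; exact: ltW|exact: ltW].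
have L0 : 0 < L by exact: lt_le_trans L1.
exists (L `^ m); first exact: powR_gt0.
move=> s s0.
have base : 1 <= 1 + rho ^+ 2 * s by rewrite lerDl mulr_ge0.
have le1 : 1 + rho ^+ 2 * s <= L * expR (eps * s / m).
  apply: (@le_trans _ _ (L * (1 + eps * s / m))); last first.
    by rewrite ler_wpM2l ?(ltW L0)// expR_ge1Dx.
  have -> : L * (1 + eps * s / m) = L + eps * s / m + rho ^+ 2 * s.
    by rewrite /L; field; rewrite !gt_eqF.
  have : 0 <= eps * s / m by rewrite divr_ge0 ?mulr_ge0// ltW.
  lra.
apply: (@le_trans _ _ ((1 + rho ^+ 2 * s) `^ m)).
  by apply: ler_powR => //; rewrite /m; have := ler_norm b; lra.
apply: (@le_trans _ _ ((L * expR (eps * s / m)) `^ m)).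
  by apply: ge0_ler_powR; rewrite ?nnegrE ?(ltW m0)//; lra.
rewrite powRM ?(ltW L0) ?expR_ge0// -expRM divfK//.
by rewrite gt_eqF.
Qed.

Section weights.
Context {R : realType} (rho beta : R).
Implicit Type v : 'rV[R]_3.

Lemma weight_gt0 v : 0 < weight rho beta v.
Proof. by apply: powR_gt0; rewrite ltr_pwDl// mulr_ge0// sqr_ge0. Qed.

Lemma weight_le_gaussian eps : 0 < eps -> exists2 K : R, 0 < K &
  forall v, weight rho beta v <= K * expR (eps * enorm v ^+ 2).
Proof.
move=> /(powR_le_gaussian rho beta) [K K0 h]; exists K => // v; apply: h.
exact: sqr_ge0.
Qed.

Lemma weightV_le_gaussian eps : 0 < eps -> exists2 K : R, 0 < K &
  forall v, (weight rho beta v)^-1 <= K * expR (eps * enorm v ^+ 2).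
Proof.
move=> /(powR_le_gaussian rho (- beta)) [K K0 h]; exists K => // v.
by rewrite /weight -powRN; apply: h; exact: sqr_ge0.
Qed.

Hypothesis hw : (@lebesgue3 R).-integrable setT
  (fun p => ((weight rho beta (vec3 p))^-1 ^+ 2 * (1 + enorm (vec3 p)) ^+ 3)%:E).

(** Finiteness of Gaussian integrals on the velocity space is read off the integrability of the
    weight: the weight grows more slowly than any Gaussian, so its inverse square dominates one. *)
Lemma gaussian_moment : exists2 C : R, 0 <= C &
  (\int[leb3 R]_p ((1 + enorm (vec3 p) ^+ 2) * expR (- (enorm (vec3 p) ^+ 2 / 16)))%:E
     <= C%:E)%E.
Proof.
have e0 : (0 : R) < 64^-1 by rewrite invr_gt0.
have [K K0 hK] := weight_le_gaussian e0.
have hw' := hw; set f := (fun p => _) in hw'.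
have f0 p : (0 <= f p)%E by rewrite lee_fin mulr_ge0 ?sqr_ge0// exprn_ge0// addr_ge0// enorm_ge0.
have /integrableP[mf fin] := hw'.
have fin' : (\int[leb3 R]_p f p < +oo)%E.
  by rewrite (eq_integral (fun p => `|f p|%E))// => p _; rewrite gee0_abs.
have I0 : (0 <= \int[leb3 R]_p f p)%E by apply: integral_ge0.
(* The squared weight costs [K ^+ 2] times a Gaussian of rate 1/32, the quadratic factor costs 32
   times another one, and together they cancel the rate 1/16. *)
pose C := K ^+ 2 * 32; have C0 : 0 <= C by rewrite mulr_ge0// sqr_ge0.
exists (C * fine (\int[leb3 R]_p f p)); first by rewrite mulr_ge0// fine_ge0.
rewrite EFinM fineK ?ge0_fin_numE// -ge0_integralZl//.
apply: ge0_le_integral => //.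
- by move=> p _; rewrite lee_fin mulr_ge0 ?expR_ge0// addr_ge0// sqr_ge0.
- apply/measurable_EFinP/mf_mul.
    by apply: mf_add; [meas|apply/mf_exp/mf_enorm_vec3; meas].
  apply/mf_expR/mf_opp/mf_mul; last by meas.
  by apply/mf_exp/mf_enorm_vec3; meas.
- exact: measurable_funeM.
move=> p _; rewrite -EFinM lee_fin.
set n := enorm (vec3 p); have n0 : 0 <= n by exact: enorm_ge0.
have wp := weight_gt0 (vec3 p); have := hK (vec3 p); rewrite -/n.
set w := weight _ _ _ in wp * => hwK.
rewrite exprVn (_ : C * _ = C * (1 + n) ^+ 3 / w ^+ 2); last by rewrite -mulrA [_^-1 * _]mulrC.
rewrite ler_pdivlMr ?exprn_gt0//.
have w2 : w ^+ 2 <= K ^+ 2 * expR (n ^+ 2 / 32).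
  apply: (@le_trans _ _ ((K * expR (64^-1 * n ^+ 2)) ^+ 2)).
    by rewrite ler_sqr ?nnegrE ?(ltW wp)// mulr_ge0 ?expR_ge0// ltW.
  rewrite exprMn [expR _ ^+ 2]expr2 -expRD (_ : _ + _ = n ^+ 2 / 32)//.
  by field.
have E1 : 1 + n ^+ 2 <= 32 * expR (n ^+ 2 / 32).
  have := expR_ge1Dx (n ^+ 2 / 32); have := sqr_ge0 n; lra.
have n3 : 1 <= (1 + n) ^+ 3 by rewrite exprn_ege1// lerDl.
apply: (@le_trans _ _ (32 * expR (n ^+ 2 / 32) * expR (- (n ^+ 2 / 16)) *
   (K ^+ 2 * expR (n ^+ 2 / 32)))).
  apply: ler_pM => //; first by rewrite mulr_ge0 ?expR_ge0// addr_ge0// sqr_ge0.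
    exact: sqr_ge0.
  by rewrite ler_wpM2r ?expR_ge0.
rewrite (_ : _ * (K ^+ 2 * _) = C * (expR (n ^+ 2 / 32) * expR (- (n ^+ 2 / 16)) *
  expR (n ^+ 2 / 32))); last by rewrite /C; ring.
rewrite -!expRD (_ : _ + _ + _ = 0); last by field.
by rewrite expR0 ler_wpM2l.
Qed.

End weights.

Lemma five_bounds (R : realType) (a b c d e x y : R) : a <= x -> b <= x -> c <= x ->
  d <= y -> e <= y -> 0 <= y -> a + b + c + (d + e) <= 3 * x + 3 * y.
Proof. by move=> *; lra. Qed.

Section kernel.
Context {R : realType} (gam : R) (hgam : 0 < gam <= 1) (q0 : R -> R)
  (hq0m : measurable_fun (`[-1, 1]%classic : set R) q0)
  (hq0pos : forall c : R, -1 <= c <= 1 -> 0 <= q0 c)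
  (hq0cut : forall u : 'rV[R]_3, enorm u = 1 ->
     (eint_sphere (fun omega => (q0 (dot u omega))%:E) < +oo)%E)
  (rho beta : R)
  (hw : (@lebesgue3 R).-integrable setT
     (fun p => ((weight rho beta (vec3 p))^-1 ^+ 2 *
                (1 + enorm (vec3 p)) ^+ 3)%:E)).

(** Extension by zero: [q0] is only controlled on the range of direction cosines, whereas the
    angular estimates want a function on the line. *)
Let q (x : R) : R := q0 x * \1_(`[-1, 1]%classic : set R) x.

Let qE x : -1 <= x <= 1 -> q x = q0 x.
Proof. by move=> h; rewrite /q indicE mem_set ?mulr1. Qed.

Let q_ge0 x : 0 <= q x.
Proof.
rewrite /q indicE; case: (boolP (_ \in _)); last by rewrite mulr0.
by rewrite inE /= in_itv /= => h; rewrite mulr1; exact: hq0pos.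
Qed.

Let mq : measurable_fun setT q.
Proof.
have := (measurable_restrictT q0 (measurable_itv `[-1, 1])).1 hq0m.
apply: eq_measurable_fun => x _; rewrite patchE /q indicE.
by case: ifP; rewrite ?mulr1 ?mulr0.
Qed.

Let dot_unit (u : 'rV[R]_3) x y : enorm u = 1 -> -1 <= dot u (sph x y) <= 1.
Proof.
by move=> u1; rewrite -ler_norml (le_trans (cauchy_schwarz _ _))// u1 enorm_sph mul1r.
Qed.

Let cross_section : exists2 C : R, 0 <= C & forall u : 'rV[R]_3, enorm u = 1 ->
  (eint_sphere (fun omega => (q (dot u omega))%:E) <= C%:E)%E.
Proof.
have e1 : enorm (vec3 (1, 0, 0) : 'rV[R]_3) = 1.
  by rewrite /enorm dotE !vec3E /= !mulr0 !addr0 mulr1 sqrtr1.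
have := hq0cut e1.
rewrite (_ : eint_sphere _ = eint_sphere (fun omega => (q (dot (vec3 (1, 0, 0)) omega))%:E)).
  rewrite eint_sphere_dot// !vec3E /= => /(angular_bound mq q_ge0) [C C0 hC].
  exists C => // u u1; rewrite eint_sphere_dot//; apply: hC.
  by rewrite -[RHS](expr1n _ 2) -u1 enorm_sqr dotE -!expr2.
by apply: eq_integral => p _; rewrite qE// dot_unit.
Qed.

Lemma post_energy (u v omega : 'rV[R]_3) : enorm omega = 1 ->
  enorm (post_u u v omega) ^+ 2 + enorm (post_v u v omega) ^+ 2 =
  enorm u ^+ 2 + enorm v ^+ 2.
Proof.
move=> o1; have oo : dot omega omega = 1 by rewrite -enorm_sqr o1 expr1n.
rewrite !enorm_sqr /post_u /post_v; set s := dot (v - u) omega.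
have hs : s = dot v omega - dot u omega by rewrite /s dotBl.
rewrite !(dotDl, dotDr, dotBl, dotBr, dotZl, dotZr, dotNl, dotNr) oo.
rewrite (dotC omega u) (dotC omega v).
rewrite (_ : dot v omega = s + dot u omega); last by rewrite hs subrK.
ring.
Qed.

Let norm_powR_le (z : R) : 0 <= z -> z `^ gam <= 1 + z ^+ 2.
Proof.
move=> z0; have [z1|z1] := leP z 1.
  apply: (@le_trans _ _ 1); last by rewrite lerDl sqr_ge0.
  have := @ge0_ler_powR R gam (ltW (andP hgam).1) z 1.
  by rewrite powR1; apply; rewrite ?nnegrE.
apply: (@le_trans _ _ z).
  by rewrite -[leRHS]powRr1//; apply: ler_powR; [exact: ltW|case/andP: hgam].
by nra.
Qed.

(* The weights exp(-a|u|^2) of the two incoming particles are those of the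
   outgoing ones by conservation of energy, so that only the integral of the
   kernel against a Gaussian is left. *)
Lemma kernel_integral_bound : exists2 C : R, 0 <= C &
  forall (a A : R) (v : 'rV[R]_3) (Phi : 'rV[R]_3 -> 'rV[R]_3 -> R),
  16^-1 <= a -> 0 <= A ->
  {ae leb3 R, forall p, {ae leb2 R, forall w,
     0 <= w.2 <= pi *+ 2 -> 0 <= w.1 <= pi ->
     `|Phi (vec3 p) (sph w.1 w.2)| <= A * expR (- (a * enorm (vec3 p) ^+ 2))}} ->
  `|int3 setT (fun u => int_sphere (fun omega => kernelB gam q0 (v - u) omega * Phi u omega))|
    <= A * (C * (1 + enorm v ^+ 2)).
Proof.
have [CI CI0 hCI] := cross_section.
have [Cg Cg0 hCg] := gaussian_moment hw.
exists (CI * 2 * Cg); first by rewrite !mulr_ge0.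
move=> a A v Phi a16 A0 hPhi.
pose b (p : R * R * R) : R := A * CI * (2 * (1 + enorm v ^+ 2)) *
  ((1 + enorm (vec3 p) ^+ 2) * expR (- (enorm (vec3 p) ^+ 2 / 16))).
have m1 : measurable_fun setT (fun p : R * R * R =>
    (1 + enorm (vec3 p) ^+ 2) * expR (- (enorm (vec3 p) ^+ 2 / 16))).
  apply: mf_mul; first by apply: mf_add; [meas|apply/mf_exp/mf_enorm_vec3; meas].
  apply/mf_expR/mf_opp/mf_mul; last by meas.
  by apply/mf_exp/mf_enorm_vec3; meas.
have g0 (p : R * R * R) : 0 <= (1 + enorm (vec3 p) ^+ 2) * expR (- (enorm (vec3 p) ^+ 2 / 16)).
  by rewrite mulr_ge0 ?expR_ge0// addr_ge0// sqr_ge0.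
have c0 : 0 <= A * CI * (2 * (1 + enorm v ^+ 2)).
  by rewrite !mulr_ge0// addr_ge0// sqr_ge0.
apply: (@normr_Rintegral_le_ae _ _ R (leb3 R) setT _ (fun p => (b p)%:E)) => //.
- by move=> p _; rewrite lee_fin mulr_ge0.
- by apply/measurable_EFinP/mf_mul => //; exact: measurable_cst.
- apply: (aeS hPhi) => p hp _; rewrite lee_fin.
  set u := vec3 p in hp *; set z := v - u.
  (* For [u = v] there is no relative direction, but the kernel vanishes because [gam] is
     positive. *)
  have [z0|z0] := eqVneq z 0.
    have -> : int_sphere (fun omega => kernelB gam q0 z omega * Phi u omega) = 0.
      rewrite /int_sphere /eint_sphere (eq_integral (cst 0%E)) ?integral0// => w _.
      rewrite /kernelB z0 enorm0 powR0 ?mul0r ?mul0e//.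
      by rewrite gt_eqF//; case/andP: hgam.
    by rewrite normr0 mulr_ge0.
  have nz : 0 < enorm z by exact: enorm_gt0.
  pose zh := (enorm z)^-1 *: z.
  have zh1 : enorm zh = 1 by rewrite enormZ ger0_norm ?invr_ge0 ?enorm_ge0// mulVf// gt_eqF.
  pose K := enorm z `^ gam * (A * expR (- (a * enorm u ^+ 2))).
  have K0 : 0 <= K by rewrite !mulr_ge0 ?powR_ge0 ?expR_ge0.
  pose D : set (R * R) := `[0, pi]%classic `*` `[0, pi *+ 2]%classic.
  have mD : measurable D by apply: measurableX; exact: measurable_itv.
  pose gg (w : R * R) : \bar R := (q (dot zh (sph w.1 w.2)) * `|sin w.1|)%:E.
  have mgg : measurable_fun setT gg.
    apply/measurable_EFinP/mf_mul; last by meas.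
    apply: (measurableT_comp mq).
    rewrite (_ : (fun w => _) = fun w : R * R => zh 0 i0 * (sin w.1 * cos w.2) +
      zh 0 i1 * (sin w.1 * sin w.2) + zh 0 i2 * cos w.1); first by meas.
    by apply/funext => w; rewrite dotE sph_i0 sph_i1 sph_i2.
  have gg0 w : (0 <= gg w)%E by rewrite lee_fin mulr_ge0.
  have ggI : (\int[leb2 R]_(w in D) gg w <= CI%:E)%E.
    apply: le_trans (hCI zh zh1); rewrite le_eqVlt; apply/orP; left; apply/eqP.
    apply: eq_integral => w; rewrite inE => -[/= w1 w2]; rewrite /gg EFinM ger0_norm//.
    by apply: sin_ge0_pi; move: w1; rewrite in_itv.
  have bound : (\int[leb2 R]_(w in D) (K%:E * gg w) <= (K * CI)%:E)%E.
    rewrite ge0_integralZl//; last exact: measurable_funTS.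
    by rewrite [leRHS]EFinM; apply: lee_wpmul2l => //; rewrite lee_fin.
  have le1 : `|int_sphere (fun omega => kernelB gam q0 z omega * Phi u omega)| <= K * CI.
    have h : {ae leb2 R, forall w, D w ->
        (`|(kernelB gam q0 z (sph w.1 w.2) * Phi u (sph w.1 w.2))%:E * (sin w.1)%:E| <=
         K%:E * gg w)%E}.
      apply: (aeS hp) => w hw' [/= w1 w2].
      have {}w1 : 0 <= w.1 <= pi by move: w1; rewrite in_itv.
      have {}w2 : 0 <= w.2 <= pi *+ 2 by move: w2; rewrite in_itv.
      rewrite /gg -EFinM lee_fin !normrM mulrA; apply: ler_wpM2r => //.
      rewrite -/zh (ger0_norm (powR_ge0 _ _)).
      have du := dot_unit w.1 w.2 zh1; have qp := hq0pos du.
      rewrite (qE du) (ger0_norm qp) /K mulrAC; apply: ler_wpM2r => //.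
      by apply: ler_wpM2l; [exact: powR_ge0|exact: hw'].
    have Kg0 w : D w -> (0 <= K%:E * gg w)%E.
      by move=> _; apply: mule_ge0; [rewrite lee_fin|exact: gg0].
    have mKg : measurable_fun D (fun w => K%:E * gg w)%E.
      by apply: measurable_funTS; exact: measurable_funeM.
    have := le_trans (@abse_integral_le_ae _ _ R (leb2 R) D
      (fun w => (kernelB gam q0 z (sph w.1 w.2) * Phi u (sph w.1 w.2))%:E * (sin w.1)%:E)%E
      (fun w => K%:E * gg w)%E mD Kg0 mKg h) bound.
    rewrite /int_sphere /eint_sphere; set I := integral _ _ _.
    move=> hI.
    by case: I hI => [r||] //=; rewrite ?lee_fin.
  apply: (le_trans le1); rewrite /K /b.
  have e1 : expR (- (a * enorm u ^+ 2)) <= expR (- (enorm u ^+ 2 / 16)).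
    by rewrite ler_expR lerN2 mulrC ler_wpM2r// sqr_ge0.
  (* The quadratic growth in [u] goes into the Gaussian moment; the growth in [v] is what the
     barrier has to absorb later. *)
  have e2 : enorm z `^ gam <= 2 * (1 + enorm v ^+ 2) * (1 + enorm u ^+ 2).
    apply: (le_trans (norm_powR_le (enorm_ge0 z))).
    have : enorm z <= enorm v + enorm u by rewrite /z -(enormN u) enormD.
    move: (enorm_ge0 z) (enorm_ge0 v) (enorm_ge0 u).
    set n1 := enorm z; set n2 := enorm v; set n3 := enorm u => h1 h2 h3 h4.
    have : n1 ^+ 2 <= (n2 + n3) ^+ 2 by rewrite ler_sqr ?nnegrE// addr_ge0.
    have := sqr_ge0 (n2 - n3); have := mulr_ge0 (sqr_ge0 n2) (sqr_ge0 n3); nra.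
  rewrite (_ : _ * (A * _) * CI = A * CI *
    (enorm z `^ gam * expR (- (a * enorm u ^+ 2)))); last by ring.
  rewrite -[leRHS]mulrA; apply: ler_wpM2l; first by rewrite mulr_ge0.
  by rewrite [leRHS]mulrA; apply: ler_pM; rewrite ?powR_ge0 ?expR_ge0.
- rewrite /b; under eq_integral do rewrite EFinM.
  rewrite ge0_integralZl//; last 2 first.
  + exact: (EFin_measurable m1).
  + by move=> p _; rewrite lee_fin.
  apply: (@le_trans _ _ ((A * CI * (2 * (1 + enorm v ^+ 2)))%:E * Cg%:E)%E).
    by rewrite lee_wpmul2l// lee_fin.
  by rewrite -EFinM lee_fin le_eqVlt; apply/orP; left; apply/eqP; ring.
Qed.

Lemma sphere_integral_ge0 (f : 'rV[R]_3 -> R) :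
  (forall omega, enorm omega = 1 -> 0 <= f omega) -> 0 <= int_sphere f.
Proof.
move=> f0; apply: fine_ge0; apply: integral_ge0 => p [/= p1 _].
rewrite mule_ge0 ?lee_fin ?f0 ?enorm_sph//.
by apply: sin_ge0_pi; move: p1; rewrite in_itv.
Qed.

Lemma kernelB_ge0 (z omega : 'rV[R]_3) : enorm omega = 1 -> 0 <= kernelB gam q0 z omega.
Proof.
move=> o1; rewrite mulr_ge0 ?powR_ge0// hq0pos// -ler_norml.
apply: (le_trans (cauchy_schwarz _ _)); rewrite o1 mulr1 enormZ.
rewrite ger0_norm ?invr_ge0 ?enorm_ge0//.
by have [->|n0] := eqVneq (enorm z) 0; rewrite ?mulr0// mulVf.
Qed.

Lemma mu_le_gaussian (a : R) (u : 'rV[R]_3) : a <= 2^-1 ->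
  mu u <= expR (- (a * enorm u ^+ 2)).
Proof.
move=> a2; rewrite ler_expR mulNr lerN2 mulrC; apply: ler_wpM2l => //; exact: sqr_ge0.
Qed.

Lemma mu_gt0 (u : 'rV[R]_3) : 0 < mu u. Proof. exact: expR_gt0. Qed.

Lemma mu_ge0 (u : 'rV[R]_3) : 0 <= mu u. Proof. exact: expR_ge0. Qed.

Lemma nu_bound : exists2 C : R, 0 <= C &
  forall v, 0 <= nu gam q0 v <= C * (1 + enorm v ^+ 2).
Proof.
have [C C0 hC] := kernel_integral_bound; exists C => // v.
have nuE : nu gam q0 v = int3 setT (fun u => int_sphere (fun omega =>
    kernelB gam q0 (v - u) omega * mu u)).
  rewrite /nu; congr int3; apply/funext => u; congr int_sphere; apply/funext => omega.
  by rewrite /kernelB mulrAC.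
apply/andP; split.
  rewrite nuE; apply: Rintegral_ge0 => p _; apply: sphere_integral_ge0 => omega o1.
  exact: mulr_ge0 (kernelB_ge0 _ o1) (mu_ge0 _).
apply: (le_trans (ler_norm _)); rewrite nuE -[leRHS]mul1r.
have a16 : (16^-1 : R) <= 16^-1 by [].
apply: (hC 16^-1 1 v (fun u _ => mu u) a16 ler01).
apply: (aeT (leb3 R)) => p; apply: (aeT (leb2 R)) => w _ _.
by rewrite (ger0_norm (mu_ge0 _)) mul1r; apply: mu_le_gaussian; lra.
Qed.

(* The collision operator of mu + g, with the vanishing term Q(mu, mu) and the
   term nu g that is treated separately left out. *)
Definition collision (g : 'rV[R]_3 -> R) (v : 'rV[R]_3) : R :=
  Qplus gam q0 (@mu R) g v + Qplus gam q0 g (@mu R) v - Qminus gam q0 g (@mu R) v +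
  (Qplus gam q0 g g v - Qminus gam q0 g g v).

(** The bound on [g] is available on the full-measure set [G] and at [v]. Gain terms see only
    post-collisional velocities, which lie in [G] for almost every collision; loss terms see [u] and
    [v]. Since [a] is at most 1/2, [mu] lies below the same Gaussian with amplitude 1, so the three
    linear terms contribute [A] and the two quadratic ones [A ^+ 2]. *)
Lemma collision_bound : exists2 C : R, 0 <= C &
  forall (a A : R) (v : 'rV[R]_3) (g : 'rV[R]_3 -> R) (G : R * R * R -> Prop),
  16^-1 <= a <= 2^-1 -> 0 <= A -> measurable [set p | G p] ->
  {ae leb3 R, forall p, G p} ->
  (forall p, G p -> `|g (vec3 p)| <= A * expR (- (a * enorm (vec3 p) ^+ 2))) ->
  `|g v| <= A * expR (- (a * enorm v ^+ 2)) ->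
  `|collision g v| <= C * (A + A ^+ 2) * ((1 + enorm v ^+ 2) * expR (- (a * enorm v ^+ 2))).
Proof.
have [C C0 hC] := kernel_integral_bound; exists (C * 3); first by rewrite mulr_ge0.
move=> a A v g G /andP[a1 a2] A0 mG hG gG gv.
pose W (u : 'rV[R]_3) := expR (- (a * enorm u ^+ 2)).
have W0 u : 0 <= W u by exact: expR_ge0.
have muW (u : 'rV[R]_3) : `|mu u| <= 1 * W u.
  by rewrite mul1r (ger0_norm (mu_ge0 _)); exact: mu_le_gaussian.
have plus (f1 f2 : 'rV[R]_3 -> R) (A1 A2 : R) : 0 <= A1 -> 0 <= A2 ->
    (forall p, G p -> `|f1 (vec3 p)| <= A1 * W (vec3 p)) ->
    (forall p, G p -> `|f2 (vec3 p)| <= A2 * W (vec3 p)) ->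
    `|Qplus gam q0 f1 f2 v| <= A1 * A2 * W v * (C * (1 + enorm v ^+ 2)).
  move=> A10 A20 h1 h2; rewrite /Qplus.
  have AA : 0 <= A1 * A2 * W v by rewrite !mulr_ge0.
  have := hC a (A1 * A2 * W v) v
    (fun u omega => f1 (post_u u v omega) * f2 (post_v u v omega)) a1 AA.
  rewrite (_ : int3 _ _ = int3 setT (fun u => int_sphere (fun omega =>
    kernelB gam q0 (v - u) omega * f1 (post_u u v omega) * f2 (post_v u v omega)))).
    apply; have hu := ae_post_u mG hG (coords v); have hv := ae_post_v mG hG (coords v).
    apply: (aeS2 hu hv) => p hpu hpv; apply: (aeS2 hpu hpv) => w wu wv w2 w1.
    have {wu} := h1 _ (wu w2 w1); have {wv} := h2 _ (wv w2 w1).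
    rewrite /coords !vec3K; set u' := post_u _ _ _; set v' := post_v _ _ _ => b2 b1.
    rewrite normrM (le_trans (ler_pM _ _ b1 b2))//.
    rewrite (_ : _ * W u' * _ = A1 * A2 * (W u' * W v')); last by ring.
    rewrite -[leRHS]mulrA ler_wpM2l ?mulr_ge0// /W -!expRD ler_expR.
    rewrite le_eqVlt; apply/orP; left; apply/eqP.
    rewrite -!opprD -!mulrDr post_energy ?enorm_sph//.
    by rewrite [enorm v ^+ 2 + _]addrC.
  congr int3; apply/funext => u; congr int_sphere; apply/funext => omega.
  by rewrite mulrA.
have minus (f1 f2 : 'rV[R]_3 -> R) (A1 A2 : R) : 0 <= A1 -> 0 <= A2 ->
    (forall p, G p -> `|f1 (vec3 p)| <= A1 * W (vec3 p)) -> `|f2 v| <= A2 * W v ->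
    `|Qminus gam q0 f1 f2 v| <= A1 * A2 * W v * (C * (1 + enorm v ^+ 2)).
  move=> A10 A20 h1 h2; rewrite /Qminus.
  have AA : 0 <= A1 * A2 * W v by rewrite !mulr_ge0.
  have := hC a (A1 * A2 * W v) v (fun u omega => f1 u * f2 v) a1 AA.
  rewrite (_ : int3 _ _ = int3 setT (fun u => int_sphere (fun omega =>
    kernelB gam q0 (v - u) omega * f1 u * f2 v))).
    apply; apply: (aeS hG) => p /h1 hp; apply: (aeT (leb2 R)) => w _ _.
    rewrite normrM (le_trans (ler_pM _ _ hp h2))// /W.
    by rewrite le_eqVlt; apply/orP; left; apply/eqP; ring.
  congr int3; apply/funext => u; congr int_sphere; apply/funext => omega.
  by rewrite mulrA.
have muG p : G p -> `|mu (vec3 p)| <= 1 * W (vec3 p) by [].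
have t1 := plus _ _ _ _ ler01 A0 muG gG; have t2 := plus _ _ _ _ A0 ler01 gG muG.
have t3 := minus _ _ _ _ A0 ler01 gG (muW v); have t4 := plus _ _ _ _ A0 A0 gG gG.
have t5 := minus _ _ _ _ A0 A0 gG gv.
rewrite /collision; move: t1 t2 t3 t4 t5.
set q1 := Qplus _ _ _ _ _; set q2 := Qplus _ _ _ _ _; set q3 := Qminus _ _ _ _ _.
set q4 := Qplus _ _ _ _ _; set q5 := Qminus _ _ _ _ _.
set X := C * (1 + enorm v ^+ 2); rewrite -/(W v) => t1 t2 t3 t4 t5.
have tri : `|q1 + q2 - q3 + (q4 - q5)| <= `|q1| + `|q2| + `|q3| + (`|q4| + `|q5|).
  apply: (le_trans (ler_normD _ _)); apply: lerD; last exact: ler_normB.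
  by apply: (le_trans (ler_normB _ _)); apply: lerD => //; exact: ler_normD.
apply: (le_trans tri); rewrite (_ : _ * _ * (_ * W v) = 3 * ((A + A ^+ 2) * W v * X)).
  have : 0 <= A * A * W v * X by rewrite !mulr_ge0// addr_ge0// sqr_ge0.
  rewrite (_ : 3 * ((A + A ^+ 2) * W v * X) = 3 * (A * W v * X) + 3 * (A * A * W v * X)).
    rewrite mul1r in t1; rewrite mulr1 in t2 t3.
    exact: (five_bounds t1 t2 t3 t4 t5).
  by ring.
by rewrite /X; ring.
Qed.

End kernel.

(** * Charts of the boundary *)

Section row_topology.
Context {R : realType}.

Lemma nbhs_rowP n (x : 'rV[R]_n.+1) (P : set 'rV[R]_n.+1) : nbhs x P <->
  exists2 d : R, 0 < d & forall y : 'rV[R]_n.+1, (forall i, `|y 0 i - x 0 i| < d) -> P y.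
Proof.
split=> [/nbhs_ballP[d /= d0 h]|[d d0 h]].
  exists d => // y yx; apply: h; split=> // i j; rewrite (ord1 i) /ball /=.
  by rewrite distrC; exact: yx.
apply/nbhs_ballP; exists d => //= y [_ yx]; apply: h => i.
by have := yx 0 i; rewrite /ball /= distrC.
Qed.

Lemma nbhs_enormP (x : 'rV[R]_3) (P : set 'rV[R]_3) : nbhs x P <->
  exists2 d : R, 0 < d & forall y, enorm (y - x) < d -> P y.
Proof.
rewrite nbhs_rowP; split=> -[d d0 h].
  exists d => // y yx; apply: h => i; apply: le_lt_trans yx.
  by have := normr_coord_le (y - x) i; rewrite !mxE.
exists (d / 3) => [|y yx]; first by rewrite divr_gt0.
apply: h; apply: le_lt_trans (enorm_le_sum _) _; rewrite !mxE.
have := yx i0; have := yx i1; have := yx i2; lra.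
Qed.

Lemma continuous_rowP n (f : 'rV[R]_n.+1 -> R) (x : 'rV[R]_n.+1) : {for x, continuous f} ->
  forall e : R, 0 < e -> exists2 d : R, 0 < d &
    forall y : 'rV[R]_n.+1, (forall i, `|y 0 i - x 0 i| < d) -> `|f y - f x| < e.
Proof.
move=> fc e e0.
have /nbhs_rowP[d d0 h] : \forall y \near x, `|f y - f x| < e.
  have /cvgrPdist_lt/(_ e e0) := fc.
  by apply: filterS => y; rewrite distrC.
by exists d.
Qed.

Lemma mvt_line n (f : 'rV[R]_n.+1 -> R) (v y : 'rV[R]_n.+1) (T : R) :
  (forall z, derivable f z v) ->
  exists2 c, 0 <= c <= 1 & f (y + T *: v) - f y = T * 'D_v f (y + (c * T) *: v).
Proof.
move=> fd; pose h (t : R) : R := f (y + (t * T) *: v).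
have hd (t : R) : is_derive t 1 h (T * 'D_v f (y + (t * T) *: v)).
  have dl : is_derive (t * T) 1 (fun s : R => f (y + s *: v)) ('D_v f (y + (t * T) *: v)).
    have q : (fun k : R => k^-1 *: (((fun s : R => f (y + s *: v)) \o shift (t * T)) (k *: 1)
          - f (y + (t * T) *: v))) =
        (fun k : R => k^-1 *: ((f \o shift (y + (t * T) *: v)) (k *: v)
          - f (y + (t * T) *: v))).
      apply/funext => k /=; congr (_ *: (f _ - _)).
      by rewrite scalerDl /GRing.scale /= mulr1 addrCA.
    by split; [rewrite /derivable q; exact: fd|rewrite /derive q].
  have dm : is_derive t (1 : R) (fun s : R => s * T) T.
    by apply: is_derive_eq; rewrite ?scaler0 ?add0r ?addr0 /GRing.scale /= mulr1.
  have := @is_derive1_comp R (fun s : R => f (y + s *: v)) (fun s : R => s * T) t _ _ dl dm.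
  by rewrite mulrC.
have [c cI e] := @MVT_segment R h _ 0 1 ler01 (fun t _ => hd t)
  (continuous_subspaceT (fun t => differentiable_continuous
    (iffLR (derivable1_diffP h t) (@ex_derive _ _ _ _ _ _ _ (hd t))))).
exists c; first by move: cI; rewrite in_itv.
by move: e; rewrite /h mul1r mul0r scale0r addr0 subr0 mulr1.
Qed.

End row_topology.

Section strict_differentiability.
Context {R : realType}.

(** From [y] to [z] one moves parallel to the axes through the corner [m]; on each side the mean
    value theorem applies, and the partial derivatives vary little near [x]. *)
Lemma strict_diff2 (Phi : 'rV[R]_2 -> R) : Ck 1 Phi ->
  forall (x : 'rV[R]_2) (e : R), 0 < e -> exists2 d : R, 0 < d &
  forall y z : 'rV[R]_2, (forall i, `|y 0 i - x 0 i| < d) ->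
    (forall i, `|z 0 i - x 0 i| < d) ->
    `|Phi z - Phi y - ('D_(delta_mx 0 ord0) Phi y * (z 0 ord0 - y 0 ord0)
       + 'D_(delta_mx 0 ord_max) Phi y * (z 0 ord_max - y 0 ord_max))| <=
    e * (`|z 0 ord0 - y 0 ord0| + `|z 0 ord_max - y 0 ord_max|).
Proof.
move=> [Pc Pd] x e e0.
have [dd0 [/(_ x) c0 _]] := Pd ord0.
have [dd1 [/(_ x) c1 _]] := Pd ord_max.
have e2 : 0 < e / 2 by rewrite divr_gt0.
have [d1 d10 h1] := continuous_rowP c0 e2.
have [d2 d20 h2] := continuous_rowP c1 e2.
exists (Num.min d1 d2); first by rewrite lt_min d10 d20.
move=> y z yx zx.
set D0 := fun y => 'D_(delta_mx 0 ord0) Phi y in c0 h1 *.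
set D1 := fun y => 'D_(delta_mx 0 ord_max) Phi y in c1 h2 *.
rewrite -[X in X * (z 0 ord0 - _)]/(D0 y) -[X in X * (z 0 ord_max - _)]/(D1 y).
have [c cI eq0] := mvt_line y (z 0 ord0 - y 0 ord0) dd0.
set m := y + (z 0 ord0 - y 0 ord0) *: delta_mx 0 ord0 in eq0.
have [c' cI' eq1] := mvt_line m (z 0 ord_max - y 0 ord_max) dd1.
have em : m + (z 0 ord_max - y 0 ord_max) *: delta_mx 0 ord_max = z.
  apply/rowP => i; rewrite !mxE /=.
  have [->|->] : i = ord0 \/ i = ord_max.
    by case: i => -[|[|//]] hi; [left|right]; apply: val_inj.
    by rewrite /= mulr1 mulr0 addr0 addrC subrK.
  by rewrite /= mulr1 mulr0 addr0 addrC subrK.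
rewrite em -/(D1 _) in eq1; rewrite -/(D0 _) in eq0.
have near d : (forall i, `|y 0 i - x 0 i| < d) -> (forall i, `|z 0 i - x 0 i| < d) ->
    (forall i, `|(y + (c * (z 0 ord0 - y 0 ord0)) *: delta_mx 0 ord0) 0 i - x 0 i| < d) /\
    (forall i, `|(m + (c' * (z 0 ord_max - y 0 ord_max)) *: delta_mx 0 ord_max) 0 i
       - x 0 i| < d).
  move=> hy hz.
  have conv (a b p t : R) : 0 <= t <= 1 -> `|a - p| < d -> `|b - p| < d ->
     `|a + t * (b - a) - p| < d.
    move=> tI; rewrite !ltr_norml => /andP[a1 a2] /andP[b1 b2]; apply/andP.
    have [->|tn] := eqVneq t 0; first by lra.
    have t0 : 0 < t by lra.
    by split; nra.
  split=> i; rewrite !mxE /=.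
    case: eqP => [->|_]; last by rewrite mulr0 addr0.
    by rewrite mulr1; exact: conv.
  have [->|->] : i = ord0 \/ i = ord_max.
    by case: i => -[|[|//]] hi; [left|right]; apply: val_inj.
    by rewrite /= mulr1 mulr0 addr0 (addrC (y 0 ord0)) subrK.
  by rewrite /= mulr1 mulr0 addr0; exact: conv.
have lt_minl (a b b' : R) : a < Num.min b b' -> a < b /\ a < b'.
  by rewrite lt_min => /andP.
have yx1 i := (lt_minl _ _ _ (yx i)).1; have yx2 i := (lt_minl _ _ _ (yx i)).2.
have zx1 i := (lt_minl _ _ _ (zx i)).1; have zx2 i := (lt_minl _ _ _ (zx i)).2.
have k0 := h1 _ (near _ yx1 zx1).1; have k0' := h1 _ yx1.
have k1 := h2 _ (near _ yx2 zx2).2; have k1' := h2 _ yx2.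
rewrite (_ : Phi z - Phi y = (Phi z - Phi m) + (Phi m - Phi y)); last by rewrite addrA subrK.
rewrite eq0 eq1.
set A := D0 (_ + _); set B := D1 (_ + _); set p := z 0 ord0 - _; set q := z 0 ord_max - _.
rewrite (_ : q * B + p * A - (D0 y * p + D1 y * q) =
  (A - D0 y) * p + (B - D1 y) * q); last by ring.
apply: le_trans (ler_normD _ _) _; rewrite !normrM mulrDr.
have bd (a b cc : R) : `|a - cc| < e / 2 -> `|b - cc| < e / 2 -> `|a - b| <= e.
  move=> ha hb; apply: ltW; apply: le_lt_trans (ler_distD cc _ _) _.
  by rewrite (splitr e) ltrD// distrC.
exact: lerD (ler_wpM2r (normr_ge0 p) (bd _ _ _ k0 k0')) (ler_wpM2r (normr_ge0 q) (bd _ _ _ k1 k1')).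
Qed.

(* [psi] has the continuous gradient [N]; uniformity of the remainder in both
   points is what makes tangency arguments stable under compactness. *)
Definition strictly_diff (psi : 'rV[R]_3 -> R) (N : 'rV[R]_3 -> 'rV[R]_3) :=
  forall (x : 'rV[R]_3) (e : R), 0 < e -> exists2 d : R, 0 < d &
    (forall y, enorm (y - x) < d -> enorm (N y - N x) < e) /\
    (forall y z, enorm (y - x) < d -> enorm (z - x) < d ->
       `|psi z - psi y - dot (N y) (z - y)| <= e * enorm (z - y)).

(** A chart with the relabelling hidden: a local defining function with unnormalised outward normal
    [N], affine along the axis [k] with slope [- sg]. Translation along [k] is what the Sard
    argument and the construction at the concave point exploit. *)
Definition graph_fun (Omega : set 'rV[R]_3) (x0 : 'rV[R]_3) (r : R)
    (psi : 'rV[R]_3 -> R) (N : 'rV[R]_3 -> 'rV[R]_3) (k : 'I_3) (sg : R) : Prop :=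
  [/\ 0 < r, strictly_diff psi N,
      forall x c, psi (x + c *: delta_mx 0 k) = psi x - sg * c /\
                  N (x + c *: delta_mx 0 k) = N x,
      (forall x, N x 0 k = - sg) /\ sg ^+ 2 = 1 &
      forall x, enorm (x - x0) < r -> (Omega x <-> psi x < 0)].

Definition chart_fun s e (Phi : 'rV[R]_2 -> R) x : R :=
  Phi (first2 (relabel s e x)) - relabel s e x 0 ord_max.

Definition chart_covector (Phi : 'rV[R]_2 -> R) y : 'rV[R]_3 :=
  vec3 ('D_(delta_mx 0 ord0) Phi y, 'D_(delta_mx 0 ord_max) Phi y, -1).

(** Inverse of [relabel], and also its transpose, which is how covectors are pulled back. *)
Definition unrelabel (s : 'S_3) (e : 'I_3 -> bool) (w : 'rV[R]_3) : 'rV[R]_3 :=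
  \row_(j < 3) ((-1) ^+ e (s^-1 j)%g * w 0 (s^-1 j)%g).

Definition chart_grad s e (Phi : 'rV[R]_2 -> R) x : 'rV[R]_3 :=
  unrelabel s e (chart_covector Phi (first2 (relabel s e x))).

Lemma signr_sqr (b : bool) : (-1) ^+ b * (-1) ^+ b = 1 :> R.
Proof. by rewrite -expr2 sqrr_sign. Qed.

Lemma relabelK s e (w : 'rV[R]_3) : relabel s e (unrelabel s e w) = w.
Proof. by apply/rowP => i; rewrite !mxE permK mulrA signr_sqr mul1r. Qed.

Lemma unrelabelK s e (w : 'rV[R]_3) : unrelabel s e (relabel s e w) = w.
Proof. by apply/rowP => i; rewrite !mxE permKV mulrA signr_sqr mul1r. Qed.

Lemma dot_unrelabel s e (w x : 'rV[R]_3) : dot (unrelabel s e w) x = dot w (relabel s e x).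
Proof.
rewrite /dot (reindex_inj (@perm_inj _ s)); apply: eq_bigr => i _.
by rewrite !mxE permK -mulrA mulrCA.
Qed.

Lemma relabelB s e (x y : 'rV[R]_3) : relabel s e (x - y) = relabel s e x - relabel s e y.
Proof. by apply/rowP => i; rewrite !mxE mulrBr. Qed.

Lemma relabel_coord_le s e (x y : 'rV[R]_3) i :
  `|relabel s e y 0 i - relabel s e x 0 i| <= enorm (y - x).
Proof.
rewrite (_ : _ - _ = relabel s e (y - x) 0 i); last by rewrite relabelB !mxE.
by rewrite mxE normrM normr_sign mul1r normr_coord_le.
Qed.

Lemma enorm_unrelabel s e (w : 'rV[R]_3) : enorm (unrelabel s e w) = enorm w.
Proof. by rewrite /enorm dot_unrelabel relabelK. Qed.

Lemma chart_strictly_diff s e (Phi : 'rV[R]_2 -> R) : Ck 1 Phi ->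
  strictly_diff (chart_fun s e Phi) (chart_grad s e Phi).
Proof.
move=> PC x eps eps0; have eps4 : 0 < eps / 4 by rewrite divr_gt0.
have [d d0 hd] := strict_diff2 PC (first2 (relabel s e x)) eps4.
have [Pc Pd] := PC; have [_ [/(_ (first2 (relabel s e x))) c0 _]] := Pd ord0.
have [_ [/(_ (first2 (relabel s e x))) c1 _]] := Pd ord_max.
have [d1 d10 h1] := continuous_rowP c0 eps4.
have [d2 d20 h2] := continuous_rowP c1 eps4.
have rl (b : R) (y z : 'rV[R]_3) i : enorm (y - z) < b ->
    `|first2 (relabel s e y) 0 i - first2 (relabel s e z) 0 i| < b.
  by rewrite !mxE => h; apply: le_lt_trans h; have := relabel_coord_le s e z y (inord i); rewrite !mxE.
exists (Num.min d (Num.min d1 d2)); first by rewrite !lt_min d0 d10 d20.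
split=> [y|y z]; rewrite !lt_min.
  move=> /and3P[y0 y1 y2].
  have k1 := h1 (first2 (relabel s e y)) (fun i => rl _ _ _ i y1).
  have k2 := h2 (first2 (relabel s e y)) (fun i => rl _ _ _ i y2).
  rewrite /chart_grad (_ : _ - _ = unrelabel s e (chart_covector Phi (first2 (relabel s e y))
    - chart_covector Phi (first2 (relabel s e x)))); last first.
    by apply/rowP => i; rewrite !mxE mulrBr.
  rewrite enorm_unrelabel; apply: le_lt_trans (enorm_le_sum _) _.
  rewrite !mxE /= subrr normr0 addr0.
  by apply: lt_le_trans (ltrD k1 k2) _; lra.
move=> /and3P[y0 _ _] /and3P[z0 _ _].
have := hd _ _ (fun i => rl _ _ _ i y0) (fun i => rl _ _ _ i z0).
have a0 := relabel_coord_le s e y z i0; have a1 := relabel_coord_le s e y z i1.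
rewrite /chart_grad dot_unrelabel dotE relabelB /chart_fun.
have -> : ord_max = i2 :> 'I_3 by apply: val_inj.
set Y := relabel s e y in a0 a1 *; set Z := relabel s e z in a0 a1 *.
have f0 (w : 'rV[R]_3) : first2 w 0 ord0 = w 0 i0.
  by rewrite mxE; congr (w 0 _); apply: val_inj; rewrite /= inordK.
have f1 (w : 'rV[R]_3) : first2 w 0 ord_max = w 0 i1.
  by rewrite mxE; congr (w 0 _); apply: val_inj; rewrite /= inordK.
rewrite !f0 !f1 /chart_covector.
set P0 := 'D_(delta_mx 0 ord0) Phi _; set P1 := 'D_(delta_mx 0 ord_max) Phi _.
clearbody Y Z; rewrite !mxE /= => h.
rewrite (_ : _ - _ = Phi (first2 Z) - Phi (first2 Y) -
   (P0 * (Z 0 i0 - Y 0 i0) + P1 * (Z 0 i1 - Y 0 i1))); last by ring.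
apply: le_trans h _; apply: le_trans (_ : eps / 4 * (enorm (z - y) *+ 2) <= _).
  by rewrite ler_wpM2l ?(ltW eps4) // mulr2n lerD.
by have := enorm_ge0 (z - y); nra.
Qed.

Lemma chart_graph_fun (Omega : set 'rV[R]_3) x0 r s e Phi :
  is_chart Omega x0 r s e Phi ->
  graph_fun Omega x0 r (chart_fun s e Phi) (chart_grad s e Phi) (s ord_max) ((-1) ^+ e ord_max).
Proof.
move=> [r0 sm eO].
have rk x c i : i != ord_max ->
    relabel s e (x + c *: delta_mx 0 (s ord_max)) 0 i = relabel s e x 0 i.
  by move=> im; rewrite !mxE eqxx (inj_eq perm_inj) (negbTE im) mulr0 addr0.
have f2 x c : first2 (relabel s e (x + c *: delta_mx 0 (s ord_max))) = first2 (relabel s e x).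
  apply/rowP => i; rewrite mxE [RHS]mxE; apply: rk.
  by rewrite -(inj_eq val_inj) /= inordK ?(ltn_trans (ltn_ord i))// neq_ltn ltn_ord.
split=> //.
- exact: chart_strictly_diff (sm 1%N).
- move=> x c; rewrite /chart_fun /chart_grad f2; split=> //.
  by rewrite !mxE !eqxx mulr1 mulrDr opprD addrA.
- split=> [x|]; last by rewrite sqrr_sign.
  by rewrite !mxE permK /= mulrN1.
move=> x xr; rewrite /chart_fun subr_lt0.
have := congr1 (fun A : set _ => A x) eO => /= eq.
by split=> h; [have := conj h xr; rewrite eq => -[]|have := conj xr h; rewrite -eq => -[]].
Qed.

Lemma enorm_chart_covector (Phi : 'rV[R]_2 -> R) y : enorm (chart_covector Phi y) =
  Num.sqrt (1 + 'D_(delta_mx 0 ord0) Phi y ^+ 2 + 'D_(delta_mx 0 ord_max) Phi y ^+ 2).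
Proof. by rewrite /enorm dotE !mxE /=; congr (Num.sqrt _); ring. Qed.

Lemma outward_normal_graph_fun (Omega : set 'rV[R]_3) x n : is_outward_normal Omega x n ->
  exists r psi N k sg, graph_fun Omega x r psi N k sg /\ n = (enorm (N x))^-1 *: N x.
Proof.
move=> [r [s [e [Phi [ch /=]]]]].
rewrite -enorm_chart_covector -/(chart_covector _ _) => en.
have := chart_graph_fun ch.
exists r, (chart_fun s e Phi), (chart_grad s e Phi), (s ord_max), ((-1) ^+ e ord_max).
split=> //; rewrite -(unrelabelK s e n) en /chart_grad enorm_unrelabel.
by apply/rowP => i; rewrite !mxE; ring.
Qed.

Lemma outward_normal_exists (Omega : set 'rV[R]_3) x : smooth_boundary Omega -> bdry Omega x ->
  exists n, is_outward_normal Omega x n.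
Proof.
move=> sb /sb[r [s [e [Phi ch]]]].
exists (unrelabel s e ((enorm (chart_covector Phi (first2 (relabel s e x))))^-1 *:
  chart_covector Phi (first2 (relabel s e x)))).
by exists r, s, e, Phi; split=> //=; rewrite relabelK enorm_chart_covector.
Qed.

End strict_differentiability.

(** * Exit times and regular points *)

Lemma normr_dot_le (R : realType) (x y : 'rV[R]_3) : `|dot x y| <= enorm x * enorm y.
Proof.
by rewrite ler_norml dot_le andbT lerNl -dotNl -(enormN x) dot_le.
Qed.

Lemma normr_coord_le_mx (R : realType) n (x : 'rV[R]_n.+1) i : `|x 0 i| <= `|x|.
Proof. by rewrite [leRHS]/Num.Def.normr /= mx_normrE; apply/bigmax_geP; right; exists (0, i). Qed.

Lemma small2 (R : realType) (a b : R) : 0 < a -> 0 < b ->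
  exists2 s, 0 < s < a & 0 < s < b.
Proof.
move=> a0 b0; have [ab|ba] := ltP a b; [exists (a / 2)|exists (b / 2)]; lra.
Qed.

Section boundary_normal.
Context {R : realType}.
Variable Omega : set 'rV[R]_3.
Hypothesis hopen : open Omega.
Hypothesis hsmooth : smooth_boundary Omega.
Implicit Types (r t c : R).

Lemma open_enorm (x : 'rV[R]_3) : Omega x ->
  exists2 d : R, 0 < d & forall y, enorm (y - x) < d -> Omega y.
Proof. by move=> Ox; apply/nbhs_enormP; rewrite nbhsE/=; exists Omega. Qed.

Lemma closure_enorm (A : set 'rV[R]_3) (x : 'rV[R]_3) : closure A x <->
  forall d : R, 0 < d -> exists2 y, A y & enorm (y - x) < d.
Proof.
split=> [cx d d0|h U /nbhs_enormP[d d0 dU]].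
  have nb : nbhs x [set y | enorm (y - x) < d] by apply/nbhs_enormP; exists d.
  by have [y [Ay yd]] := cx _ nb; exists y.
by have [y Ay yd] := h _ d0; exists y; split=> //; exact: dU.
Qed.

Lemma bdryP (x : 'rV[R]_3) : bdry Omega x <-> closure Omega x /\ ~ Omega x.
Proof. by rewrite /bdry /setD /= ((interior_id Omega).1 hopen). Qed.

Lemma closure_cases (x : 'rV[R]_3) : closure Omega x -> Omega x \/ bdry Omega x.
Proof. by move=> cx; have [|nx] := pselect (Omega x); [left|right; apply/bdryP]. Qed.

Section graph.
Variables (x0 : 'rV[R]_3) (r : R) (psi : 'rV[R]_3 -> R) (N : 'rV[R]_3 -> 'rV[R]_3)
  (k : 'I_3) (sg : R).
Hypothesis gf : graph_fun Omega x0 r psi N k sg.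

Lemma graph_grad_ge1 x : 1 <= enorm (N x).
Proof.
have [_ _ _ [Nk sg2] _] := gf; apply: le_trans (normr_coord_le _ k); rewrite Nk normrN.
by rewrite -(@ler_sqr _ 1 `|sg|) ?nnegrE// real_normK ?num_real// sg2 expr1n.
Qed.

Lemma graph_cvg x e : 0 < e -> exists2 d : R, 0 < d &
  forall y, enorm (y - x) < d -> `|psi y - psi x| < e.
Proof.
move=> e0; have [_ /(_ x 1 ltr01)[d d0 [_ h]] _ _ _] := gf.
have N1 : 0 < enorm (N x) + 2 by rewrite ltr_wpDl ?enorm_ge0.
exists (Num.min d (e / (enorm (N x) + 2))); first by rewrite lt_min d0 divr_gt0.
move=> y; rewrite lt_min ltr_pdivlMr// => /andP[yd ye].
have := h x y; rewrite subrr enorm0 => /(_ d0 yd); rewrite mul1r => h1.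
have h2 := normr_dot_le (N x) (y - x).
rewrite -(subrK (dot (N x) (y - x)) (_ - _)).
apply: le_lt_trans (ler_normD _ _) _.
apply: le_lt_trans (lerD h1 h2) _; apply: le_lt_trans ye.
by have := enorm_ge0 (y - x); nra.
Qed.

(** A negative value would put [x] in the open set; a positive one persists nearby and keeps [x]
    away from the closure. *)
Lemma graph_bdry x : enorm (x - x0) < r -> bdry Omega x -> psi x = 0.
Proof.
have [_ _ _ _ iff] := gf.
move=> xr /bdryP[cx nx]; apply/eqP/negPn/negP => px.
have [lt0|ge0] := ltP (psi x) 0; first exact: nx ((iff _ xr).2 lt0).
have p0 : 0 < psi x by rewrite lt_def px.
have [d d0 h] := graph_cvg x p0.
have [y Oy yd] : exists2 y, Omega y & enorm (y - x) < Num.min d (r - enorm (x - x0)).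
  by apply: (closure_enorm _ _).1 => //; rewrite lt_min d0 subr_gt0.
move: yd; rewrite lt_min => /andP[yd yr].
have yr' : enorm (y - x0) < r.
  by apply: le_lt_trans (enorm_triangle y x x0) _; rewrite addrC -ltrBrDl.
by have := (iff _ yr').1 Oy; have := h _ yd; rewrite ltr_norml; lra.
Qed.

Lemma graph_ray x v : enorm (x - x0) < r -> dot (N x) v != 0 ->
  exists2 d : R, 0 < d & forall s, 0 < s < d ->
    enorm (x + s *: v - x0) < r /\ 0 < (psi (x + s *: v) - psi x) * dot (N x) v.
Proof.
move=> xr nv; have [_ sd _ _ _] := gf.
have v1 : 0 < 1 + enorm v by rewrite ltr_wpDr ?enorm_ge0.
have e0 : 0 < `|dot (N x) v| / 2 / (1 + enorm v) by rewrite !divr_gt0 ?normr_gt0.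
have [d d0 [_ h]] := sd x _ e0.
exists (Num.min d (r - enorm (x - x0)) / (1 + enorm v)).
  by rewrite divr_gt0// lt_min d0 subr_gt0.
move=> s /andP[s0]; rewrite ltr_pdivlMr// lt_min => /andP[sd' sr].
have ev : enorm (x + s *: v - x) = s * enorm v.
  by rewrite [x + _]addrC addrK enormZ gtr0_norm.
have en := enorm_ge0 v.
split.
  apply: le_lt_trans (enorm_triangle _ x _) _; rewrite ev.
  by rewrite -ltrBrDr; apply: le_lt_trans sr; nra.
have := h x (x + s *: v); rewrite subrr enorm0 ev [_ - x](_ : _ = s *: v); last first.
  by rewrite [x + _]addrC addrK.
rewrite dotZr => /(_ d0); set A := psi _ - psi _; set B := dot (N x) v in nv e0 *.
have sv : s * enorm v < d by apply: le_lt_trans sd'; nra.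
move=> /(_ sv) hA.
have {}hA : `|A - s * B| <= `|B| / 2 * s.
  apply: le_trans hA _; rewrite -(mulrA (`|B| / 2)); apply: ler_wpM2l; first by rewrite divr_ge0.
  by rewrite mulrC ler_pdivrMr// ler_wpM2l ?(ltW s0)// lerDr.
have B0 : 0 < `|B| by rewrite normr_gt0.
have [Bp|Bn] := ltrP 0 B.
  have sB := mulr_gt0 s0 Bp; have A0 : 0 < A.
    by move: hA; rewrite (gtr0_norm Bp) ler_norml; lra.
  exact: mulr_gt0.
have {Bn nv}Bn : B < 0 by rewrite lt_def eq_sym nv.
have sB : s * B < 0 by rewrite pmulr_rlt0.
have A0 : A < 0 by move: hA; rewrite (ltr0_norm Bn) ler_norml; lra.
by rewrite nmulr_rgt0.
Qed.

Lemma graph_ray_in x v : enorm (x - x0) < r -> bdry Omega x -> dot (N x) v < 0 ->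
  exists2 d : R, 0 < d & forall s, 0 < s < d -> Omega (x + s *: v).
Proof.
move=> xr bx nv; have [_ _ _ _ iff] := gf.
have [d d0 h] := graph_ray xr (ltr0_neq0 nv); exists d => // s /h[sr].
by rewrite (graph_bdry xr bx) subr0 (nmulr_lgt0 _ nv) => /(iff _ sr).
Qed.

Lemma graph_ray_out x v : enorm (x - x0) < r -> bdry Omega x -> 0 < dot (N x) v ->
  exists2 d : R, 0 < d & forall s, 0 < s < d -> ~ Omega (x + s *: v).
Proof.
move=> xr bx nv; have [_ _ _ _ iff] := gf.
have [d d0 h] := graph_ray xr (lt0r_neq0 nv); exists d => // s /h[sr].
rewrite (graph_bdry xr bx) subr0 (pmulr_lgt0 _ nv) => p0 /(iff _ sr).
by apply/negP; rewrite -leNgt ltW.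
Qed.

End graph.

(** If the unit normals n and n' differed, the direction n' - n would enter the domain according to
    the first chart and leave it according to the second. *)
Lemma graph_normal_unique x0 r psi N k sg x0' r' psi' N' k' sg' x :
  graph_fun Omega x0 r psi N k sg -> graph_fun Omega x0' r' psi' N' k' sg' ->
  enorm (x - x0) < r -> enorm (x - x0') < r' -> bdry Omega x ->
  (enorm (N x))^-1 *: N x = (enorm (N' x))^-1 *: N' x.
Proof.
move=> g g' xr xr' bx.
have N1 : 0 < enorm (N x) by rewrite (lt_le_trans ltr01)// (graph_grad_ge1 g).
have N1' : 0 < enorm (N' x) by rewrite (lt_le_trans ltr01)// (graph_grad_ge1 g').
set n := _ *: N x; set n' := _ *: N' x.
have u w : 0 < enorm w -> enorm ((enorm w)^-1 *: w) = 1.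
  by move=> w0; rewrite enormZ gtr0_norm ?invr_gt0// mulVf// gt_eqF.
have un : enorm n = 1 by exact: u.
have un' : enorm n' = 1 by exact: u.
apply: unit_eq => //; rewrite leNgt; apply/negP => lt1.
have d1 : dot n n = 1 by rewrite -enorm_sqr un expr1n.
have d1' : dot n' n' = 1 by rewrite -enorm_sqr un' expr1n.
have lo : dot (N x) (n' - n) < 0.
  by rewrite -(@pmulr_rlt0 _ (enorm (N x))^-1) ?invr_gt0// -dotZl dotBr d1 subr_lt0.
have hi : 0 < dot (N' x) (n' - n).
  by rewrite -(@pmulr_rgt0 _ (enorm (N' x))^-1) ?invr_gt0// -dotZl dotBr d1' subr_gt0 dotC.
have [d d0 h] := graph_ray_in g xr bx lo.
have [d' d0' h'] := graph_ray_out g' xr' bx hi.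
have [t /h + /h'] := small2 d0 d0'.
by [].
Qed.

(** Uniqueness makes the choice inside [normal] harmless: every chart covering [x] computes it. *)
Lemma normal_graphE x0 r psi N k sg x : graph_fun Omega x0 r psi N k sg ->
  enorm (x - x0) < r -> bdry Omega x -> normal Omega x = (enorm (N x))^-1 *: N x.
Proof.
move=> g xr bx; rewrite /normal; case: (pselect (bdry Omega x)) => [b|nb]; last by case: (nb bx).
have [n hn] := outward_normal_exists hsmooth bx.
have /outward_normal_graph_fun[r' [psi' [N' [k' [sg' [g' ->]]]]]] := @xgetPex _ 0 _ (ex_intro _ n hn).
apply: (graph_normal_unique g' g _ xr bx).
by case: g' => r0 _ _ _ _; rewrite subrr enorm0.
Qed.

Lemma normal_graph x : bdry Omega x -> exists r psi N k sg, graph_fun Omega x r psi N k sg.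
Proof.
by move=> /hsmooth[r [s [e [Phi /chart_graph_fun g]]]]; do 5 eexists; exact: g.
Qed.

Lemma dot_normal_graph x0 r psi N k sg x v : graph_fun Omega x0 r psi N k sg ->
  enorm (x - x0) < r -> bdry Omega x -> dot (N x) v = enorm (N x) * dot (normal Omega x) v.
Proof.
move=> g xr bx; rewrite (normal_graphE g xr bx) dotZl mulrA divff ?mul1r//.
by rewrite gt_eqF// (lt_le_trans ltr01)// (graph_grad_ge1 g).
Qed.

Lemma enorm_normal x : bdry Omega x -> enorm (normal Omega x) = 1.
Proof.
move=> bx; have [r [psi [N [k [sg g]]]]] := normal_graph bx.
have [r0 _ _ _ _] := g; have xr : enorm (x - x) < r by rewrite subrr enorm0.
have N0 : 0 < enorm (N x) by rewrite (lt_le_trans ltr01)// (graph_grad_ge1 g).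
by rewrite (normal_graphE g xr bx) enormZ gtr0_norm ?invr_gt0// mulVf// gt_eqF.
Qed.

Lemma ray_in x v : bdry Omega x -> dot (normal Omega x) v < 0 ->
  exists2 d : R, 0 < d & forall s, 0 < s < d -> Omega (x + s *: v).
Proof.
move=> bx nv; have [r [psi [N [k [sg g]]]]] := normal_graph bx.
have [r0 _ _ _ _] := g; have xr : enorm (x - x) < r by rewrite subrr enorm0.
apply: (graph_ray_in g xr bx); rewrite (dot_normal_graph _ g xr bx) pmulr_rlt0//.
by rewrite (lt_le_trans ltr01)// (graph_grad_ge1 g).
Qed.

Lemma ray_out x v : bdry Omega x -> 0 < dot (normal Omega x) v ->
  exists2 d : R, 0 < d & forall s, 0 < s < d -> ~ Omega (x + s *: v).
Proof.
move=> bx nv; have [r [psi [N [k [sg g]]]]] := normal_graph bx.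
have [r0 _ _ _ _] := g; have xr : enorm (x - x) < r by rewrite subrr enorm0.
apply: (graph_ray_out g xr bx); rewrite (dot_normal_graph _ g xr bx) pmulr_rgt0//.
by rewrite (lt_le_trans ltr01)// (graph_grad_ge1 g).
Qed.

End boundary_normal.

Section exit_time.
Context {R : realType}.
Variable Omega : set 'rV[R]_3.
Hypotheses (hopen : open Omega) (hbounded : bounded_set Omega).
Hypothesis hsmooth : smooth_boundary Omega.
Implicit Types (x v y z : 'rV[R]_3) (s t d T : R).

Lemma bounded_enorm : exists2 M : R, 0 < M & forall x, closure Omega x -> enorm x <= M.
Proof.
have [M [_ hM]] := hbounded.
have M1 : M < `|M| + 1 by rewrite (le_lt_trans (ler_norm _))// ltrDl.
have M0 : 0 < `|M| + 1 by rewrite ltr_wpDl.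
have OM x : Omega x -> enorm x <= 3 * (`|M| + 1).
  move=> Ox; apply: le_trans (enorm_le_sum _) _.
  have h i : `|x 0 i| <= `|M| + 1.
    by apply: le_trans (normr_coord_le_mx x i) _; exact: hM Ox.
  by have := h i0; have := h i1; have := h i2; lra.
exists (3 * (`|M| + 1) + 1) => [|x /closure_enorm/(_ 1 ltr01)[y Oy yx]].
  by rewrite addr_gt0// mulr_gt0.
have := enormD (x - y) y; rewrite subrK => /le_trans; apply.
have xy : enorm (x - y) < 1 by rewrite -enormN opprB.
by rewrite addrC lerD ?(ltW xy)// OM.
Qed.

Lemma t_b_eq x v T d : 0 <= T -> (forall s, 0 < s < T -> Omega (x - s *: v)) ->
  0 < d -> (forall s, 0 < s < d -> ~ Omega (x - (T + s) *: v)) -> t_b Omega x v = T%:E.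
Proof.
move=> T0 hin d0 hout; apply/eqP; rewrite eq_le; apply/andP; split.
  apply: ge_ereal_sup => _ [->|[tau /= [tau0 htau] <-]]; first by rewrite lee_fin.
  rewrite lee_fin leNgt; apply/negP => Ttau.
  have dT : 0 < tau - T by rewrite subr_gt0.
  have [s /andP[s0 sd] /andP[_ st]] := small2 d0 dT.
  by apply: (hout s); [rewrite s0|apply: htau; lra].
apply: ereal_sup_ubound; have [->|Tn] := eqVneq T 0; [left|right] => //.
exists T => //; split=> [|s s0 sT]; first by rewrite lt_def Tn.
by apply: hin; rewrite s0.
Qed.

Lemma t_bP x v : closure Omega x -> v != 0 -> exists T,
  [/\ 0 <= T, t_b Omega x v = T%:E, forall s, 0 < s < T -> Omega (x - s *: v) &
      bdry Omega (x - T *: v)].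
Proof.
move=> cx v0; have ev : 0 < enorm v by rewrite enorm_gt0.
have [M M0 hM] := bounded_enorm.
(* A chord has length at most 2M; the factor 4 appears because membership is known strictly before
   [tau] and is tested at half of it. *)
have ub : (t_b Omega x v <= (4 * M / enorm v)%:E)%E.
  apply: ge_ereal_sup => _ [->|[tau /= [tau0 htau] <-]]; rewrite lee_fin.
    by rewrite divr_ge0 ?mulr_ge0 ?ltW.
  rewrite ler_pdivlMr//.
  have /subset_closure/hM h := htau (tau / 2) ltac:(lra) ltac:(lra).
  have := enormD x (- (x - (tau / 2) *: v)); rewrite enormN opprB addrC subrK enormZ gtr0_norm ?divr_gt0//.
  by have := hM _ cx; lra.
have lb : (0 <= t_b Omega x v)%E by apply: ereal_sup_ubound; left.
have fT : t_b Omega x v \is a fin_num by rewrite ge0_fin_numE// (le_lt_trans ub)// ltry.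
exists (fine (t_b Omega x v)); rewrite fineK//; set T := fine _.
have tT : t_b Omega x v = T%:E by rewrite fineK.
have T0 : 0 <= T by rewrite -lee_fin -tT.
have hin s : 0 < s < T -> Omega (x - s *: v).
  move=> /andP[s0 sT]; have : (s%:E < t_b Omega x v)%E by rewrite tT lte_fin.
  move=> /ereal_sup_gt[_ [->|[tau /= [tau0 htau] <-]]]; rewrite lte_fin.
    by move=> /(lt_trans s0); rewrite ltxx.
  exact: htau.
split=> //; apply/bdryP => //; split.
  have [e0|Tn] := eqVneq T 0; first by rewrite e0 scale0r subr0.
  apply/closure_enorm => d d0; have T0' : 0 < T by rewrite lt_def Tn.
  have [s /andP[s0 sT] /andP[_ sd]] := small2 T0' (divr_gt0 d0 ev).
  exists (x - (T - s) *: v); first by apply: hin; lra.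
  rewrite (_ : _ - _ = s *: v); last by rewrite scalerBl; apply/rowP => i; rewrite !mxE; ring.
  by rewrite enormZ gtr0_norm// -ltr_pdivlMr.
move=> /(open_enorm hopen)[d d0 hd].
have : (T + d / enorm v <= T)%R; last by rewrite gerDl leNgt divr_gt0.
rewrite -lee_fin -tT; apply: ereal_sup_ubound; right; exists (T + d / enorm v) => //; split.
  by rewrite ltr_wpDl// divr_gt0.
move=> s s0 sT; have [sT'|Ts] := ltP s T; first by apply: hin; rewrite s0.
apply: hd; rewrite (_ : _ - _ = - ((s - T) *: v)); last first.
  by apply/rowP => i; rewrite !mxE; ring.
by rewrite enormN enormZ ger0_norm ?subr_ge0// -ltr_pdivlMr// ltrBlDl.
Qed.

Lemma x_bE x v T : t_b Omega x v = T%:E -> x_b Omega x v = x - T *: v.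
Proof. by rewrite /x_b => ->. Qed.

Lemma dot_t_b0 x v : bdry Omega x -> dot (normal Omega x) v < 0 -> t_b Omega x v = 0%E.
Proof.
move=> bx nv; have [|d d0 h] := @ray_out _ _ hopen hsmooth x (- v) bx.
  by rewrite dotNr oppr_gt0.
apply: (t_b_eq (lexx _) _ d0) => [s|s /h]; last by rewrite add0r scalerN.
by move=> /andP[a b]; have := lt_trans a b; rewrite ltxx.
Qed.

(** Were the normal velocity positive at the exit point, the backward ray would enter the domain
    there and the forward ray leave it. The first contradicts [T = 0], the second contradicts that
    the points before a positive [T] are interior. *)
Lemma nongrazing_exit x v : closure Omega x -> ~ grazing Omega (x, v) ->
  v != 0 /\ exists T, [/\ 0 <= T, t_b Omega x v = T%:E,
    forall s, 0 < s < T -> Omega (x - s *: v) & gamma_minus Omega (x - T *: v, v)].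
Proof.
move=> cx ng; have v0 : v != 0.
  by apply/eqP => v0; apply: ng; split=> //=; rewrite v0 dot0r.
split=> //; have [T [T0 tT hin bT]] := t_bP cx v0; exists T; split=> //.
split=> //=; have n0 : dot (normal Omega (x - T *: v)) v != 0.
  by apply/eqP => n0; apply: ng; split; [exact: cx|rewrite /= (x_bE tT); exact: n0].
rewrite lt_neqAle n0 leNgt; apply/negP => np.
have [|d d0 h] := @ray_in _ _ hopen hsmooth _ (- v) bT; first by rewrite dotNr oppr_lt0.
have [d' d0' h'] := ray_out hopen hsmooth bT np.
have [Teq|Tn] := eqVneq T 0.
  have : (d%:E <= t_b Omega x v)%E.
    apply: ereal_sup_ubound; right; exists d => //; split=> // s s0 sd.
    by have := h s; rewrite s0 sd Teq scale0r subr0 scalerN; apply.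
  by rewrite tT lee_fin Teq leNgt d0.
have T0' : 0 < T by rewrite lt_def Tn.
have [s /h' ns /andP[s0 sT]] := small2 d0' T0'.
apply: ns; rewrite -addrA -scaleNr -scalerDl (_ : - T + s = - (T - s)) ?scaleNr; last by rewrite opprB addrC.
by apply: hin; rewrite subr_gt0 sT ltrBlDr ltrDl s0.
Qed.

(** The phase points at which estimates are made. The notion is symmetric in [v], passes to all
    points of the backward trajectory up to its exit, and holds for almost every [v]; transversality
    at a boundary point keeps a trajectory from merely touching there. *)
Definition regular x v := [/\ closure Omega x, ~ grazing Omega (x, v),
  ~ grazing Omega (x, - v) & bdry Omega x -> dot (normal Omega x) v != 0].

Lemma regularN x v : regular x v -> regular x (- v).
Proof. by move=> [a b c d]; split; rewrite ?opprK// => bx; rewrite dotNr oppr_eq0 d. Qed.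

Lemma regular_shift_opp x v T s : regular x v -> t_b Omega x v = T%:E -> 0 < s <= T ->
  exists T2, [/\ 0 <= T2, t_b Omega x (- v) = T2%:E,
    gamma_minus Omega (x + T2 *: v, - v) & t_b Omega (x - s *: v) (- v) = (s + T2)%:E].
Proof.
move=> [cx g1 g2 bn] tT /andP[s0 sT].
have [_ [T1 [T10 + hin1 [bT1 /= nT1]]]] := nongrazing_exit cx g1.
rewrite tT => -[eT]; subst T1.
have [_ [T2 [T20 tT2 hin2 [bT2 /= nT2]]]] := nongrazing_exit cx g2.
exists T2; rewrite tT2.
rewrite scalerN opprK in bT2 nT2; split=> //.
have [|d d0 hd] := @ray_out _ _ hopen hsmooth _ v bT2; first by rewrite -oppr_lt0 -dotNr.
apply: (t_b_eq _ _ d0); first by rewrite addr_ge0// ltW.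
  move=> s' /andP[s'0 s'1].
  rewrite (_ : x - s *: v - s' *: - v = x - (s - s') *: v); last first.
    by apply/rowP => i; rewrite !mxE; ring.
  have [lt|gt|e'] := ltgtP s' s; first by apply: hin1; rewrite subr_gt0 lt /= (lt_le_trans _ sT)// ltrBlDr ltrDl.
    rewrite (_ : _ - _ = x - (s' - s) *: - v); first by apply: hin2; rewrite subr_gt0 gt /= ltrBlDl.
    by apply/rowP => i; rewrite !mxE; ring.
  (* At [x] the two half chords meet. A boundary point there would be crossed transversally, so one
     of the two half chords would leave the domain at once. *)
  rewrite e' in s'1 *; rewrite subrr scale0r subr0; have [//|bx] := closure_cases hopen cx; exfalso.
  have T20' : 0 < T2 by move: s'1; rewrite ltrDl.
  have T0' := lt_le_trans s0 sT.
  have [np|nn|n0] := ltgtP (dot (normal Omega x) v) 0.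
  - have [|d1 d10 h1] := @ray_out _ _ hopen hsmooth x (- v) bx; first by rewrite dotNr oppr_gt0.
    have [s1 /h1 k1 /hin1] := small2 d10 T0'; first by rewrite -scalerN.
  - have [d1 d10 h1] := ray_out hopen hsmooth bx nn.
    have [s1 /h1 k1 /hin2] := small2 d10 T20'; first by rewrite scalerN opprK.
  - by have := bn bx; rewrite n0 eqxx.
move=> s' /hd; rewrite (_ : x - s *: v - (s + T2 + s') *: - v = x + T2 *: v + s' *: v) //.
by apply/rowP => i; rewrite !mxE; ring.
Qed.

Lemma regular_shift x v T s : regular x v -> t_b Omega x v = T%:E -> 0 <= s <= T ->
  t_b Omega (x - s *: v) v = (T - s)%:E /\ regular (x - s *: v) v.
Proof.
move=> rx tT /andP[s0 sT]; have [cx g1 g2 bn] := rx.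
have [->|sn] := eqVneq s 0; first by rewrite scale0r !subr0.
have s0' : 0 < s by rewrite lt_def sn.
have [v0 [T1 [T10 + hin1 [bT1 /= nT1]]]] := nongrazing_exit cx g1.
rewrite tT => -[eT]; subst T1.
have [|d d0 hd] := @ray_out _ _ hopen hsmooth _ (- v) bT1; first by rewrite dotNr oppr_gt0.
have e1 s' : x - s *: v - s' *: v = x - (s + s') *: v.
  by apply/rowP => i; rewrite !mxE; ring.
have tb : t_b Omega (x - s *: v) v = (T - s)%:E.
  apply: (t_b_eq _ _ d0) => [|s' hs'|s' /hd].
  - by rewrite subr_ge0.
  - by move: hs' => /andP[a b]; rewrite e1; apply: hin1; rewrite addr_gt0//= -ltrBrDl.
  - rewrite e1 (_ : x - T *: v + _ = x - (s + (T - s + s')) *: v)//.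
    by apply/rowP => i; rewrite !mxE; ring.
split; first exact: tb.
have sI : 0 < s <= T by rewrite s0'.
have [T2 [T20 tT2 [bT2 /= nT2] tT2']] := regular_shift_opp rx tT sI.
have in_or : Omega (x - s *: v) \/ s = T.
  by have [->|ne] := eqVneq s T; [right|left; apply: hin1; rewrite s0' /= lt_neqAle ne].
split.
- by case: in_or => [/subset_closure //|->]; case: (bT1).
- move=> [_ /=]; rewrite (x_bE tb) e1 [s + _]addrC subrK => n0.
  by move: nT1; rewrite n0 ltxx.
- move=> [_ /=]; rewrite (x_bE tT2') (_ : _ - _ - _ = x + T2 *: v); last first.
    by apply/rowP => i; rewrite !mxE; ring.
  by move=> n0; move: nT2; rewrite n0 ltxx.
- move=> /(bdryP hopen)[_ nO]; case: in_or => // ->.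
  by rewrite lt_eqF.
Qed.

(* A bounce-back trajectory runs back and forth along one chord. *)
Lemma regular_chord z w : bdry Omega z -> 0 < dot (normal Omega z) w -> regular z w ->
  exists T, [/\ 0 < T, t_b Omega z w = T%:E, gamma_minus Omega (z - T *: w, w),
    t_b Omega (z - T *: w) (- w) = T%:E & regular (z - T *: w) (- w)].
Proof.
move=> bz nz rz; have [cz g1 g2 bn] := rz.
have [v0 [T [T0 tT hin bT]]] := nongrazing_exit cz g1.
have T0' : 0 < T.
  rewrite lt_def T0 andbT; apply/eqP => Te.
  by case: bT => _ /=; rewrite Te scale0r subr0 => /(lt_trans nz); rewrite ltxx.
have TT : 0 < T <= T by rewrite T0' lexx.
have [T2 [_ + _ tT2]] := regular_shift_opp rz tT TT.
rewrite dot_t_b0 ?dotNr ?oppr_lt0// => -[e]; rewrite -e addr0 in tT2.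
exists T; split; [exact: T0'|exact: tT|exact: bT|exact: tT2|apply: regularN].
by apply: (regular_shift rz tT _).2; rewrite T0 lexx.
Qed.

Lemma compact_bdry : compact (bdry Omega).
Proof.
have [M M0 hM] := bounded_enorm; apply: bounded_closed_compact.
  exists M; split; rewrite ?num_real// => m Mm x [/hM xM _] /=.
  apply: le_trans (ltW Mm); rewrite [leLHS]/Num.Def.normr /= mx_normrE.
  apply/bigmax_leP; split=> [|[i j] _ /=]; first exact: ltW.
  by rewrite (ord1 i); exact: le_trans (normr_coord_le _ _) xM.
apply: closedI; first exact: closed_closure.
by apply: open_closedC; exact: open_interior.
Qed.

(** Compactness: a property holding near each boundary point for all small parameters holds on the
    whole boundary for one parameter. *)
Lemma near_bdry (P : R -> 'rV[R]_3 -> Prop) :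
  (forall xc, bdry Omega xc -> exists2 d : R, 0 < d &
     forall x c, enorm (x - xc) < d -> 0 < c < d -> bdry Omega x -> P c x) ->
  exists2 c : R, 0 < c & forall x, bdry Omega x -> P c x.
Proof.
move=> h; pose Q (c : R) x := bdry Omega x -> P c x.
have /(_ R 0^'+ Q) := (compact_near_coveringP _).1 compact_bdry.
case=> [x bx|d /= d0 hd].
  have [d d0 hd] := h x bx.
  exists ([set y | enorm (y - x) < d], [set c | 0 < c < d]) => /=.
    split; first by apply/nbhs_enormP; exists d.
    by exists d => //= c /=; rewrite sub0r normrN => cd c0; rewrite c0 -(gtr0_norm c0).
  by move=> [y c] /= [yx cd] by_; exact: (hd y c).
exists (d / 2) => [|x bx]; first by rewrite divr_gt0.
apply: (hd (d / 2) _ _ x bx) => //; rewrite ?divr_gt0//= sub0r normrN gtr0_norm ?divr_gt0//.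
by rewrite ltr_pdivrMr// mulr_natr mulr2n ltrDl.
Qed.

(** For unit [v] the defining function at [x - s *: v] is at most - s e + s e / 2, the gradient
    having length at least 1; strict differentiability makes the remainder uniform near each
    boundary point. *)
Lemma uniform_chord e : 0 < e -> exists2 d : R, 0 < d & forall x v s, bdry Omega x ->
  e * enorm v <= dot (normal Omega x) v -> 0 < s -> s * enorm v < d -> v != 0 ->
  Omega (x - s *: v).
Proof.
move=> e0.
have [xc bc|d d0 h] := @near_bdry (fun d x => forall v, enorm v = 1 ->
    e <= dot (normal Omega x) v -> forall s, 0 < s < d -> Omega (x - s *: v)).
  have [r [psi [N [k [sg g]]]]] := normal_graph hsmooth bc.
  have [r0 sd _ _ iff] := g; have e2 : 0 < e / 2 by rewrite divr_gt0.
  have [d d0 [_ hd]] := sd xc _ e2.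
  exists (Num.min d r / 2); first by rewrite divr_gt0// lt_min d0.
  move=> x c xxc /andP[c0 cd] bx v v1 nv s /andP[s0 sc].
  have sd2 := lt_trans sc cd.
  have [x1 x2] : enorm (x - xc) < d /\ enorm (x - xc) < r.
    by apply/andP; rewrite -lt_min (lt_trans xxc)// ltr_pdivrMr// mulr_natr mulr2n ltrDl lt_min d0.
  have es : enorm (x - s *: v - x) = s.
    by rewrite [x - _]addrC addrK enormN enormZ v1 mulr1 gtr0_norm.
  have [y1 y2] : enorm (x - s *: v - xc) < d /\ enorm (x - s *: v - xc) < r.
    apply/andP; rewrite -lt_min; apply: le_lt_trans (enorm_triangle _ x _) _.
    by rewrite es (splitr (Num.min d r)) ltrD.
  apply/(iff _ y2); have := hd _ _ x1 y1; rewrite es (graph_bdry hopen g x2 bx) subr0.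
  rewrite [x - _]addrC addrK dotNr opprK dotZr (dot_normal_graph hopen hsmooth _ g x2 bx).
  have := graph_grad_ge1 g x; set a := enorm (N x); set b := dot _ v in nv *; set p := psi _.
  move=> a1; rewrite ler_norml => /andP[_ hp].
  have ab : e <= a * b := le_trans nv (ler_peMl (le_trans (ltW e0) nv) a1).
  have : s * e <= s * (a * b) by rewrite ler_pM2l.
  by have := mulr_gt0 e0 s0; lra.
exists d => // x v s bx nv s0 sv v0; have ev : 0 < enorm v by rewrite enorm_gt0.
have -> : s *: v = (s * enorm v) *: ((enorm v)^-1 *: v).
  by rewrite scalerA mulfK// gt_eqF.
apply: (h x bx); last by rewrite sv mulr_gt0.
  by rewrite enormZ gtr0_norm ?invr_gt0// mulVf// gt_eqF.
by rewrite dotZr mulrC ler_pdivlMr.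
Qed.

End exit_time.

(** * Almost every velocity is regular *)

Section null_sets.
Context {R : realType}.

Lemma ord3_cases (k : 'I_3) : k = i0 \/ k = i1 \/ k = i2.
Proof. by elim/ord3P: k; auto. Qed.

Lemma rat_near (x e : R) : 0 < e -> exists q : rat, `|x - ratr q| < e.
Proof.
move=> e0; have [|q] := @rat_in_itvoo R (x - e) (x + e); first by lra.
by rewrite in_itv /= => /andP[h1 h2]; exists q; rewrite ltr_norml; lra.
Qed.

(** The open set is the countable union of the boxes with rational centre and size that it
    contains. *)
Lemma open_measurable_vec3 (U : set 'rV[R]_3) : open U -> measurable (@vec3 R @^-1` U).
Proof.
move=> oU.
pose box (a b c e : R) : set (R * R * R) :=
  [set p | [/\ `|p.1.1 - a| < e, `|p.1.2 - b| < e & `|p.2 - c| < e]].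
pose F a b c e := if `[< box (ratr a) (ratr b) (ratr c) (ratr e) `<=` @vec3 R @^-1` U >]
  then box (ratr a) (ratr b) (ratr c) (ratr e) else set0.
have mI (a e : R) : measurable [set x : R | `|x - a| < e].
  rewrite (_ : [set _ | _] = `]a - e, a + e[%classic); first exact: measurable_itv.
  by apply/seteqP; split => x /=; rewrite in_itv/= ltr_norml => /andP[h1 h2]; apply/andP; split; lra.
have mbox a b c e : measurable (box a b c e).
  rewrite (_ : box a b c e = ([set x : R | `|x - a| < e] `*` [set x : R | `|x - b| < e]) `*`
    [set x : R | `|x - c| < e]).
    by apply: measurableX; [apply: measurableX|]; exact: mI.
  by apply/seteqP; split => [[[x y] z] [? ? ?]|[[x y] z] [[? ?] ?]].
have mF a b c e : measurable (F a b c e) by rewrite /F; case: ifP => _; [exact: mbox|].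
rewrite (_ : _ @^-1` _ = \bigcup_a \bigcup_b \bigcup_c \bigcup_e F a b c e); last first.
  apply/seteqP; split => [p /= Up|p [a _ [b _ [c _ [e _]]]]]; last first.
    by rewrite /F; case: ifPn => // /asboolP h /h.
  have /nbhs_rowP[d d0 hd] : nbhs (vec3 p) U by rewrite nbhsE/=; exists U.
  have d4 : 0 < d / 4 by rewrite divr_gt0.
  have [a ha] := rat_near p.1.1 d4; have [b hb] := rat_near p.1.2 d4.
  have [c hc] := rat_near p.2 d4; have [e he] := rat_near (d / 2) d4.
  have e1 : d / 4 < ratr e /\ ratr e < d - d / 4 by move: he; rewrite ltr_norml; lra.
  exists a => //; exists b => //; exists c => //; exists e => //; rewrite /F asboolT.
    by split; apply: lt_trans e1.1.
  move=> q [qa qb qc] /=; apply: hd => i; have [->|[->|->]] := ord3_cases i; rewrite !mxE /=.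
  - by apply: le_lt_trans (ler_distD (ratr a) _ _) _; rewrite (distrC (ratr a)); lra.
  - by apply: le_lt_trans (ler_distD (ratr b) _ _) _; rewrite (distrC (ratr b)); lra.
  - by apply: le_lt_trans (ler_distD (ratr c) _ _) _; rewrite (distrC (ratr c)); lra.
by do 4 (apply: bigcupT_measurable_rat => ?); exact: mF.
Qed.

Lemma itv_grid (a h : R) n t : 0 <= h -> (0 < n)%N -> a <= t <= a + h *+ n ->
  exists2 i : nat, (i < n)%N & a + h *+ i <= t <= a + h *+ i.+1.
Proof.
move=> h0; case: n => // n _; elim: n => [|n IH] /andP[at1 at2].
  by exists 0%N => //; rewrite mulr0n addr0 at1.
have [le|lt] := leP t (a + h *+ n.+1).
  by have [|i ni hi] := IH; [rewrite at1|exists i => //; exact: ltn_trans ni _].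
by exists n.+1 => //; rewrite (ltW lt).
Qed.

(* One-dimensional Sard lemma: a covering by the images of a fine grid. *)
Lemma ae_critical_values (f : R -> R) (Z : set R) (a b : R) : a < b ->
  (forall e, 0 < e -> exists2 d : R, 0 < d & forall t t', a <= t <= b -> a <= t' <= b -> Z t ->
     `|t' - t| < d -> `|f t' - f t| <= e * `|t' - t|) ->
  {ae leb R, forall c, forall t, a <= t <= b -> Z t -> f t != c}.
Proof.
move=> ab hf.
have cov (e : R) : 0 < e -> exists2 E : set R, measurable E /\ (leb R E <= e%:E)%E &
    forall t, a <= t <= b -> Z t -> E (f t).
  move=> e0; have ba : 0 < b - a by rewrite subr_gt0.
  (* The grid has [n] cells of width [h] with n h = b - a, and the image of a cell with a critical
     point has length at most 2 e' h, which sums to [e]. *)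
  have e1 : 0 < e / (2 * (b - a)) by rewrite divr_gt0// mulr_gt0.
  have [d d0 hd] := hf _ e1; set e' := e / _ in e1 hd.
  have [n nd] : exists n : nat, (b - a) / d < n%:R.
    by exists (Num.truncn ((b - a) / d)).+1; exact: truncnS_gt.
  have n0 : (0 < n)%N by rewrite -(ltr0n R) (lt_trans _ nd)// divr_gt0.
  have n0' : 0 < n%:R :> R by rewrite ltr0n.
  pose h := (b - a) / n%:R; have h0 : 0 < h by rewrite divr_gt0.
  have hd' : h < d by rewrite /h ltr_pdivrMr// mulrC -ltr_pdivrMr.
  have hn : a + h *+ n = b.
    by rewrite -mulr_natr /h divfK ?gt_eqF// addrC subrK.
  pose A i : set R := if `[< exists2 t, a <= t <= b & Z t /\ a + h *+ i <= t <= a + h *+ i.+1 >]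
    then `[f (a + h *+ i) - e' * h, f (a + h *+ i) + e' * h]%classic else set0.
  have mA i : measurable (A i) by rewrite /A; case: ifP.
  have lA i : (leb R (A i) <= (e' * h *+ 2)%:E)%E.
    have eh : 0 < e' * h by rewrite mulr_gt0.
    rewrite /A; case: ifP => _; last by rewrite measure0 lee_fin mulrn_wge0// ltW.
    rewrite lebesgue_measure_itv/= lte_fin; case: ifP => _.
      by rewrite -EFinD lee_fin; lra.
    by rewrite lee_fin mulrn_wge0// ltW.
  exists (\big[setU/set0]_(i < n) A i).
    split; first exact: bigsetU_measurable.
    apply: le_trans (Boole_inequality _ _) _; first by move=> i _; exact: mA.
    apply: (@le_trans _ _ (\sum_(i < n) (e' * h *+ 2)%:E)%E); first by apply: lee_sum => i _; exact: lA.
    rewrite sumEFin lee_fin sumr_const card_ord -mulr_natr /h /e'.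
    rewrite le_eqVlt; apply/orP; left; apply/eqP; field.
    by rewrite (gt_eqF n0') (gt_eqF ba).
  move=> t tI Zt; have tI' : a <= t <= a + h *+ n by rewrite hn.
  have [i ni /andP[i1 i2]] := itv_grid (ltW h0) n0 tI'.
  rewrite -bigcup_mkord; exists i => //; rewrite /A asboolT; last by exists t => //; rewrite i1 i2.
  have ti : `|a + h *+ i - t| <= h.
    by rewrite ler_norml; move: i1 i2; rewrite mulrS; lra.
  have iI : a <= a + h *+ i <= b.
    by rewrite lerDl mulrn_wge0 ?(ltW h0)//= (le_trans i1)//; case/andP: tI.
  have := hd t _ tI iI Zt (le_lt_trans ti hd').
  have : e' * `|a + h *+ i - t| <= e' * h by rewrite ler_pM2l.
  by rewrite /= in_itv /= ler_norml => h1 /andP[h2 h3]; apply/andP; split; lra.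
have cov' (k : nat) : exists E : set R, [/\ measurable E, (leb R E <= (k.+1%:R^-1)%:E)%E &
    forall t, a <= t <= b -> Z t -> E (f t)].
  by have [|E [h1 h2] h3] := cov k.+1%:R^-1; [rewrite invr_gt0|exists E].
have [E hE] := choice cov'.
have mE : measurable (\bigcap_k E k) by apply: bigcapT_measurable => k; case: (hE k).
exists (\bigcap_k E k); split => //.
  apply/eqP; rewrite eq_le measure_ge0 andbT; apply/lee_addgt0Pr => e e0; rewrite add0e.
  have [k ke] : exists k : nat, e^-1 < k%:R.
    by exists (Num.truncn e^-1).+1; exact: truncnS_gt.
  have k1 : e^-1 < k.+1%:R by rewrite (lt_trans ke)// ltr_nat.
  apply: le_trans (_ : (leb R (E k) <= _)%E).
    by apply: le_measure; rewrite ?inE//; [case: (hE k)|exact: bigcap_inf].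
  case: (hE k) => _ /le_trans h _; apply: h; rewrite lee_fin ltW//.
  by rewrite -[ltRHS]invrK ltf_pV2 ?posrE ?invr_gt0// ltr0n.
move=> c /= nc k _; case: (hE k) => _ _ hk.
by apply: contrapT => nE; apply: nc => t tI Zt; apply/eqP => fc; apply: nE; rewrite -fc; exact: hk.
Qed.

Lemma ae_measurable_set d (T : measurableType d) (m : {measure set T -> \bar R}) (P : T -> Prop) :
  {ae m, forall x, P x} ->
  exists G : set T, [/\ measurable G, {ae m, forall x, G x} & forall x, G x -> P x].
Proof.
move=> [A [mA A0 PA]]; exists (~` A); split; first exact: measurableC.
  by exists A; split=> // x /= /contrapT.
by move=> x nA; apply: contrapT => /PA.
Qed.

Lemma ae_lines (k : 'I_3) (G : set 'rV[R]_3) : measurable (@vec3 R @^-1` G) ->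
  (forall u, {ae leb R, forall c, G (u + c *: delta_mx 0 k)}) ->
  {ae leb3 R, forall p, G (vec3 p)}.
Proof.
move=> mG h; apply/(ae_lebesgue3 mG).
have mcomp d (T : measurableType d) (f : T -> R * R * R) : measurable_fun setT f ->
    measurable [set t | G (vec3 (f t))].
  by move=> mf; rewrite -[X in measurable X]setTI; exact: (mf measurableT _ mG).
have [e|[e|e]] := ord3_cases k; rewrite e in h.
- have h1 y z : {ae leb R, forall x, G (vec3 (x, y, z))}.
    apply: (aeS (h (vec3 (0, y, z)))) => x; congr (G _).
    by apply: row3P; rewrite !mxE /=; ring.
  apply: (ae_swap12R (A := fun y x z => G (vec3 (x, y, z)))).
    by apply: (mcomp _ _ (fun t => (t.1.2, t.1.1, t.2))); meas.
  apply: (ae_swap23R (A := fun y z x => G (vec3 (x, y, z)))).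
    by apply: (mcomp _ _ (fun t => (t.2, t.1.1, t.1.2))); meas.
  by apply: aeT => y; apply: aeT => z; exact: h1.
- have h1 x z : {ae leb R, forall y, G (vec3 (x, y, z))}.
    apply: (aeS (h (vec3 (x, 0, z)))) => y; congr (G _).
    by apply: row3P; rewrite !mxE /=; ring.
  apply: (ae_swap23R (A := fun x z y => G (vec3 (x, y, z)))).
    by apply: (mcomp _ _ (fun t => (t.1.1, t.2, t.1.2))); meas.
  by apply: aeT => x; apply: aeT => z; exact: h1.
- apply: aeT => x; apply: aeT => y; apply: (aeS (h (vec3 (x, y, 0)))) => z; congr (G _).
  by apply: row3P; rewrite !mxE /=; ring.
Qed.

Lemma ae_dot_neq0 (n : 'rV[R]_3) : n != 0 -> {ae leb3 R, forall p, dot n (vec3 p) != 0}.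
Proof.
move=> n0; have [k nk] : exists k, n 0 k != 0.
  apply/existsP; rewrite -negb_forall; apply: contra n0 => /forallP h.
  by apply/eqP/rowP => i; rewrite mxE; apply/eqP.
apply: (@ae_lines k [set u | dot n u != 0]).
  rewrite (_ : _ @^-1` _ = [set p : R * R * R | n 0 i0 * p.1.1 + n 0 i1 * p.1.2 + n 0 i2 * p.2 != 0]).
    by apply: measurable_neq0; meas.
  by apply/seteqP; split => p /=; rewrite dotE !mxE.
move=> u; apply: (aeS (ae_neq (- dot n u / n 0 k))) => c; apply: contra => /eqP.
rewrite dotDr dotZr => h; rewrite -subr_eq0; apply/eqP; apply: (mulIf nk).
rewrite mul0r mulrBl divfK//.
suff -> : n 0 k = dot n (delta_mx 0 k) by lra.
rewrite /dot (bigD1 k)//= big1 ?addr0 => [|i ik]; first by rewrite mxE !eqxx mulr1.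
by rewrite mxE (negbTE ik) andbF mulr0.
Qed.

Lemma near_segment (a b : R) (P : R -> R -> Prop) :
  (forall tc, a <= tc <= b -> exists2 d : R, 0 < d &
     forall t c, `|t - tc| < d -> 0 < c < d -> a <= t <= b -> P c t) ->
  exists2 c : R, 0 < c & forall t, a <= t <= b -> P c t.
Proof.
move=> h; pose Q (c : R) t := a <= t <= b -> P c t.
have /(_ R 0^'+ Q) := (compact_near_coveringP _).1 (@segment_compact R a b).
case=> [x|d /= d0 hd].
  rewrite /= in_itv /= => bx; have [d d0 hd] := h x bx.
  exists ([set y | `|y - x| < d], [set c | 0 < c < d]) => /=.
    split; first by exists d => //= y /=; rewrite distrC.
    by exists d => //= c /=; rewrite sub0r normrN => cd c0; rewrite c0 -(gtr0_norm c0).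
  by move=> [y c] /= [yx cd] by_; exact: (hd y c).
have d2 : d / 2 < d by rewrite ltr_pdivrMr// mulr_natr mulr2n ltrDl.
exists (d / 2) => [|x bx]; first by rewrite divr_gt0.
apply: (hd (d / 2) _ _ x) => //; rewrite ?divr_gt0//= ?in_itv//=.
by rewrite sub0r normrN gtr0_norm ?divr_gt0.
Qed.

End null_sets.

(** * Tangential velocities at a fixed point form a null set *)

Section grazing_null.
Context {R : realType}.

Lemma strictly_diff_continuous (psi : 'rV[R]_3 -> R) N : strictly_diff psi N ->
  continuous psi /\ forall i, continuous (fun x => N x 0 i).
Proof.
move=> sd; split=> [x|i x] U /nbhs_ballP[e /= e0 eU]; apply/nbhs_enormP.
  have N1 : 0 < enorm (N x) + 2 by rewrite ltr_wpDl ?enorm_ge0.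
  have [d d0 [_ h]] := sd x 1 ltr01.
  exists (Num.min d (e / (enorm (N x) + 2))); first by rewrite lt_min d0 divr_gt0.
  move=> y; rewrite lt_min ltr_pdivlMr// => /andP[yd ye]; apply: eU; rewrite /ball /= distrC.
  have := h x y; rewrite subrr enorm0 => /(_ d0 yd); rewrite mul1r => h1.
  have h2 := normr_dot_le (N x) (y - x).
  rewrite -(subrK (dot (N x) (y - x)) (_ - _)).
  apply: le_lt_trans (ler_normD _ _) _.
  apply: le_lt_trans (lerD h1 h2) _; apply: le_lt_trans ye.
  by have := enorm_ge0 (y - x); nra.
have [d d0 [h _]] := sd x e e0; exists d => // y /h hy; apply: eU; rewrite /ball /= distrC.
by apply: le_lt_trans hy; have := normr_coord_le (N y - N x) i; rewrite !mxE.
Qed.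

(** Supplies the measurability that [ae_lines] asks for: over a compact time interval absence of
    tangency is stable under small changes of [u]. *)
Lemma tangency_closed psi N (y : 'rV[R]_3) (a b : R) : strictly_diff psi N ->
  open [set u | forall t, a <= t <= b ->
    ~ (psi (y - t *: u) = 0 /\ dot (N (y - t *: u)) u = 0)].
Proof.
move=> /strictly_diff_continuous[cp cN]; rewrite openE => u hu.
pose P (w : 'rV[R]_3) (t : R) := ~ (psi (y - t *: w) = 0 /\ dot (N (y - t *: w)) w = 0).
have c1 : continuous (fun p : R * 'rV[R]_3 => y - p.1 *: p.2).
  move=> p; apply: cvgB; first exact: cvg_cst.
  by apply: cvgZ; [exact: cvg_fst|exact: cvg_snd].
have c2 : continuous (fun p : R * 'rV[R]_3 => psi (y - p.1 *: p.2)).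
  by move=> p; apply: (@continuous_comp _ _ _ (fun p : R * 'rV[R]_3 => y - p.1 *: p.2) psi);
     [exact: c1|exact: cp].
have c3 : continuous (fun p : R * 'rV[R]_3 => dot (N (y - p.1 *: p.2)) p.2).
  move=> p; under eq_fun do rewrite dotE.
  have cc i : (fun p : R * 'rV[R]_3 => N (y - p.1 *: p.2) 0 i * p.2 0 i) @ p -->
      N (y - p.1 *: p.2) 0 i * p.2 0 i.
    apply: cvgM.
      by apply: (@continuous_comp _ _ _ (fun p : R * 'rV[R]_3 => y - p.1 *: p.2)
        (fun x => N x 0 i)); [exact: c1|exact: cN].
    by apply: (@continuous_comp _ _ _ (snd : R * 'rV[R]_3 -> 'rV[R]_3) (fun x => x 0 i));
       [exact: cvg_snd|exact: coord_continuous].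
  exact: (cvgD (cvgD (cc i0) (cc i1)) (cc i2)).
have h1 t : `[a, b]%classic t -> \forall t' \near t & w \near nbhs u, P w t'.
  rewrite /= in_itv /= => tI; have nn := hu t tI.
  have [p0|pn] := eqVneq (psi (y - t *: u)) 0.
    have dn : dot (N (y - t *: u)) u != 0 by apply/eqP => d0; apply: nn.
    have hh : nbhs (t, u) [set p : R * 'rV[R]_3 | dot (N (y - p.1 *: p.2)) p.2 != 0] :=
      c3 (t, u) _ (open_nbhs_nbhs (conj (@open_neq R 0) dn)).
    by apply: (@filterS _ (filter_prod (nbhs t) (nbhs u)) _ _ _ _ hh) => p /= /eqP hp [].
  have hh : nbhs (t, u) [set p : R * 'rV[R]_3 | psi (y - p.1 *: p.2) != 0] :=
    c2 (t, u) _ (open_nbhs_nbhs (conj (@open_neq R 0) pn)).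
  by apply: (@filterS _ (filter_prod (nbhs t) (nbhs u)) _ _ _ _ hh) => p /= /eqP hp [].
have d := (compact_near_coveringP _).1 (@segment_compact R a b) _ (nbhs u) P _ h1.
by apply: (@filterS _ (nbhs u) _ _ _ _ (d _)) => w hw t tI; apply: hw; rewrite /= in_itv.
Qed.

(** Along a line u + z e_k of velocities the trajectory meets the graph at time t exactly when z =
    f(t), with f(t) = - sg psi(y - t u) / t, and it is tangent there exactly when f'(t) = 0, which
    is the condition [Z]. So the tangential z are critical values of a function of one variable. *)
Lemma ae_transversal_graph (Omega : set 'rV[R]_3) x0 r psi N k sg (y : 'rV[R]_3) (a b c : R) :
  graph_fun Omega x0 r psi N k sg -> a < b -> 0 < c ->
  (forall t, a <= t <= b -> c <= `|t|) ->
  {ae leb3 R, forall p, forall t, a <= t <= b ->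
    ~ (psi (y - t *: vec3 p) = 0 /\ dot (N (y - t *: vec3 p)) (vec3 p) = 0)}.
Proof.
move=> [r0 sd tr [Nk sg2] _] ab c0 hc.
apply: (@ae_lines _ k [set u | forall t, a <= t <= b ->
    ~ (psi (y - t *: u) = 0 /\ dot (N (y - t *: u)) u = 0)]).
  apply: open_measurable_vec3; exact: tangency_closed.
move=> u; pose f t := - sg * psi (y - t *: u) / t.
pose Z : set R := [set t | psi (y - t *: u) = - t * dot (N (y - t *: u)) u].
have tn0 t : a <= t <= b -> t != 0 by move=> /hc ct; rewrite -normr_gt0 (lt_le_trans c0).
have sard : forall e, 0 < e -> exists2 d : R, 0 < d & forall t t', a <= t <= b -> a <= t' <= b ->
    Z t -> `|t' - t| < d -> `|f t' - f t| <= e * `|t' - t|.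
  move=> e e0; have u1 : 0 < 1 + enorm u by rewrite ltr_wpDr ?enorm_ge0.
  have e'0 : 0 < e * c / (1 + enorm u) by rewrite divr_gt0// mulr_gt0.
  have [|d d0 hd] := @near_segment R a b (fun d t => forall t', `|t' - t| < d ->
      `|psi (y - t' *: u) - psi (y - t *: u) + (t' - t) * dot (N (y - t *: u)) u| <=
      e * c * `|t' - t|).
    move=> tc _; have [d d0 [_ hd]] := sd (y - tc *: u) _ e'0.
    have dist s s' : (y - s *: u) - (y - s' *: u) = (s' - s) *: u.
      by apply/rowP => i; rewrite !mxE; ring.
    exists (d / (2 * (1 + enorm u))); first by rewrite divr_gt0// mulr_gt0.
    move=> t d' tt /andP[d'0 d'1] tI t' tt'; rewrite ltr_pdivlMr ?mulr_gt0// in tt; rewrite ltr_pdivlMr ?mulr_gt0// in d'1.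
    have uu := enorm_ge0 u.
    have d'u : `|t' - t| * (2 * (1 + enorm u)) < d.
      by apply: lt_trans d'1; rewrite ltr_pM2r// mulr_gt0.
    have ad s : enorm (y - s *: u - (y - tc *: u)) = `|s - tc| * enorm u.
      by rewrite dist enormZ distrC.
    have h1 : enorm (y - t *: u - (y - tc *: u)) < d.
      by rewrite ad; apply: le_lt_trans tt; have := normr_ge0 (t - tc); nra.
    have h2 : enorm (y - t' *: u - (y - tc *: u)) < d.
      rewrite ad; have := ler_distD t t' tc; move: tt d'u.
      by have := normr_ge0 (t - tc); have := normr_ge0 (t' - t); have := normr_ge0 (t' - tc); nra.
    have := hd _ _ h1 h2; rewrite dist dotZr enormZ (distrC t).
    rewrite -mulNr opprB => /le_trans; apply.
    rewrite mulrCA [leRHS]mulrC ler_wpM2l//.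
    rewrite mulrAC -mulrA ger_pMr ?mulr_gt0// ler_pdivrMr// mul1r.
    by rewrite lerDr.
  exists d => // t t' tI tI' Zt tt'; have := hd t tI t' tt'; rewrite /Z /= in Zt.
  set p := psi _ in Zt *; set p' := psi _; set D := dot _ _ in Zt * => h.
  have t0 := tn0 _ tI; have t0' := tn0 _ tI'.
  have -> : f t' - f t = - sg * (p' - p + (t' - t) * D) / t'.
    by rewrite /f -/p -/p' Zt; field; rewrite t0 t0'.
  have s1 : `|sg| = 1 by apply: (@pexpIrn _ 2) => //; rewrite ?nnegrE// real_normK ?num_real// expr1n.
  rewrite !normrM normrN s1 mul1r normfV ler_pdivrMr ?normr_gt0//.
  apply: le_trans h _; rewrite mulrAC ler_wpM2l ?hc//.
  by rewrite mulr_ge0 ?(ltW e0).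
apply: (aeS (ae_critical_values ab sard)) => z hz t tI [h1 h2].
have [e1 _] := tr (y - t *: u) (- (t * z)).
have [_ e2] := tr (y - t *: u) (- (t * z)).
have ey : y - t *: (u + z *: delta_mx 0 k) = y - t *: u + (- (t * z)) *: delta_mx 0 k.
  by apply/rowP => i; rewrite !mxE; ring.
rewrite ey e1 in h1; rewrite ey e2 dotDr dotZr in h2.
have ek : dot (N (y - t *: u)) (delta_mx 0 k) = - sg.
  rewrite -(Nk (y - t *: u)) /dot (bigD1 k)//= big1 ?addr0 => [|i ik].
    by rewrite mxE !eqxx mulr1.
  by rewrite mxE (negbTE ik) andbF mulr0.
rewrite ek in h2; have t0 := tn0 _ tI.
have ep : psi (y - t *: u) = - (sg * t * z) by lra.
have eD : dot (N (y - t *: u)) u = z * sg by lra.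
have Zt : Z t by rewrite /Z /= ep eD; ring.
have /eqP := hz t tI Zt; apply; rewrite /f ep; transitivity (sg ^+ 2 * z); first by field.
by rewrite sg2 mul1r.
Qed.

(** The nonzero times are exhausted by countably many compact intervals on either side of 0. *)
Lemma ae_transversal (Omega : set 'rV[R]_3) x0 r psi N k sg (y : 'rV[R]_3) :
  graph_fun Omega x0 r psi N k sg ->
  {ae leb3 R, forall p, forall t, t != 0 ->
    ~ (psi (y - t *: vec3 p) = 0 /\ dot (N (y - t *: vec3 p)) (vec3 p) = 0)}.
Proof.
move=> g.
have h1 (j : nat) : {ae leb3 R, forall p, forall t, j.+1%:R^-1 <= t <= j.+2%:R ->
    ~ (psi (y - t *: vec3 p) = 0 /\ dot (N (y - t *: vec3 p)) (vec3 p) = 0)}.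
  have j0 : 0 < j.+1%:R^-1 :> R by rewrite invr_gt0.
  apply: (ae_transversal_graph _ g _ j0) => [|t /andP[+ _]].
    by rewrite (@le_lt_trans _ _ 1)// ?invf_le1 ?ler1n ?ltr1n.
  by move=> /le_trans; apply; exact: ler_norm.
have h2 (j : nat) : {ae leb3 R, forall p, forall t, - j.+2%:R <= t <= - j.+1%:R^-1 ->
    ~ (psi (y - t *: vec3 p) = 0 /\ dot (N (y - t *: vec3 p)) (vec3 p) = 0)}.
  have j0 : 0 < j.+1%:R^-1 :> R by rewrite invr_gt0.
  apply: (ae_transversal_graph _ g _ j0) => [|t /andP[_ +]].
    by rewrite ltrN2 (@le_lt_trans _ _ 1)// ?invf_le1 ?ler1n ?ltr1n.
  by rewrite lerNr => /le_trans; apply; rewrite -normrN; exact: ler_norm.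
apply: (aeS2 (ae_foralln h1) (ae_foralln h2)) => p k1 k2 t t0.
have tb (s : R) : 0 < s -> exists j : nat, j.+1%:R^-1 <= s <= j.+2%:R.
  move=> s0; exists (maxn (Num.truncn s) (Num.truncn s^-1)); apply/andP; split.
    rewrite -[leRHS]invrK lef_pV2 ?posrE ?invr_gt0// ltW//.
    by apply: lt_le_trans (truncnS_gt _) _; rewrite ler_nat ltnS leq_maxr.
  by apply: le_trans (ltW (truncnS_gt _)) _; rewrite ler_nat ltnS leqW// leq_maxl.
have [tn|tp|te] := ltgtP t 0.
- have [|j /andP[j1 j2]] := tb (- t); first by rewrite oppr_gt0.
  by apply: (k2 j); rewrite lerNl j2 lerNr.
- by have [j jI] := tb t tp; exact: (k1 j).
- by rewrite te eqxx in t0.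
Qed.

Variable Omega : set 'rV[R]_3.
Hypotheses (hopen : open Omega) (hbounded : bounded_set Omega).
Hypothesis hsmooth : smooth_boundary Omega.

(** Compactness of the boundary, applied to the filter of sets of full measure, merges the null sets
    of the charts into one. *)
Lemma ae_transversal_bdry (y : 'rV[R]_3) : {ae leb3 R, forall p, forall x, bdry Omega x ->
  forall t, t != 0 -> x = y - t *: vec3 p -> dot (normal Omega x) (vec3 p) != 0}.
Proof.
pose P (p : R * R * R) (x : 'rV[R]_3) := bdry Omega x -> forall t, t != 0 ->
  x = y - t *: vec3 p -> dot (normal Omega x) (vec3 p) != 0.
have /(_ _ (almost_everywhere (leb3 R)) P _) :=
  (compact_near_coveringP _).1 (compact_bdry hbounded).
case=> [x bx|A [mA A0 hA]].
  have [r [psi [N [k [sg g]]]]] := normal_graph hsmooth bx.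
  have [r0 _ _ _ _] := g.
  exists ([set x' | enorm (x' - x) < r], [set p | forall t, t != 0 ->
    ~ (psi (y - t *: vec3 p) = 0 /\ dot (N (y - t *: vec3 p)) (vec3 p) = 0)]) => /=.
    by split; [apply/nbhs_enormP; exists r|exact: (ae_transversal y g)].
  move=> [x' p] /= [x'r hp] bx' t t0 xe; apply/eqP => n0.
  apply: (hp t t0); rewrite -xe; split; first exact: (graph_bdry hopen g x'r bx').
  by rewrite (dot_normal_graph hopen hsmooth _ g x'r bx') n0 mulr0.
exists A; split=> // p hp; apply: hA => h; apply: hp => x bx; exact: h.
Qed.

(** Tangency at nonzero times is excluded by the Sard argument, tangency at [y] itself by a
    hyperplane of velocities. The set [G] is there because the regular velocities need not visibly
    form a Borel set. *)
Lemma ae_regular (y : 'rV[R]_3) : closure Omega y ->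
  exists G : set (R * R * R), [/\ measurable G, {ae leb3 R, forall p, G p} &
    forall p, G p -> regular Omega y (vec3 p)].
Proof.
move=> cy; apply: (@ae_measurable_set _ _ _ (leb3 R)).
have d0 : (delta_mx 0 i0 : 'rV[R]_3) != 0.
  by apply/eqP => /rowP/(_ i0); rewrite !mxE /= => /eqP; rewrite oner_eq0.
have hn : {ae leb3 R, forall p, bdry Omega y -> dot (normal Omega y) (vec3 p) != 0}.
  have [by_|nb] := pselect (bdry Omega y); last by apply: aeT.
  have n0 : normal Omega y != 0.
    by apply/eqP => n0; have := enorm_normal hopen hsmooth by_; rewrite n0 enorm0 => /eqP; rewrite eq_sym oner_eq0.
  by apply: (aeS (ae_dot_neq0 n0)).
apply: (aeS3 (ae_transversal_bdry y) hn (ae_dot_neq0 d0)) => p h hb u0.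
have v0 : vec3 p != 0 by apply: contra u0 => /eqP ->; rewrite dot0r.
have ng (s : R) : s != 0 -> ~ grazing Omega (y, s *: vec3 p).
  move=> s0; have sv0 : s *: vec3 p != 0 by rewrite scaler_eq0 negb_or s0.
  have [T [T0 tT _ bT]] := t_bP hopen hbounded cy sv0.
  move=> [_ /=]; rewrite (x_bE tT) dotZr => /eqP; rewrite mulf_eq0 (negbTE s0) /=.
  have [T0'|Tn] := eqVneq T 0.
    by move: bT; rewrite T0' scale0r subr0 => /hb /negbTE ->.
  by apply/negP; apply: (h _ bT (T * s)); rewrite ?mulf_neq0// scalerA.
split=> //.
- by have := ng 1; rewrite scale1r; apply; exact: oner_neq0.
- by have := ng (-1); rewrite scaleN1r; apply; rewrite oppr_eq0 oner_neq0.
Qed.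

End grazing_null.

(** * The perturbation of the Maxwellian along characteristics *)

Section mild_solutions.
Context {R : realType} (gam : R) (hgam : 0 < gam <= 1) (q0 : R -> R)
  (hq0m : measurable_fun (`[-1, 1]%classic : set R) q0)
  (hq0pos : forall c : R, -1 <= c <= 1 -> 0 <= q0 c)
  (hq0cut : forall u : 'rV[R]_3, enorm u = 1 ->
     (eint_sphere (fun omega => (q0 (dot u omega))%:E) < +oo)%E)
  (rho beta : R)
  (hw : (@lebesgue3 R).-integrable setT
     (fun p => ((weight rho beta (vec3 p))^-1 ^+ 2 *
                (1 + enorm (vec3 p)) ^+ 3)%:E))
  (Omega : set 'rV[R]_3).

Definition pert (F : R -> 'rV[R]_3 -> 'rV[R]_3 -> R) (t : R) (x v : 'rV[R]_3) : R :=
  F t x v - mu v.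

(* The integrated equation for [F - mu], kept as an estimate: the collision term
   need not be measurable along the characteristic. *)
Definition mild (g : R -> 'rV[R]_3 -> 'rV[R]_3 -> R) : Prop :=
  forall (s t : R) (x v : 'rV[R]_3) (b : R -> R) (I : R),
    0 <= s -> s <= t -> closure Omega x -> ((t - s)%:E <= t_b Omega x v)%E ->
    measurable_fun setT b ->
    (forall tau, s <= tau <= t -> `|collision gam q0 (g tau (x - (t - tau) *: v)) v| <= b tau) ->
    (\int[leb R]_(tau in `[s, t]) (b tau)%:E <= I%:E)%E ->
    `|g t x v - expR (- nu gam q0 v * (t - s)) * g s (x - (t - s) *: v) v| <= I.

Lemma sqmu_gt0 (v : 'rV[R]_3) : 0 < sqmu v.
Proof. by rewrite sqrtr_gt0 mu_gt0. Qed.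

(** The weight and the square root of [mu] factor out of the linear and the quadratic term alike,
    which leads back to the unweighted perturbation. *)
Lemma duhamel_integrand (F : R -> 'rV[R]_3 -> 'rV[R]_3 -> R) tau y v :
  let h := wpert rho beta (F tau) y in
  Kw gam q0 rho beta h v +
    weight rho beta v * Gam gam q0 (fun u => h u / weight rho beta u)
      (fun u => h u / weight rho beta u) v =
  weight rho beta v / sqmu v * collision gam q0 (pert F tau y) v.
Proof.
move=> h; have e : (fun u => sqmu u * (h u / weight rho beta u)) = pert F tau y.
  apply/funext => u; rewrite /h /wpert /pert.
  have s0 : sqmu u != 0 by rewrite gt_eqF ?sqmu_gt0.
  have w0 : weight rho beta u != 0 by rewrite gt_eqF ?weight_gt0.
  by field; rewrite w0 s0.
have alg (a s' b1 b2 b3 b4 b5 : R) : a * (s'^-1 * (b1 + b2 - b3)) + a * (s'^-1 * (b4 - b5)) =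
    a / s' * (b1 + b2 - b3 + (b4 - b5)) by ring.
by rewrite /Kw /Kop /Gam /Qcoll /collision e alg.
Qed.

Lemma duhamel_mild (F : R -> 'rV[R]_3 -> 'rV[R]_3 -> R) :
  duhamel gam q0 rho beta Omega (fun t => wpert rho beta (F t)) -> mild (pert F).
Proof.
move=> dF s t x v b I s0 st cx tb mb hb hI.
set g := pert F in hb *; set w := weight rho beta v / sqmu v.
have w0 : 0 < w by rewrite divr_gt0 ?weight_gt0 ?sqmu_gt0.
have wE r y : wpert rho beta (F r) y v = w * g r y v by rewrite /wpert /w /g /pert; ring.
have := dF s t x v s0 st cx tb; rewrite !wE.
set J := (\int[_]_(tau in _) _)%R => eJ.
have [Cn Cn0 /(_ v)/andP[nu0 _]] := nu_bound hgam hq0m hq0pos hq0cut hw.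
have J_le : `|J| <= w * I.
  apply: (@normr_Rintegral_le_ae _ _ _ (leb R) `[s, t]%classic _ (fun tau => (w * `|b tau|)%:E)).
  - exact: measurable_itv.
  - by move=> tau _; rewrite lee_fin mulr_ge0// ltW.
  - apply: (measurable_funS measurableT (@subsetT _ _)); apply/EFin_measurable; meas.
  - apply: aeT => tau; rewrite /= in_itv /= => tI; rewrite lee_fin.
    rewrite duhamel_integrand normrM ger0_norm ?expR_ge0// normrM (gtr0_norm w0).
    have e1 : expR (- nu gam q0 v * (t - tau)) <= 1.
      by rewrite -expR0 ler_expR mulNr oppr_le0 mulr_ge0// subr_ge0; case/andP: tI.
    apply: le_trans (_ : 1 * (w * `|b tau|) <= _); last by rewrite mul1r.
    apply: ler_pM; [exact: expR_ge0|exact: mulr_ge0 (ltW w0) (normr_ge0 _)|exact: e1|].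
    by apply: ler_wpM2l; [exact: ltW|apply: le_trans (hb _ tI) (ler_norm _)].
  have bb : (\int[leb R]_(tau in `[s, t]) (w * `|b tau|)%:E =
      w%:E * \int[leb R]_(tau in `[s, t]) (b tau)%:E)%E.
    rewrite -ge0_integralZl//.
    - apply: eq_integral => tau; rewrite inE /= in_itv /= => tI.
      by rewrite EFinM ger0_norm// (le_trans _ (hb _ tI)).
    - by apply: (measurable_funS measurableT (@subsetT _ _)); apply/EFin_measurable.
    - by move=> tau; rewrite /= in_itv /= => tI; rewrite lee_fin (le_trans _ (hb _ tI)).
    - by rewrite lee_fin ltW.
  have w0' : (0 <= w%:E)%E by rewrite lee_fin ltW.
  by rewrite bb (EFinM w I); exact: (lee_wpmul2l w0' hI).
rewrite -(ler_pM2l w0) -{1}(gtr0_norm w0) -normrM mulrBr eJ.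
by rewrite mulrCA addrC addKr.
Qed.

Lemma boltzmann_mild BC F0 F : boltzmann_solution gam q0 rho beta Omega BC F0 F -> mild (pert F).
Proof. by case=> _ _ _ /duhamel_mild. Qed.

(* The Gaussian rate relaxes linearly in time, so that the derivative of the
   barrier absorbs the velocity growth of the collision term. *)
Definition barrier (lam t : R) (v : 'rV[R]_3) : R :=
  expR (- ((8^-1 - lam * t) * (1 + enorm v ^+ 2))).

Lemma barrier_gt0 lam t v : 0 < barrier lam t v. Proof. exact: expR_gt0. Qed.

Lemma barrier_le lam s t v : 0 <= lam -> s <= t -> barrier lam s v <= barrier lam t v.
Proof.
move=> l0 st; rewrite ler_expR lerN2 ler_wpM2r ?addr_ge0 ?sqr_ge0//.
by rewrite lerB// ler_wpM2l.
Qed.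

Lemma barrier_le_gaussian lam t v : lam * t <= 16^-1 ->
  barrier lam t v <= expR (- (enorm v ^+ 2 / 16)).
Proof.
move=> lt; rewrite ler_expR lerN2 mulrC.
have := sqr_ge0 (enorm v); set q := _ ^+ 2 => q0'; nra.
Qed.

Lemma gaussian_le_barrier lam t v : 0 <= lam * t -> expR (- (8^-1 * (1 + enorm v ^+ 2))) <= barrier lam t v.
Proof.
move=> lt; rewrite ler_expR lerN2 ler_wpM2r ?addr_ge0 ?sqr_ge0//.
by rewrite gerBl.
Qed.

Lemma mu_le_barrier lam t v : 0 <= lam * t -> mu v <= expR 8^-1 * barrier lam t v.
Proof.
move=> lt; apply: le_trans (_ : expR 8^-1 * expR (- (8^-1 * (1 + enorm v ^+ 2))) <= _).
  rewrite -expRD ler_expR; have := sqr_ge0 (enorm v); set q := _ ^+ 2 => q0'; lra.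
by rewrite ler_pM2l ?expR_gt0// gaussian_le_barrier.
Qed.

Lemma integral_barrier lam s t v : s <= t ->
  (\int[leb R]_(tau in `[s, t]) (lam * (1 + enorm v ^+ 2) * barrier lam tau v)%:E =
   (barrier lam t v - barrier lam s v)%:E)%E.
Proof.
rewrite le_eqVlt => /orP[/eqP ->|st].
  by rewrite set_itv1 integral_set1 subrr.
set q := 1 + _.
have dW (tau : R) : is_derive tau 1 (fun tau => barrier lam tau v) (lam * q * barrier lam tau v).
  have d1 : is_derive tau (1 : R) (fun x : R => - ((8^-1 - lam * x) * q)) (lam * q).
    by apply: is_derive_eq; rewrite /GRing.scale /=; ring.
  have := @is_derive1_comp _ expR _ tau _ _ (is_derive_expR _) d1.
  by rewrite mulrC.
have cW : continuous (fun tau => barrier lam tau v).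
  by move=> tau; apply: differentiable_continuous; apply/derivable1_diffP; case: (dW tau).
rewrite (@continuous_FTC2 _ _ (fun tau => barrier lam tau v) s t st).
- by rewrite EFinB.
- by apply: continuous_subspaceT => tau; apply: cvgM; [exact: cvg_cst|exact: cW].
- split=> [tau _||]; first by case: (dW tau).
    by apply: cvg_at_right_filter; exact: cW.
  by apply: cvg_at_left_filter; exact: cW.
by move=> tau _; rewrite derive1E; case: (dW tau).
Qed.

(** The part of the majorant with [K] is the time derivative of [K] times the barrier and integrates
    exactly; in the part with [L] the barrier is replaced by its final value. *)
Lemma leg_bound g lam K L s t x v : mild g -> 0 < lam -> 0 <= K -> 0 <= L ->
  0 <= s -> s <= t -> closure Omega x -> ((t - s)%:E <= t_b Omega x v)%E ->
  (forall tau, s <= tau <= t -> `|collision gam q0 (g tau (x - (t - tau) *: v)) v| <=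
     (lam * K * (1 + enorm v ^+ 2) + L) * barrier lam tau v) ->
  `|g t x v - expR (- nu gam q0 v * (t - s)) * g s (x - (t - s) *: v) v| <=
    K * (barrier lam t v - barrier lam s v) + L * (t - s) * barrier lam t v.
Proof.
move=> mg l0 K0 L0 s0 st cx tb hc; set q := 1 + _ in hc.
have q0' : 0 <= q by rewrite addr_ge0 ?sqr_ge0.
have mW : measurable_fun setT (fun tau => barrier lam tau v) by rewrite /barrier; meas.
apply: (mg s t x v (fun tau => K * (lam * q * barrier lam tau v) + L * barrier lam t v)) => //.
- by meas.
- move=> tau tI; apply: le_trans (hc _ tI) _.
  rewrite mulrDl lerD//; last by rewrite ler_wpM2l// barrier_le ?(ltW l0)//; case/andP: tI.
  by rewrite le_eqVlt; apply/orP; left; apply/eqP; ring.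
have ee (a b c d e : R) : a * b + c * d = e -> (a%:E * b%:E + c%:E * d%:E)%E = e%:E.
  by move=> <-; rewrite EFinD !EFinM.
have b0 tau : 0 <= lam * q * barrier lam tau v by rewrite !mulr_ge0 ?expR_ge0 ?(ltW l0).
under eq_integral do rewrite EFinD EFinM.
rewrite ge0_integralD//=.
- rewrite ge0_integralZl//=; last 2 first.
  + by apply: (measurable_funS measurableT (@subsetT _ _)); apply/EFin_measurable; meas.
  + by move=> tau _; rewrite lee_fin.
  rewrite integral_barrier// integral_cst//= lebesgue_measure_itv/= lte_fin.
  rewrite le_eqVlt; apply/orP; left; apply/eqP.
  have [_|ts] := ltP s t; first by apply: (ee _ _ _ (t - s)); ring.
  by rewrite (le_anti (introT andP (conj st ts))); apply: (ee _ _ _ 0); ring.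
- by move=> tau _; rewrite mule_ge0// lee_fin.
- by apply: (measurable_funS measurableT (@subsetT _ _)); apply/EFin_measurable; meas.
- by move=> tau _; rewrite lee_fin mulr_ge0 ?expR_ge0.
Qed.

End mild_solutions.

(** * Short-time Gaussian bounds *)

Section bootstrap.
Context {R : realType} (gam : R) (hgam : 0 < gam <= 1) (q0 : R -> R)
  (hq0m : measurable_fun (`[-1, 1]%classic : set R) q0)
  (hq0pos : forall c : R, -1 <= c <= 1 -> 0 <= q0 c)
  (hq0cut : forall u : 'rV[R]_3, enorm u = 1 ->
     (eint_sphere (fun omega => (q0 (dot u omega))%:E) < +oo)%E)
  (rho beta : R)
  (hw : (@lebesgue3 R).-integrable setT
     (fun p => ((weight rho beta (vec3 p))^-1 ^+ 2 *
                (1 + enorm (vec3 p)) ^+ 3)%:E))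
  (Omega : set 'rV[R]_3)
  (hopen : open Omega) (hbounded : bounded_set Omega) (hsmooth : smooth_boundary Omega).

Local Notation phase_fun := (R -> 'rV[R]_3 -> 'rV[R]_3 -> R).

Lemma collision_barrier : exists2 C : R, 0 < C & forall (g : 'rV[R]_3 -> 'rV[R]_3 -> R) lam t A y v,
  0 <= lam * t <= 16^-1 -> 0 <= A <= 1 -> regular Omega y v ->
  (forall u, regular Omega y u -> `|g y u| <= A * barrier lam t u) ->
  `|collision gam q0 (g y) v| <= C * A * ((1 + enorm v ^+ 2) * barrier lam t v).
Proof.
have [C C0 hC] := collision_bound hgam hq0m hq0pos hq0cut hw.
exists (2 * C + 1) => [|g lam t A y v /andP[lt0 lt1] /andP[A0 A1] ryv hA].
  by rewrite ltr_wpDl// mulr_ge0.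
have [cy _ _ _] := ryv; have [G [mG aG hG]] := ae_regular hopen hbounded hsmooth cy.
pose a := 8^-1 - lam * t; pose A' := A * expR (- a).
have WE u : A * barrier lam t u = A' * expR (- (a * enorm u ^+ 2)).
  by rewrite /A' /barrier -/a -mulrA -expRD; congr (_ * expR _); ring.
have aI : 16^-1 <= a <= 2^-1 by apply/andP; rewrite /a; split; lra.
have ea1 : expR (- a) <= 1 by rewrite -expR0 ler_expR oppr_le0; case/andP: aI => h _; apply: le_trans h.
have A'0 : 0 <= A' by rewrite mulr_ge0 ?expR_ge0.
have A'1 : A' <= 1 by rewrite /A' mulr_ile1 ?expR_ge0.
have := hC a A' v (g y) G aI A'0 mG aG.
have h1 p : G p -> `|g y (vec3 p)| <= A' * expR (- (a * enorm (vec3 p) ^+ 2)).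
  by move=> /hG /hA; rewrite WE.
have h2 : `|g y v| <= A' * expR (- (a * enorm v ^+ 2)) by rewrite -WE; exact: hA.
move=> /(_ h1 h2) /le_trans; apply.
have -> : (2 * C + 1) * A * ((1 + enorm v ^+ 2) * barrier lam t v) =
    (2 * C + 1) * A' * ((1 + enorm v ^+ 2) * expR (- (a * enorm v ^+ 2))).
  transitivity ((2 * C + 1) * (1 + enorm v ^+ 2) * (A * barrier lam t v)); first by ring.
  by rewrite WE; ring.
apply: ler_wpM2r; first by rewrite mulr_ge0 ?expR_ge0// addr_ge0 ?sqr_ge0.
have := mulr_ge0 A'0 (_ : 0 <= 1 - A'); rewrite subr_ge0 => /(_ A'1) h.
by have := mulr_ge0 C0 A'0; have := mulr_ge0 C0 h; nra.
Qed.

(** The rate 3/16 exceeds the largest rate 1/8 of the barrier, and the surplus absorbs the quadratic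
    velocity growth. The constant may depend on [D] in any way. *)
Lemma collision_crude (D : R) : 0 <= D -> exists2 B : R, 0 <= B &
  forall (g : 'rV[R]_3 -> 'rV[R]_3 -> R) lam t y v, 0 <= lam * t -> closure Omega y ->
  (forall u, `|g y u| <= D * expR (- (3 / 16 * enorm u ^+ 2))) ->
  `|collision gam q0 (g y) v| <= B * barrier lam t v.
Proof.
move=> D0; have [C C0 hC] := collision_bound hgam hq0m hq0pos hq0cut hw.
exists (C * (D + D ^+ 2) * (16 * expR 8^-1)) => [|g lam t y v lt0 cy hD].
  by rewrite !mulr_ge0 ?expR_ge0// addr_ge0// sqr_ge0.
have key (a : R) : a = 3 / 16 -> 16^-1 <= a <= 2^-1 by move=> ea; apply/andP; split; lra.
have aI := key _ erefl.
have := hC (3 / 16) D v (g y) setT aI D0 measurableT (aeT _ (fun _ => I)) (fun p _ => hD _) (hD v).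
move=> /le_trans; apply; rewrite -(mulrA (C * (D + D ^+ 2)) (16 * expR 8^-1)); apply: ler_wpM2l.
  by rewrite !mulr_ge0// addr_ge0// sqr_ge0.
apply: le_trans (_ : 16 * (expR 8^-1 * expR (- (8^-1 * (1 + enorm v ^+ 2)))) <= _); last first.
  by rewrite -mulrA ler_pM2l// ler_pM2l ?expR_gt0// gaussian_le_barrier.
rewrite -expRD; set q := enorm v ^+ 2; have q0' : 0 <= q by exact: sqr_ge0.
have -> : 8^-1 + - (8^-1 * (1 + q)) = - (3 / 16 * q) + q / 16 by lra.
rewrite expRD mulrC [leRHS]mulrCA; apply: ler_wpM2l; first exact: expR_ge0.
by have := expR_ge1Dx (q / 16); lra.
Qed.

Definition bounded_by lam (g : phase_fun) T A : Prop := forall t x v, 0 <= t <= T ->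
  regular Omega x v -> `|g t x v| <= A * barrier lam t v.

(* What a boundary condition must provide: on a short time interval a bound at
   the initial time propagates up to a fixed factor, the memory of the crude
   bound [D] being arbitrarily small. *)
Definition propagates (B : phase_fun -> Prop) : Prop := exists2 Cf : R, 1 <= Cf &
  forall lam e : R, 0 < lam -> 0 < e -> exists2 eta : R, 0 < eta &
  forall g T0 T1 K L D, mild gam q0 Omega g -> B g ->
    0 <= T0 -> T0 <= T1 -> T1 <= T0 + eta -> lam * T1 <= 16^-1 -> 0 <= K -> 0 <= L -> 0 <= D ->
    (forall x v, regular Omega x v -> `|g T0 x v| <= K * barrier lam T0 v) ->
    (forall t x v, T0 <= t <= T1 -> regular Omega x v ->
       `|collision gam q0 (g t x) v| <= (lam * K * (1 + enorm v ^+ 2) + L) * barrier lam t v) ->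
    (forall t x v, T0 <= t <= T1 -> regular Omega x v ->
       `|g t x v| <= D * expR (- (enorm v ^+ 2 / 16))) ->
    forall t x v, T0 <= t <= T1 -> regular Omega x v ->
      `|g t x v| <= (Cf * (K + L * (t - T0)) + e * D) * barrier lam t v.

(** What boundedness of the weighted perturbation gives: rate 1/4 from the square root of [mu],
    minus 1/16 spent on the inverse weight. *)
Definition gaussian_bounded (g : phase_fun) := exists2 D : R, 0 <= D &
  forall t x v, 0 <= t -> closure Omega x -> `|g t x v| <= D * expR (- (3 / 16 * enorm v ^+ 2)).

(** A continuity argument without continuity in time. As long as the amplitude is at most 1, the
    supremum is brought back to a multiple of [c]; from such a small value the crude bound extends
    the amplitude 1 a little further in time. The extension step depends on [D], but finitely many
    of them reach [Tm], which does not. *)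
Lemma bootstrap B : propagates B -> exists lam Tm Cb cs : R,
  [/\ 0 < lam, 0 < Tm, lam * Tm <= 16^-1, 0 < Cb & 0 < cs /\ Cb * cs <= 1 /\
  forall g c, mild gam q0 Omega g -> B g -> gaussian_bounded g -> 0 <= c <= cs ->
    (forall x v, regular Omega x v -> `|g 0 x v| <= c * barrier lam 0 v) ->
    bounded_by lam g Tm (Cb * c)].
Proof.
move=> [Cf Cf1 hB]; have [C C0 hC] := collision_barrier.
have Cf0 : 0 < Cf by apply: lt_le_trans Cf1.
(* With this rate of relaxation the collision term costs A/8, and the memory of the old bound, taken
   with factor 1/8, another A/8; this is the A/4 in [improve]. *)
pose lam := 8 * C * Cf; have l0 : 0 < lam by rewrite !mulr_gt0.
have e8 : (0 : R) < 8^-1 by rewrite invr_gt0.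
have [eta eta0 h1] := hB lam 8^-1 l0 e8.
pose Tm := Num.min eta (16^-1 / lam).
have Tm0 : 0 < Tm by rewrite lt_min eta0 divr_gt0// invr_gt0.
have lTm : lam * Tm <= 16^-1.
  by rewrite mulrC -ler_pdivlMr// /Tm ge_min lexx orbT.
have Tme : Tm <= eta by rewrite /Tm ge_min lexx.
(* After a restart from amplitude 2 Cf c the propagated datum is at most 2 Cf^2 c, hence at most
   1/2; collisions and memory in [extend] share the other half. *)
pose cs : R := (4 * Cf ^+ 2)^-1.
have cs0 : 0 < cs by rewrite invr_gt0 mulr_gt0// exprn_gt0.
have csE : 4 * Cf ^+ 2 * cs = 1 by rewrite mulfV// gt_eqF// mulr_gt0// exprn_gt0.
exists lam, Tm, (2 * Cf), cs; split=> //; first by rewrite mulr_gt0.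
split=> //; split; first by have := mulr_gt0 Cf0 cs0; nra.
move=> g c mg Bg [D D0 hD] /andP[c0 ccs] hc.
have Cfc : 4 * Cf ^+ 2 * c <= 1 by rewrite -[leRHS]csE; apply: ler_wpM2l => //; rewrite mulr_ge0// exprn_ge0// ltW.
have Cfc' : 4 * Cf * c <= 1.
  by apply: le_trans Cfc; rewrite expr2; have := mulr_ge0 (ltW Cf0) c0; nra.
have lT T s : T <= Tm -> 0 <= s <= T -> 0 <= lam * s <= 16^-1.
  move=> TT /andP[s0 sT]; rewrite mulr_ge0 ?(ltW l0)//=; apply: le_trans lTm.
  by rewrite ler_pM2l// (le_trans sT).
have improve T A : 0 <= T <= Tm -> 0 <= A <= 1 -> bounded_by lam g T A ->
    bounded_by lam g T (Cf * c + A / 4).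
  move=> /andP[T0 TT] /andP[A0 A1] bA.
  have CA0 : 0 <= C * A / lam := divr_ge0 (mulr_ge0 (ltW C0) A0) (ltW l0).
  have K0 : 0 <= c + C * A / lam := addr_ge0 c0 CA0.
  have T1 : T <= 0 + eta by rewrite add0r (le_trans TT Tme).
  have lTT : lam * T <= 16^-1 by have /andP[] := lT T T TT ltac:(by rewrite T0 lexx).
  have hinit x v : regular Omega x v -> `|g 0 x v| <= (c + C * A / lam) * barrier lam 0 v.
    move=> r; apply: le_trans (hc _ _ r) _; by rewrite ler_pM2r ?barrier_gt0// lerDl.
  have hcoll t x v : 0 <= t <= T -> regular Omega x v -> `|collision gam q0 (g t x) v| <=
      (lam * (c + C * A / lam) * (1 + enorm v ^+ 2) + 0) * barrier lam t v.
    move=> tI r; apply: le_trans (hC _ lam t A x v (lT _ _ TT tI) _ r _) _.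
    - by rewrite A0 A1.
    - by move=> u ru; exact: bA.
    rewrite addr0 -[leRHS]mulrA ler_wpM2r ?mulr_ge0 ?expR_ge0 ?addr_ge0 ?sqr_ge0//.
    rewrite mulrDr [lam * (_ / _)]mulrC divfK ?gt_eqF// lerDr mulr_ge0// ltW//.
  have hcr t x v : 0 <= t <= T -> regular Omega x v -> `|g t x v| <= A * expR (- (enorm v ^+ 2 / 16)).
    move=> tI r; apply: le_trans (bA _ _ _ tI r) _; rewrite ler_wpM2l// barrier_le_gaussian//.
    by case/andP: (lT _ _ TT tI).
  move=> t x v tI r.
  apply: le_trans (h1 g 0 T _ 0 A mg Bg (lexx _) T0 T1 lTT K0 (lexx _) A0 hinit hcoll hcr t x v tI r) _.
  rewrite ler_wpM2r ?(ltW (barrier_gt0 _ _ _))// mul0r addr0.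
  rewrite le_eqVlt; apply/orP; left; apply/eqP; rewrite /lam; field.
  by rewrite (gt_eqF C0) (gt_eqF Cf0).
(* The least admissible amplitude is finite by assumption, so it satisfies S <= Cf c + S/4 and can
   be solved for. *)
have best T : 0 <= T <= Tm -> bounded_by lam g T 1 -> bounded_by lam g T (2 * Cf * c).
  move=> TI b1; pose S : set R := [set r | exists t x v,
    [/\ 0 <= t <= T, regular Omega x v & r = `|g t x v| / barrier lam t v]].
  have SU A : bounded_by lam g T A -> ubound S A.
    move=> bA _ [t [x [v [tI r ->]]]]; rewrite ler_pdivrMr ?barrier_gt0//; exact: bA.
  have [[r0 Sr0]|nS] := pselect (exists r, S r); last first.
    move=> t x v tI r; exfalso; apply: nS.
    by exists (`|g t x v| / barrier lam t v), t, x, v.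
  have hS : has_sup S by split; [exists r0|exists 1; exact: SU].
  have S0 : 0 <= sup S.
    apply: le_trans (ub_le_sup hS.2 Sr0).
    by case: Sr0 => t [x [v [_ _ ->]]]; rewrite divr_ge0// ltW// barrier_gt0.
  have S1 : sup S <= 1 by apply: ge_sup => //; [exists r0|exact: SU].
  have bS : bounded_by lam g T (sup S).
    move=> t x v tI r; rewrite -ler_pdivrMr ?barrier_gt0//.
    by apply: (ub_le_sup hS.2); exists t, x, v.
  have SS : sup S <= Cf * c + sup S / 4.
    by apply: ge_sup; [exists r0|apply: SU; apply: improve; rewrite ?S0].
  have Scf : sup S <= 2 * Cf * c by have := mulr_ge0 (ltW Cf0) c0; lra.
  move=> t x v tI r; apply: le_trans (bS _ _ _ tI r) _.
  by rewrite ler_wpM2r// ltW// barrier_gt0.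
have [B' B0 hB'] := collision_crude D0.
pose e' := (4 * (D + 1))^-1; have D1 : 0 < D + 1 by rewrite ltr_wpDl.
have e'0 : 0 < e' by rewrite invr_gt0 mulr_gt0.
have e'D : e' * D <= 4^-1.
  by rewrite /e' invfM -mulrA ger_pMr ?invr_gt0// mulrC ler_pdivrMr// mul1r lerDl.
have [eta2 eta20 h2] := hB lam e' l0 e'0.
pose eta' := Num.min eta2 (4 * Cf * (B' + 1))^-1.
have B1 : 0 < B' + 1 by rewrite ltr_wpDl.
have CB : 0 < 4 * Cf * (B' + 1) by rewrite !mulr_gt0.
have eta'0 : 0 < eta' by rewrite lt_min eta20 invr_gt0.
have extend T : 0 <= T <= Tm -> bounded_by lam g T 1 ->
    bounded_by lam g (Num.min (T + eta') Tm) 1.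
  move=> /[dup] TI /andP[T0 TT] b1; have b2 := best T TI b1.
  set T1 := Num.min _ _; have T1m : T1 <= Tm by rewrite /T1 ge_min lexx orbT.
  have T1T : T1 <= T + eta' by rewrite /T1 ge_min lexx.
  have TT1 : T <= T1 by rewrite /T1 le_min TT lerDl ltW.
  have T1e : T1 <= T + eta2.
    by apply: le_trans T1T _; rewrite lerD2l /eta' ge_min lexx.
  have K0 : 0 <= 2 * Cf * c by rewrite !mulr_ge0// ltW.
  have lT1 : lam * T1 <= 16^-1.
    by have /andP[] := lT T1 T1 T1m ltac:(by rewrite (le_trans T0)// lexx).
  have pos t : T <= t <= T1 -> 0 <= t <= T1 by move=> /andP[a ->]; rewrite (le_trans T0).
  have hinit x v : regular Omega x v -> `|g T x v| <= 2 * Cf * c * barrier lam T v.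
    by move=> r; apply: b2 => //; rewrite T0 lexx.
  have hcoll t x v : T <= t <= T1 -> regular Omega x v -> `|collision gam q0 (g t x) v| <=
      (lam * (2 * Cf * c) * (1 + enorm v ^+ 2) + B') * barrier lam t v.
    move=> /pos tI [cx _ _ _]; apply: le_trans (hB' (g t) lam t x v _ cx _) _.
    - by case/andP: (lT _ _ T1m tI).
    - by move=> u; apply: hD => //; case/andP: tI.
    rewrite ler_wpM2r ?(ltW (barrier_gt0 _ _ _))// lerDr.
    exact: mulr_ge0 (mulr_ge0 (ltW l0) K0) (addr_ge0 ler01 (sqr_ge0 _)).
  have hcr t x v : T <= t <= T1 -> regular Omega x v -> `|g t x v| <= D * expR (- (enorm v ^+ 2 / 16)).
    move=> /pos tI [cx _ _ _]; apply: le_trans (hD t x v _ cx) _; first by case/andP: tI.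
    by rewrite ler_wpM2l// ler_expR lerN2 mulrC ler_wpM2r ?sqr_ge0//; lra.
  move=> t x v tI r; have [tT|/ltW Tt] := leP t T.
    by apply: b1 => //; case/andP: tI => -> _.
  have tI' : T <= t <= T1 by rewrite Tt; case/andP: tI.
  apply: le_trans (h2 g T T1 _ B' D mg Bg T0 TT1 T1e lT1 K0 B0 D0 hinit hcoll hcr t x v tI' r) _.
  rewrite ler_wpM2r ?(ltW (barrier_gt0 _ _ _))//.
  have Bt : 4 * Cf * (B' * (t - T)) <= 1.
    have tT : t - T <= (4 * Cf * (B' + 1))^-1.
      rewrite lerBlDl; case/andP: tI' => _ /le_trans; apply; apply: le_trans T1T _.
      by rewrite lerD2l /eta' ge_min lexx orbT.
    have t0 : 0 <= t - T by rewrite subr_ge0.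
    have : 4 * Cf * (B' + 1) * (t - T) <= 1 by rewrite mulrC -ler_pdivlMr// div1r.
    by have := mulr_ge0 (ltW Cf0) t0; nra.
  by rewrite expr2 in Cfc; nra.
have base : bounded_by lam g 0 1.
  move=> t x v; rewrite -eq_le => /eqP <- r; apply: le_trans (hc _ _ r) _.
  rewrite ler_wpM2r ?(ltW (barrier_gt0 _ _ _))//.
  by apply: le_trans ccs _; rewrite /cs invf_le1 ?mulr_gt0 ?exprn_gt0//; nra.
have all n : bounded_by lam g (Num.min (eta' *+ n) Tm) 1.
  elim: n => [|n IH]; first by rewrite mulr0n (min_l (ltW Tm0)).
  have mI : 0 <= Num.min (eta' *+ n) Tm <= Tm.
    by rewrite le_min mulrn_wge0 ?(ltW eta'0)//= (ltW Tm0) ge_min lexx orbT.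
  move=> t x v /andP[t0 tn] r; apply: (extend _ mI IH) => //; rewrite t0 /=.
  move: tn; rewrite mulrSr le_min => /andP[t1 t2]; rewrite le_min t2 andbT.
  by have [h|h] := leP (eta' *+ n) Tm; [exact: t1|rewrite (le_trans t2)// lerDl ltW].
have [n hn] : exists n : nat, Tm <= eta' *+ n.
  exists (Num.truncn (Tm / eta')).+1; rewrite -mulr_natl -ler_pdivrMr// ltW//.
  exact: truncnS_gt.
apply: best; first by rewrite (ltW Tm0) lexx.
by have := all n; rewrite (min_r hn).
Qed.

End bootstrap.

(** * Propagation through the boundary conditions *)

Lemma le_1Dsqr (R : realType) (x : R) : x <= 1 + x ^+ 2.
Proof. nra. Qed.

Section boundary_conditions.
Context {R : realType} (gam : R) (hgam : 0 < gam <= 1) (q0 : R -> R)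
  (hq0m : measurable_fun (`[-1, 1]%classic : set R) q0)
  (hq0pos : forall c : R, -1 <= c <= 1 -> 0 <= q0 c)
  (hq0cut : forall u : 'rV[R]_3, enorm u = 1 ->
     (eint_sphere (fun omega => (q0 (dot u omega))%:E) < +oo)%E)
  (rho beta : R)
  (hw : (@lebesgue3 R).-integrable setT
     (fun p => ((weight rho beta (vec3 p))^-1 ^+ 2 *
                (1 + enorm (vec3 p)) ^+ 3)%:E))
  (Omega : set 'rV[R]_3)
  (hopen : open Omega) (hbounded : bounded_set Omega) (hsmooth : smooth_boundary Omega)
  (cmu : R) (hcmu_pos : 0 < cmu).

Local Notation phase_fun := (R -> 'rV[R]_3 -> 'rV[R]_3 -> R).

Definition absorbs (g : phase_fun) : Prop := forall t z v, 0 <= t ->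
  gamma_minus Omega (z, v) -> g t z v = 0.

Definition reflects (g : phase_fun) : Prop := forall t z v, 0 <= t ->
  gamma_minus Omega (z, v) -> g t z v = g t z (- v).

(** Again an estimate in place of an identity: bounds on the outgoing flux hold only for almost
    every velocity, and through a measurable majorant. *)
Definition diffuses (g : phase_fun) : Prop := forall t z v (b : R * R * R -> R) (I : R),
  0 <= t -> gamma_minus Omega (z, v) -> measurable_fun setT b -> (forall p, 0 <= b p) ->
  {ae leb3 R, forall p, 0 < dot (vec3 p) (normal Omega z) ->
     `|g t z (vec3 p)| * dot (normal Omega z) (vec3 p) <= b p} ->
  (\int[leb3 R]_p (b p)%:E <= I%:E)%E -> `|g t z v| <= cmu * mu v * I.

(* The outgoing velocities at a boundary point that have not yet reached the
   initial time are nearly tangential or very fast, by [uniform_chord]. *)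
Lemma outgoing_early e d t z w T : 0 < e -> 0 < d ->
  (forall x v s, bdry Omega x -> e * enorm v <= dot (normal Omega x) v -> 0 < s ->
     s * enorm v < d -> v != 0 -> Omega (x - s *: v)) ->
  bdry Omega z -> regular Omega z w -> 0 < dot (normal Omega z) w ->
  t_b Omega z w = T%:E -> T <= t ->
  dot (normal Omega z) w <= (e + t / d) * (1 + enorm w ^+ 2).
Proof.
move=> e0 d0 hd bz [cz g1 _ _] nz tT Tt.
have [v0 [T' [T0' + _ [bT /= nT]]]] := nongrazing_exit hopen hbounded hsmooth cz g1.
rewrite tT => -[eT]; rewrite -{}eT {T'} in T0' bT nT.
have nw : dot (normal Omega z) w <= enorm w.
  by have := dot_le (normal Omega z) w; rewrite (enorm_normal hopen hsmooth bz) mul1r.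
have w1 := le_1Dsqr (enorm w); have t0 : 0 <= t := le_trans T0' Tt.
have td0 : 0 <= t / d by rewrite divr_ge0 ?(ltW d0).
have [ne|en] := leP (dot (normal Omega z) w) (e * enorm w).
  by apply: le_trans ne _; apply: ler_pM => //; rewrite ?(ltW e0) ?enorm_ge0// lerDl.
have Tn : T != 0.
  by apply/eqP => Te; move: nT; rewrite Te scale0r subr0 => /(lt_trans nz); rewrite ltxx.
have T0'' : 0 < T by rewrite lt_def Tn.
have Tw : d <= T * enorm w.
  rewrite leNgt; apply/negP => h; have := hd z w T bz (ltW en) T0'' h v0.
  by case/(bdryP hopen): bT.
have ew : 0 < enorm w by rewrite enorm_gt0.
have dw : d <= t * enorm w by apply: le_trans Tw _; rewrite ler_pM2r.
apply: le_trans nw _; apply: le_trans (_ : t / d * enorm w ^+ 2 <= _).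
  rewrite expr2 mulrA -[leLHS]mul1r; apply: ler_wpM2r; first exact: enorm_ge0.
  by rewrite mulrAC ler_pdivlMr ?mul1r.
by apply: ler_pM; rewrite ?sqr_ge0 ?lerDr ?(ltW e0).
Qed.

(** * Transport and reflection over one time interval *)

Section propagation.
Variables (g : phase_fun) (lam T0 T1 K L : R).
Hypotheses (mg : mild gam q0 Omega g) (l0 : 0 < lam) (T00 : 0 <= T0) (K0 : 0 <= K) (L0 : 0 <= L).
Hypothesis hinit : forall x v, regular Omega x v -> `|g T0 x v| <= K * barrier lam T0 v.
Hypothesis hcoll : forall t x v, T0 <= t <= T1 -> regular Omega x v ->
  `|collision gam q0 (g t x) v| <= (lam * K * (1 + enorm v ^+ 2) + L) * barrier lam t v.

Lemma propagate_leg t s x v T : T0 <= s -> s <= t -> t <= T1 -> regular Omega x v ->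
  t_b Omega x v = T%:E -> t - s <= T ->
  `|g t x v| <= `|g s (x - (t - s) *: v) v| +
     (K * (barrier lam t v - barrier lam s v) + L * (t - s) * barrier lam t v).
Proof.
move=> T0s st tT1 r tT sT; have [cx _ _ _] := r.
have s0 := le_trans T00 T0s.
have tb : ((t - s)%:E <= t_b Omega x v)%E by rewrite tT lee_fin.
have hc tau : s <= tau <= t -> `|collision gam q0 (g tau (x - (t - tau) *: v)) v| <=
    (lam * K * (1 + enorm v ^+ 2) + L) * barrier lam tau v.
  move=> /andP[st' tt]; apply: hcoll; first by rewrite (le_trans T0s)// (le_trans tt).
  apply: (regular_shift hopen hbounded hsmooth r tT _).2; rewrite subr_ge0 tt /=.
  by apply: le_trans sT; rewrite lerB.
have h := leg_bound mg l0 K0 L0 s0 st cx tb hc.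
set G := g s _ v in h *; set E := expR _ in h.
rewrite -(subrK (E * G) (g t x v)); apply: le_trans (ler_normD _ _) _.
rewrite addrC; apply: lerD => //.
have [Cn Cn0 /(_ v)/andP[nu0 _]] := nu_bound hgam hq0m hq0pos hq0cut hw.
rewrite normrM ger0_norm ?expR_ge0//.
apply: le_trans (_ : 1 * `|G| <= _); last by rewrite mul1r.
apply: ler_wpM2r => //; rewrite -expR0 ler_expR mulNr oppr_le0 mulr_ge0// subr_ge0//.
Qed.

Let KL t v := (K + L * (t - T0)) * barrier lam t v.

Lemma propagate_free t x v T : T0 <= t <= T1 -> regular Omega x v ->
  t_b Omega x v = T%:E -> t - T0 <= T -> `|g t x v| <= KL t v.
Proof.
move=> /andP[T0t tT1] r tT tt; have [cx _ _ _] := r.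
apply: le_trans (propagate_leg (lexx _) T0t tT1 r tT tt) _.
have rr : regular Omega (x - (t - T0) *: v) v.
  by apply: (regular_shift hopen hbounded hsmooth r tT _).2; rewrite subr_ge0 T0t.
have := hinit rr; rewrite /KL; set a := barrier _ T0 _; set b := barrier _ t _.
set y := `|_|; lra.
Qed.

Lemma propagate_boundary A t x v T : T0 <= t <= T1 -> regular Omega x v ->
  t_b Omega x v = T%:E -> T <= t - T0 -> 0 <= A ->
  `|g (t - T) (x - T *: v) v| <= A * barrier lam (t - T) v ->
  `|g t x v| <= A * barrier lam t v + K * (barrier lam t v - barrier lam (t - T) v) +
     L * T * barrier lam t v.
Proof.
move=> /andP[T0t tT1] r tT Tt A0 hA; have [cx g1 _ _] := r.
have [_ [T' [T'0 + _ _]]] := nongrazing_exit hopen hbounded hsmooth cx g1.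
rewrite tT => -[e]; rewrite -e in T'0; clear e.
have sE : t - (t - T) = T by rewrite opprB addrC subrK.
have := propagate_leg (t := t) (s := t - T) (x := x) (v := v) (T := T).
rewrite sE lexx lerBrDl -lerBrDr => /(_ Tt) h.
have {}h := h _ tT1 r tT isT; apply: le_trans (h _) _; first by rewrite gerBl.
have := barrier_le v (ltW l0) (_ : t - T <= t); rewrite gerBl => /(_ T'0) bb.
have : A * barrier lam (t - T) v <= A * barrier lam t v by rewrite ler_wpM2l.
by lra.
Qed.

(** The terms in [K] telescope and those in [L] add up to the elapsed time, so the bound reproduces
    itself with factor exactly 1. Arbitrarily many bounces thus cost nothing. *)
Lemma propagate_KL t x v T : T0 <= t <= T1 -> regular Omega x v ->
  t_b Omega x v = T%:E -> T <= t - T0 ->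
  `|g (t - T) (x - T *: v) v| <= KL (t - T) v -> `|g t x v| <= KL t v.
Proof.
move=> tI r tT Tt hA; have [T0t tT1] := andP tI; have [cx g1 _ _] := r.
have [_ [T' [T'0 + _ _]]] := nongrazing_exit hopen hbounded hsmooth cx g1.
rewrite tT => -[e]; rewrite -e in T'0; clear e.
have sE : t - (t - T) = T by rewrite opprB addrC subrK.
have T0s : T0 <= t - T by lra.
have st : t - T <= t by lra.
have sT : t - (t - T) <= T by rewrite sE.
apply: le_trans (propagate_leg T0s st tT1 r tT sT) _; rewrite sE.
have := barrier_le v (ltW l0) st.
move: hA; rewrite /KL; set y := `|_|; set a := barrier _ (t - T) _; set b := barrier _ t _.
move=> hA ab.
have : L * (t - T - T0) * a <= L * (t - T - T0) * b.
  by apply: ler_wpM2l => //; rewrite mulr_ge0// subr_ge0.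
lra.
Qed.

Lemma barrierN s v : barrier lam s (- v) = barrier lam s v.
Proof. by rewrite /barrier enormN. Qed.

(** Induction on a bound for the number of bounces: all legs have the same duration [T], which is
    positive, so finitely many lead back to [T0]. *)
Lemma propagate_chord : reflects g -> forall n t z w T, T0 <= t <= T1 ->
  bdry Omega z -> 0 < dot (normal Omega z) w -> regular Omega z w ->
  t_b Omega z w = T%:E -> t - T0 <= T *+ n -> `|g t z w| <= KL t w.
Proof.
move=> rg; elim=> [|n IH] t z w T tI bz nz r tT tn; have [T0t tT1] := andP tI.
  have -> : t = T0 by move: tn; rewrite mulr0n; lra.
  by rewrite /KL subrr mulr0 addr0; exact: hinit.
have [tT'|Tt] := leP (t - T0) T; first exact: propagate_free tI r tT tT'.
have [T' [T'0 + gm tT' r']] := regular_chord hopen hbounded hsmooth bz nz r.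
rewrite tT => -[e]; subst T'.
apply: (propagate_KL tI r tT (ltW Tt)).
have t0 : 0 <= t - T by have := T00; lra.
have sI : T0 <= t - T <= T1 by apply/andP; split; lra.
have tn' : t - T - T0 <= T *+ n by move: tn; rewrite mulrSr; lra.
have [bz' /= nz'] := gm; rewrite (rg _ _ _ t0 gm) /KL -barrierN.
by apply: (IH (t - T) _ _ T) => //; rewrite dotNr oppr_gt0.
Qed.

Lemma propagate_reflects : reflects g ->
  forall t x v, T0 <= t <= T1 -> regular Omega x v -> `|g t x v| <= KL t v.
Proof.
move=> rg t x v tI r; have [T0t tT1] := andP tI; have [cx g1 _ _] := r.
have [_ [T [T0' tT _ gm]]] := nongrazing_exit hopen hbounded hsmooth cx g1.
have [tT'|Tt] := leP (t - T0) T; first exact: propagate_free tI r tT tT'.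
apply: (propagate_KL tI r tT (ltW Tt)).
have t0 : 0 <= t - T by have := T00; lra.
rewrite (rg _ _ _ t0 gm) /KL -barrierN; have [bz /= nz] := gm.
have rz : regular Omega (x - T *: v) (- v).
  by apply: regularN; apply: (regular_shift hopen hbounded hsmooth r tT _).2; rewrite T0' lexx.
have nz' : 0 < dot (normal Omega (x - T *: v)) (- v) by rewrite dotNr oppr_gt0.
have [T' [T'0 tT'' _ _ _]] := regular_chord hopen hbounded hsmooth bz nz' rz.
have [n hn] : exists n : nat, t - T0 <= T' *+ n.
  exists (Num.truncn ((t - T0) / T')).+1; rewrite -mulr_natl -ler_pdivrMr// ltW//.
  exact: truncnS_gt.
apply: (propagate_chord rg (n := n) _ bz nz' rz tT''); first by apply/andP; split; lra.
lra.
Qed.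

Lemma propagate_absorbs : absorbs g ->
  forall t x v, T0 <= t <= T1 -> regular Omega x v -> `|g t x v| <= KL t v.
Proof.
move=> rg t x v tI r; have [T0t tT1] := andP tI; have [cx g1 _ _] := r.
have [_ [T [T0' tT _ gm]]] := nongrazing_exit hopen hbounded hsmooth cx g1.
have [tT'|Tt] := leP (t - T0) T; first exact: propagate_free tI r tT tT'.
apply: (propagate_KL tI r tT (ltW Tt)).
have t0 : 0 <= t - T by have := T00; lra.
rewrite (rg _ _ _ t0 gm) normr0 /KL mulr_ge0 ?(ltW (barrier_gt0 _ _ _))//.
by rewrite addr_ge0// mulr_ge0//; lra.
Qed.

(** Velocities traced back to [T0] inside the domain carry the good bound. The others have only the
    crude bound [D], but by [outgoing_early] their normal component is small against 1 + |w|^2. *)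
Lemma outgoing_bound e d D t z w : 0 < e -> 0 < d ->
  (forall x v s, bdry Omega x -> e * enorm v <= dot (normal Omega x) v -> 0 < s ->
     s * enorm v < d -> v != 0 -> Omega (x - s *: v)) ->
  0 <= D -> lam * T1 <= 16^-1 ->
  (forall t x v, T0 <= t <= T1 -> regular Omega x v ->
       `|g t x v| <= D * expR (- (enorm v ^+ 2 / 16))) ->
  T0 <= t <= T1 -> bdry Omega z -> regular Omega z w -> 0 < dot (normal Omega z) w ->
  `|g t z w| * dot (normal Omega z) w <=
    (K + L * (t - T0) + D * (e + (t - T0) / d)) * ((1 + enorm w ^+ 2) * expR (- (enorm w ^+ 2 / 16))).
Proof.
move=> e0 d0 hd D0 lT hcr tI bz r nz; have [T0t tT1] := andP tI.
have [cz g1 _ _] := r.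
have [v0 [T [T0' tT _ [bT /= nT]]]] := nongrazing_exit hopen hbounded hsmooth cz g1.
have nw : dot (normal Omega z) w <= enorm w.
  by have := dot_le (normal Omega z) w; rewrite (enorm_normal hopen hsmooth bz) mul1r.
have w1 := le_1Dsqr (enorm w).
set E := expR _; have E0 : 0 <= E by exact: expR_ge0.
have KL0 : 0 <= K + L * (t - T0) by rewrite addr_ge0// mulr_ge0// subr_ge0.
have De0 : 0 <= D * (e + (t - T0) / d).
  by rewrite mulr_ge0// addr_ge0 ?(ltW e0)// divr_ge0 ?(ltW d0)// subr_ge0.
have q0' : 0 <= 1 + enorm w ^+ 2 by rewrite addr_ge0 ?sqr_ge0.
have lt : lam * t <= 16^-1 by apply: le_trans lT; rewrite ler_pM2l.
have [tT'|Tt] := leP (t - T0) T.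
  have := propagate_free tI r tT tT'; rewrite /KL => h.
  apply: le_trans (_ : (K + L * (t - T0)) * E * (1 + enorm w ^+ 2) <= _).
    apply: ler_pM => //; [exact: ltW| |exact: le_trans nw w1].
    by apply: le_trans h _; rewrite ler_wpM2l// barrier_le_gaussian.
  by rewrite -(mulrA (K + L * (t - T0))) [E * _]mulrC; apply: ler_wpM2r; [exact: mulr_ge0|rewrite lerDl].
have hn := outgoing_early e0 d0 hd bz r nz tT (ltW Tt).
apply: le_trans (_ : D * E * ((e + (t - T0) / d) * (1 + enorm w ^+ 2)) <= _).
  by apply: ler_pM => //; [exact: ltW|exact: hcr].
rewrite (_ : D * E * _ = D * (e + (t - T0) / d) * ((1 + enorm w ^+ 2) * E)); last by ring.
by apply: ler_wpM2r; [exact: mulr_ge0|rewrite lerDr].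
Qed.

End propagation.

Local Notation propagates := (propagates gam q0 Omega).

Lemma absorbs_propagates : propagates absorbs.
Proof.
exists 1 => // lam e l0 e0; exists 1 => // g T0 T1 K L D mg Bg T00 _ _ _ K0 L0 D0 h1 h2 _ t x v tI r.
apply: le_trans (propagate_absorbs mg l0 T00 K0 L0 h1 h2 Bg tI r) _.
by rewrite mul1r ler_wpM2r ?(ltW (barrier_gt0 _ _ _))// lerDl mulr_ge0// ltW.
Qed.

Lemma reflects_propagates : propagates reflects.
Proof.
exists 1 => // lam e l0 e0; exists 1 => // g T0 T1 K L D mg Bg T00 _ _ _ K0 L0 D0 h1 h2 _ t x v tI r.
apply: le_trans (propagate_reflects mg l0 T00 K0 L0 h1 h2 Bg tI r) _.
by rewrite mul1r ler_wpM2r ?(ltW (barrier_gt0 _ _ _))// lerDl mulr_ge0// ltW.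
Qed.

(** One reflection is enough: in the flux at the wall, the velocities with a further bounce behind
    them contribute little, so their history is left in the term with [D]. The factor [C] comes from
    the wall, the added 1 from the leg after it. *)
Lemma diffuses_propagates : propagates diffuses.
Proof.
have [Cg Cg0 hCg] := gaussian_moment hw.
pose C := cmu * expR 8^-1 * Cg.
have C0 : 0 <= C by rewrite !mulr_ge0 ?expR_ge0// ltW.
have C1 : 0 < C + 1 by rewrite ltr_wpDl.
exists (C + 1) => [|lam e l0 e0]; first by rewrite lerDr.
(* Tangential and fast velocities contribute e' each, the latter thanks to the time step [d * e'];
   multiplied by C + 1 they make up [e]. *)
pose e' := e / (2 * (C + 1)); have e'0 : 0 < e' by rewrite divr_gt0// mulr_gt0.
have [d d0 hd] := uniform_chord hopen hbounded hsmooth e'0.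
exists (d * e') => [|g T0 T1 K L D mg Bg T00 TT1 T1e lT K0 L0 D0 h1 h2 h3 t x v tI r].
  by rewrite mulr_gt0.
have bd s z w : T0 <= s <= T1 -> gamma_minus Omega (z, w) ->
    `|g s z w| <= (C * (K + L * (s - T0)) + e * D) * barrier lam s w.
  move=> sI gm; have [T0s sT1] := andP sI; have [bz _] := gm.
  have [G [mG aG hG]] := ae_regular hopen hbounded hsmooth (bz.1).
  set A := K + L * (s - T0) + D * (e' + (s - T0) / d).
  have sd : (s - T0) / d <= e' by rewrite ler_pdivrMr// mulrC; lra.
  have A0 : 0 <= A.
    have sT0 : 0 <= s - T0 by rewrite subr_ge0.
    exact: addr_ge0 (addr_ge0 K0 (mulr_ge0 L0 sT0))
      (mulr_ge0 D0 (addr_ge0 (ltW e'0) (divr_ge0 sT0 (ltW d0)))).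
  have AA : A <= K + L * (s - T0) + D * (2 * e') by rewrite lerD2l ler_wpM2l//; lra.
  have s0 : 0 <= s := le_trans T00 T0s.
  apply: le_trans (Bg s z w (fun p => A * ((1 + enorm (vec3 p) ^+ 2) *
      expR (- (enorm (vec3 p) ^+ 2 / 16)))) (A * Cg) s0 gm _ _ _ _) _.
  - by have mE := mf_enorm_vec3 (@measurable_id _ (R * R * R)%type setT); meas.
  - by move=> p; exact: mulr_ge0 A0 (mulr_ge0 (addr_ge0 ler01 (sqr_ge0 _)) (expR_ge0 _)).
  - apply: (aeS aG) => p /hG rp np.
    by apply: (outgoing_bound mg l0 T00 K0 L0 h1 h2 e'0 d0 hd D0 lT h3 sI bz rp); rewrite dotC.
  - under eq_integral do rewrite EFinM.
    rewrite ge0_integralZl//=; first by rewrite EFinM; apply: lee_wpmul2l => //; rewrite lee_fin.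
      by apply/EFin_measurable; have mE := mf_enorm_vec3 (@measurable_id _ (R * R * R)%type setT); meas.
    by move=> p _; rewrite lee_fin; exact: (mulr_ge0 (addr_ge0 ler01 (sqr_ge0 _)) (expR_ge0 _)).
  have ls : 0 <= lam * s by rewrite mulr_ge0// ltW.
  apply: le_trans (_ : cmu * (expR 8^-1 * barrier lam s w) * (A * Cg) <= _).
    by rewrite ler_wpM2r ?mulr_ge0// ler_wpM2l ?(ltW hcmu_pos)// mu_le_barrier.
  rewrite (_ : cmu * _ * _ = C * A * barrier lam s w); last by rewrite /C; ring.
  rewrite ler_wpM2r ?(ltW (barrier_gt0 _ _ _))//.
  apply: le_trans (ler_wpM2l C0 AA) _; rewrite mulrDr lerD2l.
  have -> : e * D = (C + 1) * (D * (2 * e')) by rewrite /e'; field; rewrite gt_eqF.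
  apply: ler_wpM2r; last by rewrite lerDl.
  exact: mulr_ge0 D0 (mulr_ge0 (ltW (ltr0Sn _ 1)) (ltW e'0)).
have [T0t tT1] := andP tI; have [cx g1 _ _] := r.
have [_ [T [T0' tT _ gm]]] := nongrazing_exit hopen hbounded hsmooth cx g1.
have W0 := barrier_gt0 lam t v.
have eD : 0 <= e * D by rewrite mulr_ge0// ltW.
have KL0 : 0 <= K + L * (t - T0) by rewrite addr_ge0// mulr_ge0// subr_ge0.
have [tT'|Tt] := leP (t - T0) T.
  apply: le_trans (propagate_free mg l0 T00 K0 L0 h1 h2 tI r tT tT') _.
  rewrite ler_wpM2r ?(ltW W0)//; have := mulr_ge0 C0 KL0; lra.
have sI : T0 <= t - T <= T1 by apply/andP; split; lra.
have KL0s : 0 <= K + L * (t - T - T0) by rewrite addr_ge0// mulr_ge0//; lra.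
have A0 : 0 <= C * (K + L * (t - T - T0)) + e * D by rewrite addr_ge0// mulr_ge0.
apply: le_trans (propagate_boundary mg l0 T00 K0 L0 h2 tI r tT (ltW Tt) A0 (bd _ _ _ sI gm)) _.
have K1 : K * (barrier lam t v - barrier lam (t - T) v) <= K * barrier lam t v.
  by rewrite ler_wpM2l// gerBl ltW// barrier_gt0.
set W := barrier lam t v in W0 K1 *.
have LT : 0 <= L * T * W by rewrite !mulr_ge0// ltW.
have CLT : 0 <= C * (L * T * W) by rewrite mulr_ge0.
have KW : 0 <= L * (t - T - T0) * W by rewrite !mulr_ge0//; lra.
by rewrite /= in KL0s *; nra.
Qed.

End boundary_conditions.

(** * Initial data *)

Section bump.
Context {R : realType}.
Implicit Types (p x v : 'rV[R]_3) (r c : R).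

(** The positive part of 1 - |x - p|^2 / r^2, written with an absolute value so that continuity and
    measurability are immediate. *)
Definition bump p r x : R :=
  let a := 1 - dot (x - p) (x - p) / r ^+ 2 in (a + `|a|) / 2.

Lemma bump_ge0 p r x : 0 <= bump p r x.
Proof. by rewrite /bump /=; set a := 1 - _; rewrite divr_ge0//; have := ler_norm (- a); rewrite normrN; lra. Qed.

Lemma bump_le1 p r x : bump p r x <= 1.
Proof.
rewrite /bump /=; set b := dot _ _ / _; have b0 : 0 <= b by rewrite divr_ge0 ?dot_ge0 ?sqr_ge0.
by rewrite ler_pdivrMr// mul1r; case: (ger0P (1 - b)); lra.
Qed.

Lemma bump_out p r x : 0 < r -> r <= enorm (x - p) -> bump p r x = 0.
Proof.
move=> r0 rx; rewrite /bump /= -enorm_sqr; set b := enorm _ ^+ 2 / _.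
have b1 : 1 <= b by rewrite ler_pdivlMr ?exprn_gt0// mul1r ler_sqr ?nnegrE ?(ltW r0) ?enorm_ge0.
by rewrite ler0_norm ?subr_le0// subrr mul0r.
Qed.

Lemma bump_half p r x : 0 < r -> enorm (x - p) <= r / 2 -> 3 / 4 <= bump p r x.
Proof.
move=> r0 rx; rewrite /bump /= -enorm_sqr; set b := enorm _ ^+ 2 / _.
have b1 : b <= 4^-1.
  rewrite ler_pdivrMr ?exprn_gt0//.
  have : enorm (x - p) ^+ 2 <= (r / 2) ^+ 2.
    by rewrite ler_sqr ?nnegrE ?enorm_ge0 ?divr_ge0 ?(ltW r0).
  by rewrite !expr2; lra.
by rewrite ger0_norm; lra.
Qed.

Lemma continuous_dot (T : topologicalType) (f g : T -> 'rV[R]_3) :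
  continuous f -> continuous g -> continuous (fun t => dot (f t) (g t)).
Proof.
move=> cf cg t; rewrite (_ : (fun _ => _) = fun t => f t 0 i0 * g t 0 i0 + f t 0 i1 * g t 0 i1 + f t 0 i2 * g t 0 i2).
  have cc i : (fun t => f t 0 i * g t 0 i) @ t --> f t 0 i * g t 0 i.
    by apply: cvgM; [apply: (@continuous_comp _ _ _ f (fun x : 'rV[R]_3 => x 0 i))
      |apply: (@continuous_comp _ _ _ g (fun x : 'rV[R]_3 => x 0 i))];
      first [exact: cf|exact: cg|exact: coord_continuous].
  exact: (cvgD (cvgD (cc i0) (cc i1)) (cc i2)).
by apply/funext => s; rewrite dotE.
Qed.

Lemma continuous_bump p r : continuous (bump p r).
Proof.
have cd : continuous (fun x => dot (x - p) (x - p)).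
  by apply: continuous_dot => x; apply: (@cvgB _ _ _ (nbhs x)); first [exact: cvg_id|exact: cvg_cst].
have ca : continuous (fun x => 1 - dot (x - p) (x - p) / r ^+ 2).
  move=> x; apply: (@cvgB _ _ _ (nbhs x)); first exact: cvg_cst.
  by apply: (@cvgM _ _ (nbhs x)); [exact: cd|exact: cvg_cst].
move=> x; apply: (@cvgM _ _ (nbhs x)); last exact: cvg_cst.
by apply: (@cvgD _ _ _ (nbhs x)); [exact: ca|apply: cvg_norm; exact: ca].
Qed.

Lemma continuous_mu : continuous (@mu R).
Proof.
have cd : continuous (fun x : 'rV[R]_3 => - dot x x / 2).
  move=> x; apply: (@cvgM _ _ (nbhs x)); last exact: cvg_cst.
  by apply: cvgN; apply: continuous_dot => y; exact: cvg_id.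
rewrite (_ : @mu R = fun v => expR (- dot v v / 2)); last first.
  by apply/funext => v; rewrite /mu enorm_sqr.
by move=> x; apply: (@continuous_comp _ _ _ (fun x : 'rV[R]_3 => - dot x x / 2) expR);
  [exact: cd|exact: continuous_expR].
Qed.

Lemma mf_dot_vec3 d (T : measurableType d) (f g : T -> R * R * R) p q :
  measurable_fun setT f -> measurable_fun setT g ->
  measurable_fun setT (fun t => dot (vec3 (f t) - p) (vec3 (g t) - q)).
Proof.
move=> mf mg; rewrite (_ : (fun _ => _) = fun t =>
  ((f t).1.1 - p 0 i0) * ((g t).1.1 - q 0 i0) + ((f t).1.2 - p 0 i1) * ((g t).1.2 - q 0 i1)
  + ((f t).2 - p 0 i2) * ((g t).2 - q 0 i2)); first by meas.
by apply/funext => t; rewrite dotE !mxE.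
Qed.

Lemma mf_bump d (T : measurableType d) (f : T -> R * R * R) p r :
  measurable_fun setT f -> measurable_fun setT (fun t => bump p r (vec3 (f t))).
Proof. by move=> mf; rewrite /bump; have m := mf_dot_vec3 p p mf mf; meas. Qed.

Lemma mf_mu d (T : measurableType d) (f : T -> R * R * R) :
  measurable_fun setT f -> measurable_fun setT (fun t => mu (vec3 (f t))).
Proof. by move=> mf; rewrite /mu; have m := mf_enorm_vec3 mf; meas. Qed.

Definition bump_datum c p r1 q r2 x v : R := mu v + c * (bump p r1 x * bump q r2 v).

Lemma bump_datum_measurable (Omega : set 'rV[R]_3) c p r1 q r2 :
  measurable_datum Omega (bump_datum c p r1 q r2).
Proof.
move=> mD; apply: (measurable_funS measurableT (@subsetT _ _) _ mD).
rewrite /bump_datum.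
have m1 := @mf_mu _ (((R * R * R) * (R * R * R))%type) snd ltac:(meas).
have m2 := @mf_bump _ (((R * R * R) * (R * R * R))%type) fst p r1 ltac:(meas).
have m3 := @mf_bump _ (((R * R * R) * (R * R * R))%type) snd q r2 ltac:(meas).
by meas.
Qed.

Lemma bump_datum_continuous (Omega : set 'rV[R]_3) c p r1 q r2 :
  continuous_datum Omega (bump_datum c p r1 q r2).
Proof.
apply: continuous_subspaceT => z; apply: cvgD.
  by apply: (@continuous_comp _ _ _ snd (@mu R)); [exact: cvg_snd|exact: continuous_mu].
apply: cvgM; first exact: cvg_cst.
apply: cvgM.
  by apply: (@continuous_comp _ _ _ fst (bump p r1)); [exact: cvg_fst|exact: continuous_bump].
by apply: (@continuous_comp _ _ _ snd (bump q r2)); [exact: cvg_snd|exact: continuous_bump].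
Qed.

End bump.

(** * Density of sets of full measure, and lower bounds for jumps *)

Lemma ae_near (R : realType) (P : R -> Prop) : {ae leb R, forall x, P x} ->
  forall a e : R, 0 < e -> exists2 x, `|x - a| < e & P x.
Proof.
move=> [N [mN N0 PN]] a e e0; apply: contrapT => nex.
have sub : `]a - e, a + e[%classic `<=` N.
  move=> x; rewrite /= in_itv /= => /andP[x1 x2]; apply: PN => Px; apply: nex; exists x => //.
  by rewrite ltr_norml; apply/andP; split; lra.
pose I : set R := `]a - e, a + e[%classic; have le : (leb R I <= leb R N)%E.
  by apply: le_measure => //; rewrite inE; [exact: measurable_itv|exact: mN].
move: le; rewrite (_ : leb R N = 0%E); last exact: N0.
rewrite /I lebesgue_measure_itv /= lte_fin ifT; last by lra.
by rewrite -EFinB lee_fin; lra.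
Qed.

Lemma ae_near3 (R : realType) (P : R * R * R -> Prop) : {ae leb3 R, forall p, P p} ->
  forall (v : 'rV[R]_3) (e : R), 0 < e -> exists2 p, enorm (vec3 p - v) < e & P p.
Proof.
move=> /ae_measurable_set[G [mG /(ae_lebesgue3 mG) aG GP]] v e e0.
have e3 : 0 < e / 3 by rewrite divr_gt0.
have [x hx /ae_near hy] := ae_near aG (v 0 i0) e3.
have [y {}hy /ae_near hz] := hy (v 0 i1) _ e3.
have [z {}hz Gz] := hz (v 0 i2) _ e3.
exists (x, y, z); last exact: GP.
by apply: le_lt_trans (enorm_le_sum _) _; rewrite !mxE /=; lra.
Qed.

(** The supremum is monotone in the radius, so the limit exists; only then does a bound at every
    radius pass to [lim], which takes a default value on divergent families. *)
Lemma jump_lower_bound (R : realType) (Omega : set 'rV[R]_3) phi (t : R) x v (k : R) : 0 < k ->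
  (forall d, 0 < d -> exists q1 q2, [/\ jump_nbhd Omega (x, v) d q1, jump_nbhd Omega (x, v) d q2 &
     k <= `|phi t q1.1 q1.2 - phi t q2.1 q2.2|]) ->
  discontinuous_at Omega phi t x v.
Proof.
move=> k0 h; rewrite /discontinuous_at /jump.
set S := fun d : R => nnsup _.
have S_mono : {homo S : a b / a <= b >-> (a <= b)%E}.
  move=> a b ab; apply: le_ereal_sup => z [->|]; first by left.
  move=> [q1 [q2 [[c1 g1 p1 n1] [c2 g2 p2 n2] ->]]]; right; exists q1, q2; split=> //.
    by split=> //; exact: lt_le_trans ab.
  by split=> //; exact: lt_le_trans ab.
have cS : cvg (S d @[d --> 0^'+]).
  apply: nondecreasing_at_right_is_cvge; near=> y => a b _ _; exact: S_mono.
have : (k%:E <= lim (S d @[d --> 0^'+]))%E.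
  apply: lime_ge => //; near=> d; have d0 : 0 < d by near: d; exact: nbhs_right_gt.
  have [q1 [q2 [n1 n2 hk]]] := h d d0.
  apply: le_trans (_ : (`|phi t q1.1 q1.2 - phi t q2.1 q2.2|%:E <= _)%E); first by rewrite lee_fin.
  by apply: ereal_sup_ubound; right; exists q1, q2.
by move=> /[swap] ->; rewrite lee_fin leNgt k0.
Unshelve. all: by end_near. Qed.

(** * From Boltzmann solutions to estimates for the perturbation *)

Section solution_boundary.
Context {R : realType} (gam : R) (q0 : R -> R) (rho beta : R)
  (hw : (@lebesgue3 R).-integrable setT
     (fun p => ((weight rho beta (vec3 p))^-1 ^+ 2 *
                (1 + enorm (vec3 p)) ^+ 3)%:E))
  (Omega : set 'rV[R]_3)
  (hopen : open Omega) (hbounded : bounded_set Omega) (hsmooth : smooth_boundary Omega)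
  (cmu : R) (hcmu_pos : 0 < cmu)
  (hcmu : forall x, bdry Omega x ->
     cmu * int3 [set v' | 0 < dot v' (normal Omega x)]
                (fun v' => mu v' * `|dot (normal Omega x) v'|) = 1).

Lemma sqmuE (v : 'rV[R]_3) : sqmu v = expR (- (4^-1 * enorm v ^+ 2)).
Proof.
rewrite /sqmu (_ : mu v = expR (- (4^-1 * enorm v ^+ 2)) ^+ 2).
  by rewrite sqrtr_sqr ger0_norm// expR_ge0.
by rewrite expr2 -expRD; congr expR; lra.
Qed.

Lemma solution_gaussian_bounded BC F0 F : boltzmann_solution gam q0 rho beta Omega BC F0 F ->
  gaussian_bounded Omega (pert F).
Proof.
move=> [_ [M hM] _ _ _].
have e0 : (0 : R) < 16^-1 by rewrite invr_gt0.
have [K K0 hK] := weightV_le_gaussian rho beta e0.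
exists (`|M| * K) => [|t x v t0 cx]; first by rewrite mulr_ge0// ltW.
have w0 := weight_gt0 rho beta v; have s0 := sqmu_gt0 v.
have := hM t x v t0 cx; rewrite /wpert -/(pert F t x v).
rewrite normrM (gtr0_norm w0) normf_div (gtr0_norm s0) => h.
have : `|pert F t x v| <= M * (sqmu v / weight rho beta v).
  rewrite mulrA ler_pdivlMr// -ler_pdivrMr//; apply: le_trans h.
  by rewrite mulrA (mulrC (weight _ _ _)).
move=> /le_trans; apply.
have sw : 0 <= sqmu v / weight rho beta v by rewrite divr_ge0// ltW.
apply: le_trans (ler_wpM2r sw (ler_norm M)) _; rewrite -(mulrA `|M|); apply: ler_wpM2l => //.
rewrite mulrC; apply: le_trans (ler_wpM2r (ltW s0) (hK v)) _.
rewrite sqmuE -(mulrA K) -expRD; apply: ler_wpM2l; [exact: ltW|rewrite ler_expR].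
by set q := enorm v ^+ 2; lra.
Qed.

Lemma inflow_absorbs F : inflow_bc Omega (fun _ _ v => mu v) F -> absorbs Omega (pert F).
Proof. by move=> h t z v t0 gm; rewrite /pert (h t z v t0 gm) subrr. Qed.

Lemma bounceback_reflects F : bounceback_bc Omega F -> reflects Omega (pert F).
Proof. by move=> h t z v t0 gm; rewrite /pert (h t z v t0 gm) /mu enormN. Qed.

Lemma closure_measurable : measurable [set p : R * R * R | closure Omega (vec3 p)].
Proof.
rewrite -[X in measurable X]setCK; apply: measurableC.
apply: (@open_measurable_vec3 _ (~` closure Omega)).
by apply: closed_openC; exact: closed_closure.
Qed.

Lemma section_measurable F t z : measurable_sol Omega F -> 0 <= t -> closure Omega z ->
  measurable_fun setT (fun p => F t z (vec3 p)).
Proof.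
move=> mF t0 cz.
pose D := [set p : R * ((R * R * R) * (R * R * R)) | 0 <= p.1 /\ closure Omega (vec3 p.2.1)].
have mf : measurable_fun setT (fun p : R * ((R * R * R) * (R * R * R)) => p.2.1) by meas.
have mf1 : measurable_fun setT (fun p : R * ((R * R * R) * (R * R * R)) => p.1) by meas.
have mD : measurable D.
  rewrite (_ : D = (setT `&` (fun p => p.1) @^-1` `[0, +oo[%classic) `&`
      (setT `&` (fun p => p.2.1) @^-1` [set p | closure Omega (vec3 p)])).
    apply: measurableI; first by apply: mf1 => //; exact: measurable_itv.
    by apply: mf => //; exact: closure_measurable.
  by apply/seteqP; split => p /=; rewrite in_itv /= andbT => -[]; [move=> a b|move=> [_ a] [_ b]].
have mg : measurable_fun setT (fun p : R * R * R => (t, (coords z, p))) by meas.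
have := @measurable_comp _ _ _ _ _ _ D _ setT _ mD _ mF mg.
have sub : range (fun p : R * R * R => (t, (coords z, p))) `<=` D.
  by move=> _ [p _ <-]; split=> //=; rewrite vec3K.
move=> /(_ sub); rewrite (_ : _ \o _ = fun p => F t z (vec3 p))//.
by apply/funext => p /=; rewrite vec3K.
Qed.

(** By [hcmu] the Maxwellian is reflected into itself, so the perturbation equals the reflected
    difference of two fluxes. Writing it as one integral requires integrability of both, hence
    measurability of [F] and the Gaussian bound. *)
Lemma diffuse_diffuses F : measurable_sol Omega F -> gaussian_bounded Omega (pert F) ->
  diffuse_bc cmu Omega F -> diffuses Omega cmu (pert F).
Proof.
move=> mF [D D0 hD] hF t z v b I t0 gm mb b0 hb hI.
have [bz _] := gm; have cz : closure Omega z by case: bz.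
set n := normal Omega z in hb *.
pose A := [set p : R * R * R | 0 < dot (vec3 p) n].
have mdot : measurable_fun setT (fun p : R * R * R => dot n (vec3 p)).
  have := @mf_dot_vec3 R _ (R * R * R)%type (fun _ => coords n) id 0 0 ltac:(meas) ltac:(meas).
  by apply: eq_measurable_fun => p _; rewrite !subr0 vec3K.
have mA : measurable A.
  rewrite (_ : A = (fun p => dot n (vec3 p)) @^-1` `]0, +oo[%classic); last first.
    by apply/seteqP; split => p /=; rewrite /A /= in_itv /= andbT dotC.
  by rewrite -[X in measurable X]setTI; apply: mdot => //; exact: measurable_itv.
have [Cg Cg0 hCg] := gaussian_moment hw.
have mE := mf_enorm_vec3 (@measurable_id _ (R * R * R)%type setT).
have nn (p : R * R * R) : 0 <= (1 + enorm (vec3 p) ^+ 2) * expR (- (enorm (vec3 p) ^+ 2 / 16)).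
  exact: mulr_ge0 (addr_ge0 ler01 (sqr_ge0 _)) (expR_ge0 _).
have dom (f : R * R * R -> R) (K : R) : measurable_fun setT f ->
    (forall p, `|f p| <= K * expR (- (enorm (vec3 p) ^+ 2 / 16))) ->
    (leb3 R).-integrable A (fun p => (f p * dot n (vec3 p))%:E).
  move=> mf hf; apply: (@integrableS _ _ _ _ setT) => //.
  apply: (@le_integrable _ _ _ (leb3 R) setT measurableT _ (fun p => (K%:E *
    ((1 + enorm (vec3 p) ^+ 2) * expR (- (enorm (vec3 p) ^+ 2 / 16)))%:E)%E)).
  - by apply/EFin_measurable; meas.
  - move=> p _; rewrite -EFinM !abse_EFin lee_fin [leRHS]ger0_norm; last first.
      apply: mulr_ge0; last exact: mulr_ge0 (addr_ge0 ler01 (sqr_ge0 _)) (expR_ge0 _).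
      by have := le_trans (normr_ge0 _) (hf p); rewrite pmulr_lge0 ?expR_gt0.
    rewrite normrM mulrCA mulrC.
    apply: le_trans (_ : (1 + enorm (vec3 p) ^+ 2) * (K * expR (- (enorm (vec3 p) ^+ 2 / 16))) <= _).
      apply: ler_pM => //; apply: le_trans (normr_dot_le _ _) _.
      by rewrite (enorm_normal hopen hsmooth bz) mul1r le_1Dsqr.
    by rewrite mulrCA.
  apply: integrableZl => //; apply/integrableP; split; first by apply/EFin_measurable; meas.
  under eq_integral => p _ do rewrite abse_EFin ger0_norm ?nn//.
  exact: le_lt_trans hCg (ltry _).
have mFz := section_measurable mF t0 cz.
have mmu := mf_mu (@measurable_id _ (R * R * R)%type setT).
have mu1 (p : R * R * R) : `|mu (vec3 p)| <= 1 * expR (- (enorm (vec3 p) ^+ 2 / 16)).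
  by rewrite mul1r ger0_norm ?mu_ge0// [_ / _]mulrC mu_le_gaussian//; lra.
have F1 p : `|F t z (vec3 p)| <= (1 + D) * expR (- (enorm (vec3 p) ^+ 2 / 16)).
  rewrite -(subrK (mu (vec3 p)) (F t z (vec3 p))); apply: le_trans (ler_normD _ _) _.
  rewrite addrC mulrDl; apply: lerD; first exact: mu1.
  apply: le_trans (hD t z (vec3 p) t0 cz) _.
  by rewrite ler_wpM2l// ler_expR lerN2 mulrC ler_wpM2r ?sqr_ge0//; lra.
have intF := dom _ _ mFz F1; have intmu := dom _ _ mmu mu1.
have out1 : outflux Omega z (F t z) = \int[leb3 R]_(p in A) (F t z (vec3 p) * dot n (vec3 p)) by [].
have mu1' : cmu * \int[leb3 R]_(p in A) (mu (vec3 p) * dot n (vec3 p)) = 1.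
  rewrite -(hcmu bz) /int3; congr (_ * _); apply: eq_Rintegral => p.
  by rewrite inE /A /= dotC => np; rewrite (gtr0_norm np).
have -> : pert F t z v = cmu * mu v *
    \int[leb3 R]_(p in A) (F t z (vec3 p) * dot n (vec3 p) - mu (vec3 p) * dot n (vec3 p)).
  have alg (a m o b' : R) : a * b' = 1 -> a * m * (o - b') = a * m * o - m.
    by move=> h; rewrite mulrBr -(mulrA a m b') mulrCA h mulr1.
  by rewrite RintegralB// alg// -out1 /pert (hF t z v t0 gm).
have cm0 : 0 <= cmu * mu v by rewrite mulr_ge0 ?mu_ge0// ltW.
rewrite normrM ger0_norm//; apply: ler_wpM2l => //.
apply: (@normr_Rintegral_le_ae _ _ _ (leb3 R) A _ (fun p => (b p)%:E)) => //.
- by move=> p _; rewrite lee_fin.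
- by apply: (measurable_funS measurableT (@subsetT _ _)); apply/EFin_measurable.
- apply: (aeS hb) => p hp Ap; rewrite -mulrBl normrM lee_fin; apply: le_trans (hp Ap).
  by rewrite [X in _ * X]gtr0_norm// dotC.
- apply: le_trans hI; apply: ge0_subset_integral => //.
    by apply/EFin_measurable.
  by move=> p _; rewrite lee_fin.
Qed.

End solution_boundary.

(** * Darkness on the far side of the grazing point *)

Section shadow.
Context {R : realType} (gam : R) (hgam : 0 < gam <= 1) (q0 : R -> R)
  (hq0m : measurable_fun (`[-1, 1]%classic : set R) q0)
  (hq0pos : forall c : R, -1 <= c <= 1 -> 0 <= q0 c)
  (hq0cut : forall u : 'rV[R]_3, enorm u = 1 ->
     (eint_sphere (fun omega => (q0 (dot u omega))%:E) < +oo)%E)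
  (rho beta : R)
  (hw : (@lebesgue3 R).-integrable setT
     (fun p => ((weight rho beta (vec3 p))^-1 ^+ 2 *
                (1 + enorm (vec3 p)) ^+ 3)%:E))
  (Omega : set 'rV[R]_3)
  (hopen : open Omega) (hbounded : bounded_set Omega) (hsmooth : smooth_boundary Omega)
  (cmu : R) (hcmu_pos : 0 < cmu).

Local Notation phase_fun := (R -> 'rV[R]_3 -> 'rV[R]_3 -> R).

(** [leg_bound] with [K = 0]: the velocity growth stays explicit, and in exchange the error is
    proportional to the duration of the leg. *)
Lemma leg_short : exists2 C : R, 0 < C & forall g lam A tm, mild gam q0 Omega g -> 0 < lam ->
  0 <= A <= 1 -> lam * tm <= 16^-1 -> bounded_by Omega lam g tm A ->
  forall s t x v T, 0 <= s -> s <= t -> t <= tm -> regular Omega x v ->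
    t_b Omega x v = T%:E -> t - s <= T ->
    `|g t x v - expR (- nu gam q0 v * (t - s)) * g s (x - (t - s) *: v) v| <=
      C * A * (1 + enorm v ^+ 2) * (t - s) * barrier lam t v.
Proof.
have [C C0 hC] := collision_barrier hgam hq0m hq0pos hq0cut hw hopen hbounded hsmooth.
exists C => // g lam A tm mg l0 /andP[A0 A1] lt bA s t x v T s0 st ttm r tT tsT.
have [cx _ _ _] := r; have q0' : 0 <= 1 + enorm v ^+ 2 by rewrite addr_ge0 ?sqr_ge0.
have L0 : 0 <= C * A * (1 + enorm v ^+ 2) := mulr_ge0 (mulr_ge0 (ltW C0) A0) q0'.
have tb : ((t - s)%:E <= t_b Omega x v)%E by rewrite tT lee_fin.
have := leg_bound mg l0 (lexx 0) L0 s0 st cx tb.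
rewrite mul0r add0r; apply => tau /andP[stau taut].
rewrite mulr0 mul0r add0r -(mulrA (C * A)).
have rr : regular Omega (x - (t - tau) *: v) v.
  apply: (regular_shift hopen hbounded hsmooth r tT _).2; rewrite subr_ge0 taut /=.
  by apply: le_trans tsT; rewrite lerB.
have tau0 : 0 <= tau := le_trans s0 stau.
have taum : tau <= tm := le_trans taut ttm.
apply: hC => //; last 1 first.
- by move=> u ru; apply: bA => //; rewrite tau0.
- rewrite mulr_ge0 ?(ltW l0)//=; apply: le_trans lt; by rewrite ler_pM2l.
- by rewrite A0.
Qed.

(* The boundary points entered by particles close to [v0] stay dark compared with
   the amplitude [c] of a datum concentrated near [v0]. *)
Definition shaded (B : phase_fun -> Prop) (v0 : 'rV[R]_3) : Prop :=
  forall lam Cb : R, 0 < lam -> 0 < Cb -> exists2 r2 : R, 0 < r2 <= 1 & exists2 ts : R, 0 < ts &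
  forall g c tm, mild gam q0 Omega g -> B g -> 0 <= c -> Cb * c <= 1 ->
    lam * tm <= 32^-1 -> tm <= ts -> bounded_by Omega lam g tm (Cb * c) ->
    (forall x v, closure Omega x -> `|g 0 x v| <= c) ->
    (forall x v, closure Omega x -> r2 <= enorm (v - v0) -> g 0 x v = 0) ->
    forall t z w T, 0 <= t <= tm -> regular Omega z w -> gamma_minus Omega (z, w) ->
      enorm (w - v0) < r2 -> t_b Omega z (- w) = T%:E -> t <= T -> `|g t z w| <= c / 16.

Lemma absorbs_shaded v0 : shaded (absorbs Omega) v0.
Proof.
move=> lam Cb l0 Cb0; exists 1; rewrite ?ltr01 ?lexx//; exists 1 => //.
move=> g c tm mg Bg c0 _ _ _ _ _ _ t z w T /andP[t0 _] _ gm _ _ _.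
by rewrite (Bg _ _ _ t0 gm) normr0 divr_ge0.
Qed.

Lemma enorm_near (v v0 : 'rV[R]_3) : enorm (v - v0) < 1 -> enorm v <= enorm v0 + 1.
Proof.
move=> h; rewrite -(subrK v0 v) addrC; apply: le_trans (enormD _ _) _.
by rewrite lerD2l ltW.
Qed.

Lemma barrier_le1 lam t (v : 'rV[R]_3) : lam * t <= 16^-1 -> barrier lam t v <= 1.
Proof.
move=> lt; apply: le_trans (barrier_le_gaussian v lt) _.
by rewrite -expR0 ler_expR oppr_le0 divr_ge0 ?sqr_ge0.
Qed.

(** The reflected velocity - w is close to - v0, hence at distance at least |v0| from [v0], where
    the datum vanishes; the hypothesis on [T] excludes a second bounce. What remains is the
    collision history, small for short times. *)
Lemma reflects_shaded v0 : v0 != 0 -> shaded (reflects Omega) v0.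
Proof.
move=> v00 lam Cb l0 Cb0; have [C C0 hC] := leg_short.
have v0' : 0 < enorm v0 by rewrite enorm_gt0.
have V0 : 0 < 1 + (enorm v0 + 1) ^+ 2 by rewrite ltr_wpDr ?sqr_ge0.
exists (Num.min 1 (enorm v0)); first by rewrite lt_min ltr01 v0' ge_min lexx.
exists (16 * (C * Cb * (1 + (enorm v0 + 1) ^+ 2)))^-1; first by rewrite invr_gt0 !mulr_gt0.
move=> g c tm mg Bg c0 Cc lt tmts bA g01 g00 t z w T /andP[t0 ttm] r gm; rewrite lt_min => /andP[wv0 wv1] tT tTT.
have lt16 : lam * tm <= 16^-1 by apply: le_trans lt _; rewrite lef_pV2 ?posrE// ler_nat.
rewrite (Bg _ _ _ t0 gm); have rN := regularN r; have [cz _ _ _] := rN.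
have AI : 0 <= Cb * c <= 1 by rewrite mulr_ge0// ltW.
have := hC g lam (Cb * c) tm mg l0 AI lt16 bA 0 t z (- w) T (lexx _) t0 ttm rN tT.
rewrite subr0 => /(_ tTT).
have cx : closure Omega (z - t *: (- w)).
  have [] := (regular_shift hopen hbounded hsmooth rN tT (s := t)); first by rewrite t0.
  by move=> _ [].
rewrite g00//; last first.
  apply: le_trans (_ : enorm v0 <= _); first by rewrite ge_min lexx orbT.
  have := enorm_triangle (- v0) (- w) v0.
  rewrite -[- w - v0]opprD enormN (_ : - v0 - v0 = - (2 *: v0)); last first.
    by rewrite scaler_nat mulr2n opprD.
  rewrite (_ : - v0 - - w = w - v0); last by rewrite opprK addrC.
  by rewrite enormN enormZ ger0_norm//; move: wv1; rewrite -[enorm (w + v0)]enormN opprD; lra.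
rewrite mulr0 subr0 enormN => /le_trans; apply.
have w1 := enorm_near wv0.
apply: le_trans (_ : C * (Cb * c) * (1 + (enorm v0 + 1) ^+ 2) * t * 1 <= _).
  apply: ler_pM; rewrite ?(ltW (barrier_gt0 _ _ _))//.
  - rewrite !mulr_ge0 ?(ltW C0) ?(ltW Cb0)// addr_ge0 ?sqr_ge0//.
  - rewrite ler_wpM2r// ler_wpM2l ?mulr_ge0 ?(ltW C0) ?(ltW Cb0)// lerD2l ler_sqr ?nnegrE ?enorm_ge0//.
    by rewrite addr_ge0 ?enorm_ge0.
  - by apply: barrier_le1; apply: le_trans lt16; rewrite ler_pM2l.
have : t * (16 * (C * Cb * (1 + (enorm v0 + 1) ^+ 2))) <= 1.
  by rewrite -ler_pdivlMr ?mulr_gt0// div1r; exact: le_trans ttm tmts.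
set Q := C * Cb * _ => tQ; rewrite mulr1.
rewrite (_ : C * (Cb * c) * (1 + (enorm v0 + 1) ^+ 2) * t = c * (t * Q)); last by rewrite /Q; ring.
by rewrite ler_wpM2l//; lra.
Qed.

(** The stricter bound on the time keeps the rate of the barrier at least 1/16 + 1/32, and the
    surplus 1/32 absorbs the factor |u| of the flux. *)
Lemma barrier_enorm_le lam t (u : 'rV[R]_3) : lam * t <= 32^-1 ->
  barrier lam t u * enorm u <= 32 * expR (- (enorm u ^+ 2 / 16)).
Proof.
move=> lt; apply: le_trans (_ : expR (- (enorm u ^+ 2 / 16) - enorm u ^+ 2 / 32) *
  (32 * expR (enorm u ^+ 2 / 32)) <= _); last by rewrite mulrCA -expRD subrK.
have q0' := sqr_ge0 (enorm u); apply: ler_pM; rewrite ?expR_ge0 ?enorm_ge0//.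
  by rewrite ler_expR; set q := _ ^+ 2 in q0' *; nra.
apply: le_trans (le_1Dsqr _) _; have := expR_ge1Dx (enorm u ^+ 2 / 32); lra.
Qed.

Lemma integral_lin2 (f1 f2 : R * R * R -> R) (k1 k2 : R) :
  measurable_fun setT f1 -> measurable_fun setT f2 -> (forall p, 0 <= f1 p) ->
  (forall p, 0 <= f2 p) -> 0 <= k1 -> 0 <= k2 ->
  (\int[leb3 R]_p (k1 * f1 p + k2 * f2 p)%:E =
   k1%:E * \int[leb3 R]_p (f1 p)%:E + k2%:E * \int[leb3 R]_p (f2 p)%:E)%E.
Proof.
move=> m1 m2 f10 f20 k10 k20.
rewrite -ge0_integralZl//=; [|by apply/EFin_measurable|by move=> p _; rewrite lee_fin].
rewrite -ge0_integralZl//=; [|by apply/EFin_measurable|by move=> p _; rewrite lee_fin].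
rewrite -ge0_integralD//=.
- by move=> p _; rewrite mule_ge0// lee_fin.
- by apply/EFin_measurable; meas.
- by move=> p _; rewrite mule_ge0// lee_fin.
- by apply/EFin_measurable; meas.
Qed.

Lemma leb3_box (a : 'rV[R]_3) (r : R) : 0 < r ->
  let I i : set R := `]a 0 i - r, a 0 i + r[%classic in
  leb3 R ((I i0 `*` I i1) `*` I i2) = ((2 * r) ^+ 3)%:E.
Proof.
move=> r0 I.
have lI i : leb R (I i) = (2 * r)%:E.
  by rewrite lebesgue_measure_itv /= lte_fin ifT; [rewrite -EFinB; congr (_%:E); ring|lra].
have mI i : measurable (I i) by exact: measurable_itv.
rewrite (_ : leb3 R _ = (leb2 R (I i0 `*` I i1) * leb R (I i2))%E); last first.
  exact: (product_measure1E (leb2 R) (leb R) (measurableX (mI i0) (mI i1)) (mI i2)).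
rewrite (_ : leb2 R _ = (leb R (I i0) * leb R (I i1))%E); last exact: (product_measure1E (leb R) (leb R) (mI i0) (mI i1)).
by rewrite !lI -!EFinM; congr (_%:E); ring.
Qed.

(** Three contributions to the outgoing flux are each made at most c/64: the datum, supported in a
    cube of velocities of side 2 r2; the nearly tangential velocities; and what is proportional to
    time, that is the collisions and the fast velocities. *)
Lemma diffuses_shaded v0 : shaded (diffuses Omega cmu) v0.
Proof.
move=> lam Cb l0 Cb0; have [C C0 hC] := leg_short.
have [Cg Cg0 hCg] := gaussian_moment hw.
pose V := enorm v0 + 1; have V0 : 0 < V by rewrite ltr_wpDl ?enorm_ge0.
have nat_mul (n : nat) (x : R) : 0 < x -> 0 < n.+1%:R * x by move=> x0; exact: mulr_gt0 (ltr0Sn R n) x0.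
have cV0 : 0 < cmu * V by exact: mulr_gt0.
(* 512 = 8 * 64: the cube has volume 8 r2^3, at most 8 r2, and [V] bounds the speed in it. *)
pose k := 16 * (32 * (cmu * V)); have k0 : 0 < k by exact: (nat_mul 15 _ (nat_mul 31 _ cV0)).
pose r2 : R := Num.min 1 k^-1.
have r20 : 0 < r2 by rewrite lt_min ltr01 invr_gt0 k0.
have r21 : r2 <= 1 by rewrite /r2 ge_min lexx.
exists r2; first by rewrite r20.
have Cg1 : 0 < Cg + 1 by rewrite ltr_wpDl.
pose M := cmu * Cb * (Cg + 1); have M0 : 0 < M by exact: mulr_gt0 (mulr_gt0 hcmu_pos Cb0) Cg1.
(* [M] collects the reflection constant, the amplitude factor and the Gaussian moment; adding 1 to
   the moment makes it invertible. *)
pose e := (64 * M)^-1; have e0 : 0 < e by rewrite invr_gt0; exact: (nat_mul 63 _ M0).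
have [d d0 hd] := uniform_chord hopen hbounded hsmooth e0.
have Q0 : 0 < C * 32 + d^-1 by rewrite addr_gt0 ?invr_gt0// mulrC; exact: (nat_mul 31 _ C0).
have MQ0 : 0 < 64 * (M * (C * 32 + d^-1)) by exact: (nat_mul 63 _ (mulr_gt0 M0 Q0)).
exists (64 * (M * (C * 32 + d^-1)))^-1; first by rewrite invr_gt0.
move=> g c tm mg Bg c0 Cc lt32 tmts bA g01 g00 t z w T /andP[t0 ttm] r gm wv0 _ _.
have lt16 : lam * tm <= 16^-1 by apply: le_trans lt32 _; rewrite lef_pV2 ?posrE// ler_nat.
have [bz _] := gm; have [cz _ _ _] := r.
have A0 : 0 <= Cb * c by rewrite mulr_ge0// ltW.
have AI : 0 <= Cb * c <= 1 by rewrite A0.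
set A := Cb * c in Cc bA A0 AI.
pose I i : set R := `]v0 0 i - r2, v0 0 i + r2[%classic.
have inI i (x : R) : `|x - v0 0 i| < r2 -> I i x.
  by rewrite ltr_norml /I /= in_itv /= => /andP[a1 a2]; apply/andP; split; lra.
pose X := ((I i0 `*` I i1) `*` I i2).
have mX : measurable X by apply: measurableX; [apply: measurableX|]; exact: measurable_itv.
pose N := A * (C * 32 * t + (e + t / d)).
have td0 : 0 <= t / d by rewrite divr_ge0 ?(ltW d0).
have N0 : 0 <= N.
  by rewrite mulr_ge0// addr_ge0 ?mulr_ge0 ?(ltW C0)// addr_ge0// ltW.
pose G (p : R * R * R) := (1 + enorm (vec3 p) ^+ 2) * expR (- (enorm (vec3 p) ^+ 2 / 16)).
have G0 p : 0 <= G p by exact: mulr_ge0 (addr_ge0 ler01 (sqr_ge0 _)) (expR_ge0 _).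
have cV : 0 <= c * V by rewrite mulr_ge0// ltW.
pose b p := c * V * \1_X p + N * G p.
have [GG [mGG aGG hGG]] := ae_regular hopen hbounded hsmooth cz.
have mE := mf_enorm_vec3 (@measurable_id _ (R * R * R)%type setT).
have mG : measurable_fun setT G by rewrite /G; meas.
have mX1 : measurable_fun setT (\1_X : R * R * R -> R) by exact: measurable_indic.
have b0 p : 0 <= b p by rewrite addr_ge0// mulr_ge0.
have bb p : GG p -> 0 < dot (vec3 p) (normal Omega z) ->
    `|g t z (vec3 p)| * dot (normal Omega z) (vec3 p) <= b p.
  move=> /hGG; set u := vec3 p => ru; rewrite dotC => nu0.
  have [cu g1 _ _] := ru.
  have [_ [Tu [Tu0 tTu _ _]]] := nongrazing_exit hopen hbounded hsmooth cz g1.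
  have un : dot (normal Omega z) u <= enorm u.
    by have := dot_le (normal Omega z) u; rewrite (enorm_normal hopen hsmooth bz) mul1r.
  have lt' : lam * t <= 16^-1 by apply: le_trans lt16; rewrite ler_pM2l.
  have [tTT|/ltW Tut] := leP t Tu; last first.
    have h1 := outgoing_early hopen hbounded hsmooth e0 d0 hd bz ru nu0 tTu Tut.
    have h2 : `|g t z u| <= A * expR (- (enorm u ^+ 2 / 16)).
      apply: le_trans (bA t z u _ ru) _; first by rewrite t0.
      by rewrite ler_wpM2l// barrier_le_gaussian.
    apply: le_trans (ler_pM (normr_ge0 _) (ltW nu0) h2 h1) _.
    apply: le_trans (_ : A * (e + t / d) * G p <= _).
      by rewrite le_eqVlt; apply/orP; left; apply/eqP; rewrite /G -/u; ring.
    have X0 : 0 <= c * V * \1_X p by rewrite mulr_ge0.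
    apply: le_trans (_ : N * G p <= _); last by rewrite lerDr.
    by rewrite ler_wpM2r// ler_wpM2l// lerDr mulr_ge0// mulr_ge0// ltW.
  have := hC g lam A tm mg l0 AI lt16 bA 0 t z u Tu (lexx _) t0 ttm ru tTu.
  rewrite subr0 => /(_ tTT) h.
  have cx : closure Omega (z - t *: u).
    have [] := (regular_shift hopen hbounded hsmooth ru tTu (s := t)); first by rewrite t0.
    by move=> _ [].
  set E := expR (- nu gam q0 u * t) in h.
  have E1 : E <= 1.
    have [Cn Cn0 /(_ u)/andP[nn _]] := nu_bound hgam hq0m hq0pos hq0cut hw.
    by rewrite -expR0 ler_expR mulNr oppr_le0 mulr_ge0.
  have h0 : `|E * g 0 (z - t *: u) u| * enorm u <= c * V * \1_X p.
    have [far|near] := leP r2 (enorm (u - v0)).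
      by rewrite g00// mulr0 normr0 mul0r mulr_ge0.
    have pX : X p.
      have cc i : `|u 0 i - v0 0 i| < r2.
        by apply: le_lt_trans near; have := normr_coord_le (u - v0) i; rewrite !mxE.
      have e0' := cc i0; have e1 := cc i1; have e2 := cc i2; rewrite !mxE /= in e0' e1 e2.
      by split; [split|]; apply: inI.
    rewrite indicE mem_set// mulr1; apply: ler_pM; rewrite ?enorm_ge0//.
      rewrite normrM ger0_norm ?expR_ge0//; apply: le_trans (g01 _ u cx).
      by rewrite -[leRHS]mul1r ler_wpM2r.
    by apply: enorm_near; exact: lt_le_trans near r21.
  have h2 : barrier lam t u * enorm u <= 32 * expR (- (enorm u ^+ 2 / 16)).
    by apply: barrier_enorm_le; apply: le_trans lt32; rewrite ler_pM2l.
  apply: le_trans (ler_wpM2l (normr_ge0 _) un) _.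
  rewrite -(subrK (E * g 0 (z - t *: u) u) (g t z u)).
  apply: le_trans (ler_wpM2r (enorm_ge0 _) (ler_normD _ _)) _.
  rewrite mulrDl addrC; apply: lerD => //.
  apply: le_trans (ler_wpM2r (enorm_ge0 _) h) _.
  have K0 : 0 <= C * A * (1 + enorm u ^+ 2) * t.
    exact: mulr_ge0 (mulr_ge0 (mulr_ge0 (ltW C0) A0) (addr_ge0 ler01 (sqr_ge0 _))) t0.
  rewrite -(mulrA _ (barrier lam t u)); apply: le_trans (ler_wpM2l K0 h2) _.
  apply: le_trans (_ : A * (C * 32 * t) * G p <= _).
    by rewrite le_eqVlt; apply/orP; left; apply/eqP; rewrite /G -/u; ring.
  by rewrite ler_wpM2r// ler_wpM2l// lerDl addr_ge0// ltW.
have intb : (\int[leb3 R]_p (b p)%:E <= (c * V * (2 * r2) ^+ 3 + N * Cg)%:E)%E.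
  have X3 : (\int[leb3 R]_p (\1_X p)%:E = ((2 * r2) ^+ 3)%:E)%E.
    by rewrite integral_indic// setIT; exact: (leb3_box v0 r20).
  rewrite /b integral_lin2// X3 EFinD (EFinM (c * V)) (EFinM N); apply: leeD => //.
  by apply: lee_wpmul2l => //; rewrite lee_fin.
apply: le_trans (Bg t z w b _ t0 gm _ b0 (aeS aGG bb) intb) _.
  by rewrite /b; meas.
apply: le_trans (_ : cmu * (c * V * (2 * r2) ^+ 3 + N * Cg) <= _).
  have r20' : 0 <= 2 * r2 := mulr_ge0 (ler0n R 2) (ltW r20).
  have I0 := addr_ge0 (mulr_ge0 cV (exprn_ge0 3 r20')) (mulr_ge0 N0 Cg0).
  apply: (ler_wpM2r I0); rewrite ger_pMr// /mu -expR0 ler_expR.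
  by rewrite mulNr oppr_le0 divr_ge0 ?sqr_ge0.
have p1 : r2 * k <= 1.
  have : r2 <= k^-1 by rewrite /r2 ge_min lexx orbT.
  by rewrite -[_^-1]div1r ler_pdivlMr.
have p2 : (2 * r2) ^+ 3 <= 8 * r2.
  by have := mulr_ge0 (ltW r20) (ltW r20); rewrite !exprS expr0; nra.
have p3 : M * e = 64^-1 by rewrite /e; field; rewrite gt_eqF.
have p4 : M * (C * 32 * t + t / d) <= 64^-1.
  have : t * (64 * (M * (C * 32 + d^-1))) <= 1.
    by rewrite -ler_pdivlMr// div1r; exact: le_trans ttm tmts.
  by rewrite mulrDr; lra.
have p5 : cmu * (N * Cg) <= c * (M * (C * 32 * t + (e + t / d))).
  rewrite (_ : cmu * (N * Cg) = c * (cmu * Cb * Cg * (C * 32 * t + (e + t / d)))); last first.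
    by rewrite /N /A; ring.
  rewrite ler_wpM2l// ler_wpM2r// ?/M; first by rewrite addr_ge0 ?mulr_ge0 ?(ltW C0)// addr_ge0// ltW.
  by rewrite ler_wpM2l ?mulr_ge0 ?(ltW hcmu_pos) ?(ltW Cb0)// lerDl.
have p6 : cmu * (c * V * (2 * r2) ^+ 3) <= c * 64^-1.
  rewrite (_ : cmu * (c * V * (2 * r2) ^+ 3) = c * (cmu * V * (2 * r2) ^+ 3)); last by ring.
  by rewrite ler_wpM2l//; have := ler_wpM2l (ltW cV0) p2; move: p1; rewrite /k; lra.
rewrite mulrDr; apply: le_trans (lerD p6 p5) _.
rewrite -mulrDr ler_wpM2l//; move: p3 p4; set x := C * 32 * t; set y := t / d; lra.
Qed.

End shadow.

(** * The jump *)

Section concave_point.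
Context {R : realType}.
Variable Omega : set 'rV[R]_3.
Hypothesis hopen : open Omega.
Implicit Types (x v y w : 'rV[R]_3) (t s d T r : R).

Lemma enorm_sub x y : enorm (x - y) <= enorm x + enorm y.
Proof. by rewrite -(enormN y); exact: enormD. Qed.

Lemma tube x v T : (forall s, 0 <= s <= T -> Omega (x - s *: v)) ->
  exists2 d, 0 < d & forall s y, 0 <= s <= T -> enorm (y - (x - s *: v)) < d -> Omega y.
Proof.
move=> h; have v1 : 0 < 1 + enorm v by rewrite ltr_wpDr ?enorm_ge0.
have [sc sI|d d0 hd] := @near_segment R 0 T (fun c s => forall y, enorm (y - (x - s *: v)) < c -> Omega y).
  have [r r0 hr] := open_enorm hopen (h sc sI).
  exists (r / (2 * (1 + enorm v))); first by rewrite divr_gt0// mulr_gt0.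
  move=> s c; rewrite !ltr_pdivlMr ?mulr_gt0// => sr /andP[c0 cr] _ y yc; apply: hr.
  apply: le_lt_trans (enorm_triangle _ (x - s *: v) _) _.
  have -> : x - s *: v - (x - sc *: v) = (sc - s) *: v.
    by apply/rowP => i; rewrite !mxE; ring.
  rewrite enormZ distrC; have := enorm_ge0 v; have := normr_ge0 (s - sc).
  move: (enorm v) (enorm _) `|_| v1 sr cr yc => a b k v1 sr cr yc k0 a0; nra.
by exists d => // s y sI; exact: hd.
Qed.

(** The line through [x0] in direction [v0] lies in the domain on both sides of its contact with the
    boundary. Shifted inwards it clears the obstacle; shifted outwards it runs into it. Both are
    open conditions on the velocity. *)
Lemma concave_points x0 v0 t0 : smooth_boundary Omega -> bdry Omega x0 -> 0 < t0 ->
  (forall s, 0 < s <= t0 -> Omega (x0 - s *: v0)) ->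
  (forall s, 0 < s <= 2 * t0 -> Omega (x0 + s *: v0)) ->
  forall d, 0 < d -> exists x1 x2, [/\ enorm (x1 - x0) < d, enorm (x2 - x0) < d &
    exists2 e : R, 0 < e & forall w, enorm (w - v0) < e ->
    [/\ forall s, 0 <= s <= t0 -> Omega (x2 - s *: w),
        forall s, 0 <= s <= t0 -> Omega (x1 + s *: w) &
        exists2 s, 0 < s <= t0 / 2 & ~ closure Omega (x1 - s *: w)]].
Proof.
move=> hsmooth bx t00 hin hout d d0.
have [r [psi [N [k [sg g]]]]] := normal_graph hsmooth bx.
have [r0 _ tr [_ sg2] iff] := g.
(* The unit vector along the chart axis pointing inwards: [psi] decreases along it at unit rate. *)
pose a : 'rV[R]_3 := sg *: delta_mx 0 k.
have psia x c : psi (x + c *: a) = psi x - c.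
  by rewrite /a scalerA (tr x (c * sg)).1 mulrCA -expr2 sg2 mulr1.
have a1 : enorm a = 1.
  have -> : enorm a = `|sg| * enorm (delta_mx 0 k : 'rV[R]_3) by rewrite enormZ.
  have -> : `|sg| = 1 by apply: (@pexpIrn _ 2) => //; rewrite ?nnegrE// real_normK ?num_real// expr1n.
  rewrite mul1r /enorm /dot (bigD1 k)//= big1 ?addr0 => [|i ik].
    by rewrite mxE !eqxx mulr1 sqrtr1.
  by rewrite mxE (negbTE ik) andbF mulr0.
clearbody a.
have psi0 : psi x0 = 0 by apply: (graph_bdry hopen g) => //; rewrite subrr enorm0.
have V0 : 0 < enorm v0 + 1 by rewrite ltr_wpDl ?enorm_ge0.
have ev0 := enorm_ge0 v0.
(* [s] is the distance in time of [x1] past the contact point. It precedes the shift [e], which must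
   fit into the tube around the segment starting at [x0 + s *: v0]. *)
have [s s0 /andP[s1 s2]] : exists2 s, 0 < s & (s < t0 / 2) && (s < d / (2 * (enorm v0 + 1))).
  have [|s /andP[sp s1] /andP[_ s2]] := small2 (divr_gt0 t00 (ltr0Sn R 1)) (_ : 0 < d / (2 * (enorm v0 + 1))).
    by rewrite divr_gt0// mulr_gt0.
  by exists s; rewrite ?s1.
have sd : s * enorm v0 < d / 2.
  move: s2; rewrite ltr_pdivlMr ?mulr_gt0// => s2; nra.
have [d1 d10 h1] := @tube (x0 + s *: v0) (- v0) t0 ltac:(move=> u /andP[u0 u1];
  rewrite scalerN opprK -addrA -scalerDl; apply: hout; apply/andP; split; lra).
(* Up to [t1] the backward segment stays in the chart, where shifting inwards makes [psi] negative;
   beyond [t1] it has positive distance from the boundary. *)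
pose t1 := Num.min (r / (2 * (enorm v0 + 1))) t0.
have t10 : 0 < t1 by rewrite lt_min t00 divr_gt0// mulr_gt0.
have t1t : t1 <= t0 by rewrite /t1 ge_min lexx orbT.
have t1r : t1 * enorm v0 < r / 2.
  have : t1 <= r / (2 * (enorm v0 + 1)) by rewrite /t1 ge_min lexx.
  by rewrite ler_pdivlMr ?mulr_gt0// => h; nra.
have [d2 d20 h2] := @tube (x0 - t1 *: v0) v0 (t0 - t1) ltac:(move=> u /andP[u0 u1];
  rewrite -addrA -opprD -scalerDl; apply: hin; apply/andP; split; lra).
pose m := Num.min (Num.min (d / 2) (d1 / 2)) (Num.min (r / 2) d2).
have m0 : 0 < m by rewrite !lt_min !divr_gt0.
pose e := m / 2; have e0 : 0 < e by rewrite divr_gt0.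
have em : e < m by rewrite /e ltr_pdivrMr//; lra.
have := em; rewrite !lt_min => /andP[/andP[e1 e2] /andP[e3 e4]].
have out : ~ closure Omega (x0 - e *: a).
  have xr : enorm (x0 - e *: a - x0) < r.
    by rewrite [x0 - _]addrC addrK enormN enormZ a1 mulr1 gtr0_norm//; lra.
  have pe : psi (x0 - e *: a) = e by rewrite -scaleNr psia psi0 sub0r opprK.
  move=> /(closure_cases hopen)[/(iff _ xr).1|/(graph_bdry hopen g xr)]; rewrite pe; lra.
have x2in u : 0 <= u <= t0 -> Omega (x0 + e *: a - u *: v0).
  move=> /andP[u0 u1]; have [ut|tu] := leP u t1; last first.
    apply: (h2 (u - t1)); first by apply/andP; split; lra.
    rewrite (_ : _ - _ = e *: a); last by apply/rowP => i; rewrite !mxE; ring.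
    by rewrite enormZ a1 mulr1 gtr0_norm.
  have uv : u * enorm v0 < r / 2 by apply: le_lt_trans t1r; rewrite ler_wpM2r.
  have ur : enorm (x0 - u *: v0 - x0) < r.
    by rewrite [x0 - _]addrC addrK enormN enormZ ger0_norm//; lra.
  have pu : psi (x0 - u *: v0) <= 0.
    have [->|un] := eqVneq u 0; first by rewrite scale0r subr0 psi0.
    by apply: ltW; apply/(iff _ ur); apply: hin; rewrite lt_def un u0.
  have eq : x0 + e *: a - u *: v0 = x0 - u *: v0 + e *: a by rewrite addrAC.
  rewrite eq; apply/iff; last by rewrite psia; lra.
  rewrite (_ : _ - _ = e *: a - u *: v0); last by apply/rowP => i; rewrite !mxE; ring.
  apply: le_lt_trans (enorm_sub _ _) _; rewrite !enormZ a1 mulr1 (gtr0_norm e0) (ger0_norm u0); lra.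
have [d3 d30 h3] := tube x2in.
have [d4 d40 h4] : exists2 d4, 0 < d4 & forall y, enorm (y - (x0 - e *: a)) < d4 -> ~ closure Omega y.
  have : nbhs (x0 - e *: a) (~` closure Omega).
    by rewrite nbhsE /=; exists (~` closure Omega) => //; split=> //; apply: closed_openC; exact: closed_closure.
  by move=> /nbhs_enormP.
(* Tracing the first point back by time [s] with velocity [v0] gives [x0 - e *: a], which lies
   outside the closure. *)
exists (x0 + s *: v0 - e *: a), (x0 + e *: a); split.
- rewrite (_ : _ - _ = s *: v0 - e *: a); last by apply/rowP => i; rewrite !mxE; ring.
  apply: le_lt_trans (enorm_sub _ _) _; rewrite !enormZ a1 mulr1 !gtr0_norm//; lra.
- by rewrite [x0 + _]addrC addrK enormZ a1 mulr1 gtr0_norm//; lra.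
pose q := Num.min (Num.min d3 (d1 / 2)) d4.
have q0' : 0 < q by rewrite !lt_min d30 d40 divr_gt0.
have t01 : 0 < t0 + 1 by lra.
exists (q / (t0 + 1)); first by rewrite divr_gt0.
move=> w; rewrite ltr_pdivlMr// => wq.
have uw u : 0 <= u <= t0 -> u * enorm (w - v0) < q.
  move=> /andP[u0 u1]; apply: le_lt_trans wq; rewrite mulrC ler_wpM2l ?enorm_ge0//; lra.
have ltq u : u < q -> [/\ u < d3, u < d1 / 2 & u < d4].
  by rewrite !lt_min => /andP[/andP[]].
split=> [u uI|u uI|].
- have [k3 _ _] := ltq _ (uw u uI); apply: (h3 u) => //.
  rewrite (_ : _ - _ = - (u *: (w - v0))); last by apply/rowP => i; rewrite !mxE; ring.
  by rewrite enormN enormZ ger0_norm//; case/andP: uI.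
- have [_ k3 _] := ltq _ (uw u uI); apply: (h1 u) => //.
  rewrite (_ : _ - _ = u *: (w - v0) - e *: a); last by apply/rowP => i; rewrite !mxE; ring.
  apply: le_lt_trans (enorm_sub _ _) _; have u0 : 0 <= u by case/andP: uI.
  rewrite !enormZ a1 mulr1 (gtr0_norm e0) (ger0_norm u0); lra.
exists s; first by rewrite s0 ltW.
have sI : 0 <= s <= t0 by apply/andP; split; lra.
have [_ _ k3] := ltq _ (uw s sI); apply: h4.
rewrite (_ : _ - _ = - (s *: (w - v0))); last by apply/rowP => i; rewrite !mxE; ring.
by rewrite enormN enormZ gtr0_norm.
Qed.

End concave_point.

(** * Choice of constants and comparison of the two trajectories *)

Section discontinuity.
Context {R : realType} (gam : R) (hgam : 0 < gam <= 1) (q0 : R -> R)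
  (hq0m : measurable_fun (`[-1, 1]%classic : set R) q0)
  (hq0pos : forall c : R, -1 <= c <= 1 -> 0 <= q0 c)
  (hq0cut : forall u : 'rV[R]_3, enorm u = 1 ->
     (eint_sphere (fun omega => (q0 (dot u omega))%:E) < +oo)%E)
  (rho beta : R)
  (hw : (@lebesgue3 R).-integrable setT
     (fun p => ((weight rho beta (vec3 p))^-1 ^+ 2 *
                (1 + enorm (vec3 p)) ^+ 3)%:E))
  (Omega : set 'rV[R]_3)
  (hopen : open Omega) (hbounded : bounded_set Omega) (hsmooth : smooth_boundary Omega).

Lemma phase_dist_lt (d : R) (p q : 'rV[R]_3 * 'rV[R]_3) :
  enorm (p.1 - q.1) < d / 2 -> enorm (p.2 - q.2) < d / 2 -> phase_dist p q < d.
Proof.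
move=> h1 h2; have a0 := enorm_ge0 (p.1 - q.1); have b0 := enorm_ge0 (p.2 - q.2).
rewrite /phase_dist; move: (enorm _) (enorm (p.2 - q.2)) h1 h2 a0 b0 => a b h1 h2 a0 b0.
have d0 : 0 <= d by lra.
rewrite -[ltRHS]ger0_norm// -sqrtr_sqr ltr_sqrt; last by rewrite exprn_gt0//; lra.
by rewrite !expr2; nra.
Qed.

Lemma exists_small (s : seq R) : all (fun x => 0 < x) s ->
  exists2 t : R, 0 < t & all (fun x => t < x) s.
Proof.
elim: s => [_|x s IH /= /andP[x0 /IH[t t0 ht]]]; first by exists 1.
have [u /andP[u0 ux] /andP[_ ut]] := small2 x0 t0.
exists u; rewrite ?ux//=; apply/allP => y ys; exact: lt_trans ut (allP ht _ ys).
Qed.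

Lemma mul_le_inv (k a b : R) : 0 < k -> 0 < b -> a < (k * b)^-1 -> b * a <= k^-1.
Proof.
move=> k0 b0 h; rewrite -(ler_pM2l k0) divff ?gt_eqF// mulrA.
by have := ltW h; rewrite -[_^-1]div1r ler_pdivlMr ?mulr_gt0// mulrC.
Qed.

Lemma stays_inside x w t : Omega x -> ~ grazing Omega (x, w) ->
  (forall s, 0 <= s <= t -> Omega (x - s *: w)) ->
  exists T, [/\ 0 < T, t < T, t_b Omega x w = T%:E & gamma_minus Omega (x - T *: w, w)].
Proof.
move=> Ox ng hin; have cx : closure Omega x by exact: subset_closure.
have [_ [T [T0 tT _ gm]]] := nongrazing_exit hopen hbounded hsmooth cx ng.
have [/(bdryP hopen)[_ nO] _] := gm; exists T; split=> //.
  by rewrite lt_def T0 andbT; apply/eqP => T00; apply: nO; rewrite /= T00 scale0r subr0.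
by rewrite ltNge; apply/negP => Tt; apply: nO; apply: hin; rewrite T0.
Qed.

Lemma wpert_bump_bound q : exists2 K : R, 0 < K & forall c p r1 r2 x v, 0 <= c -> 0 < r2 <= 1 ->
  `|wpert rho beta (bump_datum c p r1 q r2) x v| <= c * K.
Proof.
have [K K0 hK] := weight_le_gaussian rho beta (@ltr01 R).
pose V := enorm q + 1.
exists (K * expR (V ^+ 2) * expR (V ^+ 2 / 4)) => [|c p r1 r2 x v c0 /andP[r20 r21]].
  by rewrite !mulr_gt0 ?expR_gt0.
rewrite /wpert /bump_datum addrAC subrr add0r.
have w0 := weight_gt0 rho beta v; have s0 := sqmu_gt0 v.
have [far|near] := leP r2 (enorm (v - q)).
  by rewrite (bump_out r20 far) !mulr0 mul0r mulr0 normr0 !mulr_ge0 ?expR_ge0// ltW.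
have vV : enorm v ^+ 2 <= V ^+ 2.
  rewrite ler_sqr ?nnegrE ?addr_ge0 ?enorm_ge0//; apply: enorm_near; exact: lt_le_trans near r21.
have bb : 0 <= bump p r1 x * bump q r2 v <= 1.
  by rewrite mulr_ge0 ?bump_ge0//= mulr_ile1 ?bump_ge0 ?bump_le1.
set b := _ * bump _ _ _ in bb *; have /andP[b0 b1] := bb.
have si0 : 0 < (sqmu v)^-1 by rewrite invr_gt0.
have cb0 : 0 <= c * b := mulr_ge0 c0 b0.
have -> : weight rho beta v * (c * b / sqmu v) = c * b * (weight rho beta v * (sqmu v)^-1) by ring.
rewrite (ger0_norm (mulr_ge0 cb0 (mulr_ge0 (ltW w0) (ltW si0)))).
apply: (ler_pM cb0 (mulr_ge0 (ltW w0) (ltW si0))).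
  by rewrite -[leRHS]mulr1; exact: ler_wpM2l.
apply: (ler_pM (ltW w0) (ltW si0)).
  apply: le_trans (hK v) _; rewrite mul1r; apply: ler_wpM2l; first exact: ltW.
  by rewrite ler_expR.
by rewrite sqmuE -expRN ler_expR; lra.
Qed.

End discontinuity.

(** Common to the three boundary conditions, which enter only through [propagates] and [shaded]. The
    lower bound of the jump is a fixed fraction of [c] at every radius [d], although the points and
    the velocity depend on [d]. *)
Lemma concave_discontinuity {R : realType} (gam : R) (hgam : 0 < gam <= 1) (q0 : R -> R)
  (hq0m : measurable_fun (`[-1, 1]%classic : set R) q0)
  (hq0pos : forall c : R, -1 <= c <= 1 -> 0 <= q0 c)
  (hq0cut : forall u : 'rV[R]_3, enorm u = 1 ->
     (eint_sphere (fun omega => (q0 (dot u omega))%:E) < +oo)%E)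
  (rho beta : R)
  (hw : (@lebesgue3 R).-integrable setT
     (fun p => ((weight rho beta (vec3 p))^-1 ^+ 2 *
                (1 + enorm (vec3 p)) ^+ 3)%:E))
  (Omega : set 'rV[R]_3)
  (hopen : open Omega) (hbounded : bounded_set Omega) (hsmooth : smooth_boundary Omega)
  (B : (R -> 'rV[R]_3 -> 'rV[R]_3 -> R) -> Prop) (x0 v0 : 'rV[R]_3) :
  propagates gam q0 Omega B -> shaded gam q0 Omega B v0 -> v0 != 0 -> gamma_0S Omega (x0, v0) ->
  forall delta, 0 < delta -> exists (t0 c : R) (p : 'rV[R]_3) (r1 r2 : R),
  [/\ 0 < t0 < delta, (t0%:E < t_b Omega x0 v0)%E, (t0%:E < t_b Omega x0 (- v0))%E,
      0 < r1 /\ (forall x, ~ Omega x -> r1 <= enorm (x - p)) &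
      (forall x v, `|wpert rho beta (bump_datum c p r1 v0 r2) x v| <= delta / 2) /\
      forall F, mild gam q0 Omega (pert F) -> B (pert F) -> gaussian_bounded Omega (pert F) ->
        (forall x v, closure Omega x -> F 0 x v = bump_datum c p r1 v0 r2 x v) ->
        discontinuous_at Omega F t0 x0 v0].
Proof.
move=> hB hS v00 [[bx _] tb1 tb2] delta delta0.
rewrite /= in bx tb1 tb2.
have [lam [Tm [Cb [cs [l0 Tm0 lTm Cb0 [cs0 [Cbcs hboot]]]]]]] :=
  bootstrap hgam hq0m hq0pos hq0cut hw hopen hbounded hsmooth hB.
pose V := enorm v0 + 1; have V0 : 0 < V by rewrite ltr_wpDl ?enorm_ge0.
pose Q := 1 + V ^+ 2; have Q0 : 0 < Q by rewrite ltr_wpDr ?sqr_ge0.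
(* Minimum of the initial barrier over the velocities within distance 1 of [v0], so that a datum of
   size [c] there has amplitude at most c / kap. *)
pose kap := expR (- (8^-1 * Q)); have kap0 : 0 < kap by exact: expR_gt0.
have [r2 /andP[r20 r21] [ts ts0 hsh]] := hS lam (Cb / kap) l0 (divr_gt0 Cb0 kap0).
have [C C0 hC] := leg_short hgam hq0m hq0pos hq0cut hw hopen hbounded hsmooth.
have [Cn Cn0 hCn] := nu_bound hgam hq0m hq0pos hq0cut hw.
have [Kd Kd0 hKd] := wpert_bump_bound rho beta v0.
have cx : closure Omega x0 by case: bx.
have vN : - v0 != 0 by rewrite oppr_eq0.
have [Tb [Tb0 tTb inb _]] := t_bP hopen hbounded cx v00.
have [Tf [Tf0 tTf inf _]] := t_bP hopen hbounded cx vN.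
have Tb0' : 0 < Tb by rewrite lt_def Tb0 andbT; apply/eqP => e; apply: tb1; rewrite tTb e.
have Tf0' : 0 < Tf by rewrite lt_def Tf0 andbT; apply/eqP => e; apply: tb2; rewrite tTf e.
pose Kc := C * (Cb / kap) * Q.
have Kc0 : 0 < Kc by rewrite !mulr_gt0// invr_gt0.
have Cn1 : 0 < Cn + 1 by rewrite ltr_wpDl.
(* In order: the required time, the backward exit, room for twice [t0] forwards, the range of the
   bootstrap, the shadow, [lam * t0] at most 1/32, an error at most c/32 on each leg, and a damping
   factor at least 1/2. *)
have [t0 t00 ht] := @exists_small R
  [:: delta; Tb; Tf / 2; Tm; ts; (32 * lam)^-1; (32 * Kc)^-1; (2 * ((Cn + 1) * Q))^-1]
  ltac:(by rewrite /= !(divr_gt0, invr_gt0, mulr_gt0, delta0, Tb0', Tf0', Tm0, ts0, l0, Kc0, Cn1, Q0) /=).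
move: ht => /= /and5P[t0d t0b t0f t0m /and5P[t0s t0l t0K t0n _]].
have Op : Omega (x0 - t0 *: v0) by apply: inb; rewrite t00.
have [r1 r10 hr1] := open_enorm hopen Op.
have [c c0 hc] := @exists_small R [:: kap * cs; delta / (2 * Kd)]
  ltac:(by rewrite /= !(divr_gt0, mulr_gt0, kap0, cs0, delta0, Kd0)).
move: hc => /= /and3P[cks cd _].
set p := x0 - t0 *: v0 in Op hr1.
exists t0, c, p, r1, r2; split.
- by rewrite t00.
- by rewrite tTb lte_fin.
- by rewrite tTf lte_fin; move: t0f Tf0'; clear; lra.
- by split=> // x nx; rewrite leNgt; apply/negP => /hr1.
split=> [x v|F mF BF gF hF0].
  apply: le_trans (hKd c p r1 r2 x v (ltW c0) _) _; first by rewrite r20.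
  by move: cd; rewrite ltr_pdivlMr ?mulr_gt0//; clear; lra.
set g := pert F in mF BF gF.
have g0E x v : closure Omega x -> g 0 x v = c * (bump p r1 x * bump v0 r2 v).
  by move=> cx'; rewrite /g /pert (hF0 _ _ cx') /bump_datum addrC addKr.
have bb x v : 0 <= bump p r1 x * bump v0 r2 v <= 1.
  by rewrite mulr_ge0 ?bump_ge0//= mulr_ile1 ?bump_ge0 ?bump_le1.
have g01 x v : closure Omega x -> `|g 0 x v| <= c.
  move=> /g0E ->; have /andP[b0 b1] := bb x v.
  rewrite (ger0_norm (mulr_ge0 (ltW c0) b0)) -[leRHS]mulr1.
  by apply: ler_wpM2l => //; exact: ltW.
have g00 x v : closure Omega x -> r2 <= enorm (v - v0) -> g 0 x v = 0.
  by move=> /g0E -> far; rewrite (bump_out r20 far) !mulr0.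
have ckap : c / kap <= cs by rewrite ler_pdivrMr// mulrC ltW.
have ginit x v : regular Omega x v -> `|g 0 x v| <= c / kap * barrier lam 0 v.
  move=> [cx' _ _ _]; have [far|near] := leP r2 (enorm (v - v0)).
    by rewrite g00// normr0 mulr_ge0 ?(ltW (barrier_gt0 _ _ _))// divr_ge0// ltW.
  apply: le_trans (g01 _ _ cx') _; rewrite mulrAC ler_pdivlMr// ler_pM2l//.
  rewrite ler_expR lerN2 mulr0 subr0 ler_pM2l ?invr_gt0// lerD2l ler_sqr ?nnegrE ?enorm_ge0 ?(ltW V0)//.
  by apply: enorm_near; exact: lt_le_trans near r21.
have bT : bounded_by Omega lam g t0 (Cb / kap * c).
  have cI : 0 <= c / kap <= cs by rewrite divr_ge0 ?(ltW c0) ?(ltW kap0).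
  have := hboot g (c / kap) mF BF gF cI ginit.
  rewrite (_ : Cb * (c / kap) = Cb / kap * c); last by ring.
  move=> h t x v /andP[t_0 t_1]; apply: h; rewrite t_0 (le_trans t_1)// ltW//.
have A0 : 0 <= Cb / kap * c by rewrite mulr_ge0 ?(ltW c0)// divr_ge0 ?(ltW Cb0) ?(ltW kap0).
have A1 : Cb / kap * c <= 1.
  rewrite (_ : _ * _ = Cb * (c / kap)); last by ring.
  by apply: le_trans Cbcs; rewrite ler_pM2l.
have AI : 0 <= Cb / kap * c <= 1 by rewrite A0.
have lt32 : lam * t0 <= 32^-1.
  exact: mul_le_inv t0l.
have lt16 : lam * t0 <= 16^-1 by move: lt32; clear; lra.
have shade := hsh g c t0 mF BF (ltW c0) A1 lt32 (ltW t0s) bT g01 g00.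
have leg s t x w T : 0 <= s -> s <= t -> t <= t0 -> regular Omega x w -> enorm (w - v0) < r2 ->
    t_b Omega x w = T%:E -> t - s <= T ->
    `|g t x w - expR (- nu gam q0 w * (t - s)) * g s (x - (t - s) *: w) w| <= c / 32.
  move=> s0 st tt0 rw wv tT tsT.
  apply: le_trans (hC g lam _ t0 mF l0 AI lt16 bT s t x w T s0 st tt0 rw tT tsT) _.
  have wV : 1 + enorm w ^+ 2 <= Q.
    rewrite lerD2l ler_sqr ?nnegrE ?enorm_ge0 ?(ltW V0)//.
    by apply: enorm_near; exact: lt_le_trans wv r21.
  have ts' : 0 <= t - s by rewrite subr_ge0.
  apply: le_trans (_ : C * (Cb / kap * c) * Q * t0 * 1 <= _); last first.
    rewrite mulr1 (_ : _ * t0 = c * (Kc * t0)); last by rewrite /Kc; ring.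
    by apply: ler_wpM2l; [exact: ltW|exact: mul_le_inv t0K].
  have CA0 : 0 <= C * (Cb / kap * c) := mulr_ge0 (ltW C0) A0.
  have q1 : 0 <= 1 + enorm w ^+ 2 := addr_ge0 ler01 (sqr_ge0 _).
  apply: ler_pM; rewrite ?(ltW (barrier_gt0 _ _ _))//; first exact: mulr_ge0 (mulr_ge0 CA0 q1) ts'.
    apply: ler_pM => //; first exact: mulr_ge0 CA0 q1.
      exact: ler_wpM2l.
    by move: s0 tt0; clear; lra.
  by apply: barrier_le1; apply: le_trans lt16; rewrite ler_pM2l.
(* The bright value is at least 8c/32 and the dark one at most 3c/32, which leaves more than
   c/16. *)
apply: (@jump_lower_bound _ _ _ _ _ _ (c / 16)); first by rewrite divr_gt0.
move=> d d0.
have [d' d'0 /= /and3P[dd1 dd2 _]] := @exists_small R [:: d / 2; r1 / 4] ltac:(by rewrite /= !divr_gt0).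
have hin s : 0 < s <= t0 -> Omega (x0 - s *: v0).
  by move=> /andP[s0 s1]; apply: inb; rewrite s0 (le_lt_trans s1).
have hout s : 0 < s <= 2 * t0 -> Omega (x0 + s *: v0).
  move=> /andP[s0 s1]; have := inf s; rewrite scalerN opprK; apply.
  by rewrite s0 (le_lt_trans s1)//; move: t0f; clear; lra.
have [x1 [x2 [xd1 xd2 [e e0 he]]]] := concave_points hopen hsmooth bx t00 hin hout d'0.
have t01 : 0 < 4 * (t0 + 1) by rewrite mulr_gt0// ltr_wpDl// ltW.
have [e' e'0 /= /and5P[ee ed er2 er1 _]] := @exists_small R [:: e; d / 2; r2 / 2; r1 / (4 * (t0 + 1))]
  ltac:(by rewrite /= !divr_gt0 ?e0).
have [i1 i2] : Omega x1 /\ Omega x2.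
  have vv : enorm (v0 - v0) < e by rewrite subrr enorm0.
  have [h1 h2 _] := he v0 vv; split.
    by have := h2 0; rewrite scale0r addr0; apply; rewrite lexx ltW.
  by have := h1 0; rewrite scale0r subr0; apply; rewrite lexx ltW.
have cx1 : closure Omega x1 by exact: subset_closure.
have cx2 : closure Omega x2 by exact: subset_closure.
have [G1 [_ aG1 hG1]] := ae_regular hopen hbounded hsmooth cx1.
have [G2 [_ aG2 hG2]] := ae_regular hopen hbounded hsmooth cx2.
(* A single velocity, regular at both points and as close to [v0] as desired, serves for both
   trajectories. *)
have aw : {ae leb3 R, forall q, G1 q /\ G2 q} by apply: (aeS2 aG1 aG2) => q.
have [q wv' [/hG1 reg1 /hG2 reg2]] := ae_near3 aw v0 e'0.
set w := vec3 q in wv' reg1 reg2.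
have wv : enorm (w - v0) < r2 by apply: (lt_trans wv'); move: er2 r20; clear; lra.
have [in2 in1 [s1 sI ns1]] := he w (lt_trans wv' ee).
have [_ nO0] := (bdryP hopen x0).1 bx.
have jn x' : enorm (x' - x0) < d' -> regular Omega x' w -> Omega x' -> jump_nbhd Omega (x0, v0) d (x', w).
  move=> h [cx' ng _ _] Ox'; split=> //=.
    by apply: phase_dist_lt => /=; [exact: lt_trans h dd1|exact: lt_trans wv' ed].
  by move=> [ex _]; apply: nO0; rewrite -ex.
exists (x1, w), (x2, w); split; [exact: jn|exact: jn|rewrite /=].
rewrite (_ : F t0 x1 w - F t0 x2 w = g t0 x1 w - g t0 x2 w); last by rewrite /g /pert; ring.
have [nu0 nuC] : 0 <= nu gam q0 w /\ nu gam q0 w * t0 <= 1 / 2.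
  have /andP[nu0 nu1] := hCn w; split=> //.
  have wV : 1 + enorm w ^+ 2 <= Q.
    rewrite lerD2l ler_sqr ?nnegrE ?enorm_ge0 ?(ltW V0)//.
    by apply: enorm_near; exact: lt_le_trans wv r21.
  have nuQ : nu gam q0 w <= (Cn + 1) * Q.
    apply: le_trans nu1 _; apply: (ler_pM Cn0 (addr_ge0 ler01 (sqr_ge0 _)) _ wV).
    by move: Cn0; clear; lra.
  have CQ : 0 < (Cn + 1) * Q := mulr_gt0 Cn1 Q0.
  move: t0n; rewrite -[_^-1]div1r ltr_pdivlMr ?(mulr_gt0 _ CQ)// => t0n.
  by have := ler_wpM2r (ltW t00) nuQ; move: t0n; clear; lra.
(* Both bumps are at least 3/4 at the foot of the trajectory and damping costs at most a half: 9/32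
   minus the error 1/32. *)
have lit : c / 4 <= g t0 x2 w.
  have [_ ng _ _] := reg2.
  have [T [T0 tT tbT _]] := stays_inside hopen hbounded hsmooth i2 ng in2.
  have := leg 0 t0 x2 w T (lexx 0) (ltW t00) (lexx t0) reg2 wv tbT.
  rewrite subr0 => /(_ (ltW tT)).
  have E1 : 1 / 2 <= expR (- nu gam q0 w * t0).
    by apply: le_trans (expR_ge1Dx _); move: nuC; clear; lra.
  have Oy : Omega (x2 - t0 *: w) by apply: in2; rewrite lexx ltW.
  have yp : enorm (x2 - t0 *: w - p) <= r1 / 2.
    have -> : x2 - t0 *: w - p = (x2 - x0) - t0 *: (w - v0).
      by apply/rowP => i; rewrite !mxE; ring.
    apply: le_trans (enorm_sub _ _) _; rewrite enormZ (ger0_norm (ltW t00)).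
    have h : t0 * enorm (w - v0) <= r1 / 4.
      apply: le_trans (_ : t0 * (r1 / (4 * (t0 + 1))) <= _).
        by apply: ler_wpM2l; [exact: ltW|exact: ltW (lt_trans wv' er1)].
      rewrite mulrCA ler_pM2l// ler_pdivrMr//; move: t00; clear; lra.
    by have := lt_trans xd2 dd2; move: h; clear; lra.
  have b1 := bump_half r10 yp.
  have b2 : 3 / 4 <= bump v0 r2 w by apply: bump_half => //; exact: ltW (lt_trans wv' er2).
  have gy : c * (9 / 16) <= g 0 (x2 - t0 *: w) w.
    rewrite g0E; last exact: subset_closure.
    apply: ler_wpM2l; first exact: ltW.
    have h0 : 0 <= 3 / 4 :> R by rewrite divr_ge0.
    by apply: le_trans (ler_pM h0 h0 b1 b2); clear; lra.
  have c90 : 0 <= c * (9 / 16) by rewrite mulr_ge0 ?divr_ge0// ltW.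
  have half0 : 0 <= 1 / 2 :> R by rewrite divr_ge0.
  have := ler_pM half0 c90 E1 gy.
  move: (expR _ * _) => X hX; rewrite ler_norml => /andP[hl _].
  by move: hX hl c0; clear; lra.
have dark : `|g t0 x1 w| <= c / 16 + c / 32.
  have [_ ng ngN _] := reg1.
  have [vw [T [T0 tbT inT gmT]]] := nongrazing_exit hopen hbounded hsmooth cx1 ng.
  have /andP[s10 s1t] := sI.
  (* The trajectory is outside the closure at time [s1], so it has met the wall before, and well
     within [t0]. *)
  have Ts1 : T <= s1.
    rewrite leNgt; apply/negP => sT; apply: ns1; apply: subset_closure; apply: inT.
    by rewrite s10.
  have T00 : 0 < T.
    rewrite lt_def T0 andbT; apply/eqP => e0'.
    have [/(bdryP hopen)[_ nO] _] := gmT; apply: nO.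
    by rewrite /= e0' scale0r subr0.
  have TI : 0 < T <= T by rewrite T00 lexx.
  have TI' : 0 <= T <= T by rewrite T0 lexx.
  have in1' s : 0 <= s <= t0 -> Omega (x1 - s *: - w).
    by move=> sI'; rewrite scalerN opprK; exact: in1.
  have [T3 [_ tT3 tbT3 _]] := stays_inside hopen hbounded hsmooth i1 ngN in1'.
  have [T2 [_ tbT2 _ tbz]] := regular_shift_opp hopen hbounded hsmooth reg1 tbT TI.
  have eT : T3 = T2 by move: tbT3; rewrite tbT2 => -[].
  have [_ regz] := regular_shift hopen hbounded hsmooth reg1 tbT TI'.
  have tT : T <= t0 by move: Ts1 s1t t00; clear; lra.
  have sI' : 0 <= t0 - T <= t0 by rewrite subr_ge0 tT lerBlDr lerDl.
  have tT' : t0 - T <= T + T2 by rewrite -eT; move: tT3 T0; clear; lra.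
  have hz := shade (t0 - T) (x1 - T *: w) w (T + T2) sI' regz gmT wv tbz tT'.
  have s0 : 0 <= t0 - T by rewrite subr_ge0.
  have st : t0 - T <= t0 by rewrite lerBlDr lerDl.
  have := leg (t0 - T) t0 x1 w T s0 st (lexx t0) reg1 wv tbT.
  rewrite subKr => /(_ (lexx T)).
  set E := expR _; have E1 : 0 <= E <= 1.
    by rewrite expR_ge0 -expR0 ler_expR mulNr oppr_le0 mulr_ge0.
  have /andP[E0 E1'] := E1.
  have hE : `|E * g (t0 - T) (x1 - T *: w) w| <= c / 16.
    rewrite normrM (ger0_norm E0) -[leRHS]mul1r; exact: ler_pM.
  move=> hl; rewrite -[g t0 x1 w](subrK (E * g (t0 - T) (x1 - T *: w) w)).
  apply: le_trans (ler_normD _ _) _; rewrite addrC; exact: lerD.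
move: lit dark c0; move: (g t0 x2 w) (g t0 x1 w) => a2 a1; clear=> h1.
by rewrite ler_norml => /andP[h2 h3] c0; rewrite ler_normr; apply/orP; right; lra.
Qed.

Lemma nnsup_le (R : realType) (A : set (\bar R)) (k : \bar R) : (0 <= k)%E ->
  (forall z, A z -> (z <= k)%E) -> (nnsup A <= k)%E.
Proof. by move=> k0 h; apply: ge_ereal_sup => z [->|/h]. Qed.

Lemma bdatum_norm_mu (R : realType) (rho beta : R) (Omega : set 'rV[R]_3) :
  bdatum_norm rho beta Omega (fun _ _ v => mu v) = 0%E.
Proof.
apply/le_anti/andP; split; last by apply: ereal_sup_ubound; left.
apply: nnsup_le => // z [t _ <-]; apply: nnsup_le => // {}z [p _ <-].
by rewrite /wpert subrr mul0r mulr0 normr0.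
Qed.

Lemma continuous_bdatum_mu (R : realType) (Omega : set 'rV[R]_3) :
  continuous_bdatum Omega (fun _ _ v => mu v).
Proof.
apply: continuous_subspaceT => z.
apply: (@continuous_comp _ _ _ (fun p : R * ('rV[R]_3 * 'rV[R]_3) => p.2.2) (@mu R)).
  by apply: (@continuous_comp _ _ _ snd snd); exact: cvg_snd.
exact: continuous_mu.
Qed.

(** [BC] is the actual boundary condition and [B] the estimate it implies for the perturbation. The
    bump lives inside the domain, so the datum is the Maxwellian over the boundary and compatible
    with all three conditions. *)
Lemma discontinuous_datum {R : realType} (gam : R) (hgam : 0 < gam <= 1) (q0 : R -> R)
  (hq0m : measurable_fun (`[-1, 1]%classic : set R) q0)
  (hq0pos : forall c : R, -1 <= c <= 1 -> 0 <= q0 c)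
  (hq0cut : forall u : 'rV[R]_3, enorm u = 1 ->
     (eint_sphere (fun omega => (q0 (dot u omega))%:E) < +oo)%E)
  (rho beta : R)
  (hw : (@lebesgue3 R).-integrable setT
     (fun p => ((weight rho beta (vec3 p))^-1 ^+ 2 *
                (1 + enorm (vec3 p)) ^+ 3)%:E))
  (Omega : set 'rV[R]_3)
  (hopen : open Omega) (hbounded : bounded_set Omega) (hsmooth : smooth_boundary Omega)
  (B BC : (R -> 'rV[R]_3 -> 'rV[R]_3 -> R) -> Prop) (x0 v0 : 'rV[R]_3) :
  propagates gam q0 Omega B -> shaded gam q0 Omega B v0 ->
  (forall F, measurable_sol Omega F -> gaussian_bounded Omega (pert F) -> BC F -> B (pert F)) ->
  v0 != 0 -> gamma_0S Omega (x0, v0) ->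
  forall delta, 0 < delta -> exists (t0 : R) F0,
  [/\ [/\ 0 < t0, (t0%:E < delta%:E)%E, (t0%:E < t_b Omega x0 v0)%E
        & (t0%:E < t_b Omega x0 (- v0))%E],
      measurable_datum Omega F0 /\ continuous_datum Omega F0,
      forall x v, gamma_in Omega (x, v) -> F0 x = @mu R,
      (datum_norm rho beta Omega F0 < delta%:E)%E &
      forall F, boltzmann_solution gam q0 rho beta Omega BC F0 F ->
        discontinuous_at Omega F t0 x0 v0].
Proof.
move=> hB hS hBC v00 hx delta delta0.
have [t0 [c [p [r1 [r2 [/andP[t00 t0d] tb tf [r10 hr1] [hw0 hF]]]]]]] :=
  concave_discontinuity hgam hq0m hq0pos hq0cut hw hopen hbounded hsmooth hB hS v00 hx delta0.
have d2 : 0 <= delta / 2 by rewrite divr_ge0 ?ltW.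
exists t0, (bump_datum c p r1 v0 r2); split=> //.
- by split; [exact: bump_datum_measurable|exact: bump_datum_continuous].
- move=> x v hin; have bx : bdry Omega x by case: hin => [[]|[[]]].
  have [_ nO] := (bdryP hopen x).1 bx.
  by apply/funext => u; rewrite /bump_datum (bump_out r10 (hr1 x nO)) mul0r mulr0 addr0.
- apply: le_lt_trans (_ : ((delta / 2)%:E < _)%E); last first.
    by rewrite lte_fin ltr_pdivrMr// mulr_natr mulr2n ltrDl.
  by apply: nnsup_le => [|z [[x v] _ <-]]; rewrite lee_fin.
- move=> F hsol; have gF := solution_gaussian_bounded hsol.
  have mF := boltzmann_mild hgam hq0m hq0pos hq0cut hw hsol.
  have [mS _ hF0 _ bF] := hsol.
  exact: hF mF (hBC F mS gF bF) gF hF0.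
Qed.

Lemma outflux_mu (R : realType) (Omega : set 'rV[R]_3) (cmu : R)
    (hcmu : forall x, bdry Omega x ->
     cmu * int3 [set v' | 0 < dot v' (normal Omega x)]
                (fun v' => mu v' * `|dot (normal Omega x) v'|) = 1) x v :
  bdry Omega x -> cmu * mu v * outflux Omega x (@mu R) = mu v.
Proof.
move=> bx; rewrite mulrAC -[RHS]mul1r -(hcmu x bx); congr (_ * _ * _).
by apply: eq_Rintegral => p; rewrite inE /= dotC => np; rewrite (gtr0_norm np).
Qed.

Theorem theorem1 (R : realType)
  (gam : R) (hgam : 0 < gam <= 1)
  (q0 : R -> R)
  (hq0m : measurable_fun (`[-1, 1]%classic : set R) q0)
  (hq0pos : forall c : R, -1 <= c <= 1 -> 0 <= q0 c)
  (hq0cut : forall u : 'rV[R]_3, enorm u = 1 ->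
     (eint_sphere (fun omega => (q0 (dot u omega))%:E) < +oo)%E)
  (rho beta : R)
  (hw : (@lebesgue3 R).-integrable setT
     (fun p => ((weight rho beta (vec3 p))^-1 ^+ 2 *
                (1 + enorm (vec3 p)) ^+ 3)%:E))
  (Omega : set 'rV[R]_3)
  (hopen : open Omega) (hbounded : bounded_set Omega)
  (hconnected : connected Omega) (hsmooth : smooth_boundary Omega)
  (hnonconvex : gamma_0S Omega !=set0)
  (cmu : R) (hcmu_pos : 0 < cmu)
  (hcmu : forall x, bdry Omega x ->
     cmu * int3 [set v' | 0 < dot v' (normal Omega x)]
                (fun v' => mu v' * `|dot (normal Omega x) v'|) = 1)
  (x0 v0 : 'rV[R]_3) (hx0v0 : gamma_0S Omega (x0, v0)) (hv0 : v0 <> 0) :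
  exists2 delta0 : R, 0 < delta0 &
  forall delta : R, 0 < delta -> delta < delta0 ->
  [/\ (* in-flow *)
      exists (t0 : R) (F0 : 'rV[R]_3 -> 'rV[R]_3 -> R)
             (G : R -> 'rV[R]_3 -> 'rV[R]_3 -> R),
        [/\ 0 < t0 /\ (t0%:E < mine delta%:E (t_b Omega x0 (- v0)))%E,
            [/\ measurable_datum Omega F0, continuous_datum Omega F0 &
                continuous_bdatum Omega G],
            forall x v, gamma_in Omega (x, v) -> F0 x v = G 0 x v,
            (datum_norm rho beta Omega F0 + bdatum_norm rho beta Omega G
               < delta%:E)%E &
            forall F,
              boltzmann_solution gam q0 rho beta Omega (inflow_bc Omega G) F0 F ->
              discontinuous_at Omega F t0 x0 v0],
      (* diffuse reflection *)
      exists (t0 : R) (F0 : 'rV[R]_3 -> 'rV[R]_3 -> R),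
        [/\ 0 < t0 /\ (t0%:E < mine delta%:E (t_b Omega x0 (- v0)))%E,
            measurable_datum Omega F0 /\ continuous_datum Omega F0,
            forall x v, gamma_in Omega (x, v) ->
              F0 x v = cmu * mu v * outflux Omega x (F0 x),
            (datum_norm rho beta Omega F0 < delta%:E)%E &
            forall F,
              boltzmann_solution gam q0 rho beta Omega (diffuse_bc cmu Omega) F0 F ->
              discontinuous_at Omega F t0 x0 v0] &
      (* bounce-back *)
      exists (t0 : R) (F0 : 'rV[R]_3 -> 'rV[R]_3 -> R),
        [/\ 0 < t0 /\ (t0%:E < mine delta%:E
                (mine (t_b Omega x0 (- v0)) (t_b Omega x0 v0)))%E,
            measurable_datum Omega F0 /\ continuous_datum Omega F0,
            (datum_norm rho beta Omega F0 < delta%:E)%E,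
            forall x v, gamma_in Omega (x, v) -> F0 x v = F0 x (- v) &
            forall F,
              boltzmann_solution gam q0 rho beta Omega (bounceback_bc Omega) F0 F ->
              discontinuous_at Omega F t0 x0 v0]].
Proof.
have v00 : v0 != 0 by apply/eqP.
(* The construction works for each positive [delta], so any threshold serves. *)
exists 1 => // delta delta0 _; split.
- have [t0 [F0 [[t00 td _ tf] [mF0 cF0] hF0 nF0 hF]]] :=
    @discontinuous_datum _ _ hgam _ hq0m hq0pos hq0cut _ _ hw _ hopen hbounded hsmooth
      (absorbs Omega) (inflow_bc Omega (fun _ _ v => mu v)) x0 v0
      (absorbs_propagates hgam hq0m hq0pos hq0cut hw hopen hbounded hsmooth)
      (absorbs_shaded _ _ _ _) (fun F _ _ h => inflow_absorbs h) v00 hx0v0 delta delta0.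
  exists t0, F0, (fun _ _ v => mu v); split=> //; first by rewrite lt_min td tf.
  + by split=> //; exact: continuous_bdatum_mu.
  + by move=> x v /hF0 ->.
  + by rewrite bdatum_norm_mu adde0.
- have [t0 [F0 [[t00 td _ tf] hm hF0 nF0 hF]]] :=
    @discontinuous_datum _ _ hgam _ hq0m hq0pos hq0cut _ _ hw _ hopen hbounded hsmooth
      (diffuses Omega cmu) (diffuse_bc cmu Omega) x0 v0
      (diffuses_propagates hgam hq0m hq0pos hq0cut hw hopen hbounded hsmooth hcmu_pos)
      (diffuses_shaded hgam hq0m hq0pos hq0cut hw hopen hbounded hsmooth hcmu_pos _)
      (fun F mF gF h => diffuse_diffuses hw hopen hsmooth hcmu_pos hcmu mF gF h) v00 hx0v0 delta delta0.
  exists t0, F0; split=> //; first by rewrite lt_min td tf.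
  move=> x v hin; rewrite (hF0 x v hin) (outflux_mu hcmu)//.
  by case: hin => [[]|[[]]].
- have [t0 [F0 [[t00 td tb tf] hm hF0 nF0 hF]]] :=
    @discontinuous_datum _ _ hgam _ hq0m hq0pos hq0cut _ _ hw _ hopen hbounded hsmooth
      (reflects Omega) (bounceback_bc Omega) x0 v0
      (reflects_propagates hgam hq0m hq0pos hq0cut hw hopen hbounded hsmooth)
      (reflects_shaded hgam hq0m hq0pos hq0cut hw hopen hbounded hsmooth v00)
      (fun F _ _ h => bounceback_reflects h) v00 hx0v0 delta delta0.
  exists t0, F0; split=> //; first by rewrite !lt_min td tf tb.
  by move=> x v /hF0 ->; rewrite /mu enormN.
Qed.
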